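(* Let $0<p<1$, $q=1-p$, $\lambda=1+\frac{2}{pq}$, and let $\mathcal{L}_\mu=\lim_{n\to\infty}\lambda^n(-\Delta_n)$ be the Laplacian of the double $pq$-model. Let $R(z)=\frac{1}{pq}z\left(\frac{z^2}{4}+\frac{3z}{2}+2+pq\right)$, let $\Phi$ be the entire function with $\Phi(\lambda z)=R(\Phi(z))$, $\Phi(0)=0$, $\Phi'(0)=1$, and let $\zeta_{\Phi,0},\zeta_{\Phi,-4}$ be the associated polynomial zeta functions. Then the (meromorphically continued) spectral zeta function of $\mathcal{L}_\mu$ is $$\zeta_{\mathcal{L}_\mu}(s)=\zeta_{\Phi,0}(s)+\zeta_{\Phi,-4}(s),$$ and thus it has no poles on the imaginary axis. The regularized determinant of $\mathcal{L}_\mu$ is $$\det\mathcal{L}_\mu=\frac{1}{pq}.$$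
   Context: The $pq$-model on $[0,1]$: put $r_1=r_3=\frac{p}{1+p}$, $r_2=\frac{q}{1+p}$, $m_1=m_3=\frac{q}{1+q}$, $m_2=\frac{p}{1+q}$, and $F_i(x)=r_ix+(1-r_i)p_i$ with fixed points $p_1=0$, $p_2=\frac12$, $p_3=1$. Then $[0,1]=\bigcup_iF_i([0,1])$; let $V_0=\{0,1\}$, $V_n=\bigcup_{i=1}^3F_i(V_{n-1})$, with consecutive points of $V_n$ adjacent. The measure $\mu$ is the unique self-similar probability measure $\mu=\sum_jm_j\,\mu\circ F_j^{-1}$. At an interior point $x_k\in V_n$ (points listed in increasing order), the discrete Laplacian is $\Delta_nf(x_k)=2pf(x_{k-1})+2qf(x_{k+1})-2f(x_k)$ or $\Delta_nf(x_k)=2qf(x_{k-1})+2pf(x_{k+1})-2f(x_k)$; that is, $\Delta_n=2(P_n-I)$ where $P_n$ is the nearest-neighbour random walk whose transition probabilities from $x_k$ to its two neighbours are $p,q$ in the order making them inversely proportional to the lengths of the adjacent intervals. Double $pq$-model: two copies of this model are glued at the two boundary points $0$ and $1$ (copy of $0$ with copy of $0$, copy of $1$ with copy of $1$). The level-$n$ vertex set then has $2\cdot3^n$ points arranged in a cycle; $\Delta_n$ is given by the same formulas at interior points of each copy, and at each of the two glued points $x$ by $\Delta_nf(x)=f(x')+f(x'')-2f(x)$, with $x',x''$ the neighbours of $x$ in the two copies (for $n=0$: the two glued points are each other's neighbour in both copies). The Laplacian is $\mathcal{L}_\mu=-\Delta_\mu$ with $\Delta_\mu f(x)=\lim_{n\to\infty}\lambda^n\Delta_nf(x)$;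 it is a non-negative self-adjoint operator with discrete spectrum, and if $0=\lambda_1(-\Delta_n)\le\lambda_2(-\Delta_n)\le\cdots$ are the eigenvalues of $-\Delta_n$ with multiplicity, then the eigenvalues of $\mathcal{L}_\mu$ with multiplicity are $\lambda_k=\lim_{n\to\infty}\lambda^n\lambda_k(-\Delta_n)$. Spectral zeta function and regularized determinant: $\zeta_{\mathcal{L}_\mu}(s)$ is the sum of $\nu^{-s}$ over all nonzero eigenvalues $\nu$ of $\mathcal{L}_\mu$ counted with multiplicity, for $\mathrm{Re}(s)$ large, and its meromorphic continuation to $\mathbb{C}$ otherwise. The regularized determinant is $\det\mathcal{L}_\mu=e^{-\zeta_{\mathcal{L}_\mu}'(0)}$. Polynomial zeta functions: for $w\in\{0,-4\}$, $\zeta_{\Phi,w}(s)$ is the sum of $t^{-s}$ over all $t>0$ with $\Phi(-t)=w$, counted according to the multiplicity of $t$ as a zero of $t\mapsto\Phi(-t)-w$, for $\mathrm{Re}(s)$ large, and its meromorphic continuation to $\mathbb{C}$ otherwise. *)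

(* Defs.v *)
From Stdlib Require Export Reals List Arith.
From Coquelicot Require Export Coquelicot.

Open Scope R_scope.

(* Complex analysis *)

Definition Cexp (z : C) : C := (exp (Re z) * cos (Im z), exp (Re z) * sin (Im z)).

(* t ^ s for a positive real base t. *)
Definition Cpower (t : R) (s : C) : C := Cexp (s * RtoC (ln t))%C.

Definition C_differentiable (f : C -> C) (z : C) : Prop :=
  @ex_derive C_AbsRing C_NormedModule f z.

Definition entire (f : C -> C) : Prop := forall z, C_differentiable f z.

Definition holomorphic_at (f : C -> C) (a : C) : Prop :=
  locally a (C_differentiable f).

Definition zero_of_order (f : C -> C) (a : C) (m : nat) : Prop :=
  exists g : C -> C,
    holomorphic_at g a /\ g a <> RtoC 0 /\
    locally a (fun z => f z = ((z - a) ^ m * g z)%C).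

Definition pole (f : C -> C) (a : C) : Prop :=
  exists (m : nat) (g : C -> C),
    (0 < m)%nat /\ holomorphic_at g a /\ g a <> RtoC 0 /\
    locally' a (fun z => f z = (g z / (z - a) ^ m)%C).

(* Removable singularities are required to be removed; the value of f at a
   pole is irrelevant. *)
Definition meromorphic (f : C -> C) : Prop :=
  forall a, holomorphic_at f a \/ pole f a.

(* Zeta function of a multiset of reals.  The multiset consists of the t in D,
   where mult t m means that t occurs exactly m times (m = 0 if t is absent). *)

Definition enumerates (D : R -> Prop) (mult : R -> nat -> Prop) (nu : nat -> R)
  : Prop :=
  (forall k, D (nu k)) /\
  forall t, D t ->
    exists l : list nat,
      NoDup l /\ (forall k, In k l <-> nu k = t) /\ mult t (length l).

(* Z is determined by this up to its values at its poles, by the identity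
   theorem. *)
Definition is_zeta (D : R -> Prop) (mult : R -> nat -> Prop) (Z : C -> C) : Prop :=
  meromorphic Z /\
  exists (nu : nat -> R) (sigma : R),
    enumerates D mult nu /\
    forall s : C, sigma < Re s ->
      ex_series (fun k => Cmod (Cpower (nu k) (- s)%C)) /\
      @is_series C_AbsRing C_NormedModule (fun k => Cpower (nu k) (- s)%C) (Z s).

(* exp (- Z'(0)) = d *)
Definition is_regularized_det (Z : C -> C) (d : C) : Prop :=
  exists l : C,
    @is_derive C_AbsRing C_NormedModule Z (RtoC 0) l /\ Cexp (- l)%C = d.

(* The pq-model *)

Definition similitude (r a x : R) : R := r * x + (1 - r) * a.

Definition F1 (p q : R) : R -> R := similitude (p / (1 + p)) 0.
Definition F2 (p q : R) : R -> R := similitude (q / (1 + p)) (1 / 2).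
Definition F3 (p q : R) : R -> R := similitude (p / (1 + p)) 1.

(* V_n as an increasing list of 3^n + 1 points: since q = 1 - p, one has
   F1 1 = F2 0 and F2 1 = F3 0, and these shared points are listed once. *)
Fixpoint V (p q : R) (n : nat) : list R :=
  match n with
  | O => 0 :: 1 :: nil
  | S n' => map (F1 p q) (V p q n') ++ tl (map (F2 p q) (V p q n'))
              ++ tl (map (F3 p q) (V p q n'))
  end.

Definition vertex (p q : R) (n k : nat) : R := nth k (V p q n) 0.

(* Probability of moving from x to its left neighbour y, z being the right
   neighbour: whichever of p, q is in inverse proportion to the lengths. *)
Definition prob_left (p q y x z : R) : R :=
  if Req_dec_T (p * (x - y)) (q * (z - x)) then p else q.

Definition prob_right (p q y x z : R) : R :=
  if Req_dec_T (p * (x - y)) (q * (z - x)) then q else p.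

(* The double pq-model: functions on two copies of [0,1], indexed by bool.
   Only the values on [0,1] are meaningful. *)

Definition dfun := bool -> R -> R.

Definition unit_itv (x : R) : Prop := 0 <= x <= 1.

Definition continuous_double (f : dfun) : Prop :=
  (forall c, continuous_on unit_itv (f c)) /\
  f true 0 = f false 0 /\ f true 1 = f false 1.

(* Delta_n f at the k-th point of V_n in copy c, 0 <= k <= 3^n. *)
Definition Delta (p q : R) (n : nat) (f : dfun) (c : bool) (k : nat) : R :=
  let x := vertex p q n in
  if Nat.eqb k 0 then
    f true (x 1%nat) + f false (x 1%nat) - 2 * f c (x k)
  else if Nat.eqb k (3 ^ n) then
    f true (x (k - 1)%nat) + f false (x (k - 1)%nat) - 2 * f c (x k)
  else
    let y := x (k - 1)%nat in
    let z := x (k + 1)%nat in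
    2 * prob_left p q y (x k) z * f c y
    + 2 * prob_right p q y (x k) z * f c z - 2 * f c (x k).

Definition lambda (p q : R) : R := 1 + 2 / (p * q).

(* f is in the domain of the Laplacian L = lim lambda^n (- Delta_n) and
   L f = g.  As usual for Laplacians on fractals, f and g are continuous and the
   limit is uniform over the vertices; the pointwise limit alone would also
   annihilate, e.g., every continuous function that is locally constant near
   each vertex. *)
Definition is_Laplacian (p q : R) (f g : dfun) : Prop :=
  continuous_double f /\ continuous_double g /\
  forall eps : R, 0 < eps ->
    exists N : nat, forall (n : nat) (c : bool) (k : nat),
      (N <= n)%nat -> (k <= 3 ^ n)%nat ->
      Rabs (lambda p q ^ n * - Delta p q n f c k - g c (vertex p q n k)) < eps.

Definition eigenfunction (p q nu : R) (f : dfun) : Prop :=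
  is_Laplacian p q f (fun c x => nu * f c x).

Definition lin_comb (m : nat) (a : nat -> R) (e : nat -> dfun) : dfun :=
  fun c x => fold_right (fun i s => a i * e i c x + s) 0 (seq 0 m).

Definition eq_double (f g : dfun) : Prop :=
  forall c x, unit_itv x -> f c x = g c x.

(* The eigenspace of L for nu has dimension m. *)
Definition eigenvalue_mult (p q nu : R) (m : nat) : Prop :=
  exists e : nat -> dfun,
    (forall i, (i < m)%nat -> eigenfunction p q nu (e i)) /\
    (forall a, eq_double (lin_comb m a e) (fun _ _ => 0) ->
       forall i, (i < m)%nat -> a i = 0) /\
    (forall f, eigenfunction p q nu f ->
       exists a, eq_double f (lin_comb m a e)).

Definition is_spectral_zeta (p q : R) (Z : C -> C) : Prop :=
  is_zeta (fun nu => nu <> 0) (eigenvalue_mult p q) Z.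

(* Polynomial zeta functions *)

Definition Rpoly (p q : R) (z : C) : C :=
  (RtoC (1 / (p * q)) * z
   * (z ^ 2 / RtoC 4 + RtoC 3 * z / RtoC 2 + RtoC 2 + RtoC (p * q)))%C.

Definition is_polynomial_zeta (Phi : C -> C) (w : C) (Z : C -> C) : Prop :=
  is_zeta (fun t => 0 < t)
    (fun t m => zero_of_order (fun z => Phi (- z) - w)%C (RtoC t) m) Z.

(* Main.v *)
Require Import Defs.
From Stdlib Require Import Lra Lia Psatz Classical ClassicalEpsilon List Permutation.
Open Scope R_scope.

(** The proof compares three things: the zeros of [Phi] and of [Phi + 4], the
    spectrum of the Laplacian, and the behaviour of the two Dirichlet series at
    [s = 0].

    Zeros.  In the coordinate [x = 1 + z / 2] the polynomial [Rpoly] becomes the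
    odd cubic [cubP], and 0, -4 become its fixed points 1, -1.  Every point of
    [-1, 1] has three preimages in [-1, 1], so the [n]-th iterate minus 1 or -1
    factors over [3 ^ n] real preimages.  Since [Phi z] is the [n]-th iterate of
    [Rpoly] at [Phi (z / lambda ^ n)], which is close to [z / lambda ^ n], the
    rescaled factors converge and [tannery] gives
    [Phi z = z * prod (1 + z / nu)] and [1 + Phi z / 4 = prod (1 + z / nu')]
    with positive [nu], [nu'] that grow at least quadratically
    ([Phi_product], [Phi_product_4]).  The two polynomial zeta functions are the
    Dirichlet series of the [nu] and of the [nu'].

    Continuation.  For such a product let [L u] be the sum of
    [ln (1 + exp u / nu)].  Its two-sided Laplace transform is
    [PI / (s * sin (PI * s))] times the Dirichlet series, on the strip
    [3 / 4 < Re s < 1] ([log_transform], [defect_transform]).  Passing from [L]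
    to the defect [E u = L (u + ln lambda) - 3 * L u] multiplies the transform by
    [lambda ^ s - 3].  As [Rpoly] has degree 3, the functional equation says that
    [E] is an affine function [2 * a * u + e0] up to an error that decays faster
    than every exponential at [+oo], while [E u = O(exp u)] at [-oo].  Therefore
    [(lambda ^ s - 3) * zeta s = sinc s * (s ^ 2 * J s + 2 * a + e0 * s)] with [J]
    holomorphic for [Re s < 1], where [sinc s = sin (PI * s) / (PI * s)].  Poles can
    only occur where [lambda ^ s = 3], on the line [Re s = ln 3 / ln lambda], which
    is not the imaginary axis.  The constants are [a = 1],
    [e0 = - ln (4 * p * q) - ln lambda] for [Phi] and [a = 0],
    [e0 = ln (4 / (p * q))] for [Phi + 4]; so the sum of the two zeta functions is
    [N s / (lambda ^ s - 3)] with [N 0 = 2] and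
    [N' 0 = - 2 * ln (p * q) - ln lambda], whence its derivative at 0 is
    [ln (p * q)].

    Spectrum.  Put [a n = 1 + Phi (- t / lambda ^ n) / 2], an orbit of [cubP] read
    backwards.  Uniform convergence of the rescaled Laplacians forces an
    eigenfunction for [t] to solve the discrete equation with eigenvalue
    [2 * (1 - a n)] exactly on all fine levels ([residual_vanishes]).  Discrete
    solutions are propagated by transfer matrices that are compatible with
    subdivision ([transfer_thirds]), so on each copy they are given by a value and
    a slope at 0, and closing up at the second glued point reduces to
    [c 0 * value = 0] and [b 0 * slope = 0] for numbers with
    [b 0 * c 0 = a 0 ^ 2 - 1] ([eigenvalue_dimension]).  Now [b 0 = 0] exactly if
    the orbit passes through [p] or [-p], and [c 0 = 0] exactly if it passes
    through [q] or [-q].  The same two events count the multiplicity of [t] as a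
    zero of [Phi (- t)] or of [Phi (- t) + 4] ([zero_count]): the
    points [p], [q], up to sign, are the roots other than 1 and -1 of
    [cubP x = 1] and of [cubP x = -1], simple ones for [p <> q], while for [p = q]
    they are double and both events occur together.  So the two multisets agree. *)

(** * Complex differentiability by estimates *)

(** The neighbourhoods of the product structure are squares; this trades them
    for discs. *)
Lemma locally_Cmod (a : C) (P : C -> Prop) :
  locally a P <-> exists d, 0 < d /\ forall z, Cmod (z - a) < d -> P z.
Proof.
  split.
  - intros H. apply locally_C in H. destruct H as [d Hd].
    exists d. split. apply cond_pos. intros z Hz. apply Hd. exact Hz.
  - intros [d [Hd H]]. apply locally_C. exists (mkposreal d Hd).
    intros y Hy. apply H. exact Hy.
Qed.

Lemma locally'_Cmod (a : C) (P : C -> Prop) :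
  locally' a P <->
  exists d, 0 < d /\ forall z, Cmod (z - a) < d -> z <> a -> P z.
Proof. unfold locally', within. apply locally_Cmod. Qed.

Lemma Cplus_minus_l (z h : C) : (z + h - z)%C = h.
Proof. ring. Qed.

Lemma Cplus_minus_r (z y : C) : (z + (y - z))%C = y.
Proof. ring. Qed.

Notation is_Cderive := (@is_derive C_AbsRing C_NormedModule).

Lemma is_Cderive_eps (f : C -> C) (z l : C) :
  is_Cderive f z l <->
  forall eps, 0 < eps -> exists d, 0 < d /\
    forall h, Cmod h < d -> Cmod (f (z + h) - f z - l * h)%C <= eps * Cmod h.
Proof.
  split.
  - intros [_ H] eps Heps.
    destruct (H z (fun P HP => HP) (mkposreal eps Heps)) as [d Hd].
    exists d. split. apply cond_pos. intros h Hh.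
    specialize (Hd (z + h)%C).
    assert (Hb : ball (M := AbsRing_UniformSpace C_AbsRing) z d (z + h)%C).
    { change (Cmod (z + h - z)%C < d). now rewrite (Cplus_minus_l z h). }
    specialize (Hd Hb). simpl in Hd.
    change (Cmod (f (z + h) - f z - (z + h - z) * l)%C <= eps * Cmod (z + h - z)%C) in Hd.
    rewrite (Cplus_minus_l z h) in Hd.
    now rewrite (Cmult_comm l h).
  - intros H. split.
    + apply is_linear_scal_l.
    + intros x Hx.
      apply (is_filter_lim_locally_unique (V := AbsRing_NormedModule C_AbsRing)) in Hx.
      subst x. intros eps. destruct (H eps (cond_pos eps)) as [d [Hd Hh]].
      exists (mkposreal d Hd). intros y Hy.
      change (Cmod (y - z)%C < d) in Hy.
      specialize (Hh (y - z)%C Hy).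
      rewrite (Cplus_minus_r z y) in Hh.
      change (Cmod (f y - f z - (y - z) * l)%C <= eps * Cmod (y - z)%C).
      now rewrite (Cmult_comm _ l).
Qed.

Lemma is_Cderive_quadratic (f : C -> C) (z l : C) (r M : R) :
  0 < r -> 0 <= M ->
  (forall h, Cmod h < r -> Cmod (f (z + h) - f z - l * h)%C <= M * Cmod h ^ 2) ->
  is_Cderive f z l.
Proof.
  intros Hr HM H. apply is_Cderive_eps. intros eps Heps.
  exists (Rmin r (eps / (M + 1))). split.
  - apply Rmin_pos; trivial. apply Rdiv_lt_0_compat; lra.
  - intros h Hh. eapply Rle_trans. apply H.
    eapply Rlt_le_trans; [exact Hh | apply Rmin_l].
    assert (Cmod h < eps / (M + 1)).
    { eapply Rlt_le_trans; [exact Hh | apply Rmin_r]. }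
    assert (Hh0 := Cmod_ge_0 h).
    assert (Cmod h * (M + 1) < eps).
    { apply Rlt_div_r; lra. }
    simpl. nra.
Qed.

(** ** Second order expansions *)

(** [cubic f a c d]: a second order Taylor expansion at [a] with a cubic
    remainder.  This much regularity is what dividing out a simple zero costs,
    so it replaces the Cauchy theory behind removable singularities. *)
Definition cubic (f : C -> C) (a c d : C) : Prop :=
  exists r M, 0 < r /\ 0 <= M /\ forall h, Cmod h < r ->
    Cmod (f (a + h) - f a - c * h - d * h ^ 2)%C <= M * Cmod h ^ 3.

Lemma cubic_quadratic f a c d : cubic f a c d ->
  exists r M, 0 < r /\ 0 <= M /\ forall h, Cmod h < r ->
    Cmod (f (a + h) - f a - c * h)%C <= M * Cmod h ^ 2.
Proof.
  intros (r & M & Hr & HM & H).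
  exists (Rmin r 1), (M + Cmod d). assert (Hd := Cmod_ge_0 d).
  split; [apply Rmin_pos; lra | split; [lra |]].
  intros h Hh.
  assert (Hh1 : Cmod h < r) by (eapply Rlt_le_trans; [exact Hh | apply Rmin_l]).
  assert (Hh2 : Cmod h < 1) by (eapply Rlt_le_trans; [exact Hh | apply Rmin_r]).
  assert (Hh0 := Cmod_ge_0 h).
  replace (f (a + h) - f a - c * h)%C
    with ((f (a + h) - f a - c * h - d * h ^ 2) + d * h ^ 2)%C by ring.
  eapply Rle_trans; [apply Cmod_triangle |].
  rewrite Cmod_mult, Cmod_pow. specialize (H h Hh1).
  assert (M * Cmod h ^ 3 <= M * Cmod h ^ 2).
  { apply Rmult_le_compat_l; trivial. simpl. nra. }
  lra.
Qed.

Lemma cubic_derive f a c d : cubic f a c d -> is_Cderive f a c.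
Proof.
  intros H. destruct (cubic_quadratic _ _ _ _ H) as (r & M & Hr & HM & Hq).
  now apply (is_Cderive_quadratic f a c r M).
Qed.

Lemma cubic_ext f g a c d : (exists r, 0 < r /\ forall z, Cmod (z - a) < r -> f z = g z) ->
  cubic f a c d -> cubic g a c d.
Proof.
  intros (r0 & Hr0 & He) (r & M & Hr & HM & H).
  exists (Rmin r0 r), M. split; [now apply Rmin_pos | split; [trivial |]].
  intros h Hh. rewrite <- !He.
  - apply H. eapply Rlt_le_trans; [exact Hh | apply Rmin_r].
  - replace (a - a)%C with (RtoC 0) by ring. now rewrite Cmod_0.
  - replace (a + h - a)%C with h by ring.
    eapply Rlt_le_trans; [exact Hh | apply Rmin_l].
Qed.

Lemma cubic_const k a : cubic (fun _ => k) a 0 0.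
Proof.
  exists 1, 0. split; [lra | split; [lra |]]. intros h _.
  replace (k - k - 0 * h - 0 * h ^ 2)%C with (RtoC 0) by ring. rewrite Cmod_0. lra.
Qed.

Lemma cubic_id a : cubic (fun z => z) a 1 0.
Proof.
  exists 1, 0. split; [lra | split; [lra |]]. intros h _.
  replace (a + h - a - 1 * h - 0 * h ^ 2)%C with (RtoC 0) by ring. rewrite Cmod_0. lra.
Qed.

Lemma cubic_plus f g a c d c' d' :
  cubic f a c d -> cubic g a c' d' ->
  cubic (fun z => f z + g z)%C a (c + c') (d + d').
Proof.
  intros (r & M & Hr & HM & H) (r' & M' & Hr' & HM' & H').
  exists (Rmin r r'), (M + M'). split; [now apply Rmin_pos | split; [lra |]].
  intros h Hh.
  specialize (H h (Rlt_le_trans _ _ _ Hh (Rmin_l _ _))).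
  specialize (H' h (Rlt_le_trans _ _ _ Hh (Rmin_r _ _))).
  replace (f (a + h) + g (a + h) - (f a + g a) - (c + c') * h - (d + d') * h ^ 2)%C
    with ((f (a + h) - f a - c * h - d * h ^ 2) +
          (g (a + h) - g a - c' * h - d' * h ^ 2))%C by ring.
  eapply Rle_trans; [apply Cmod_triangle | lra].
Qed.

Lemma cubic_mult f g a c d c' d' :
  cubic f a c d -> cubic g a c' d' ->
  cubic (fun z => f z * g z)%C a (c * g a + f a * c')
    (d * g a + c * c' + f a * d').
Proof.
  intros (r & M & Hr & HM & H) (r' & M' & Hr' & HM' & H').
  set (B := Cmod (f a) + Cmod c + Cmod d).
  set (B' := Cmod (g a) + Cmod c' + Cmod d').
  assert (HB : 0 <= B). { unfold B. generalize (Cmod_ge_0 (f a)), (Cmod_ge_0 c), (Cmod_ge_0 d). lra. }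
  assert (HB' : 0 <= B'). { unfold B'. generalize (Cmod_ge_0 (g a)), (Cmod_ge_0 c'), (Cmod_ge_0 d'). lra. }
  assert (Hcd : Cmod (c * d' + d * c' + d * d')%C + Cmod (d * d')%C >= 0).
  { generalize (Cmod_ge_0 (c * d' + d * c' + d * d')%C), (Cmod_ge_0 (d * d')%C). lra. }
  exists (Rmin 1 (Rmin r r')), (M * (B' + M') + B * M' + (Cmod (c * d' + d * c')%C + Cmod (d * d')%C)).
  split; [repeat apply Rmin_pos; lra | split].
  { generalize (Cmod_ge_0 (c * d' + d * c')%C), (Cmod_ge_0 (d * d')%C).
    intros. assert (0 <= M * (B' + M')) by (apply Rmult_le_pos; lra).
    assert (0 <= B * M') by (apply Rmult_le_pos; lra). lra. }
  intros h Hh.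
  assert (Hh1 : Cmod h < 1) by (eapply Rlt_le_trans; [exact Hh | apply Rmin_l]).
  assert (Hh2 : Cmod h < Rmin r r') by (eapply Rlt_le_trans; [exact Hh | apply Rmin_r]).
  specialize (H h (Rlt_le_trans _ _ _ Hh2 (Rmin_l _ _))).
  specialize (H' h (Rlt_le_trans _ _ _ Hh2 (Rmin_r _ _))).
  assert (H0 := Cmod_ge_0 h).
  set (u := (f (a + h) - f a - c * h - d * h ^ 2)%C) in *.
  set (v := (g (a + h) - g a - c' * h - d' * h ^ 2)%C) in *.
  set (P := (f a + c * h + d * h ^ 2)%C). set (Q := (g a + c' * h + d' * h ^ 2)%C).
  assert (HP : Cmod P <= B).
  { unfold P, B. eapply Rle_trans; [apply Cmod_triangle |].
    apply Rplus_le_compat. eapply Rle_trans; [apply Cmod_triangle |].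
    apply Rplus_le_compat_l. rewrite Cmod_mult. generalize (Cmod_ge_0 c). nra.
    rewrite Cmod_mult, Cmod_pow. generalize (Cmod_ge_0 d).
    assert (Cmod h ^ 2 <= 1) by (simpl; nra). assert (0 <= Cmod h ^ 2) by (simpl; nra). nra. }
  assert (HQ : Cmod Q <= B').
  { unfold Q, B'. eapply Rle_trans; [apply Cmod_triangle |].
    apply Rplus_le_compat. eapply Rle_trans; [apply Cmod_triangle |].
    apply Rplus_le_compat_l. rewrite Cmod_mult. generalize (Cmod_ge_0 c'). nra.
    rewrite Cmod_mult, Cmod_pow. generalize (Cmod_ge_0 d').
    assert (Cmod h ^ 2 <= 1) by (simpl; nra). assert (0 <= Cmod h ^ 2) by (simpl; nra). nra. }
  assert (Hh3 : 0 <= Cmod h ^ 3 <= 1).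
  { split. apply pow_le, H0. rewrite <- (pow1 3). apply pow_incr. lra. }
  assert (Hv : Cmod v <= M').
  { eapply Rle_trans; [exact H' |]. nra. }
  replace (f (a + h) * g (a + h) - f a * g a - (c * g a + f a * c') * h -
      (d * g a + c * c' + f a * d') * h ^ 2)%C
    with (u * (Q + v) + P * v + ((c * d' + d * c') * h ^ 3 + d * d' * h ^ 4))%C
    by (unfold u, v, P, Q; ring).
  eapply Rle_trans; [apply Cmod_triangle |].
  eapply Rle_trans; [apply Rplus_le_compat; [apply Cmod_triangle | apply Cmod_triangle] |].
  rewrite (Cmod_mult u), (Cmod_mult P), (Cmod_mult _ (h ^ 3)%C), (Cmod_mult _ (h ^ 4)%C), !Cmod_pow.
  assert (Cmod u * Cmod (Q + v) <= M * Cmod h ^ 3 * (B' + M')).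
  { apply Rmult_le_compat; try apply Cmod_ge_0; trivial.
    eapply Rle_trans; [apply Cmod_triangle | lra]. }
  assert (Cmod P * Cmod v <= B * (M' * Cmod h ^ 3)).
  { apply Rmult_le_compat; try apply Cmod_ge_0; trivial. }
  assert (Cmod (d * d') * Cmod h ^ 4 <= Cmod (d * d') * Cmod h ^ 3).
  { apply Rmult_le_compat_l. apply Cmod_ge_0. simpl. simpl in Hh3. nra. }
  lra.
Qed.

Lemma cubic_inv a : a <> RtoC 0 -> cubic (fun z => / z)%C a (- / a ^ 2)%C (/ a ^ 3)%C.
Proof.
  intros Ha. assert (Ha' : 0 < Cmod a) by now apply Cmod_gt_0.
  exists (Cmod a / 2), (2 / Cmod a ^ 4). split; [lra | split].
  { apply Rlt_le, Rdiv_lt_0_compat; [lra |]. now apply pow_lt. }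
  intros h Hh.
  assert (Hah : Cmod a / 2 <= Cmod (a + h)).
  { assert (Cmod a <= Cmod (a + h) + Cmod h).
    { replace a with (a + h + - h)%C at 1 by ring.
      eapply Rle_trans; [apply Cmod_triangle |]. rewrite Cmod_opp. lra. }
    lra. }
  assert (Hah0 : (a + h)%C <> RtoC 0). { apply Cmod_gt_0. lra. }
  replace (/ (a + h) - / a - - / a ^ 2 * h - / a ^ 3 * h ^ 2)%C
    with (- h ^ 3 / (a ^ 3 * (a + h)))%C by (field; repeat split; trivial).
  rewrite Cmod_div.
  2:{ apply Cmult_neq_0; trivial. apply Cpow_nz, Ha. }
  rewrite Cmod_opp, Cmod_mult, !Cmod_pow.
  assert (0 < Cmod a ^ 3) by now apply pow_lt.
  assert (0 <= Cmod h ^ 3) by apply pow_le, Cmod_ge_0.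
  unfold Rdiv.
  replace (2 * / Cmod a ^ 4 * Cmod h ^ 3) with (Cmod h ^ 3 * / (Cmod a ^ 3 * (Cmod a / 2))).
  2:{ field. lra. }
  apply Rmult_le_compat_l; trivial. apply Rinv_le_contravar.
  apply Rmult_lt_0_compat; lra. apply Rmult_le_compat_l; lra.
Qed.

Definition patch (a v : C) (g : C -> C) (z : C) : C :=
  if excluded_middle_informative (z = a) then v else g z.

Lemma patch_at a v g : patch a v g a = v.
Proof. unfold patch. destruct excluded_middle_informative; congruence. Qed.

Lemma patch_off a v g z : z <> a -> patch a v g z = g z.
Proof. intros. unfold patch. destruct excluded_middle_informative; congruence. Qed.

(** Dividing by [z - a] moves the Taylor coefficients down by one, so the
    remainder of order three becomes one of order two. *)
Lemma cubic_divided f a c d : cubic f a c d ->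
  is_Cderive (patch a c (fun z => (f z - f a) / (z - a))%C) a d.
Proof.
  intros (r & M & Hr & HM & H).
  apply (is_Cderive_quadratic _ a d r M Hr HM). intros h Hh.
  rewrite patch_at. destruct (classic (h = RtoC 0)) as [-> | Hh0].
  - replace (a + 0)%C with a by ring. rewrite patch_at.
    replace (c - c - d * 0)%C with (RtoC 0) by ring. rewrite Cmod_0. lra.
  - assert (n : (a + h)%C <> a).
    { intros e. apply Hh0. rewrite <- (Cplus_minus_l a h), e. ring. }
    rewrite patch_off by trivial.
    replace ((f (a + h) - f a) / (a + h - a) - c - d * h)%C
      with ((f (a + h) - f a - c * h - d * h ^ 2) / h)%C
      by (rewrite (Cplus_minus_l a h); now field).
    rewrite Cmod_div by trivial.
    assert (0 < Cmod h) by now apply Cmod_gt_0.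
    apply Rle_div_l; [lra |]. eapply Rle_trans; [now apply H |]. simpl. lra.
Qed.

(** ** Rules of differentiation *)

Lemma is_Cderive_const (k a : C) : is_Cderive (fun _ => k) a (RtoC 0).
Proof. eapply cubic_derive, cubic_const. Qed.

Lemma is_Cderive_id (a : C) : is_Cderive (fun z => z) a (RtoC 1).
Proof. eapply cubic_derive, cubic_id. Qed.

Lemma is_Cderive_plus (f g : C -> C) (a l : C) (l' : C) : is_Cderive f a l -> is_Cderive g a l' ->
  is_Cderive (fun z => f z + g z)%C a (l + l')%C.
Proof. intros. now apply @is_derive_plus. Qed.

(** The rules for products and inverses concern C as a module over itself, a
    structure with the same topology as the one of the normed space. *)
Lemma is_Cderive_AbsRing (f : C -> C) a l :
  is_Cderive f a l <-> is_derive (K := C_AbsRing) (V := AbsRing_NormedModule C_AbsRing) f a l.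
Proof.
  split; intros [_ H]; (split; [apply is_linear_scal_l | exact H]).
Qed.

Lemma is_Cderive_comp (f g : C -> C) (a l : C) (l' : C) : is_Cderive f (g a) l -> is_Cderive g a l' ->
  is_Cderive (fun z => f (g z)) a (l' * l)%C.
Proof.
  intros H H'. apply is_Cderive_AbsRing in H'.
  exact (is_derive_comp (K := C_AbsRing) (V := C_NormedModule) f g a l l' H H').
Qed.

Lemma is_Cderive_mult (f g : C -> C) (a l : C) (l' : C) : is_Cderive f a l -> is_Cderive g a l' ->
  is_Cderive (fun z => f z * g z)%C a (l * g a + f a * l')%C.
Proof.
  rewrite !is_Cderive_AbsRing. intros H H'.
  apply (is_derive_mult (K := C_AbsRing) f g a l l' H H'). intros. apply Cmult_comm.
Qed.

Lemma is_Cderive_inv f a l : is_Cderive f a l -> f a <> RtoC 0 ->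
  is_Cderive (fun z => / f z)%C a (l * (- / f a ^ 2))%C.
Proof.
  intros H H'. apply (is_Cderive_comp Cinv f); trivial.
  eapply cubic_derive, cubic_inv, H'.
Qed.

Lemma is_Cderive_div (f g : C -> C) (a l : C) (l' : C) : is_Cderive f a l -> is_Cderive g a l' ->
  g a <> RtoC 0 ->
  is_Cderive (fun z => f z / g z)%C a ((l * g a - f a * l') / g a ^ 2)%C.
Proof.
  intros H H' Hg.
  replace ((l * g a - f a * l') / g a ^ 2)%C
    with (l * / g a + f a * (l' * (- / g a ^ 2)))%C by (field; trivial).
  apply (is_Cderive_mult f (fun z => / g z)%C); trivial. now apply is_Cderive_inv.
Qed.

Lemma is_Cderive_ext (f g : C -> C) (a l : C) :
  (exists d, 0 < d /\ forall z, Cmod (z - a) < d -> f z = g z) ->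
  is_Cderive f a l -> is_Cderive g a l.
Proof.
  intros (d & Hd & H). apply (is_derive_ext_loc (K := C_AbsRing)).
  exists (mkposreal d Hd). intros y Hy. now apply H.
Qed.

Lemma is_Cderive_continuous f a l : is_Cderive f a l ->
  forall eps, 0 < eps -> exists d, 0 < d /\
    forall z, Cmod (z - a) < d -> Cmod (f z - f a) < eps.
Proof.
  intros H eps Heps. apply is_Cderive_eps with (eps := 1) in H; [| lra].
  destruct H as (d & Hd & H). assert (Hl := Cmod_ge_0 l).
  exists (Rmin d (eps / (2 + Cmod l))). split.
  - apply Rmin_pos; trivial. apply Rdiv_lt_0_compat; lra.
  - intros z Hz.
    assert (H1 : Cmod (z - a) < d) by (eapply Rlt_le_trans; [exact Hz | apply Rmin_l]).
    assert (H2 : Cmod (z - a) < eps / (2 + Cmod l)) by (eapply Rlt_le_trans; [exact Hz | apply Rmin_r]).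
    apply Rlt_div_r in H2; [| lra].
    specialize (H _ H1). rewrite (Cplus_minus_r a z) in H.
    replace (f z - f a)%C with ((f z - f a - l * (z - a)) + l * (z - a))%C by ring.
    eapply Rle_lt_trans; [apply Cmod_triangle |]. rewrite Cmod_mult.
    assert (H3 := Cmod_ge_0 (z - a)). nra.
Qed.

Lemma is_Cderive_nonzero f a l : is_Cderive f a l -> f a <> RtoC 0 ->
  exists d, 0 < d /\ forall z, Cmod (z - a) < d -> f z <> RtoC 0.
Proof.
  intros H Ha. apply Cmod_gt_0 in Ha.
  destruct (is_Cderive_continuous f a l H _ Ha) as (d & Hd & Hz).
  exists d. split; trivial. intros z Hzd e. specialize (Hz z Hzd).
  rewrite e in Hz. replace (0 - f a)%C with (- f a)%C in Hz by ring.
  rewrite Cmod_opp in Hz. lra.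
Qed.

Lemma holomorphic_at_intro f a :
  (exists d, 0 < d /\ forall z, Cmod (z - a) < d -> exists l, is_Cderive f z l) ->
  holomorphic_at f a.
Proof.
  intros (d & Hd & H). apply locally_Cmod. exists d. split; trivial.
Qed.

Lemma holomorphic_at_continuous f a : holomorphic_at f a ->
  forall eps, 0 < eps -> exists d, 0 < d /\
    forall z, Cmod (z - a) < d -> Cmod (f z - f a) < eps.
Proof.
  intros H. apply locally_Cmod in H. destruct H as (d & Hd & H).
  destruct (H a) as [l Hl].
  { replace (a - a)%C with (RtoC 0) by ring. now rewrite Cmod_0. }
  now apply (is_Cderive_continuous f a l).
Qed.

(** A function continuous at [a] is bounded near [a], whereas a pole is not. *)
Lemma holomorphic_not_pole f a : holomorphic_at f a -> ~ pole f a.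
Proof.
  intros Hf (m & g & Hm & Hg & Hga & Hloc).
  destruct (holomorphic_at_continuous f a Hf 1) as (d1 & Hd1 & H1); [lra |].
  apply Cmod_gt_0 in Hga.
  destruct (holomorphic_at_continuous g a Hg (Cmod (g a) / 2)) as (d2 & Hd2 & H2); [lra |].
  apply locally'_Cmod in Hloc. destruct Hloc as (d3 & Hd3 & H3).
  assert (Hfa := Cmod_ge_0 (f a)).
  set (e := Rmin (Rmin d1 d2) (Rmin (Rmin d3 1) (Cmod (g a) / (2 * (Cmod (f a) + 1)))) / 2).
  assert (He : 0 < e).
  { unfold e. apply Rdiv_lt_0_compat; [| lra]. repeat apply Rmin_pos; try lra.
    apply Rdiv_lt_0_compat; lra. }
  assert (E2 : forall x, 2 * (x / 2) = x) by (intros; field).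
  assert (He1 : 2 * e <= Rmin d1 d2). { unfold e. rewrite E2. apply Rmin_l. }
  assert (He2 : 2 * e <= Rmin (Rmin d3 1) (Cmod (g a) / (2 * (Cmod (f a) + 1)))).
  { unfold e. rewrite E2. apply Rmin_r. }
  generalize (Rmin_l d1 d2) (Rmin_r d1 d2) (Rmin_l d3 1) (Rmin_r d3 1)
    (Rmin_l (Rmin d3 1) (Cmod (g a) / (2 * (Cmod (f a) + 1))))
    (Rmin_r (Rmin d3 1) (Cmod (g a) / (2 * (Cmod (f a) + 1)))).
  intros.
  set (z := (a + RtoC e)%C).
  assert (Hz : (z - a)%C = RtoC e) by (unfold z; ring).
  assert (Hze : Cmod (z - a) = e). { rewrite Hz, Cmod_R. apply Rabs_pos_eq. lra. }
  assert (Hza : z <> a).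
  { intros E. rewrite E in Hze. replace (a - a)%C with (RtoC 0) in Hze by ring.
    rewrite Cmod_0 in Hze. lra. }
  specialize (H1 z ltac:(lra)). specialize (H2 z ltac:(lra)).
  specialize (H3 z ltac:(lra) Hza).
  assert (Hfz : Cmod (f z) <= Cmod (f a) + 1).
  { replace (f z) with ((f z - f a) + f a)%C by ring.
    eapply Rle_trans; [apply Cmod_triangle | lra]. }
  assert (Hgz : Cmod (g a) / 2 <= Cmod (g z)).
  { assert (Cmod (g a) <= Cmod (g z) + Cmod (g z - g a)).
    { replace (g a) with (g z + - (g z - g a))%C at 1 by ring.
      eapply Rle_trans; [apply Cmod_triangle |]. rewrite Cmod_opp. lra. }
    lra. }
  rewrite H3, Hz in Hfz.
  assert (Hem : (RtoC e ^ m)%C <> RtoC 0).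
  { apply Cpow_nz. intros E. apply RtoC_inj in E. lra. }
  rewrite Cmod_div, Cmod_pow, Cmod_R, Rabs_pos_eq in Hfz by (trivial; lra).
  assert (e ^ m <= e).
  { destruct m as [|m]; [lia |]. simpl. assert (e ^ m <= 1).
    { rewrite <- (pow1 m). apply pow_incr. lra. }
    assert (0 < e ^ m) by now apply pow_lt. nra. }
  assert (0 < e ^ m) by now apply pow_lt.
  apply Rle_div_l in Hfz; [| lra].
  assert (2 * e * (2 * (Cmod (f a) + 1)) <= Cmod (g a)).
  { apply Rle_div_r; lra. }
  nra.
Qed.

(** ** The complex exponential *)

Lemma Cexp_plus a b : Cexp (a + b) = (Cexp a * Cexp b)%C.
Proof.
  destruct a as [x y], b as [u v]. unfold Cexp, Cmult, Re, Im; simpl.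
  rewrite exp_plus, cos_plus, sin_plus. f_equal; ring.
Qed.

Lemma Cexp_RtoC x : Cexp (RtoC x) = RtoC (exp x).
Proof.
  unfold Cexp, RtoC, Re, Im; simpl. rewrite cos_0, sin_0. f_equal; ring.
Qed.

Lemma Cexp_0 : Cexp 0 = RtoC 1.
Proof. rewrite Cexp_RtoC, exp_0. reflexivity. Qed.

Lemma Cmod_Cexp z : Cmod (Cexp z) = exp (Re z).
Proof.
  unfold Cmod, Cexp. simpl fst; simpl snd.
  replace ((exp (Re z) * cos (Im z)) ^ 2 + (exp (Re z) * sin (Im z)) ^ 2)
    with (exp (Re z) ^ 2).
  - rewrite sqrt_pow2; trivial. apply Rlt_le, exp_pos.
  - generalize (sin2_cos2 (Im z)). unfold Rsqr. intros H.
    replace (exp (Re z) ^ 2) with (exp (Re z) ^ 2 * (sin (Im z) * sin (Im z) + cos (Im z) * cos (Im z))) by (rewrite H; ring).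
    ring.
Qed.

Lemma Cexp_neq_0 z : Cexp z <> RtoC 0.
Proof. apply Cmod_gt_0. rewrite Cmod_Cexp. apply exp_pos. Qed.

(** Project on the direction of the increment and use the real mean value
    inequality. *)
Lemma Cmod_mean_value (f df : R -> C) (M : R) :
  (forall t, Rabs t <= 1 ->
     is_derive (fun t => Re (f t)) t (Re (df t)) /\
     is_derive (fun t => Im (f t)) t (Im (df t)) /\ Cmod (df t) <= M) ->
  Cmod (f 1 - f 0) <= M.
Proof.
  intros H. set (v := (f 1 - f 0)%C).
  destruct (classic (v = RtoC 0)) as [E | Hv].
  - rewrite E, Cmod_0. destruct (H 0) as (_ & _ & H0). rewrite Rabs_R0; lra.
    eapply Rle_trans; [apply Cmod_ge_0 | exact H0].
  - apply Cmod_gt_0 in Hv.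
    assert (Hsq : Cmod v ^ 2 = Re v ^ 2 + Im v ^ 2) by apply Cmod2_alt.
    generalize (bounded_variation (fun t => Re v * Re (f t) + Im v * Im (f t))
      (fun t => Re v * Re (df t) + Im v * Im (df t)) (Cmod v * M) 0 1).
    intros B.
    assert (B' : Rabs (Re v * Re (f 1) + Im v * Im (f 1) - (Re v * Re (f 0) + Im v * Im (f 0)))
                 <= Cmod v * M * Rabs (1 - 0)).
    { apply B. intros t Ht. rewrite Rminus_0_r, Rminus_0_r, Rabs_R1 in Ht.
      destruct (H t Ht) as (H1 & H2 & H3). split.
      - apply @is_derive_plus; apply is_derive_scal; trivial.
      - apply Rle_trans with (Cmod (Cconj v * df t)).
        + eapply Rle_trans; [| apply re_le_Cmod]. apply Req_le. f_equal.
          destruct v, (df t). unfold Cconj, Cmult, Re, Im; simpl. ring.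
        + rewrite Cmod_mult, Cmod_conj. apply Rmult_le_compat_l; trivial. lra. }
    rewrite Rminus_0_r, Rabs_R1, Rmult_1_r in B'.
    replace (Re v * Re (f 1) + Im v * Im (f 1) - (Re v * Re (f 0) + Im v * Im (f 0)))
      with (Cmod v ^ 2) in B'.
    + rewrite Rabs_pos_eq in B'; [nra | apply pow2_ge_0].
    + rewrite Hsq. unfold v. destruct (f 1), (f 0). unfold Re, Im; simpl. ring.
Qed.

Lemma is_derive_Cexp_line (w : C) (t : R) :
  is_derive (fun t : R => Re (Cexp (t * w))) t (Re (w * Cexp (t * w))) /\
  is_derive (fun t : R => Im (Cexp (t * w))) t (Im (w * Cexp (t * w))).
Proof.
  destruct w as [x y]. unfold Cexp, Cmult, RtoC, Re, Im; simpl.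
  split; auto_derive; trivial; unfold Rminus; ring.
Qed.

Lemma Cmod_scal_le (t : R) (w : C) : Rabs t <= 1 -> Cmod (t * w) <= Cmod w.
Proof.
  intros H. rewrite Cmod_mult, Cmod_R. generalize (Cmod_ge_0 w). nra.
Qed.

Lemma exp_le_mono x y : x <= y -> exp x <= exp y.
Proof. intros [H | ->]; [left; now apply exp_increasing | right; trivial]. Qed.

Lemma Cexp_le z : Cmod (Cexp z) <= exp (Cmod z).
Proof.
  rewrite Cmod_Cexp. apply exp_le_mono. eapply Rle_trans; [| apply re_le_Cmod]. apply Rle_abs.
Qed.

Lemma Cexp_taylor0 w : Cmod (Cexp w - 1) <= Cmod w * exp (Cmod w).
Proof.
  replace (Cexp w - 1)%C with (Cexp (1 * w) - Cexp (0 * w))%C.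
  2:{ replace (1 * w)%C with w by ring. replace (0 * w)%C with (RtoC 0) by ring. now rewrite Cexp_0. }
  apply (Cmod_mean_value (fun t => Cexp (t * w)) (fun t => w * Cexp (t * w))%C).
  intros t Ht. destruct (is_derive_Cexp_line w t) as [H1 H2]. split; [exact H1 | split; [exact H2 |]].
  cbv beta; rewrite Cmod_mult. apply Rmult_le_compat_l; [apply Cmod_ge_0 |].
  eapply Rle_trans; [apply Cexp_le | apply exp_le_mono, Cmod_scal_le, Ht].
Qed.

Lemma Cexp_taylor1 w : Cmod (Cexp w - 1 - w) <= Cmod w ^ 2 * exp (Cmod w).
Proof.
  replace (Cexp w - 1 - w)%C with ((Cexp (1 * w) - 1 * w) - (Cexp (0 * w) - 0 * w))%C.
  2:{ replace (1 * w)%C with w by ring. replace (0 * w)%C with (RtoC 0) by ring. rewrite Cexp_0. ring. }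
  apply (Cmod_mean_value (fun t => Cexp (t * w) - t * w)%C (fun t => w * (Cexp (t * w) - 1))%C).
  intros t Ht. destruct (is_derive_Cexp_line w t) as [H1 H2]. split; [| split].
  - apply is_derive_ext with (fun t : R => Re (Cexp (t * w)) - t * Re w).
    { intros u. destruct w. unfold Re, Cminus, Cmult, Cplus, Copp, RtoC; simpl. ring. }
    replace (Re (w * (Cexp (t * w) - 1))) with (Re (w * Cexp (t * w)) - Re w).
    2:{ destruct w, (Cexp (t * (r, r0))). unfold Re, Cminus, Cmult, Cplus, Copp, RtoC; simpl. ring. }
    apply @is_derive_minus; trivial. auto_derive; trivial. ring.
  - apply is_derive_ext with (fun t : R => Im (Cexp (t * w)) - t * Im w).
    { intros u. destruct w. unfold Im, Cminus, Cmult, Cplus, Copp, RtoC; simpl. ring. }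
    replace (Im (w * (Cexp (t * w) - 1))) with (Im (w * Cexp (t * w)) - Im w).
    2:{ destruct w, (Cexp (t * (r, r0))). unfold Im, Cminus, Cmult, Cplus, Copp, RtoC; simpl. ring. }
    apply @is_derive_minus; trivial. auto_derive; trivial. ring.
  - cbv beta; rewrite Cmod_mult. simpl. rewrite Rmult_assoc. apply Rmult_le_compat_l; [apply Cmod_ge_0 |].
    eapply Rle_trans; [apply Cexp_taylor0 |]. rewrite Rmult_1_r.
    apply Rmult_le_compat; [apply Cmod_ge_0 | apply Rlt_le, exp_pos | now apply Cmod_scal_le |].
    apply exp_le_mono, Cmod_scal_le, Ht.
Qed.

(** Each order follows from the previous one by the mean value inequality on
    the segment from 0 to [w]. *)
Lemma Cexp_taylor2 w : Cmod (Cexp w - 1 - w - w ^ 2 / 2) <= Cmod w ^ 3 * exp (Cmod w).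
Proof.
  replace (Cexp w - 1 - w - w ^ 2 / 2)%C
    with ((Cexp (1 * w) - 1 * w - 1 * 1 * (w ^ 2 / 2)) - (Cexp (0 * w) - 0 * w - 0 * 0 * (w ^ 2 / 2)))%C.
  2:{ replace (1 * w)%C with w by ring. replace (0 * w)%C with (RtoC 0) by ring. rewrite Cexp_0. ring. }
  apply (Cmod_mean_value (fun t => Cexp (t * w) - t * w - t * t * (w ^ 2 / 2))%C
    (fun t => w * (Cexp (t * w) - 1 - t * w))%C).
  assert (E : (w ^ 2 / 2)%C = ((Re w ^ 2 - Im w ^ 2) / 2, Re w * Im w)).
  { destruct w as [x y]. unfold Cdiv, Cinv, Cmult, RtoC, Re, Im; simpl. f_equal; field. }
  intros t Ht. destruct (is_derive_Cexp_line w t) as [H1 H2]. split; [| split].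
  - apply is_derive_ext with (fun t : R => Re (Cexp (t * w)) - (t * Re w + t * t * ((Re w ^ 2 - Im w ^ 2) / 2))).
    { intros u. rewrite E. destruct w. unfold Re, Im, Cminus, Cmult, Cplus, Copp, RtoC; simpl. ring. }
    replace (Re (w * (Cexp (t * w) - 1 - t * w))) with (Re (w * Cexp (t * w)) - (Re w + t * (Re w ^ 2 - Im w ^ 2))).
    2:{ destruct w, (Cexp (t * (r, r0))). unfold Re, Im, Cminus, Cmult, Cplus, Copp, RtoC; simpl. ring. }
    apply @is_derive_minus; trivial. auto_derive; trivial. field.
  - apply is_derive_ext with (fun t : R => Im (Cexp (t * w)) - (t * Im w + t * t * (Re w * Im w))).
    { intros u. rewrite E. destruct w. unfold Re, Im, Cminus, Cmult, Cplus, Copp, RtoC; simpl. ring. }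
    replace (Im (w * (Cexp (t * w) - 1 - t * w))) with (Im (w * Cexp (t * w)) - (Im w + 2 * t * (Re w * Im w))).
    2:{ destruct w, (Cexp (t * (r, r0))). unfold Re, Im, Cminus, Cmult, Cplus, Copp, RtoC; simpl. ring. }
    apply @is_derive_minus; trivial. auto_derive; trivial. ring.
  - cbv beta; rewrite Cmod_mult. replace (Cmod w ^ 3) with (Cmod w * Cmod w ^ 2) by ring.
    rewrite Rmult_assoc. apply Rmult_le_compat_l; [apply Cmod_ge_0 |].
    eapply Rle_trans; [apply Cexp_taylor1 |].
    apply Rmult_le_compat; [apply pow2_ge_0 | apply Rlt_le, exp_pos | |].
    + apply pow_incr. split; [apply Cmod_ge_0 | now apply Cmod_scal_le].
    + apply exp_le_mono, Cmod_scal_le, Ht.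
Qed.

Lemma cubic_Cexp_scal (k a : C) :
  cubic (fun s => Cexp (k * s)) a (k * Cexp (k * a)) (k ^ 2 / 2 * Cexp (k * a)).
Proof.
  assert (HM : 0 <= Cmod (Cexp (k * a)) * (Cmod k ^ 3 * exp (Cmod k))).
  { apply Rmult_le_pos; [apply Cmod_ge_0 |].
    apply Rmult_le_pos; [apply pow_le, Cmod_ge_0 | apply Rlt_le, exp_pos]. }
  exists 1, (Cmod (Cexp (k * a)) * (Cmod k ^ 3 * exp (Cmod k))).
  split; [lra | split; trivial]. intros h Hh.
  replace (k * (a + h))%C with (k * a + k * h)%C by ring. rewrite Cexp_plus.
  replace (Cexp (k * a) * Cexp (k * h) - Cexp (k * a) - k * Cexp (k * a) * h - k ^ 2 / 2 * Cexp (k * a) * h ^ 2)%C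
    with (Cexp (k * a) * (Cexp (k * h) - 1 - k * h - (k * h) ^ 2 / 2))%C by field.
  rewrite Cmod_mult, !Rmult_assoc. apply Rmult_le_compat_l; [apply Cmod_ge_0 |].
  eapply Rle_trans; [apply Cexp_taylor2 |].
  rewrite Cmod_mult, Rpow_mult_distr, Rmult_assoc.
  apply Rmult_le_compat_l; [apply pow_le, Cmod_ge_0 |].
  rewrite Rmult_comm. apply Rmult_le_compat_r; [apply pow_le, Cmod_ge_0 |].
  apply exp_le_mono. generalize (Cmod_ge_0 k) (Cmod_ge_0 h). nra.
Qed.

(** * Limits, sums and products of complex sequences *)

Definition Clim (u : nat -> C) (l : C) : Prop :=
  forall eps, 0 < eps -> exists N, forall n, (N <= n)%nat -> Cmod (u n - l) < eps.

Lemma Clim_ext_from u v l N0 : (forall n, (N0 <= n)%nat -> u n = v n) -> Clim u l -> Clim v l.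
Proof.
  intros E H eps Heps. destruct (H eps Heps) as [N HN]. exists (N + N0)%nat.
  intros n Hn. rewrite <- E by lia. apply HN. lia.
Qed.

Lemma Clim_ext u v l : (forall n, u n = v n) -> Clim u l -> Clim v l.
Proof. intros E. apply (Clim_ext_from u v l 0). intros; apply E. Qed.

Lemma Clim_const k : Clim (fun _ => k) k.
Proof.
  intros eps Heps. exists 0%nat. intros. replace (k - k)%C with (RtoC 0) by ring.
  now rewrite Cmod_0.
Qed.

Lemma Clim_le_dist u l k B N0 : Clim u l ->
  (forall n, (N0 <= n)%nat -> Cmod (u n - k) <= B) -> Cmod (l - k) <= B.
Proof.
  intros H HB. apply Rnot_lt_le. intros Hlt.
  destruct (H (Cmod (l - k) - B)) as [N HN]; [lra |].
  specialize (HN (N + N0)%nat ltac:(lia)). specialize (HB (N + N0)%nat ltac:(lia)).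
  assert (Cmod (l - k) <= Cmod (u (N + N0)%nat - k) + Cmod (u (N + N0)%nat - l)).
  { replace (l - k)%C with ((u (N + N0)%nat - k) + - (u (N + N0)%nat - l))%C by ring.
    eapply Rle_trans; [apply Cmod_triangle |]. rewrite Cmod_opp. lra. }
  lra.
Qed.

Lemma Clim_le u l B N0 : Clim u l ->
  (forall n, (N0 <= n)%nat -> Cmod (u n) <= B) -> Cmod l <= B.
Proof.
  intros H HB. replace l with (l - 0)%C by ring. apply (Clim_le_dist u l 0 B N0 H).
  intros n Hn. replace (u n - 0)%C with (u n) by ring. now apply HB.
Qed.

Lemma Clim_unique u l l' : Clim u l -> Clim u l' -> l = l'.
Proof.
  intros H H'. assert (E : (l - l')%C = RtoC 0).
  { apply Cmod_eq_0. apply Rle_antisym; [| apply Cmod_ge_0].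
    apply Rnot_lt_le. intros Hlt. destruct (H' (Cmod (l - l') / 2)) as [N HN]; [lra |].
    assert (Cmod (l - l') <= Cmod (l - l') / 2); [| lra].
    apply (Clim_le_dist u l l' _ N H). intros n Hn. left. now apply HN. }
  replace l with (l - l' + l')%C by ring. rewrite E. ring.
Qed.

Lemma Clim_plus u v l l' : Clim u l -> Clim v l' -> Clim (fun n => u n + v n)%C (l + l').
Proof.
  intros H H' eps Heps. destruct (H (eps / 2)) as [N HN]; [lra |].
  destruct (H' (eps / 2)) as [N' HN']; [lra |]. exists (N + N')%nat. intros n Hn.
  replace (u n + v n - (l + l'))%C with ((u n - l) + (v n - l'))%C by ring.
  eapply Rle_lt_trans; [apply Cmod_triangle |].
  specialize (HN n ltac:(lia)). specialize (HN' n ltac:(lia)). lra.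
Qed.

Lemma Clim_scal k u l : Clim u l -> Clim (fun n => k * u n)%C (k * l).
Proof.
  intros H eps Heps. assert (Hk := Cmod_ge_0 k).
  destruct (H (eps / (Cmod k + 1))) as [N HN]; [apply Rdiv_lt_0_compat; lra |].
  exists N. intros n Hn. replace (k * u n - k * l)%C with (k * (u n - l))%C by ring.
  rewrite Cmod_mult. specialize (HN n Hn).
  apply Rlt_div_r in HN; [| lra]. generalize (Cmod_ge_0 (u n - l)). nra.
Qed.

Lemma Clim_mult u v l l' : Clim u l -> Clim v l' -> Clim (fun n => u n * v n)%C (l * l').
Proof.
  intros H H' eps Heps.
  assert (Hl := Cmod_ge_0 l). assert (Hl' := Cmod_ge_0 l').
  set (e := Rmin 1 (eps / (Cmod l + Cmod l' + 2))).
  assert (He : 0 < e). { apply Rmin_pos; [lra | apply Rdiv_lt_0_compat; lra]. }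
  assert (He1 : e <= 1) by apply Rmin_l.
  assert (He2 : e * (Cmod l + Cmod l' + 2) <= eps).
  { apply Rle_div_r; [lra | apply Rmin_r]. }
  destruct (H e He) as [N HN]. destruct (H' e He) as [N' HN'].
  exists (N + N')%nat. intros n Hn.
  specialize (HN n ltac:(lia)). specialize (HN' n ltac:(lia)).
  replace (u n * v n - l * l')%C with ((u n - l) * (v n - l') + (u n - l) * l' + l * (v n - l'))%C by ring.
  eapply Rle_lt_trans; [apply Cmod_triangle |].
  eapply Rle_lt_trans; [apply Rplus_le_compat_r, Cmod_triangle |].
  rewrite !Cmod_mult.
  generalize (Cmod_ge_0 (u n - l)) (Cmod_ge_0 (v n - l')). intros. nra.
Qed.

Lemma Clim_shift u l k : Clim u l -> Clim (fun n => u (n + k)%nat) l.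
Proof.
  intros H eps Heps. destruct (H eps Heps) as [N HN]. exists N. intros n Hn. apply HN. lia.
Qed.

Lemma Clim_RtoC (u : nat -> R) (l : R) : is_lim_seq u l -> Clim (fun n => RtoC (u n)) (RtoC l).
Proof.
  intros H eps Heps. apply is_lim_seq_spec in H. destruct (H (mkposreal eps Heps)) as [N HN].
  exists N. intros n Hn. rewrite <- RtoC_minus, Cmod_R. now apply HN.
Qed.

Lemma Clim_components u (x y : R) :
  is_lim_seq (fun n => Re (u n)) x -> is_lim_seq (fun n => Im (u n)) y -> Clim u (x, y).
Proof.
  intros Hx Hy. apply Clim_RtoC in Hx. apply Clim_RtoC in Hy.
  apply (Clim_ext (fun n => RtoC (Re (u n)) + Ci * RtoC (Im (u n)))%C).
  { intros n. destruct (u n). unfold RtoC, Ci, Re, Im, Cplus, Cmult; simpl. f_equal; ring. }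
  replace ((x, y) : C) with (RtoC x + Ci * RtoC y)%C.
  2:{ unfold RtoC, Ci, Cplus, Cmult; simpl. f_equal; ring. }
  apply Clim_plus; trivial. now apply Clim_scal.
Qed.

Lemma Re_minus_le a b : Rabs (Re a - Re b) <= Cmod (a - b).
Proof. apply (re_le_Cmod (a - b)). Qed.

Lemma Im_minus_le a b : Rabs (Im a - Im b) <= Cmod (a - b).
Proof. eapply Rle_trans; [apply Rmax_r | apply (Rmax_Cmod (a - b)%C)]. Qed.

Lemma Clim_Re u l : Clim u l -> is_lim_seq (fun n => Re (u n)) (Re l).
Proof.
  intros H. apply is_lim_seq_spec. intros eps. destruct (H eps (cond_pos eps)) as [N HN].
  exists N. intros n Hn. eapply Rle_lt_trans; [apply Re_minus_le | now apply HN].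
Qed.

Lemma Clim_Im u l : Clim u l -> is_lim_seq (fun n => Im (u n)) (Im l).
Proof.
  intros H. apply is_lim_seq_spec. intros eps. destruct (H eps (cond_pos eps)) as [N HN].
  exists N. intros n Hn. eapply Rle_lt_trans; [apply Im_minus_le | now apply HN].
Qed.

Lemma Clim_cauchy u :
  (forall eps, 0 < eps -> exists N, forall n m, (N <= n)%nat -> (N <= m)%nat -> Cmod (u n - u m) < eps) ->
  exists l, Clim u l.
Proof.
  intros H.
  assert (Hx : ex_finite_lim_seq (fun n => Re (u n))).
  { apply ex_lim_seq_cauchy_corr. intros eps. destruct (H eps (cond_pos eps)) as [N HN].
    exists N. intros n m Hn Hm. eapply Rle_lt_trans; [apply Re_minus_le | now apply HN]. }
  assert (Hy : ex_finite_lim_seq (fun n => Im (u n))).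
  { apply ex_lim_seq_cauchy_corr. intros eps. destruct (H eps (cond_pos eps)) as [N HN].
    exists N. intros n m Hn Hm. eapply Rle_lt_trans; [apply Im_minus_le | now apply HN]. }
  destruct Hx as [x Hx], Hy as [y Hy]. exists (x, y). now apply Clim_components.
Qed.

Fixpoint Rsum (f : nat -> R) (n : nat) : R :=
  match n with O => 0 | S n => Rsum f n + f n end.

Fixpoint Csum (f : nat -> C) (n : nat) : C :=
  match n with O => RtoC 0 | S n => (Csum f n + f n)%C end.

Fixpoint Cprod (f : nat -> C) (n : nat) : C :=
  match n with O => RtoC 1 | S n => (Cprod f n * f n)%C end.

Lemma Rsum_ext f g n : (forall k, (k < n)%nat -> f k = g k) -> Rsum f n = Rsum g n.
Proof. induction n; simpl; intros; trivial. rewrite IHn, H; auto. Qed.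

Lemma Csum_ext f g n : (forall k, (k < n)%nat -> f k = g k) -> Csum f n = Csum g n.
Proof. induction n; simpl; intros; trivial. rewrite IHn, H; auto. Qed.

Lemma Cprod_ext f g n : (forall k, (k < n)%nat -> f k = g k) -> Cprod f n = Cprod g n.
Proof. induction n; simpl; intros; trivial. rewrite IHn, H; auto. Qed.

Lemma Rsum_plus f n m : Rsum f (n + m) = Rsum f n + Rsum (fun k => f (n + k)%nat) m.
Proof.
  induction m; simpl. rewrite Nat.add_0_r; ring.
  replace (n + S m)%nat with (S (n + m)) by lia. simpl. rewrite IHm. ring.
Qed.

Lemma Csum_plus f n m : Csum f (n + m) = (Csum f n + Csum (fun k => f (n + k)%nat) m)%C.
Proof.
  induction m; simpl. rewrite Nat.add_0_r; ring.
  replace (n + S m)%nat with (S (n + m)) by lia. simpl. rewrite IHm. ring.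
Qed.

Lemma Cprod_plus f n m : Cprod f (n + m) = (Cprod f n * Cprod (fun k => f (n + k)%nat) m)%C.
Proof.
  induction m; simpl. rewrite Nat.add_0_r; ring.
  replace (n + S m)%nat with (S (n + m)) by lia. simpl. rewrite IHm. ring.
Qed.

Lemma Cprod_mult f g n : Cprod (fun k => f k * g k)%C n = (Cprod f n * Cprod g n)%C.
Proof. induction n; simpl. ring. rewrite IHn. ring. Qed.

Lemma Rsum_le f g n : (forall k, (k < n)%nat -> f k <= g k) -> Rsum f n <= Rsum g n.
Proof. induction n; simpl; intros. lra. generalize (H n ltac:(lia)). assert (Rsum f n <= Rsum g n) by auto. lra. Qed.

Lemma Rsum_pos f n : (forall k, (k < n)%nat -> 0 <= f k) -> 0 <= Rsum f n.
Proof. induction n; simpl; intros. lra. generalize (H n ltac:(lia)). assert (0 <= Rsum f n) by auto. lra. Qed.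

Lemma Rsum_scal k f n : Rsum (fun i => k * f i) n = k * Rsum f n.
Proof. induction n; simpl. ring. rewrite IHn. ring. Qed.

Lemma Csum_scal k f n : Csum (fun i => k * f i)%C n = (k * Csum f n)%C.
Proof. induction n; simpl. ring. rewrite IHn. ring. Qed.

Lemma Cmod_Csum f n : Cmod (Csum f n) <= Rsum (fun k => Cmod (f k)) n.
Proof.
  induction n; simpl. rewrite Cmod_0. lra.
  eapply Rle_trans; [apply Cmod_triangle | lra].
Qed.

Lemma Cprod_bound a n :
  Cmod (Cprod (fun k => 1 + a k)%C n) <= exp (Rsum (fun k => Cmod (a k)) n).
Proof.
  induction n; simpl. rewrite Cmod_1, exp_0. lra.
  rewrite Cmod_mult, exp_plus. apply Rmult_le_compat; try apply Cmod_ge_0; trivial.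
  eapply Rle_trans; [apply Cmod_triangle |]. rewrite Cmod_1. apply exp_ineq1_le.
Qed.

(** Expanding the product, every term of the left side is dominated by the
    corresponding term for the moduli. *)
Lemma Cprod_minus_1 a n :
  Cmod (Cprod (fun k => 1 + a k)%C n - 1) <= exp (Rsum (fun k => Cmod (a k)) n) - 1.
Proof.
  induction n; simpl. replace (1 - 1)%C with (RtoC 0) by ring. rewrite Cmod_0, exp_0. lra.
  replace (Cprod (fun k => 1 + a k) n * (1 + a n) - 1)%C
    with ((Cprod (fun k => 1 + a k)%C n - 1) + Cprod (fun k => 1 + a k)%C n * a n)%C by ring.
  eapply Rle_trans; [apply Cmod_triangle |]. rewrite Cmod_mult, exp_plus.
  generalize (Cprod_bound a n) (exp_ineq1_le (Cmod (a n))) (Cmod_ge_0 (a n))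
    (exp_pos (Rsum (fun k => Cmod (a k)) n)). nra.
Qed.

Lemma exp_minus_1_small eps : 0 < eps -> exists d, 0 < d /\ forall x, x <= d -> exp x - 1 < eps.
Proof.
  intros H. exists (ln (1 + eps / 2)). split.
  - rewrite <- ln_1. apply ln_increasing; lra.
  - intros x Hx. apply exp_le_mono in Hx. rewrite exp_ln in Hx; lra.
Qed.

(** Telescoping: [1 / (m + 1) ^ 2 <= 1 / m - 1 / (m + 1)]. *)
Lemma sq_tail (m n : nat) : (0 < m)%nat ->
  Rsum (fun k => / (INR (m + k) + 1) ^ 2) n <= / INR m - / INR (m + n).
Proof.
  intros Hm. assert (Hm' : 0 < INR m) by now apply lt_0_INR.
  induction n; cbn [Rsum]. rewrite Nat.add_0_r. lra.
  replace (m + S n)%nat with (S (m + n)) by lia. rewrite S_INR.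
  assert (0 < INR (m + n)) by (apply lt_0_INR; lia). set (x := INR (m + n)) in *.
  assert (/ (x + 1) ^ 2 <= / x - / (x + 1)); [| lra].
  replace (/ x - / (x + 1)) with (/ (x * (x + 1))) by (field; lra).
  apply Rinv_le_contravar; [nra | simpl; nra].
Qed.

(** ** Infinite products with quadratically decaying terms *)

(** The reciprocals [iota] of the zeros of [Phi] satisfy this bound, since the
    [k]-th zero is at least [(k + 1) ^ 2]; it makes every series below converge
    with explicit tails. *)
Definition sq_small (iota : nat -> R) : Prop :=
  forall k, 0 <= iota k <= / (INR k + 1) ^ 2.

Lemma sq_small_tail iota m n : sq_small iota -> (0 < m)%nat ->
  Rsum (fun k => iota (m + k)%nat) n <= / INR m.
Proof.
  intros H Hm. eapply Rle_trans; [apply Rsum_le; intros; apply H |].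
  eapply Rle_trans; [now apply sq_tail |].
  assert (0 < / INR (m + n)) by (apply Rinv_0_lt_compat, lt_0_INR; lia). lra.
Qed.

Lemma sq_small_sum iota n : sq_small iota -> Rsum iota n <= 2.
Proof.
  intros H. destruct n; simpl; [lra |].
  change (Rsum iota (S n) <= 2). change (S n) with (1 + n)%nat. rewrite Rsum_plus.
  generalize (sq_small_tail iota 1 n H ltac:(lia)) (H 0%nat). simpl.
  rewrite Rinv_1, Rplus_0_l, Rmult_1_r, Rmult_1_r, Rinv_1. lra.
Qed.

Lemma Rsum_Cmod_scal z iota n : sq_small iota ->
  Rsum (fun k => Cmod (z * iota k)) n = Cmod z * Rsum iota n.
Proof.
  intros H. rewrite <- Rsum_scal. apply Rsum_ext. intros. rewrite Cmod_mult, Cmod_R.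
  rewrite Rabs_pos_eq; trivial. apply H.
Qed.

Lemma sq_small_shift iota m : sq_small iota -> sq_small (fun k => iota (m + k)%nat).
Proof.
  intros H k. split; [apply H |]. eapply Rle_trans; [apply H |].
  apply Rinv_le_contravar. apply pow_lt. generalize (pos_INR k). lra.
  apply pow_incr. rewrite plus_INR. generalize (pos_INR k) (pos_INR m). lra.
Qed.

Lemma Cprod_tail iota z m n : sq_small iota -> (0 < m)%nat ->
  Cmod (Cprod (fun k => 1 + z * iota (m + k)%nat)%C n - 1) <= exp (Cmod z * / INR m) - 1.
Proof.
  intros H Hm. eapply Rle_trans; [apply Cprod_minus_1 |].
  rewrite (Rsum_Cmod_scal z (fun k => iota (m + k)%nat)) by now apply sq_small_shift.
  assert (exp (Cmod z * Rsum (fun k => iota (m + k)%nat) n) <= exp (Cmod z * / INR m)); [| lra].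
  apply exp_le_mono, Rmult_le_compat_l; [apply Cmod_ge_0 | now apply sq_small_tail].
Qed.

Lemma inv_INR_small eps : 0 < eps -> exists m, (0 < m)%nat /\ / INR m <= eps.
Proof.
  intros H. destruct (archimed_cor1 eps H) as (m & Hm & Hm0). exists m. split; [lia | lra].
Qed.

Lemma Cprod_tail_small iota z eps : sq_small iota -> 0 < eps ->
  exists m, (0 < m)%nat /\ forall m' n, (m <= m')%nat ->
    Cmod (Cprod (fun k => 1 + z * iota (m' + k)%nat)%C n - 1) < eps.
Proof.
  intros H Heps. destruct (exp_minus_1_small eps Heps) as (d & Hd & He).
  assert (Hz := Cmod_ge_0 z).
  destruct (inv_INR_small (d / (Cmod z + 1))) as (m & Hm & Hmd).
  { apply Rdiv_lt_0_compat; lra. }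
  exists m. split; trivial. intros m' n Hm'.
  eapply Rle_lt_trans; [apply Cprod_tail; trivial; lia |]. apply He.
  assert (/ INR m' <= / INR m). { apply Rinv_le_contravar; [now apply lt_0_INR | now apply le_INR]. }
  assert (/ INR m * (Cmod z + 1) <= d) by (apply Rle_div_r; lra).
  assert (0 < / INR m') by (apply Rinv_0_lt_compat, lt_0_INR; lia). nra.
Qed.

Lemma Cprod_bounded iota z n : sq_small iota ->
  Cmod (Cprod (fun k => 1 + z * iota k)%C n) <= exp (2 * Cmod z).
Proof.
  intros H. eapply Rle_trans; [apply Cprod_bound |]. cbv beta; rewrite (Rsum_Cmod_scal z iota n) by trivial.
  apply exp_le_mono. generalize (sq_small_sum iota n H) (Cmod_ge_0 z). nra.
Qed.

Lemma eprod_exists iota z : sq_small iota ->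
  exists l, Clim (Cprod (fun k => 1 + z * iota k)%C) l.
Proof.
  intros H. apply Clim_cauchy. intros eps Heps.
  assert (Hb := exp_pos (2 * Cmod z)).
  destruct (Cprod_tail_small iota z (eps / (exp (2 * Cmod z) * 2)) H) as (m & Hm & Ht).
  { apply Rdiv_lt_0_compat; lra. }
  set (e := eps / (exp (2 * Cmod z) * 2)) in *.
  assert (He : e * exp (2 * Cmod z) = eps / 2) by (unfold e; field; lra).
  exists m. assert (G : forall n, (m <= n)%nat ->
    Cmod (Cprod (fun k => 1 + z * iota k)%C n - Cprod (fun k => 1 + z * iota k)%C m) < eps / 2).
  { intros n Hn. replace n with (m + (n - m))%nat by lia. rewrite Cprod_plus.
    set (Q := Cprod _ (n - m)). specialize (Ht m (n - m)%nat (le_n m)). fold Q in Ht.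
    set (P := Cprod _ m). assert (HP : Cmod P <= exp (2 * Cmod z)) by now apply Cprod_bounded.
    replace (P * Q - P)%C with (P * (Q - 1))%C by ring. rewrite Cmod_mult.
    generalize (Cmod_ge_0 P) (Cmod_ge_0 (Q - 1)). nra. }
  intros n n' Hn Hn'. generalize (G n Hn) (G n' Hn'). set (P := Cprod _ m).
  set (u := Cprod _ n). set (u' := Cprod _ n'). intros.
  replace (u - u')%C with ((u - P) + - (u' - P))%C by ring.
  eapply Rle_lt_trans; [apply Cmod_triangle |]. rewrite Cmod_opp. lra.
Qed.

Definition eprod (iota : nat -> R) (z : C) : C :=
  epsilon (inhabits (RtoC 0)) (Clim (Cprod (fun k => 1 + z * iota k)%C)).

Lemma eprod_lim iota z : sq_small iota -> Clim (Cprod (fun k => 1 + z * iota k)%C) (eprod iota z).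
Proof. intros H. unfold eprod. apply epsilon_spec. now apply eprod_exists. Qed.

Lemma eprod_unique iota z l : sq_small iota ->
  Clim (Cprod (fun k => 1 + z * iota k)%C) l -> eprod iota z = l.
Proof. intros H Hl. eapply Clim_unique; [now apply eprod_lim | exact Hl]. Qed.

Lemma Cprod_neq_0 f n : (forall k, f k <> RtoC 0) -> Cprod f n <> RtoC 0.
Proof.
  intros H. induction n; simpl. intros E. apply RtoC_inj in E. lra.
  now apply Cmult_neq_0.
Qed.

Lemma eprod_neq_0 iota z : sq_small iota ->
  (forall k, (1 + z * iota k)%C <> RtoC 0) -> eprod iota z <> RtoC 0.
Proof.
  intros H Hk. destruct (Cprod_tail_small iota z (1 / 2) H) as (m & Hm & Ht); [lra |].
  set (P := Cprod (fun k => 1 + z * iota k)%C m).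
  assert (HP : 0 < Cmod P) by (apply Cmod_gt_0, Cprod_neq_0; trivial).
  assert (G : Cmod (eprod iota z - P) <= Cmod P * (1 / 2)).
  { apply (Clim_le_dist _ _ P _ m (eprod_lim iota z H)). intros n Hn.
    replace n with (m + (n - m))%nat by lia. rewrite Cprod_plus. fold P.
    specialize (Ht m (n - m)%nat (le_n m)). set (Q := Cprod _ (n - m)) in *.
    replace (P * Q - P)%C with (P * (Q - 1))%C by ring. rewrite Cmod_mult. nra. }
  intros E. rewrite E in G. replace (0 - P)%C with (- P)%C in G by ring.
  rewrite Cmod_opp in G. lra.
Qed.

(** A uniform quadratic bound survives pointwise limits, because it forces the
    derivatives themselves to form a Cauchy sequence. *)
Lemma Clim_derive (f : nat -> C -> C) (g : C -> C) (c : nat -> C) a r M :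
  0 < r -> 0 <= M ->
  (forall z, Cmod (z - a) < r -> Clim (fun n => f n z) (g z)) ->
  (forall n h, Cmod h < r -> Cmod (f n (a + h) - f n a - c n * h)%C <= M * Cmod h ^ 2) ->
  exists l, is_Cderive g a l.
Proof.
  intros Hr HM Hlim Hq.
  assert (Ha : Clim (fun n => f n a) (g a)).
  { apply Hlim. replace (a - a)%C with (RtoC 0) by ring. now rewrite Cmod_0. }
  assert (Hc : exists l, Clim c l).
  { apply Clim_cauchy. intros eps Heps.
    (* Compare the difference quotients for one fixed small step [e]. *)
    set (e := Rmin (r / 2) (eps / (4 * (M + 1)))).
    assert (He : 0 < e). { apply Rmin_pos; [lra | apply Rdiv_lt_0_compat; lra]. }
    assert (He1 : e <= r / 2) by apply Rmin_l.
    assert (He2 : e * (4 * (M + 1)) <= eps) by (apply Rle_div_r; [lra | apply Rmin_r]).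
    assert (Hme : Cmod e = e) by (rewrite Cmod_R; apply Rabs_pos_eq; lra).
    assert (Hae : Clim (fun n => f n (a + e)%C) (g (a + e)%C)).
    { apply Hlim. rewrite (Cplus_minus_l a e), Hme. lra. }
    destruct (Ha (e * eps / 8)) as [N HN]; [nra |].
    destruct (Hae (e * eps / 8)) as [N' HN']; [nra |].
    exists (N + N')%nat. intros n m Hn Hm.
    assert (HN1 := HN n ltac:(lia)). assert (HN2 := HN m ltac:(lia)).
    assert (HN3 := HN' n ltac:(lia)). assert (HN4 := HN' m ltac:(lia)).
    assert (Q1 := Hq n (RtoC e) ltac:(lra)). assert (Q2 := Hq m (RtoC e) ltac:(lra)).
    rewrite Hme in Q1, Q2.
    set (u1 := (f n (a + e) - f n a - c n * e)%C) in *.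
    set (u2 := (f m (a + e) - f m a - c m * e)%C) in *.
    set (v1 := (f n a - g a)%C) in *. set (v2 := (f m a - g a)%C) in *.
    set (w1 := (f n (a + e) - g (a + e))%C) in *. set (w2 := (f m (a + e) - g (a + e))%C) in *.
    assert (B : Cmod (c n - c m) * e <= 2 * M * e ^ 2 + e * eps / 2).
    { rewrite <- Hme at 1. rewrite <- Cmod_mult.
      replace ((c n - c m) * e)%C with (- u1 + u2 + w1 + - w2 + - v1 + v2)%C
        by (unfold u1, u2, v1, v2, w1, w2; ring).
      generalize (Cmod_triangle (- u1 + u2 + w1 + - w2 + - v1) v2) (Cmod_triangle (- u1 + u2 + w1 + - w2) (- v1))
        (Cmod_triangle (- u1 + u2 + w1) (- w2)) (Cmod_triangle (- u1 + u2) w1) (Cmod_triangle (- u1) u2).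
      rewrite !Cmod_opp. lra. }
    assert (2 * M * e ^ 2 < e * (eps / 2)). { simpl. nra. }
    assert (Cmod (c n - c m) * e < eps * e) by lra.
    now apply Rmult_lt_reg_r with e. }
  destruct Hc as [l Hl]. exists l. apply (is_Cderive_quadratic g a l r M Hr HM).
  intros h Hh.
  apply (Clim_le (fun n => f n (a + h) - f n a - c n * h)%C _ _ 0).
  - replace (g (a + h) - g a - l * h)%C with (g (a + h)%C + (- (1)) * g a + (- h) * l)%C by ring.
    apply Clim_ext with (fun n => f n (a + h)%C + (- (1)) * f n a + (- h) * c n)%C.
    { intros. ring. }
    repeat apply Clim_plus; try apply Clim_scal; trivial.
    apply Hlim. now rewrite (Cplus_minus_l a h).
  - intros n _. now apply Hq.
Qed.

(** The constants depend on the factors only through [Rsum iota n], so for a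
    summable sequence the bound is uniform in [n], as [Clim_derive] requires. *)
Lemma Cprod_quadratic (iota : nat -> R) (r : R) n : 0 <= r -> (forall k, 0 <= iota k) ->
  exists c : C -> C,
  forall z w, Cmod z <= r -> Cmod w <= r ->
    let e := exp (r * Rsum iota n) in let S := Rsum iota n in
    Cmod (c w) <= e * S /\
    Cmod (Cprod (fun k => 1 + z * iota k)%C n - Cprod (fun k => 1 + w * iota k)%C n
          - c w * (z - w))%C <= e * S ^ 2 * Cmod (z - w) ^ 2.
Proof.
  intros Hr Hi. induction n as [|n [c IH]].
  - exists (fun _ => RtoC 0). intros z w _ _. simpl. rewrite Cmod_0. split; [lra |].
    replace (1 - 1 - 0 * (z - w))%C with (RtoC 0) by ring. rewrite Cmod_0. lra.
  - exists (fun w => (1 + w * iota n) * c w + iota n * Cprod (fun k => 1 + w * iota k)%C n)%C.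
    intros z w Hz Hw. destruct (IH z w Hz Hw) as [H1 H2].
    assert (H3 : Cmod (Cprod (fun k => 1 + w * iota k)%C n) <= exp (r * Rsum iota n)).
    { eapply Rle_trans; [apply Cprod_bound |]. apply exp_le_mono. rewrite <- Rsum_scal.
      apply Rsum_le. intros k _. rewrite Cmod_mult, Cmod_R, Rabs_pos_eq by apply Hi.
      apply Rmult_le_compat_r; [apply Hi | trivial]. }
    assert (HF : forall y : C, Cmod y <= r -> Cmod (1 + y * iota n) <= exp (r * iota n)).
    { intros y Hy. eapply Rle_trans; [apply Cmod_triangle |]. rewrite Cmod_1, Cmod_mult, Cmod_R, Rabs_pos_eq by apply Hi.
      eapply Rle_trans; [| apply exp_ineq1_le]. generalize (Hi n). nra. }
    cbv zeta. cbn [Rsum Cprod]. rewrite (Rmult_plus_distr_l r), exp_plus.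
    set (e := exp (r * Rsum iota n)) in *. set (S := Rsum iota n) in *.
    set (f := exp (r * iota n)) in *.
    set (P := Cprod (fun k => 1 + z * iota k)%C n) in *. set (Q := Cprod (fun k => 1 + w * iota k)%C n) in *.
    assert (He : 0 < e) by apply exp_pos. assert (Hf : 1 <= f).
    { unfold f. rewrite <- exp_0. apply exp_le_mono. generalize (Hi n). nra. }
    assert (HS : 0 <= S) by (apply Rsum_pos; intros; apply Hi). assert (Hin := Hi n).
    assert (HFz := HF z Hz). assert (HFw := HF w Hw).
    split.
    + eapply Rle_trans; [apply Cmod_triangle |]. rewrite !Cmod_mult, Cmod_R, Rabs_pos_eq by trivial.
      assert (Cmod (1 + w * iota n) * Cmod (c w) <= f * (e * S)) by (apply Rmult_le_compat; trivial; apply Cmod_ge_0).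
      assert (iota n * Cmod Q <= iota n * e) by now apply Rmult_le_compat_l.
      assert (iota n * e <= f * (iota n * e)). { assert (0 <= iota n * e) by nra. nra. }
      nra.
    + replace (P * (1 + z * iota n) - Q * (1 + w * iota n)
        - ((1 + w * iota n) * c w + iota n * Q) * (z - w))%C
        with ((1 + z * iota n) * (P - Q - c w * (z - w)) + iota n * c w * (z - w) ^ 2)%C by ring.
      eapply Rle_trans; [apply Cmod_triangle |]. rewrite !Cmod_mult, Cmod_pow, Cmod_R, Rabs_pos_eq by trivial.
      set (x := Cmod (z - w) ^ 2) in *. assert (Hx : 0 <= x) by (apply pow_le, Cmod_ge_0).
      assert (Cmod (1 + z * iota n) * Cmod (P - Q - c w * (z - w)) <= f * (e * S ^ 2 * x)) by (apply Rmult_le_compat; trivial; apply Cmod_ge_0).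
      assert (iota n * Cmod (c w) * x <= f * (iota n * (e * S)) * x).
      { apply Rmult_le_compat_r; trivial. assert (iota n * Cmod (c w) <= iota n * (e * S)) by now apply Rmult_le_compat_l.
        assert (0 <= iota n * (e * S)) by (apply Rmult_le_pos; nra). nra. }
      assert (0 <= e * f * x) by (apply Rmult_le_pos; nra).
      replace (e * f * (S + iota n) ^ 2 * x) with (f * (e * S ^ 2 * x) + f * (iota n * (e * S)) * x + (e * f * x) * (iota n * S + iota n ^ 2)) by ring.
      assert (0 <= iota n * S + iota n ^ 2) by nra.
      assert (0 <= e * f * x * (iota n * S + iota n ^ 2)) by now apply Rmult_le_pos. lra.
Qed.

Lemma eprod_derive iota a : sq_small iota -> exists l, is_Cderive (eprod iota) a l.
Proof.
  intros H. assert (Ha := Cmod_ge_0 a).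
  set (r := Cmod a + 1).
  assert (Hc : forall n, exists c : C, forall h, Cmod h < 1 ->
    Cmod (Cprod (fun k => 1 + (a + h) * iota k)%C n - Cprod (fun k => 1 + a * iota k)%C n - c * h)%C
    <= exp (r * 2) * 4 * Cmod h ^ 2).
  { intros n. destruct (Cprod_quadratic iota r n) as [c Hc]; [unfold r; lra | apply H |].
    exists (c a). intros h Hh. destruct (Hc (a + h)%C a) as [_ B].
    - eapply Rle_trans; [apply Cmod_triangle | unfold r; lra].
    - unfold r; lra.
    - rewrite (Cplus_minus_l a h) in B. eapply Rle_trans; [exact B |].
      apply Rmult_le_compat_r; [apply pow_le, Cmod_ge_0 |].
      assert (S1 := sq_small_sum iota n H).
      assert (S0 : 0 <= Rsum iota n) by (apply Rsum_pos; intros; apply H).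
      apply Rmult_le_compat; [apply Rlt_le, exp_pos | apply pow_le; trivial | | simpl; nra].
      apply exp_le_mono. apply Rmult_le_compat_l; [unfold r; lra | trivial]. }
  apply (Clim_derive (fun n z => Cprod (fun k => 1 + z * iota k)%C n) (eprod iota)
    (fun n => epsilon (inhabits (RtoC 0)) (fun c : C => forall h, Cmod h < 1 ->
    Cmod (Cprod (fun k => 1 + (a + h) * iota k)%C n - Cprod (fun k => 1 + a * iota k)%C n - c * h)%C
    <= exp (r * 2) * 4 * Cmod h ^ 2)) a 1 (exp (r * 2) * 4)).
  - lra.
  - generalize (exp_pos (r * 2)). lra.
  - intros z _. now apply eprod_lim.
  - intros n. exact (epsilon_spec _ _ (Hc n)).
Qed.

(** * The cubic polynomial in the coordinate [1 + z / 2] *)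

(** Conjugating [Rpoly] by [z = 2 (x - 1)] gives this odd polynomial; the
    eigenvalues 0 and -4 of the two-point graph become its fixed points 1, -1. *)
Definition cubP (p q x : R) : R := (x ^ 3 - (1 - p * q) * x) / (p * q).
Definition cubPC (p q : R) (x : C) : C := ((x ^ 3 - RtoC (1 - p * q) * x) / RtoC (p * q))%C.

Lemma cubPC_RtoC p q x : p * q <> 0 -> cubPC p q (RtoC x) = RtoC (cubP p q x).
Proof.
  intros H. unfold cubPC, cubP. rewrite RtoC_div, (RtoC_minus (x ^ 3)), (RtoC_mult (1 - p * q)), (RtoC_pow x) by trivial.
  reflexivity.
Qed.

Section Branches.

Variables p q : R.
Hypothesis Hp : 0 < p < 1.
Hypothesis Hq : q = 1 - p.

Local Notation Mx := (Rmax p q).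
Local Notation lam := (lambda p q).

Lemma pq_pos : 0 < p * q.
Proof. subst q. nra. Qed.

Lemma pq_le : p * q <= 1 / 4.
Proof. subst q. generalize (pow2_ge_0 (p - 1 / 2)). simpl. lra. Qed.

Lemma lambda_ge_9 : 9 <= lam.
Proof.
  unfold lambda. generalize pq_pos pq_le; intros.
  assert (8 <= 2 / (p * q)); [| lra]. apply (Rle_div_r 8 2 (p * q)); lra.
Qed.

Lemma lambda_eq : lam = (1 + p) * (1 + q) / (p * q).
Proof. unfold lambda. generalize pq_pos; intros. rewrite Hq in *. field. split; lra. Qed.

Lemma Mx_bounds : 1 / 2 <= Mx < 1.
Proof. unfold Rmax. destruct (Rle_dec p q); lra. Qed.

Lemma Mx_prod : Mx * (1 - Mx) = p * q.
Proof. unfold Rmax. destruct (Rle_dec p q); rewrite Hq; ring. Qed.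

Lemma cubP_minus_1 x : cubP p q x - 1 = (x - 1) * (x + p) * (x + q) / (p * q).
Proof. unfold cubP. generalize pq_pos; intros. rewrite Hq in *. field. split; lra. Qed.

Lemma cubP_plus_1 x : cubP p q x + 1 = (x + 1) * (x - p) * (x - q) / (p * q).
Proof. unfold cubP. generalize pq_pos; intros. rewrite Hq in *. field. split; lra. Qed.

Lemma branch0_exists c : -1 <= c <= 1 -> exists x, Mx <= x <= 1 /\ cubP p q x = c.
Proof.
  intros Hc. assert (HM := Mx_bounds).
  assert (E1 : cubP p q 1 = 1).
  { generalize (cubP_minus_1 1). replace ((1 - 1) * (1 + p) * (1 + q) / (p * q)) with 0 by (unfold Rdiv; ring). lra. }
  assert (E2 : cubP p q Mx = -1).
  { generalize (cubP_plus_1 Mx). replace ((Mx + 1) * (Mx - p) * (Mx - q) / (p * q)) with 0; [lra |].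
    unfold Rmax. destruct (Rle_dec p q); unfold Rdiv; ring. }
  destruct (IVT_gen (cubP p q) Mx 1 c) as (x & Hx & E).
  - intros x. unfold cubP. reg.
  - rewrite E1, E2, (Rmin_left (-1)), (Rmax_right (-1)) by lra. trivial.
  - rewrite (Rmin_left Mx), (Rmax_right Mx) in Hx by lra. now exists x.
Qed.

(** The largest preimage; near the repelling fixed point 1 it is the local
    inverse of [cubP]. *)
Definition branch0 (c : R) : R :=
  epsilon (inhabits 0) (fun x => Mx <= x <= 1 /\ cubP p q x = c).

(** The other two preimages solve the quadratic left after dividing by the
    first one. *)
Definition branch (i : nat) (c : R) : R :=
  match i with
  | 0%nat => branch0 c
  | 1%nat => (- branch0 c + sqrt (4 * (1 - p * q) - 3 * branch0 c ^ 2)) / 2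
  | _ => (- branch0 c - sqrt (4 * (1 - p * q) - 3 * branch0 c ^ 2)) / 2
  end.

Lemma branch0_spec c : -1 <= c <= 1 -> Mx <= branch0 c <= 1 /\ cubP p q (branch0 c) = c.
Proof. intros H. unfold branch0. apply epsilon_spec. now apply branch0_exists. Qed.

Lemma disc_bounds c : -1 <= c <= 1 ->
  (1 - 4 * (p * q)) <= 4 * (1 - p * q) - 3 * branch0 c ^ 2 <= (2 - branch0 c) ^ 2 /\
  4 * (1 - p * q) - 3 * branch0 c ^ 2 <= (2 - Mx) ^ 2.
Proof.
  intros Hc. destruct (branch0_spec c Hc) as [Hb _]. assert (HM := Mx_bounds).
  assert (HMp := Mx_prod). set (b := branch0 c) in *. simpl. repeat split; nra.
Qed.

(** Away from [branch 0] the preimages keep a distance from 1; this is what makes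
    the zeros of [Phi] grow. *)
Lemma branch_le c i : -1 <= c <= 1 -> (i <> 0)%nat -> branch i c <= 1 / 2.
Proof.
  intros Hc Hi. destruct (branch0_spec c Hc) as [Hb _]. assert (HM := Mx_bounds).
  destruct (disc_bounds c Hc) as (_ & H2).
  assert (S1 := sqrt_pos (4 * (1 - p * q) - 3 * branch0 c ^ 2)).
  apply sqrt_le_1_alt in H2. rewrite sqrt_pow2 in H2 by lra.
  destruct i as [|[|i]]; [lia | |]; unfold branch; lra.
Qed.

Lemma branch_range c i : -1 <= c <= 1 -> -1 <= branch i c <= 1.
Proof.
  intros Hc. destruct (branch0_spec c Hc) as [Hb _]. assert (HM := Mx_bounds).
  destruct (disc_bounds c Hc) as ((_ & H1) & H2).
  assert (S1 := sqrt_pos (4 * (1 - p * q) - 3 * branch0 c ^ 2)).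
  apply sqrt_le_1_alt in H1. rewrite sqrt_pow2 in H1 by lra.
  destruct i as [|[|i]].
  - unfold branch. lra.
  - generalize (branch_le c 1 Hc ltac:(lia)). unfold branch. lra.
  - generalize (branch_le c (S (S i)) Hc ltac:(lia)). unfold branch. lra.
Qed.

Lemma branch_lt_1 c i : -1 <= c < 1 -> branch i c < 1.
Proof.
  intros Hc. destruct (Nat.eq_dec i 0) as [-> | Hi].
  - destruct (branch0_spec c ltac:(lra)) as [Hb E]. unfold branch.
    assert (branch0 c <> 1); [| lra]. intros E1. rewrite E1 in E.
    generalize (cubP_minus_1 1). unfold Rdiv. rewrite Rminus_diag, !Rmult_0_l. lra.
  - generalize (branch_le c i ltac:(lra) Hi). lra.
Qed.

Lemma branch_vieta c : -1 <= c <= 1 ->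
  branch 1 c + branch 2 c = - branch0 c /\
  branch 1 c * branch 2 c = branch0 c ^ 2 - (1 - p * q).
Proof.
  intros Hc. destruct (disc_bounds c Hc) as ((H0 & _) & _). assert (Hle := pq_le).
  assert (S1 := sqrt_sqrt (4 * (1 - p * q) - 3 * branch0 c ^ 2) ltac:(lra)).
  unfold branch. set (r := sqrt _) in *. split; [field |].
  replace ((- branch0 c + r) / 2 * ((- branch0 c - r) / 2)) with ((branch0 c ^ 2 - r * r) / 4) by field.
  rewrite S1. field.
Qed.

Lemma branch_factor c x : -1 <= c <= 1 ->
  (cubPC p q x - c)%C = ((x - branch 0 c) * (x - branch 1 c) * (x - branch 2 c) / RtoC (p * q))%C.
Proof.
  intros Hc. destruct (branch_vieta c Hc) as [V1 V2]. destruct (branch0_spec c Hc) as [_ E].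
  assert (Hpq := pq_pos).
  assert (Hpq' : RtoC (p * q) <> RtoC 0) by (intros E0; apply RtoC_inj in E0; lra).
  rewrite <- E at 1. rewrite <- cubPC_RtoC by lra. unfold cubPC.
  replace ((x - branch 0 c) * (x - branch 1 c) * (x - branch 2 c))%C
    with ((x - branch 0 c) * (x ^ 2 - RtoC (branch 1 c + branch 2 c) * x + RtoC (branch 1 c * branch 2 c)))%C
    by (rewrite RtoC_plus, RtoC_mult; ring).
  rewrite V1, V2. change (branch 0 c) with (branch0 c).
  rewrite RtoC_opp, (RtoC_minus (branch0 c ^ 2)), (RtoC_pow (branch0 c)). field. trivial.
Qed.

Lemma branch_root c i : -1 <= c <= 1 -> cubP p q (branch i c) = c.
Proof.
  intros Hc. assert (Hpq := pq_pos).
  assert (H : (cubPC p q (branch i c) - c)%C = RtoC 0).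
  { rewrite branch_factor by trivial. unfold Cdiv.
    destruct i as [|[|i]].
    - change (branch 0 c - branch 0 c)%C with (branch 0 c - branch 0 c)%C. ring.
    - ring.
    - change (branch (S (S i)) c) with (branch 2 c). ring. }
  rewrite cubPC_RtoC, <- RtoC_minus in H by lra. apply RtoC_inj in H. lra.
Qed.

Lemma branch_surj c x : -1 <= c <= 1 -> cubP p q x = c -> exists i, (i < 3)%nat /\ x = branch i c.
Proof.
  intros Hc E. assert (Hpq := pq_pos).
  assert (H := branch_factor c (RtoC x) Hc).
  rewrite cubPC_RtoC, E, <- !RtoC_minus, <- !RtoC_mult, <- RtoC_div in H by lra.
  apply RtoC_inj in H. unfold Rdiv in H. rewrite Rminus_diag in H.
  symmetry in H. apply Rmult_integral in H. destruct H as [H | H].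
  - apply Rmult_integral in H. destruct H as [H | H]; [apply Rmult_integral in H; destruct H as [H | H] |].
    + exists 0%nat. split; [lia | lra].
    + exists 1%nat. split; [lia | lra].
    + exists 2%nat. split; [lia | lra].
  - assert (0 < / (p * q)) by now apply Rinv_0_lt_compat. lra.
Qed.

(** ** Iterated preimages *)

(** The [k]-th preimage of [c] under the [n]-th iterate.  The leading base 3
    digit of [k] selects the last branch taken, so that for fixed [k] only
    [branch 0], the branch at the repelling fixed point 1, is used once
    [3 ^ n > k]. *)
Fixpoint preim (c : R) (n k : nat) : R :=
  match n with
  | O => c
  | S n' => branch (k / 3 ^ n') (preim c n' (k mod 3 ^ n'))
  end.

Lemma pow3_pos n : (0 < 3 ^ n)%nat.
Proof. induction n; simpl; lia. Qed.

Lemma preim_digit c n i k : (k < 3 ^ n)%nat ->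
  preim c (S n) (i * 3 ^ n + k) = branch i (preim c n k).
Proof.
  intros Hk. assert (H3 := pow3_pos n). cbn [preim].
  rewrite Nat.div_add_l, Nat.div_small, Nat.add_0_r by lia.
  rewrite Nat.add_comm, Nat.Div0.mod_add, Nat.mod_small by lia. reflexivity.
Qed.

Lemma preim_range c n k : -1 <= c <= 1 -> -1 <= preim c n k <= 1.
Proof.
  intros Hc. revert k. induction n; intros k; [exact Hc |]. apply branch_range, IHn.
Qed.

Lemma preim_lt_1 c n k : -1 <= c < 1 -> preim c n k < 1.
Proof.
  intros Hc. revert k. induction n; intros k; [apply Hc |]. apply branch_lt_1. split; [| apply IHn].
  apply preim_range. lra.
Qed.

Lemma preim_1_lt_1 n k : (0 < k < 3 ^ n)%nat -> preim 1 n k < 1.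
Proof.
  revert k. induction n; intros k Hk; [simpl in Hk; lia |].
  assert (H3 := pow3_pos n). destruct (Nat.lt_ge_cases k (3 ^ n)) as [Hlt | Hge].
  - replace k with (0 * 3 ^ n + k)%nat by lia. rewrite preim_digit by trivial.
    apply branch_lt_1. split; [apply preim_range; lra | apply IHn; lia].
  - cbn [preim]. assert (Hd : (k / 3 ^ n <> 0)%nat).
    { intros E. apply Nat.div_small_iff in E; lia. }
    generalize (branch_le (preim 1 n (k mod 3 ^ n)) (k / 3 ^ n) ltac:(apply preim_range; lra) Hd). lra.
Qed.

Lemma preim_1_0 n : preim 1 n 0 = 1.
Proof.
  induction n; [reflexivity |].
  change 0%nat with (0 * 3 ^ n + 0)%nat. rewrite preim_digit by apply pow3_pos.
  rewrite IHn. unfold branch. destruct (branch0_spec 1 ltac:(lra)) as [Hb E].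
  generalize (cubP_minus_1 (branch0 1)). rewrite E, Rminus_diag. intros H. symmetry in H.
  assert (HM := Mx_bounds). assert (Hpq := pq_pos).
  assert (0 < / (p * q)) by now apply Rinv_0_lt_compat.
  unfold Rdiv in H. apply Rmult_integral in H. destruct H as [H | H]; [| lra].
  apply Rmult_integral in H. destruct H as [H | H]; [| lra].
  apply Rmult_integral in H. destruct H as [H | H]; lra.
Qed.

Fixpoint iterP (n : nat) (x : C) : C :=
  match n with O => x | S n => iterP n (cubPC p q x) end.

(** The linear polynomial with root [r] and value 1 at 1.  With this
    normalization the factorization of a polynomial taking the value 1 at 1 needs
    no leading coefficient. *)
Definition lin (r : R) (x : C) : C := (1 + (x - 1) * / RtoC (1 - r))%C.

Lemma lin_eq r x : r <> 1 -> lin r x = ((x - r) / RtoC (1 - r))%C.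
Proof.
  intros H. assert (RtoC (1 - r) <> RtoC 0) by (intros E; apply RtoC_inj in E; lra).
  unfold lin. rewrite RtoC_minus in *. field. trivial.
Qed.

(** Both sides are cubic polynomials in [x] with the same roots and with value 1 at
    the fixed point 1. *)
Lemma lin_branches r x : -1 <= r < 1 ->
  lin r (cubPC p q x) = (lin (branch 0 r) x * lin (branch 1 r) x * lin (branch 2 r) x)%C.
Proof.
  intros Hr. assert (Hb := fun i => branch_lt_1 r i Hr).
  assert (Hpq := pq_pos).
  assert (N : forall y : R, y <> 0 -> RtoC y <> RtoC 0) by (intros y Hy E; apply RtoC_inj in E; lra).
  rewrite !lin_eq by (generalize (Hb 0%nat) (Hb 1%nat) (Hb 2%nat); lra).
  rewrite branch_factor by lra.
  assert (E : (1 - r)%R = (1 - branch 0 r) * (1 - branch 1 r) * (1 - branch 2 r) / (p * q)).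
  { apply RtoC_inj. rewrite RtoC_div, !RtoC_mult, !RtoC_minus by lra.
    rewrite <- (RtoC_mult p q), <- branch_factor by lra. f_equal.
    rewrite cubPC_RtoC by lra. f_equal.
    generalize (cubP_minus_1 1). unfold Rdiv. rewrite Rminus_diag, !Rmult_0_l. lra. }
  rewrite E, RtoC_div, !RtoC_mult by lra.
  assert (N0 := N (1 - branch 0 r) ltac:(generalize (Hb 0%nat); lra)).
  assert (N1 := N (1 - branch 1 r) ltac:(generalize (Hb 1%nat); lra)).
  assert (N2 := N (1 - branch 2 r) ltac:(generalize (Hb 2%nat); lra)).
  assert (Np := N p ltac:(lra)). assert (Nq := N q ltac:(lra)).
  field. repeat split; trivial.
Qed.

Lemma Cprod_preim c n f : (3 ^ S n = 3 ^ n + 3 ^ n + 3 ^ n)%nat /\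
  Cprod (fun k => f (preim c (S n) k)) (3 ^ S n) =
  Cprod (fun k => f (branch 0 (preim c n k)) * f (branch 1 (preim c n k)) * f (branch 2 (preim c n k)))%C (3 ^ n).
Proof.
  assert (E : (3 ^ S n = 3 ^ n + 3 ^ n + 3 ^ n)%nat) by (cbn [Nat.pow]; lia).
  split; trivial. rewrite E, !Cprod_plus, !Cprod_mult. f_equal; [f_equal |].
  - apply Cprod_ext. intros k Hk. now rewrite <- (preim_digit c n 0).
  - apply Cprod_ext. intros k Hk. rewrite <- (preim_digit c n 1) by trivial. do 2 f_equal. lia.
  - apply Cprod_ext. intros k Hk. rewrite <- (preim_digit c n 2) by trivial. do 2 f_equal. lia.
Qed.

Lemma lin_preim c n x : -1 <= c < 1 ->
  lin c (iterP n x) = Cprod (fun k => lin (preim c n k) x) (3 ^ n).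
Proof.
  intros Hc. revert x. induction n; intros x.
  - simpl. ring.
  - destruct (Cprod_preim c n (fun r => lin r x)) as [_ ->].
    cbn [iterP]. rewrite IHn. apply Cprod_ext. intros k _. apply lin_branches.
    split; [apply preim_range; lra | now apply preim_lt_1].
Qed.

Lemma iterP_S n x : iterP (S n) x = cubPC p q (iterP n x).
Proof. revert x. induction n; intros x; [reflexivity |]. apply (IHn (cubPC p q x)). Qed.

Lemma branch_1 : branch 0 1 = 1.
Proof. exact (preim_1_0 1). Qed.

Lemma lin_branches_1 x :
  (cubPC p q x - 1)%C = (lam * (x - 1) * (lin (branch 1 1) x * lin (branch 2 1) x))%C.
Proof.
  assert (Hpq := pq_pos). rewrite branch_factor by lra. rewrite branch_1.
  assert (H1 := branch_le 1 1 ltac:(lra) ltac:(lia)). assert (H2 := branch_le 1 2 ltac:(lra) ltac:(lia)).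
  rewrite !lin_eq by lra.
  assert (E : lam = (1 - branch 1 1) * (1 - branch 2 1) / (p * q)).
  { destruct (branch_vieta 1 ltac:(lra)) as [V1 V2].
    change (branch0 1) with (branch 0 1) in V1, V2. rewrite branch_1 in V1, V2.
    replace ((1 - branch 1 1) * (1 - branch 2 1)) with (1 - (branch 1 1 + branch 2 1) + branch 1 1 * branch 2 1) by ring.
    rewrite V1, V2. unfold lambda. field. lra. }
  assert (N : forall y : R, y <> 0 -> RtoC y <> RtoC 0) by (intros y Hy E0; apply RtoC_inj in E0; lra).
  assert (N1 := N (1 - branch 1 1) ltac:(lra)). assert (N2 := N (1 - branch 2 1) ltac:(lra)).
  rewrite E, RtoC_div, !RtoC_mult by lra.
  assert (Np := N p ltac:(lra)). assert (Nq := N q ltac:(lra)).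
  field. repeat split; trivial.
Qed.

(** For [c = 1] the factor of the root 1 itself is split off; its multiplier
    under the iterates is [lam ^ n]. *)
Lemma lin_preim_1 n x :
  (iterP n x - 1)%C = (lam ^ n * (x - 1) * Cprod (fun k => lin (preim 1 n (S k)) x) (3 ^ n - 1))%C.
Proof.
  revert x. induction n; intros x.
  - simpl. ring.
  - assert (H3 := pow3_pos n).
    set (f := fun r => if Req_dec_T r 1 then RtoC 1 else lin r x).
    assert (Ef : forall r, r < 1 -> f r = lin r x).
    { intros r Hr. unfold f. destruct (Req_dec_T r 1); [lra | trivial]. }
    assert (Ef1 : f 1 = RtoC 1). { unfold f. destruct (Req_dec_T 1 1); [trivial | lra]. }
    destruct (Cprod_preim 1 n f) as [E3 E].
    assert (L : Cprod (fun k => f (preim 1 (S n) k)) (3 ^ S n) = Cprod (fun k => lin (preim 1 (S n) (S k)) x) (3 ^ S n - 1)).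
    { replace (3 ^ S n)%nat with (1 + (3 ^ S n - 1))%nat at 1 by lia. rewrite Cprod_plus.
      cbn [Cprod]. rewrite preim_1_0, Ef1. rewrite !Cmult_1_l. apply Cprod_ext. intros k Hk.
      apply Ef. apply preim_1_lt_1. lia. }
    rewrite <- L, E. replace (3 ^ n)%nat with (1 + (3 ^ n - 1))%nat by lia. rewrite Cprod_plus.
    cbn [Cprod]. rewrite preim_1_0, branch_1, Ef1, !Cmult_1_l.
    assert (H1 := branch_le 1 1 ltac:(lra) ltac:(lia)). assert (H2 := branch_le 1 2 ltac:(lra) ltac:(lia)).
    rewrite (Ef (branch 1 1)), (Ef (branch 2 1)) by lra.
    cbn [iterP]. rewrite IHn, lin_branches_1.
    rewrite (Cprod_ext (fun k => lin (preim 1 n (S k)) (cubPC p q x))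
      (fun k => f (branch 0 (preim 1 n (1 + k))) * f (branch 1 (preim 1 n (1 + k))) * f (branch 2 (preim 1 n (1 + k))))%C).
    2:{ intros k Hk. assert (Hr : -1 <= preim 1 n (1 + k) < 1).
        { split; [apply preim_range; lra | apply preim_1_lt_1; lia]. }
        rewrite !Ef by now apply branch_lt_1. now apply lin_branches. }
    rewrite <- (RtoC_pow lam (S n)), <- (RtoC_pow lam n).
    replace (lam ^ S n) with (lam * lam ^ n) by reflexivity. rewrite RtoC_mult. ring.
Qed.

(** ** Reciprocals of the rescaled preimages *)

(** The reciprocals of the zeros of [iterP n (1 + z / (2 * lam ^ n)) - c] as a function of [z], up to
    sign. *)
Definition recip (c : R) (n k : nat) : R := / (2 * lam ^ n * (1 - preim c n k)).

Lemma lam_pow_pos n : 0 < lam ^ n.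
Proof. apply pow_lt. generalize lambda_ge_9. lra. Qed.

Lemma preim_S c n k : (k < 3 ^ n)%nat -> preim c (S n) k = branch 0 (preim c n k).
Proof. intros H. exact (preim_digit c n 0 k H). Qed.

(** [cubP] expands by at most [lam] between [branch 0 r] and the fixed point 1. *)
Lemma recip_decr c n k : -1 <= c <= 1 -> (k < 3 ^ n)%nat -> preim c n k < 1 ->
  recip c (S n) k <= recip c n k.
Proof.
  intros Hc Hk Hr. unfold recip. rewrite preim_S by trivial.
  assert (Hr' : -1 <= preim c n k) by now apply preim_range.
  set (r := preim c n k) in *. assert (HL := lam_pow_pos n).
  destruct (branch0_spec r ltac:(lra)) as [Hb E]. unfold branch.
  assert (Hb1 : branch0 r < 1) by (apply (branch_lt_1 r 0); lra).
  apply Rinv_le_contravar; [apply Rmult_lt_0_compat; lra |].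
  replace (2 * lam ^ S n * (1 - branch0 r)) with (2 * lam ^ n * (lam * (1 - branch0 r))) by (simpl; ring).
  apply Rmult_le_compat_l; [lra |].
  generalize (cubP_minus_1 (branch0 r)). rewrite E. intros E'.
  set (b := branch0 r) in *. rewrite lambda_eq.
  replace (1 - r) with ((1 - b) * (b + p) * (b + q) / (p * q)) by lra.
  assert (Hpq := pq_pos).
  replace ((1 + p) * (1 + q) / (p * q) * (1 - b)) with ((1 - b) * (1 + p) * (1 + q) * / (p * q)) by (field; lra).
  unfold Rdiv. apply Rmult_le_compat_r; [left; now apply Rinv_0_lt_compat |].
  assert (HM := Mx_bounds). assert ((b + p) * (b + q) <= (1 + p) * (1 + q)) by nra. nra.
Qed.

(** Together with [recip_decr] this keeps the limit away from 0, as the preimages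
    tend to 1. *)
Lemma recip_incr c n k : -1 <= c <= 1 -> (k < 3 ^ n)%nat -> preim c n k < 1 ->
  recip c n k * preim c n k <= recip c (S n) k * preim c (S n) k.
Proof.
  intros Hc Hk Hr. unfold recip. rewrite preim_S by trivial.
  assert (Hr' : -1 <= preim c n k) by now apply preim_range.
  set (r := preim c n k) in *. assert (HL := lam_pow_pos n).
  destruct (branch0_spec r ltac:(lra)) as [Hb E]. unfold branch.
  assert (Hb1 : branch0 r < 1) by (apply (branch_lt_1 r 0); lra).
  set (b := branch0 r) in *. assert (HM := Mx_bounds). assert (Hpq := pq_pos).
  assert (HL9 := lambda_ge_9).
  replace (/ (2 * lam ^ S n * (1 - b)) * b) with (/ (2 * lam ^ n) * (b / (lam * (1 - b)))) by (simpl; field; repeat split; lra).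
  replace (/ (2 * lam ^ n * (1 - r)) * r) with (/ (2 * lam ^ n) * (r / (1 - r))) by (field; split; lra).
  apply Rmult_le_compat_l; [left; apply Rinv_0_lt_compat; lra |].
  apply Rle_div_l; [lra |].
  replace (b / (lam * (1 - b)) * (1 - r)) with (b * (1 - r) / (lam * (1 - b))) by (field; split; lra).
  apply Rle_div_r; [nra |].
  generalize (cubP_minus_1 b). rewrite E. intros E'.
  assert (E1 : 1 - r = (1 - b) * (b + p) * (b + q) / (p * q)) by lra.
  assert (E2 : r = b * (b ^ 2 - 1 + p * q) / (p * q)).
  { rewrite <- E. unfold cubP. field. split; lra. }
  rewrite E1. rewrite E2 at 1. rewrite lambda_eq.
  replace (b * (b ^ 2 - 1 + p * q) / (p * q) * ((1 + p) * (1 + q) / (p * q) * (1 - b)))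
    with (b * (1 - b) * ((b ^ 2 - 1 + p * q) * ((1 + p) * (1 + q))) * (/ (p * q) * / (p * q))) by (field; split; lra).
  replace (b * ((1 - b) * (b + p) * (b + q) / (p * q)))
    with (b * (1 - b) * ((b + p) * (b + q) * (p * q)) * (/ (p * q) * / (p * q))) by (field; split; lra).
  apply Rmult_le_compat_r.
  { left. apply Rmult_lt_0_compat; now apply Rinv_0_lt_compat. }
  apply Rmult_le_compat_l; [nra |].
  assert (Eq1 : (b + p) * (b + q) = b ^ 2 + b + p * q) by (rewrite Hq; ring).
  assert (Eq2 : (1 + p) * (1 + q) = 2 + p * q) by (rewrite Hq; ring).
  rewrite Eq1, Eq2. assert (Hle := pq_le). set (w := p * q) in *.
  assert (0 <= (1 - b) * (2 + 2 * b - w)) by nra. nra.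
Qed.

Lemma recip_pos c n k : preim c n k < 1 -> 0 < recip c n k.
Proof.
  intros H. apply Rinv_0_lt_compat. generalize (lam_pow_pos n). nra.
Qed.

(** Compare with the level at which the index [k] first appears: there the preimage
    is at most 1/2 and [lam ^ n >= 9 ^ n >= (k + 1) ^ 2]; afterwards [recip]
    decreases. *)
Lemma recip_small c n k : -1 <= c <= 1 -> (0 < k < 3 ^ n)%nat -> (forall k, (0 < k < 3 ^ n)%nat -> preim c n k < 1) ->
  recip c n k <= / (INR k + 1) ^ 2.
Proof.
  intros Hc. revert k. induction n; intros k Hk Hlt; [simpl in Hk; lia |].
  assert (H3 := pow3_pos n). assert (E3 : (3 ^ S n = 3 ^ n + 3 ^ n + 3 ^ n)%nat) by (cbn [Nat.pow]; lia).
  destruct (Nat.lt_ge_cases k (3 ^ n)) as [Hk' | Hk'].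
  - assert (Hlt' : forall k, (0 < k < 3 ^ n)%nat -> preim c n k < 1).
    { intros j Hj. specialize (Hlt j ltac:(lia)). rewrite preim_S in Hlt by lia.
      destruct (Rle_lt_or_eq_dec (preim c n j) 1) as [h | h]; [apply preim_range; trivial | trivial |].
      rewrite h, branch_1 in Hlt. lra. }
    eapply Rle_trans; [apply recip_decr; trivial; apply Hlt'; lia |]. apply IHn; trivial. lia.
  - assert (Hh : preim c (S n) k <= 1 / 2).
    { cbn [preim]. apply branch_le; [now apply preim_range |].
      intros E. apply Nat.div_small_iff in E; lia. }
    unfold recip. apply Rinv_le_contravar.
    { apply pow_lt. generalize (pos_INR k). lra. }
    apply Rle_trans with (lam ^ S n).
    2:{ generalize (lam_pow_pos (S n)). nra. }
    apply Rle_trans with (9 ^ S n).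
    2:{ apply pow_incr. generalize lambda_ge_9. lra. }
    replace 9 with (3 * 3) by ring. rewrite Rpow_mult_distr.
    assert (HI : INR k + 1 <= 3 ^ S n).
    { rewrite <- S_INR. replace 3 with (INR 3) by (simpl; ring). rewrite <- pow_INR. apply le_INR. lia. }
    generalize (pos_INR k). intros. set (x := 3 ^ S n) in *. simpl. nra.
Qed.

(** The reciprocal of the number [t] with [1 + Phi (- t) / 2 = c] that belongs to the
    branches selected by [k]. *)
Definition iota (c : R) (k : nat) : R := real (Lim_seq (fun n => recip c n k)).

Lemma nat_lt_pow3 k : (k < 3 ^ k)%nat.
Proof. induction k; simpl; lia. Qed.

Lemma lt_pow3_mono k n m : (k < 3 ^ n)%nat -> (n <= m)%nat -> (k < 3 ^ m)%nat.
Proof. intros H Hm. eapply Nat.lt_le_trans; [exact H |]. apply Nat.pow_le_mono_r; lia. Qed.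

(** For [c = 1] the index 0 belongs to the fixed point 1 itself, which gives no
    zero of the product. *)
Definition admissible (c : R) (k : nat) : Prop := -1 <= c < 1 \/ c = 1 /\ (0 < k)%nat.

Lemma admissible_range c k : admissible c k -> -1 <= c <= 1.
Proof. intros [H | [-> H]]; lra. Qed.

Lemma admissible_lt c k n : admissible c k -> (k < 3 ^ n)%nat -> preim c n k < 1.
Proof.
  intros [H | [-> H]] Hk; [now apply preim_lt_1 | apply preim_1_lt_1; lia].
Qed.

Lemma recip_antitone c k n m : admissible c k -> (k < 3 ^ n)%nat -> (n <= m)%nat -> recip c m k <= recip c n k.
Proof.
  intros H Hk Hm. induction Hm; [lra |]. eapply Rle_trans; [| exact IHHm].
  assert (k < 3 ^ m)%nat by now apply lt_pow3_mono with n.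
  apply recip_decr; trivial; [now apply admissible_range with k | now apply admissible_lt].
Qed.

Lemma recip_mul_mono c k n m : admissible c k -> (k < 3 ^ n)%nat -> (n <= m)%nat ->
  recip c n k * preim c n k <= recip c m k * preim c m k.
Proof.
  intros H Hk Hm. induction Hm; [lra |]. eapply Rle_trans; [exact IHHm |].
  assert (k < 3 ^ m)%nat by now apply lt_pow3_mono with n.
  apply recip_incr; trivial; [now apply admissible_range with k | now apply admissible_lt].
Qed.

Lemma iota_lim c k : admissible c k -> is_lim_seq (fun n => recip c n k) (iota c k).
Proof.
  intros H.
  assert (Hex : ex_finite_lim_seq (fun n => recip c (n + k)%nat k)).
  { apply ex_finite_lim_seq_decr with 0.
    - intros n. apply recip_antitone; trivial; [| lia].
      apply lt_pow3_mono with k; [apply nat_lt_pow3 | lia].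
    - intros n. left. apply recip_pos, admissible_lt; trivial.
      apply lt_pow3_mono with k; [apply nat_lt_pow3 | lia]. }
  destruct Hex as [l Hl].
  assert (Hl' : is_lim_seq (fun n => recip c n k) l) by (apply is_lim_seq_incr_n with k; exact Hl).
  unfold iota. rewrite (is_lim_seq_unique _ _ Hl'). exact Hl'.
Qed.

Lemma lim_seq_le_from (u : nat -> R) (l B : R) N : is_lim_seq u l -> (forall n, (N <= n)%nat -> u n <= B) -> l <= B.
Proof.
  intros H HB. apply (is_lim_seq_le_loc u (fun _ => B) l B); trivial; [| apply is_lim_seq_const].
  exists N. exact HB.
Qed.

Lemma lim_seq_ge_from (u : nat -> R) (l B : R) N : is_lim_seq u l -> (forall n, (N <= n)%nat -> B <= u n) -> B <= l.
Proof.
  intros H HB. apply (is_lim_seq_le_loc (fun _ => B) u B l); trivial; [| apply is_lim_seq_const].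
  exists N. exact HB.
Qed.

Lemma iota_pos c k : admissible c k -> 0 < iota c k.
Proof.
  intros H. assert (Hk := nat_lt_pow3 k).
  assert (HkS : (k < 3 ^ S k)%nat) by (apply lt_pow3_mono with k; lia).
  assert (HM := Mx_bounds).
  assert (Hpos : 0 < preim c (S k) k).
  { rewrite preim_S by trivial. generalize (branch0_spec (preim c k k) (preim_range c k k (admissible_range c k H))).
    unfold branch. lra. }
  assert (Hrec := recip_pos c (S k) k (admissible_lt c k (S k) H HkS)).
  apply Rlt_le_trans with (recip c (S k) k * preim c (S k) k); [nra |].
  apply (lim_seq_ge_from _ _ _ (S k) (iota_lim c k H)). intros n Hn.
  eapply Rle_trans; [apply (recip_mul_mono c k (S k) n); trivial |].
  assert (k < 3 ^ n)%nat by now apply lt_pow3_mono with (S k).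
  generalize (recip_pos c n k (admissible_lt c k n H ltac:(trivial))) (preim_range c n k (admissible_range c k H)). nra.
Qed.

Lemma iota_le_recip c k n : admissible c k -> (k < 3 ^ n)%nat -> iota c k <= recip c n k.
Proof.
  intros H Hk. apply (lim_seq_le_from _ _ _ n (iota_lim c k H)). intros m Hm. now apply recip_antitone.
Qed.

Lemma recip_le_sq c n k : admissible c (S k) -> (S k < 3 ^ n)%nat ->
  0 <= recip c n (S k) <= / (INR (S k) + 1) ^ 2.
Proof.
  intros H Hk. split.
  - left. now apply recip_pos, admissible_lt.
  - apply recip_small; [now apply admissible_range with (S k) | lia |].
    intros j Hj. apply admissible_lt; [| lia]. destruct H as [H | [-> _]]; [now left | right; split; trivial; lia].
Qed.

Lemma iota_sq_small c : -1 <= c <= 1 -> sq_small (fun k => iota c (S k)).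
Proof.
  intros Hc k. assert (H : admissible c (S k)).
  { destruct (Req_dec c 1) as [-> | N]; [right; split; trivial; lia | left; lra]. }
  split; [left; now apply iota_pos |].
  assert (Hk := nat_lt_pow3 (S k)).
  eapply Rle_trans; [now apply (iota_le_recip c (S k) (S k)) |].
  eapply Rle_trans; [now apply recip_le_sq |].
  rewrite S_INR. generalize (pos_INR k). intros. apply Rinv_le_contravar; [apply pow_lt; lra | apply pow_incr; lra].
Qed.

End Branches.

(** * Product formulas for [Phi] *)

Lemma Clim_Cprod (f : nat -> nat -> C) (g : nat -> C) m :
  (forall k, (k < m)%nat -> Clim (fun n => f n k) (g k)) ->
  Clim (fun n => Cprod (f n) m) (Cprod g m).
Proof.
  induction m; intros H; simpl. apply Clim_const.
  apply Clim_mult; [apply IHm; intros; apply H; lia | apply H; lia].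
Qed.

Lemma Clim_bounded_near u l : Clim u l -> exists N, forall n, (N <= n)%nat -> Cmod (u n) <= Cmod l + 1.
Proof.
  intros H. destruct (H 1) as [N HN]; [lra |]. exists N. intros n Hn.
  replace (u n) with ((u n - l) + l)%C by ring.
  eapply Rle_trans; [apply Cmod_triangle |]. specialize (HN n Hn). lra.
Qed.

(** The tails of the products are uniformly small by the quadratic bound, and the
    heads converge factor by factor. *)
Lemma tannery (J : nat -> nat -> R) (K : nat -> nat) (ia : nat -> R) (eta : nat -> C) (z : C) :
  (forall n k, (k < K n)%nat -> 0 <= J n k <= / (INR k + 1) ^ 2) ->
  (forall k, is_lim_seq (fun n => J n k) (ia k)) ->
  (forall k, exists N, forall n, (N <= n)%nat -> (k < K n)%nat) ->
  Clim eta (RtoC 1) -> sq_small ia ->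
  Clim (fun n => Cprod (fun k => 1 + z * eta n * J n k)%C (K n)) (eprod ia z).
Proof.
  intros HJ Hlim HK Heta Hia eps Heps.
  destruct (Clim_bounded_near _ _ Heta) as [N1 HN1]. rewrite Cmod_1 in HN1.
  set (w := (RtoC 2 * RtoC (Cmod z))%C).
  assert (Hz := Cmod_ge_0 z).
  assert (Hw : Cmod w = 2 * Cmod z).
  { unfold w. rewrite Cmod_mult, !Cmod_R, !Rabs_pos_eq; lra. }
  set (B := exp (2 * (2 * Cmod z))). assert (HB : 1 <= B).
  { unfold B. rewrite <- exp_0 at 1. apply exp_le_mono. lra. }
  destruct (exp_minus_1_small (eps / (4 * B))) as (d & Hd & He); [apply Rdiv_lt_0_compat; lra |].
  destruct (inv_INR_small (d / (2 * Cmod z + 1))) as (m & Hm & Hmd); [apply Rdiv_lt_0_compat; lra |].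
  assert (Hmd' : 2 * Cmod z * / INR m <= d).
  { apply (Rle_div_r (/ INR m) d) in Hmd; [| lra].
    assert (0 < / INR m) by (apply Rinv_0_lt_compat, lt_0_INR; lia). nra. }
  assert (T : exp (2 * Cmod z * / INR m) - 1 < eps / (4 * B)) by now apply He.
  assert (T1 : B * (exp (2 * Cmod z * / INR m) - 1) < eps / 4).
  { apply (Rmult_lt_compat_l B) in T; [| lra]. replace (B * (eps / (4 * B))) with (eps / 4) in T by (field; lra). exact T. }
  assert (G1 : Cmod (eprod ia z - Cprod (fun k => 1 + z * ia k)%C m) <= eps / 4).
  { apply (Clim_le_dist _ _ _ _ m (eprod_lim ia z Hia)). intros n Hn.
    replace n with (m + (n - m))%nat by lia. rewrite Cprod_plus.
    set (P := Cprod _ m). set (Q := Cprod _ (n - m)).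
    replace (P * Q - P)%C with (P * (Q - 1))%C by ring. rewrite Cmod_mult.
    assert (HP : Cmod P <= B).
    { eapply Rle_trans; [now apply Cprod_bounded |]. apply exp_le_mono. lra. }
    assert (HQ : Cmod (Q - 1) <= exp (2 * Cmod z * / INR m) - 1).
    { eapply Rle_trans; [apply Cprod_tail; trivial |].
      assert (exp (Cmod z * / INR m) <= exp (2 * Cmod z * / INR m)); [| lra].
      apply exp_le_mono. assert (0 < / INR m) by (apply Rinv_0_lt_compat, lt_0_INR; lia). nra. }
    left. eapply Rle_lt_trans; [| exact T1].
    apply Rmult_le_compat; trivial; apply Cmod_ge_0. }
  assert (G2 : Clim (fun n => Cprod (fun k => 1 + z * eta n * J n k)%C m) (Cprod (fun k => 1 + z * ia k)%C m)).
  { apply Clim_Cprod. intros k _. apply Clim_plus; [apply Clim_const |].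
    replace (z * ia k)%C with (z * 1 * ia k)%C by ring.
    apply Clim_mult; [now apply Clim_scal | apply Clim_RtoC, Hlim]. }
  destruct (G2 (eps / 4)) as [N2 HN2]; [lra |]. destruct (HK m) as [N3 HN3].
  exists (N1 + N2 + N3)%nat. intros n Hn.
  specialize (HN1 n ltac:(lia)). specialize (HN2 n ltac:(lia)). specialize (HN3 n ltac:(lia)).
  set (J' := fun k => if lt_dec k (K n) then J n k else 0).
  assert (HJ' : sq_small J').
  { intros k. unfold J'. destruct (lt_dec k (K n)); [now apply HJ |]. split; [lra |].
    left. apply Rinv_0_lt_compat, pow_lt. generalize (pos_INR k). lra. }
  set (v := (z * eta n)%C) in *.
  assert (Hv : Cmod v <= 2 * Cmod z). { unfold v. rewrite Cmod_mult. nra. }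
  assert (E : Cprod (fun k => 1 + v * J n k)%C (K n) = Cprod (fun k => 1 + v * J' k)%C (K n)).
  { apply Cprod_ext. intros k Hk. unfold J'. destruct (lt_dec k (K n)); [trivial | lia]. }
  assert (E' : Cprod (fun k => 1 + v * J n k)%C m = Cprod (fun k => 1 + v * J' k)%C m).
  { apply Cprod_ext. intros k Hk. unfold J'. destruct (lt_dec k (K n)); [trivial | lia]. }
  rewrite E. rewrite E' in HN2.
  assert (G3 : Cmod (Cprod (fun k => 1 + v * J' k)%C (K n) - Cprod (fun k => 1 + v * J' k)%C m) <= eps / 4).
  { replace (K n) with (m + (K n - m))%nat by lia. rewrite Cprod_plus.
    set (P := Cprod _ m). set (Q := Cprod _ (K n - m)).
    replace (P * Q - P)%C with (P * (Q - 1))%C by ring. rewrite Cmod_mult.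
    assert (HP : Cmod P <= B).
    { eapply Rle_trans; [now apply Cprod_bounded |]. apply exp_le_mono. lra. }
    assert (HQ : Cmod (Q - 1) <= exp (2 * Cmod z * / INR m) - 1).
    { eapply Rle_trans; [apply Cprod_tail; trivial |].
      assert (exp (Cmod v * / INR m) <= exp (2 * Cmod z * / INR m)); [| lra].
      apply exp_le_mono. assert (0 < / INR m) by (apply Rinv_0_lt_compat, lt_0_INR; lia). nra. }
    left. eapply Rle_lt_trans; [| exact T1].
    apply Rmult_le_compat; trivial; apply Cmod_ge_0. }
  set (X := Cprod (fun k => 1 + v * J' k)%C (K n)) in *. set (Y := Cprod (fun k => 1 + v * J' k)%C m) in *.
  set (W := Cprod (fun k => 1 + z * ia k)%C m) in *.
  replace (X - eprod ia z)%C with ((X - Y) + ((Y - W) + - (eprod ia z - W)))%C by ring.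
  eapply Rle_lt_trans; [apply Cmod_triangle |].
  eapply Rle_lt_trans; [apply Rplus_le_compat_l, Cmod_triangle |]. rewrite Cmod_opp. lra.
Qed.

Lemma eprod_cons ia z : sq_small ia -> sq_small (fun k => ia (S k)) ->
  eprod ia z = ((1 + z * ia 0%nat) * eprod (fun k => ia (S k)) z)%C.
Proof.
  intros H H'. apply eprod_unique; trivial.
  apply (Clim_ext_from (fun n => (1 + z * ia 0%nat) * Cprod (fun k => 1 + z * ia (S k)) (n - 1))%C _ _ 1).
  { intros n Hn. replace n with (1 + (n - 1))%nat at 2 by lia. rewrite Cprod_plus. simpl. ring. }
  apply Clim_scal. intros eps Heps. destruct (eprod_lim _ z H' eps Heps) as [N HN].
  exists (S N). intros n Hn. apply HN. lia.
Qed.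

Lemma Cprod_real (f : nat -> R) n : exists x, Cprod (fun k => RtoC (f k)) n = RtoC x.
Proof.
  induction n as [|n [x IH]]; [now exists 1 |]. simpl. rewrite IH. exists (x * f n). now rewrite RtoC_mult.
Qed.

Lemma eprod_real ia x : sq_small ia -> eprod ia (RtoC x) = RtoC (Re (eprod ia (RtoC x))).
Proof.
  intros H. assert (HI : Im (eprod ia (RtoC x)) = 0).
  { assert (L := Clim_Im _ _ (eprod_lim ia (RtoC x) H)).
    apply (is_lim_seq_ext _ (fun _ => 0)) in L.
    - assert (L' := is_lim_seq_unique _ _ L). rewrite Lim_seq_const in L'. now inversion L'.
    - intros n. rewrite (Cprod_ext _ (fun k => RtoC (1 + x * ia k))).
      + destruct (Cprod_real (fun k => 1 + x * ia k) n) as [y ->]. reflexivity.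
      + intros. now rewrite RtoC_plus, RtoC_mult. }
  destruct (eprod ia (RtoC x)) as [a b]. simpl in *. unfold RtoC. now rewrite HI.
Qed.

Section Products.

Variables (p q : R) (Phi : C -> C).
Hypothesis Hp : 0 < p < 1.
Hypothesis Hq : q = 1 - p.
Hypothesis Hfun : forall z : C, Phi (RtoC (lambda p q) * z)%C = Rpoly p q (Phi z).
Hypothesis Hzero : Phi (RtoC 0) = RtoC 0.
Hypothesis Hder : is_Cderive Phi (RtoC 0) (RtoC 1).

Local Notation lam := (lambda p q).

(** The function [Phi] in the coordinate in which [Rpoly] becomes [cubP]. *)
Definition Psi (z : C) : C := (1 + Phi z / 2)%C.

Lemma RtoC_neq_0 (x : R) : x <> 0 -> RtoC x <> RtoC 0.
Proof. intros H E. now apply RtoC_inj in E. Qed.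

Lemma Psi_fun z : Psi (RtoC lam * z) = cubPC p q (Psi z).
Proof.
  unfold Psi. rewrite Hfun. unfold Rpoly, cubPC.
  assert (Hpq := pq_pos p q Hp Hq).
  assert (Np := RtoC_neq_0 (p * q) ltac:(lra)).
  rewrite RtoC_div, RtoC_minus by lra. field. trivial.
Qed.

Lemma lam_neq_0 : RtoC lam <> RtoC 0.
Proof. apply RtoC_neq_0. generalize (lambda_ge_9 p q Hp Hq). lra. Qed.

Lemma Psi_iter n z : iterP p q n (Psi (z / RtoC lam ^ n)) = Psi z.
Proof.
  assert (N := lam_neq_0). revert z. induction n; intros z.
  - simpl. f_equal. field.
  - rewrite iterP_S. replace (z / RtoC lam ^ S n)%C with (z / RtoC lam / RtoC lam ^ n)%C.
    2:{ simpl. field. split; trivial. now apply Cpow_nz. }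
    rewrite IHn, <- Psi_fun. f_equal. field. trivial.
Qed.

Definition Phi_ratio (z : C) (n : nat) : C := (Phi (z / RtoC lam ^ n) / (z / RtoC lam ^ n))%C.

Lemma div_lam_pow_small z eps : 0 < eps -> exists N, forall n, (N <= n)%nat -> Cmod (z / RtoC lam ^ n) < eps.
Proof.
  intros Heps. assert (H9 := lambda_ge_9 p q Hp Hq).
  destruct (pow_lt_1_zero (/ 9) ltac:(rewrite Rabs_pos_eq; lra) (eps / (Cmod z + 1))) as [N HN].
  { apply Rdiv_lt_0_compat; trivial. generalize (Cmod_ge_0 z). lra. }
  exists N. intros n Hn. specialize (HN n Hn).
  rewrite Cmod_div by apply Cpow_nz, lam_neq_0. rewrite Cmod_pow, Cmod_R, (Rabs_pos_eq lam) by lra.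
  rewrite Rabs_pos_eq in HN by (apply pow_le; lra).
  assert (/ lam ^ n <= (/ 9) ^ n).
  { rewrite pow_inv. apply Rinv_le_contravar; [apply pow_lt; lra | apply pow_incr; lra]. }
  apply (Rlt_div_r _ eps) in HN; [| generalize (Cmod_ge_0 z); lra].
  assert (0 < / lam ^ n) by (apply Rinv_0_lt_compat, pow_lt; lra).
  unfold Rdiv. generalize (Cmod_ge_0 z). nra.
Qed.

Lemma Phi_ratio_lim z : z <> RtoC 0 -> Clim (Phi_ratio z) (RtoC 1).
Proof.
  intros Hz eps Heps. apply is_Cderive_eps with (eps := eps / 2) in Hder; [| lra].
  destruct Hder as (d & Hd & H). destruct (div_lam_pow_small z d Hd) as [N HN].
  exists N. intros n Hn. specialize (H _ (HN n Hn)). unfold Phi_ratio.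
  assert (Hw : (z / RtoC lam ^ n)%C <> RtoC 0).
  { intros E. apply Hz. replace z with (z / RtoC lam ^ n * RtoC lam ^ n)%C.
    rewrite E. ring. field. apply Cpow_nz, lam_neq_0. }
  set (w := (z / RtoC lam ^ n)%C) in *. rewrite Hzero in H.
  replace (0 + w)%C with w in H by ring. replace (Phi w - 0 - 1 * w)%C with (Phi w - w)%C in H by ring.
  replace (Phi w / w - 1)%C with ((Phi w - w) / w)%C by (field; trivial).
  rewrite Cmod_div by trivial. assert (0 < Cmod w) by now apply Cmod_gt_0.
  apply (Rlt_div_l _ eps); nra.
Qed.

(** The rescaled factor belonging to a preimage, evaluated at the point of the
    orbit close to the fixed point. *)
Lemma lin_Phi_ratio c n k z : z <> RtoC 0 -> preim p q c n k < 1 ->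
  lin (preim p q c n k) (Psi (z / RtoC lam ^ n)) = (1 + z * Phi_ratio z n * recip p q c n k)%C.
Proof.
  intros Hz Hr. assert (HL := lam_pow_pos p q Hp Hq n).
  assert (NL := Cpow_nz _ n lam_neq_0).
  assert (N1 := RtoC_neq_0 (1 - preim p q c n k) ltac:(lra)).
  unfold lin, Phi_ratio, recip, Psi.
  rewrite RtoC_inv by (apply Rmult_integral_contrapositive_currified; lra).
  rewrite !RtoC_mult, RtoC_pow. field. repeat split; trivial.
Qed.

Lemma lin_Psi_product c z : -1 <= c < 1 ->
  lin c (Psi z) = ((1 + z * iota p q c 0) * eprod (fun k => iota p q c (S k)) z)%C.
Proof.
  intros Hc. assert (Hs := iota_sq_small p q Hp Hq c ltac:(lra)).
  assert (Had : forall k, admissible c k) by (left; trivial).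
  destruct (classic (z = RtoC 0)) as [-> | Hz].
  - rewrite (eprod_unique _ (RtoC 0) (RtoC 1)); trivial.
    + unfold lin, Psi. rewrite Hzero. unfold Cdiv. ring.
    + apply Clim_ext with (fun _ => RtoC 1); [| apply Clim_const]. intros n. symmetry.
      induction n; simpl; trivial. rewrite IHn. ring.
  - apply (Clim_unique (fun n => lin c (Psi z))); [apply Clim_const |].
    apply (Clim_ext (fun n => (1 + z * Phi_ratio z n * recip p q c n 0) *
      Cprod (fun k => 1 + z * Phi_ratio z n * recip p q c n (S k)) (3 ^ n - 1))%C).
    { intros n. rewrite <- (Psi_iter n z), lin_preim by trivial. assert (H3 := pow3_pos n).
      replace (3 ^ n)%nat with (1 + (3 ^ n - 1))%nat at 2 by lia. rewrite Cprod_plus.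
      cbn [Cprod]. rewrite lin_Phi_ratio; trivial; [| now apply preim_lt_1].
      rewrite Cmult_1_l. f_equal. apply Cprod_ext. intros k Hk.
      symmetry. apply lin_Phi_ratio; trivial. now apply preim_lt_1. }
    assert (Hr := Phi_ratio_lim z Hz).
    apply Clim_mult.
    + apply Clim_plus; [apply Clim_const |]. replace (z * iota p q c 0)%C with (z * 1 * iota p q c 0)%C by ring.
      apply Clim_mult; [now apply Clim_scal | apply Clim_RtoC; now apply iota_lim].
    + apply (tannery (fun n k => recip p q c n (S k)) (fun n => 3 ^ n - 1)%nat); trivial.
      * intros n k Hk. destruct (recip_le_sq p q Hp Hq c n k (Had _) ltac:(lia)) as [H1 H2].
        split; trivial. eapply Rle_trans; [exact H2 |]. rewrite S_INR. generalize (pos_INR k). intros.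
        apply Rinv_le_contravar; [apply pow_lt; lra | apply pow_incr; lra].
      * intros k. now apply iota_lim.
      * intros k. exists (S k). intros n Hn. assert (S k < 3 ^ n)%nat; [| lia].
        apply lt_pow3_mono with (S k); trivial. apply nat_lt_pow3.
Qed.

Lemma Phi_product z : Phi z = (z * eprod (fun k => iota p q 1 (S k)) z)%C.
Proof.
  assert (Hs := iota_sq_small p q Hp Hq 1 ltac:(lra)).
  assert (Had : forall k, admissible 1 (S k)) by (intros; right; split; [trivial | lia]).
  destruct (classic (z = RtoC 0)) as [-> | Hz].
  - rewrite Hzero. ring.
  - apply (Clim_unique (fun n => Phi z)); [apply Clim_const |].
    apply (Clim_ext (fun n => (z * Phi_ratio z n) *
      Cprod (fun k => 1 + z * Phi_ratio z n * recip p q 1 n (S k)) (3 ^ n - 1))%C).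
    { intros n. assert (E := Psi_iter n z). apply (f_equal (fun x => x - 1)%C) in E.
      rewrite lin_preim_1 in E by trivial.
      replace (Phi z) with (2 * (Psi z - 1))%C by (unfold Psi; field).
      rewrite <- E. assert (H3 := pow3_pos n).
      rewrite (Cprod_ext (fun k => lin (preim p q 1 n (S k)) (Psi (z / RtoC lam ^ n)))
        (fun k => 1 + z * Phi_ratio z n * recip p q 1 n (S k))%C).
      2:{ intros k Hk. apply lin_Phi_ratio; trivial. apply preim_1_lt_1; trivial; lia. }
      assert (NL := Cpow_nz _ n lam_neq_0).
      unfold Psi, Phi_ratio. field. repeat split; trivial. }
    assert (Hr := Phi_ratio_lim z Hz).
    replace (z * eprod (fun k => iota p q 1 (S k)) z)%C with (z * 1 * eprod (fun k => iota p q 1 (S k)) z)%C by ring.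
    apply Clim_mult; [now apply Clim_scal |].
    apply (tannery (fun n k => recip p q 1 n (S k)) (fun n => 3 ^ n - 1)%nat); trivial.
    * intros n k Hk. destruct (recip_le_sq p q Hp Hq 1 n k (Had _) ltac:(lia)) as [H1 H2].
      split; trivial. eapply Rle_trans; [exact H2 |]. rewrite S_INR. generalize (pos_INR k). intros.
      apply Rinv_le_contravar; [apply pow_lt; lra | apply pow_incr; lra].
    * intros k. now apply iota_lim.
    * intros k. exists (S k). intros n Hn. assert (S k < 3 ^ n)%nat; [| lia].
      apply lt_pow3_mono with (S k); trivial. apply nat_lt_pow3.
Qed.

Lemma iota_m1_sq_small : sq_small (iota p q (-1)).
Proof.
  intros [|k].
  - split; [left; apply iota_pos; trivial; left; lra |].
    eapply Rle_trans; [apply (iota_le_recip p q Hp Hq (-1) 0 0); [left; lra | simpl; lia] |].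
    unfold recip. simpl. apply Rinv_le_contravar; lra.
  - assert (H : admissible (-1) (S k)) by (left; lra).
    split; [left; now apply iota_pos |].
    assert (Hk := nat_lt_pow3 (S k)).
    eapply Rle_trans; [now apply (iota_le_recip p q Hp Hq (-1) (S k) (S k)) |].
    now apply recip_le_sq.
Qed.

Lemma Phi_product_4 z : (1 + Phi z / 4)%C = eprod (iota p q (-1)) z.
Proof.
  rewrite (eprod_cons (iota p q (-1))).
  - rewrite <- lin_Psi_product by lra. unfold lin, Psi.
    replace (1 - -1) with 2 by ring. field.
  - apply iota_m1_sq_small.
  - apply iota_sq_small; trivial. lra.
Qed.

Lemma Phi_real x : Phi (RtoC x) = RtoC (Re (Phi (RtoC x))).
Proof.
  rewrite Phi_product, eprod_real by (apply iota_sq_small; trivial; lra).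
  rewrite <- RtoC_mult. reflexivity.
Qed.

Definition psiR (x : R) : R := 1 + Re (Phi (RtoC x)) / 2.

Lemma Psi_real x : Psi (RtoC x) = RtoC (psiR x).
Proof.
  unfold Psi, psiR. rewrite Phi_real. rewrite RtoC_plus, RtoC_div by lra. reflexivity.
Qed.

Lemma psiR_fun x : psiR (lam * x) = cubP p q (psiR x).
Proof.
  apply RtoC_inj. rewrite <- Psi_real, RtoC_mult, Psi_fun, Psi_real, cubPC_RtoC; trivial.
  generalize (pq_pos p q Hp Hq). lra.
Qed.

(** A product that converges vanishes only if one of its factors does. *)
Lemma psiR_zeros c t : -1 <= c < 1 ->
  psiR (- t) = c <-> exists k, t * iota p q c k = 1.
Proof.
  intros Hc. assert (H := lin_Psi_product c (RtoC (- t)) Hc).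
  assert (Hs := iota_sq_small p q Hp Hq c ltac:(lra)).
  rewrite Psi_real, lin_eq in H by lra. split.
  - intros E. rewrite E in H. apply NNPP. intros Hn.
    assert (Hk : forall k, (1 + RtoC (- t) * RtoC (iota p q c k))%C <> RtoC 0).
    { intros k. rewrite <- RtoC_mult, <- RtoC_plus. apply RtoC_neq_0. intros E0. apply Hn. exists k. lra. }
    assert (H1 := eprod_neq_0 _ (RtoC (- t)) Hs (fun k => Hk (S k))).
    assert (H2 := Cmult_neq_0 _ _ (Hk 0%nat) H1). apply H2. rewrite <- H. unfold Cdiv. ring.
  - intros [k Hk].
    assert (E : ((RtoC (psiR (- t)) - RtoC c) / RtoC (1 - c))%C = RtoC 0).
    { rewrite H. destruct k as [|k].
      - rewrite <- RtoC_mult, <- RtoC_plus. replace (1 + - t * iota p q c 0) with 0 by lra. ring.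
      - replace (eprod (fun k => iota p q c (S k)) (RtoC (- t))) with (RtoC 0); [ring |].
        symmetry. apply eprod_unique; trivial.
        apply (Clim_ext_from (fun _ => RtoC 0) _ _ (S k)); [| apply Clim_const].
        intros n Hn. replace n with (S k + (n - S k))%nat by lia. rewrite Cprod_plus. cbn [Cprod].
        replace (1 + RtoC (- t) * RtoC (iota p q c (S k)))%C with (RtoC 0); [ring |].
        rewrite <- RtoC_mult, <- RtoC_plus. f_equal. lra. }
    rewrite <- RtoC_minus, <- RtoC_div in E by lra. apply RtoC_inj in E.
    apply (f_equal (fun x => x * (1 - c))) in E. unfold Rdiv in E.
    rewrite Rmult_assoc, Rinv_l in E by lra. lra.
Qed.

Lemma psiR_zeros_1 t : t <> 0 ->
  psiR (- t) = 1 <-> exists k, t * iota p q 1 (S k) = 1.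
Proof.
  intros Ht. assert (H := Phi_product (RtoC (- t))).
  assert (Hs := iota_sq_small p q Hp Hq 1 ltac:(lra)). unfold psiR. split.
  - intros E. apply NNPP. intros Hn.
    assert (Hk : forall k, (1 + RtoC (- t) * RtoC (iota p q 1 (S k)))%C <> RtoC 0).
    { intros k. rewrite <- RtoC_mult, <- RtoC_plus. apply RtoC_neq_0. intros E0. apply Hn. exists k. lra. }
    assert (H1 := eprod_neq_0 _ (RtoC (- t)) Hs Hk).
    assert (H2 := Cmult_neq_0 _ _ (RtoC_neq_0 (- t) ltac:(lra)) H1). apply H2. rewrite <- H.
    rewrite Phi_real. f_equal. lra.
  - intros [k Hk].
    replace (Phi (RtoC (- t))) with (RtoC 0); [simpl; lra |].
    rewrite H. replace (eprod (fun k => iota p q 1 (S k)) (RtoC (- t))) with (RtoC 0); [ring |].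
    symmetry. apply eprod_unique; trivial.
    apply (Clim_ext_from (fun _ => RtoC 0) _ _ (S k)); [| apply Clim_const].
    intros n Hn. replace n with (S k + (n - S k))%nat by lia. rewrite Cprod_plus. cbn [Cprod].
    replace (1 + RtoC (- t) * RtoC (iota p q 1 (S k)))%C with (RtoC 0); [ring |].
    rewrite <- RtoC_mult, <- RtoC_plus. f_equal. lra.
Qed.

End Products.

(** * Multiplicities of the zeros *)

Lemma Cprod_split f k m :
  Cprod f (k + S m) = (Cprod f k * f k * Cprod (fun j => f (S k + j)%nat) m)%C.
Proof.
  replace (k + S m)%nat with (S k + m)%nat by lia. rewrite Cprod_plus. reflexivity.
Qed.

Definition drop_at (k : nat) (ia : nat -> R) (j : nat) : R :=
  if Nat.eq_dec j k then 0 else ia j.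

Lemma eprod_remove ia k z : sq_small ia ->
  sq_small (drop_at k ia) /\
  eprod ia z = ((1 + z * ia k) * eprod (drop_at k ia) z)%C.
Proof.
  intros H.
  assert (H' : sq_small (drop_at k ia)).
  { intros j. unfold drop_at. destruct (Nat.eq_dec j k); [| apply H]. split; [lra |].
    left. apply Rinv_0_lt_compat, pow_lt. generalize (pos_INR j). lra. }
  split; trivial. apply eprod_unique; trivial.
  apply (Clim_ext_from (fun n => (1 + z * ia k) * Cprod (fun j => 1 + z * RtoC (drop_at k ia j)) n)%C _ _ (S k)).
  { intros n Hn. replace n with (k + S (n - S k))%nat by lia. rewrite !Cprod_split.
    replace (drop_at k ia k) with 0 by (unfold drop_at; destruct (Nat.eq_dec k k); [trivial | lia]).
    rewrite (Cprod_ext (fun j => 1 + z * RtoC (drop_at k ia j))%C (fun j => 1 + z * ia j)%C k).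
    2:{ intros j Hj. unfold drop_at. destruct (Nat.eq_dec j k); [lia | trivial]. }
    rewrite (Cprod_ext (fun j => 1 + z * RtoC (drop_at k ia (S k + j)))%C (fun j => 1 + z * ia (S k + j)%nat)%C).
    2:{ intros j Hj. unfold drop_at. destruct (Nat.eq_dec (S k + j) k); [lia | trivial]. }
    ring. }
  apply Clim_scal. now apply eprod_lim.
Qed.

Lemma eprod_remove_list (t : R) (l : list nat) : forall ia, sq_small ia -> NoDup l ->
  (forall k, In k l -> t * ia k = 1) ->
  exists ia', sq_small ia' /\ (forall k, In k l -> ia' k = 0) /\ (forall k, ~ In k l -> ia' k = ia k) /\
    forall z, eprod ia z = ((1 + z * / t) ^ length l * eprod ia' z)%C.
Proof.
  induction l as [|k l IH]; intros ia Hs Hn Hl.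
  - exists ia. repeat split; try apply Hs; trivial. intros k []. intros z. simpl. ring.
  - inversion Hn as [|? ? Hk Hn']; subst.
    assert (Ht : t * ia k = 1) by (apply Hl; now left).
    assert (Ht0 : t <> 0) by (intros ->; lra).
    destruct (eprod_remove ia k 0 Hs) as [Hs1 _].
    destruct (IH _ Hs1 Hn') as (ia' & H1 & H2 & H3 & H4).
    { intros j Hj. unfold drop_at. destruct (Nat.eq_dec j k) as [-> | _]; [contradiction |]. apply Hl. now right. }
    exists ia'. split; [trivial | split; [| split]].
    + intros j [<- | Hj]; [| now apply H2]. rewrite H3 by trivial. unfold drop_at. destruct (Nat.eq_dec k k); [trivial | lia].
    + intros j Hj. rewrite H3 by (intros Hj'; apply Hj; now right).
      unfold drop_at. destruct (Nat.eq_dec j k) as [-> | _]; trivial. destruct Hj. now left.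
    + intros z. destruct (eprod_remove ia k z Hs) as [_ ->]. rewrite H4. simpl.
      rewrite <- RtoC_inv by trivial. replace (ia k) with (/ t); [ring |]. apply Rmult_eq_reg_l with t; trivial.
      rewrite Ht. now field.
Qed.

(** The finitely many factors that vanish at [t] are split off one by one; what is
    left is again a product of the same kind, without zero at [t]. *)
Lemma eprod_zero_order ia (t : R) (l : list nat) (f u : C -> C) :
  sq_small ia -> NoDup l -> t <> 0 -> (forall k, In k l <-> t * ia k = 1) ->
  (forall z, f z = (u z * eprod ia (- z))%C) ->
  (forall z, exists d, is_Cderive u z d) -> u (RtoC t) <> RtoC 0 ->
  zero_of_order f (RtoC t) (length l).
Proof.
  intros Hs Hn Ht Hl Hf Hu Hu0.
  destruct (eprod_remove_list t l ia Hs Hn) as (ia' & H1 & H2 & H3 & H4); [intros k Hk; now apply Hl |].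
  assert (Nt := RtoC_neq_0 t Ht).
  exists (fun z => (- / t) ^ length l * (u z * eprod ia' (- z)))%C. split; [| split].
  - apply holomorphic_at_intro. exists 1. split; [lra |]. intros z _.
    destruct (Hu z) as [d Hd]. destruct (eprod_derive ia' (- z)%C H1) as [d' Hd'].
    eexists. apply is_Cderive_mult; [apply is_Cderive_const |].
    apply is_Cderive_mult; [exact Hd |].
    apply (is_Cderive_comp (eprod ia') Copp); [exact Hd' |].
    apply (is_Cderive_ext (fun z => (- (1)) * z)%C).
    { exists 1. split; [lra | intros; ring]. }
    apply is_Cderive_mult; [apply is_Cderive_const | apply is_Cderive_id].
  - apply Cmult_neq_0.
    + apply Cpow_nz. intros E. assert (E' : (/ RtoC t * RtoC t = 0)%C) by (replace (/ t)%C with (- - / t)%C by ring; rewrite E; ring).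
      rewrite Cinv_l in E' by trivial. apply RtoC_inj in E'. lra.
    + apply Cmult_neq_0; trivial. apply eprod_neq_0; trivial. intros k.
      destruct (in_dec Nat.eq_dec k l) as [Hk | Hk].
      * rewrite H2 by trivial. replace (1 + - RtoC t * 0)%C with (RtoC 1) by ring. apply RtoC_neq_0. lra.
      * rewrite H3 by trivial. rewrite <- RtoC_opp, <- RtoC_mult, <- RtoC_plus. apply RtoC_neq_0.
        intros E. apply Hk, Hl. lra.
  - apply locally_Cmod. exists 1. split; [lra |]. intros z _. rewrite Hf, H4.
    replace (1 + - z * / t)%C with ((z - t) * (- / t))%C by (field; trivial).
    rewrite Cpow_mult_l. ring.
Qed.

(** ** Counting *)

Definition ind (P : Prop) : nat := if excluded_middle_informative P then 1%nat else 0%nat.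

Lemma ind_true P : P -> ind P = 1%nat.
Proof. intros. unfold ind. destruct excluded_middle_informative; tauto. Qed.

Lemma ind_false P : ~ P -> ind P = 0%nat.
Proof. intros. unfold ind. destruct excluded_middle_informative; tauto. Qed.

Lemma ind_iff P Q : (P <-> Q) -> ind P = ind Q.
Proof. intros. unfold ind. repeat destruct excluded_middle_informative; tauto. Qed.

Fixpoint count (P : nat -> Prop) (n : nat) : nat :=
  match n with O => 0 | S n => count P n + ind (P n) end.

Lemma count_ext P Q n : (forall k, (k < n)%nat -> P k <-> Q k) -> count P n = count Q n.
Proof.
  induction n; intros H; simpl; trivial. rewrite IHn by (intros; apply H; lia).
  f_equal. apply ind_iff, H. lia.
Qed.

Lemma count_plus P n m : count P (n + m) = (count P n + count (fun k => P (n + k)) m)%nat.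
Proof.
  induction m; simpl. rewrite Nat.add_0_r; lia.
  replace (n + S m)%nat with (S (n + m)) by lia. simpl. lia.
Qed.

Lemma count_and P (Q : Prop) n : count (fun k => P k /\ Q) n = (count P n * ind Q)%nat.
Proof.
  induction n; simpl; trivial. rewrite IHn. unfold ind.
  repeat destruct excluded_middle_informative; try tauto; lia.
Qed.

Lemma count_length (P : nat -> Prop) (l : list nat) n : NoDup l ->
  (forall k, In k l <-> P k) -> (forall k, P k -> (k < n)%nat) -> length l = count P n.
Proof.
  intros Hn Hl Hb.
  assert (G : forall m, exists l', NoDup l' /\ (forall k, In k l' <-> P k /\ (k < m)%nat) /\ length l' = count P m).
  { induction m as [|m (l' & H1 & H2 & H3)].
    - exists nil. split; [constructor | split; [| trivial]]. intros k. split; [intros [] | lia].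
    - simpl. destruct (classic (P m)) as [HP | HP].
      + exists (m :: l'). split; [| split].
        * constructor; trivial. intros Hm. apply H2 in Hm. lia.
        * intros k. simpl. rewrite H2. split.
          -- intros [<- | [H H']]; split; trivial; lia.
          -- intros [H H']. destruct (Nat.eq_dec m k) as [-> | ne]; [now left | right; split; trivial; lia].
        * simpl. rewrite H3, ind_true by trivial. lia.
      + exists l'. split; [trivial | split].
        * intros k. rewrite H2. split; intros [H H']; split; trivial; try lia.
          destruct (Nat.eq_dec m k) as [-> | ne]; [contradiction | lia].
        * rewrite H3, ind_false by trivial. lia. }
  destruct (G n) as (l' & H1 & H2 & H3). rewrite <- H3.
  apply Permutation_length, NoDup_Permutation; trivial. intros k. rewrite Hl, H2. split; [| tauto].
  intros HP. split; trivial. now apply Hb.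
Qed.

Lemma inv_sq_le_1 j : / (INR j + 1) ^ 2 <= 1.
Proof.
  rewrite <- Rinv_1. apply Rinv_le_contravar; [lra |]. generalize (pos_INR j). intros. simpl. nra.
Qed.

Lemma m1_plus_1 : -1 + 1 = 0.
Proof. ring. Qed.

(** The [k]-th zero is at least [(k + 1) ^ 2]. *)
Lemma zero_index_bound ia t k : sq_small ia -> t * ia k = 1 -> INR k + 1 <= Rabs t + 1.
Proof.
  intros H E. assert (Hk := H k). assert (HI := pos_INR k).
  assert (Hpos : 0 < (INR k + 1) ^ 2) by (apply pow_lt; lra).
  assert (0 < ia k). { destruct (proj1 Hk) as [h | h]; trivial. rewrite <- h in E. lra. }
  assert (0 < t) by nra. rewrite Rabs_pos_eq by lra.
  assert ((INR k + 1) ^ 2 <= t).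
  { assert (t * / (INR k + 1) ^ 2 >= 1) by nra.
    apply Rmult_le_reg_r with (/ (INR k + 1) ^ 2); [now apply Rinv_0_lt_compat |].
    rewrite Rinv_r; lra. }
  simpl in *. nra.
Qed.

Section Multiplicity.

Variables (p q : R) (Phi : C -> C).
Hypothesis Hp : 0 < p < 1.
Hypothesis Hq : q = 1 - p.
Hypothesis Hfun : forall z : C, Phi (RtoC (lambda p q) * z)%C = Rpoly p q (Phi z).
Hypothesis Hzero : Phi (RtoC 0) = RtoC 0.
Hypothesis Hder : is_Cderive Phi (RtoC 0) (RtoC 1).

Local Notation lam := (lambda p q).
Local Notation psi := (psiR Phi).

Definition fiber_mult (a : R) : nat := count (fun i => branch p q i (cubP p q a) = a) 3.

(** Whether a preimage of level [n + 1] equals [a] is decided by its image, of level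
    [n], and by the branch. *)
Lemma count_preim_S c n a : -1 <= c <= 1 ->
  count (fun k => preim p q c (S n) k = a) (3 ^ S n) =
  (count (fun k => preim p q c n k = cubP p q a) (3 ^ n) * fiber_mult a)%nat.
Proof.
  intros Hc. assert (E : (3 ^ S n = 3 ^ n + 3 ^ n + 3 ^ n)%nat) by (cbn [Nat.pow]; lia).
  rewrite E, !count_plus.
  assert (G : forall i f, (forall k, (k < 3 ^ n)%nat -> f k = (i * 3 ^ n + k)%nat) ->
    count (fun k => preim p q c (S n) (f k) = a) (3 ^ n) =
    (count (fun k => preim p q c n k = cubP p q a) (3 ^ n) * ind (branch p q i (cubP p q a) = a))%nat).
  { intros i f Hf. rewrite <- count_and. apply count_ext. intros k Hk. rewrite Hf, preim_digit by trivial.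
    assert (Hr := preim_range p q Hp Hq c n k Hc). split.
    - intros H. assert (Ep : preim p q c n k = cubP p q a).
      { rewrite <- H. symmetry. now apply branch_root. }
      split; trivial. now rewrite <- Ep.
    - intros [H1 H2]. now rewrite H1. }
  rewrite (G 0%nat (fun k => k)) by (intros; lia).
  rewrite (G 1%nat (fun k => (3 ^ n + k)%nat)) by (intros; lia).
  rewrite (G 2%nat (fun k => (3 ^ n + 3 ^ n + k)%nat)) by (intros; lia).
  unfold fiber_mult. simpl. lia.
Qed.

(** The largest preimage is at least the maximum of [p] and [q], the others are at
    most 1/2 and differ by the root of a discriminant at least [1 - 4 * p * q].  So
    two of them can only agree for [p = q], when [cubP] is a Chebyshev polynomial
    with critical points 1/2 and -1/2. *)
Lemma fiber_mult_eq a : -1 <= cubP p q a <= 1 ->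
  fiber_mult a = (if excluded_middle_informative (p = q /\ a ^ 2 = p ^ 2)%R then 2 else 1)%nat.
Proof.
  intros Hc. set (c := cubP p q a) in *.
  destruct (branch0_spec p q Hp Hq c Hc) as [Hb E0].
  destruct (branch_vieta p q Hp Hq c Hc) as [V1 V2].
  assert (HM := Mx_bounds p q Hp Hq). assert (Hle := pq_le p q Hq). assert (Hpq := pq_pos p q Hp Hq).
  assert (Hd := proj1 (proj1 (disc_bounds p q Hp Hq c Hc))).
  assert (H1 := branch_le p q Hp Hq c 1 Hc ltac:(lia)). assert (H2 := branch_le p q Hp Hq c 2 Hc ltac:(lia)).
  assert (Hs := sqrt_pos (4 * (1 - p * q) - 3 * branch0 p q c ^ 2)).
  assert (Hss := sqrt_sqrt (4 * (1 - p * q) - 3 * branch0 p q c ^ 2) ltac:(lra)).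
  destruct (branch_surj p q Hp Hq c a Hc eq_refl) as (i & Hi & Ea).
  assert (D1 : branch p q 1 c - branch p q 2 c = sqrt (4 * (1 - p * q) - 3 * branch0 p q c ^ 2)).
  { unfold branch. field. }
  set (s := sqrt _) in *. change (branch0 p q c) with (branch p q 0 c) in *.
  unfold fiber_mult. cbn [count]. fold c.
  set (b0 := branch p q 0 c) in *. set (b1 := branch p q 1 c) in *. set (b2 := branch p q 2 c) in *.
  assert (Ea' : a = b0 \/ a = b1 \/ a = b2).
  { destruct i as [|[|[|i]]]; [left | right; left | right; right | lia]; trivial. }
  destruct (Req_dec p q) as [Epq | Npq].
  - assert (p = 1 / 2) by lra. assert (q = 1 / 2) by lra. subst p q.
    rewrite Rmax_left in Hb, HM by lra.
    replace (1 / 2 * (1 - 1 / 2)) with (1 / 4) in * by field.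
    assert (K : forall x, x ^ 2 = (1 / 2) ^ 2 -> x = 1 / 2 \/ x = - (1 / 2)).
    { intros x Hx. assert (Hx' : (x - 1 / 2) * (x + 1 / 2) = 0) by (simpl in Hx; lra).
      apply Rmult_integral in Hx'. destruct Hx'; [left | right]; lra. }
    assert (P1 : b1 + b2 = - b0) by trivial. assert (P2 : b1 * b2 = b0 ^ 2 - 3 / 4) by lra.
    assert (F01 : b0 = b1 -> b0 = 1 / 2) by lra.
    assert (F02 : b0 <> b2).
    { intros E. assert (b1 <= 1 / 2) by trivial. assert (b0 = 1 / 2) by lra. assert (b1 = -1) by lra. lra. }
    assert (F12 : b1 = b2 -> b1 = - (1 / 2) /\ b0 = 1).
    { intros E. assert (b0 = - 2 * b1) by lra. assert (b1 * b1 = 1 / 4).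
      { assert (3 * (b1 * b1) = 3 / 4); [| lra]. rewrite <- E in P2. rewrite H in P2. simpl in P2. lra. }
      destruct (K b1) as [K1 | K1]; [simpl; lra | lra | split; lra]. }
    assert (G0 : b0 = 1 / 2 -> b1 = 1 / 2 /\ b2 = - 1).
    { intros E. rewrite E in P1, P2. assert (Hb1 : (b1 - 1 / 2) * (b1 + 1) = 0).
      { assert (b2 = - (1 / 2) - b1) by lra. subst b2. simpl in P2. nra. }
      apply Rmult_integral in Hb1. destruct Hb1; [split; lra |]. exfalso. assert (b2 = 1 / 2) by lra. lra. }
    assert (G1 : b1 = - (1 / 2) -> b0 = 1).
    { intros E. rewrite E in P1, P2. assert (Hb1 : (b0 - 1) * (b0 + 1 / 2) = 0).
      { assert (b2 = 1 / 2 - b0) by lra. simpl in P2. nra. }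
      apply Rmult_integral in Hb1. destruct Hb1; lra. }
    assert (G2 : b2 = - (1 / 2) -> b1 = - (1 / 2)).
    { intros E. rewrite E in P1, P2. assert (Hb1 : (b1 + 1 / 2) * (b1 - 1) = 0).
      { assert (b0 = 1 / 2 - b1) by lra. simpl in P2. nra. }
      apply Rmult_integral in Hb1. destruct Hb1; lra. }
    assert (G1' : b1 = 1 / 2 -> b0 = 1 / 2).
    { intros E. rewrite E in P1, P2. assert (Hb1 : (b0 - 1 / 2) * (b0 + 1) = 0).
      { assert (b2 = - b0 - 1 / 2) by lra. simpl in P2. nra. }
      apply Rmult_integral in Hb1. destruct Hb1; lra. }
    destruct (excluded_middle_informative (1 / 2 = 1 / 2 /\ a ^ 2 = (1 / 2) ^ 2)) as [[_ H] | H].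
    + destruct (K a H) as [Ka | Ka].
      * assert (b0 = 1 / 2).
        { destruct Ea' as [A | [A | A]]; [lra | apply G1'; lra |]. exfalso. apply F02.
          assert (b1 = 1 / 2) by lra. assert (b0 = 1 / 2) by (now apply G1'). lra. }
        destruct (G0 ltac:(trivial)).
        rewrite (ind_true (b0 = a)), (ind_true (b1 = a)), (ind_false (b2 = a)) by first [lra | intro; lra]. reflexivity.
      * assert (b1 = - (1 / 2)) by (destruct Ea' as [A | [A | A]]; try lra; apply G2; lra).
        assert (b0 = 1) by now apply G1. assert (b2 = - (1 / 2)) by lra.
        rewrite (ind_false (b0 = a)), (ind_true (b1 = a)), (ind_true (b2 = a)) by first [lra | intro; lra]. reflexivity.
    + assert (Na : a <> 1 / 2 /\ a <> - (1 / 2)).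
      { split; intros ->; apply H; split; trivial; simpl; field. }
      clear V2 Hle Hpq Hd Hss P2 K H E0 Hb. destruct Na as [Na1 Na2]. destruct Ea' as [A | [A | A]].
      * assert (b1 <> a) by (intros B; apply Na1; rewrite A; apply F01; lra).
        assert (b2 <> a) by (intros B; apply F02; lra).
        rewrite (ind_true (b0 = a)), (ind_false (b1 = a)), (ind_false (b2 = a)) by auto. reflexivity.
      * assert (b0 <> a) by (intros B; apply Na1; rewrite <- B; apply F01; lra).
        assert (b2 <> a) by (intros B; apply Na2; rewrite A; apply F12; lra).
        rewrite (ind_false (b0 = a)), (ind_true (b1 = a)), (ind_false (b2 = a)) by auto. reflexivity.
      * assert (b0 <> a) by (intros B; apply F02; lra).
        assert (b1 <> a) by (intros B; apply Na2; rewrite <- B; apply F12; lra).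
        rewrite (ind_false (b0 = a)), (ind_false (b1 = a)), (ind_true (b2 = a)) by auto. reflexivity.
  - destruct (excluded_middle_informative (p = q /\ a ^ 2 = p ^ 2)) as [[H _] | _]; [contradiction |].
    assert (Hs0 : 0 < s).
    { assert (p * q < 1 / 4).
      { rewrite Hq. assert (0 < (p - 1 / 2) * (p - 1 / 2)); [| nra].
        destruct (Rtotal_order p (1 / 2)) as [L | [L | L]]; [nra | lra | nra]. }
      destruct Hs as [Hs | Hs]; trivial. exfalso. rewrite <- Hs in Hss. lra. }
    assert (F01 : b1 < b0).
    { assert (1 / 2 < Rmax p q). { unfold Rmax. destruct (Rle_dec p q); lra. } lra. }
    destruct Ea' as [A | [A | A]].
    + rewrite (ind_true (b0 = a)), (ind_false (b1 = a)), (ind_false (b2 = a)) by first [lra | intro; lra]. reflexivity.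
    + rewrite (ind_false (b0 = a)), (ind_true (b1 = a)), (ind_false (b2 = a)) by first [lra | intro; lra]. reflexivity.
    + rewrite (ind_false (b0 = a)), (ind_false (b1 = a)), (ind_true (b2 = a)) by first [lra | intro; lra]. reflexivity.
Qed.

(** The orbit of [cubP] belonging to [t], read backwards from its end
    [1 + Phi (- t) / 2]; it starts, for large [n], near the fixed point 1. *)
Definition orbit (t : R) (n : nat) : R := psi (- (t / lam ^ n)).

Lemma orbit_S t n : cubP p q (orbit t (S n)) = orbit t n.
Proof.
  unfold orbit. rewrite <- psiR_fun by trivial. f_equal. assert (H := lambda_ge_9 p q Hp Hq).
  assert (HL := lam_pow_pos p q Hp Hq n). simpl. field. split; lra.
Qed.

Lemma orbit_0 t : orbit t 0 = psi (- t).
Proof. unfold orbit. f_equal. simpl. field. Qed.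

Lemma orbit_pm1 t n j : orbit t n = 1 \/ orbit t n = -1 -> (j <= n)%nat -> orbit t j = orbit t n.
Proof.
  intros H Hj. induction n; [replace j with 0%nat by lia; trivial |].
  assert (E : orbit t n = orbit t (S n)).
  { rewrite <- orbit_S. generalize (cubP_minus_1 p q Hp Hq (orbit t (S n))) (cubP_plus_1 p q Hp Hq (orbit t (S n))).
    unfold Rdiv. destruct H as [-> | ->]; intros H1 H2; [rewrite Rminus_diag, !Rmult_0_l in H1 | rewrite m1_plus_1, !Rmult_0_l in H2]; lra. }
  destruct (Nat.eq_dec j (S n)) as [-> | Nj]; trivial. rewrite <- E. apply IHn; [now rewrite E | lia].
Qed.

Lemma cubP_pm1 x : cubP p q x = 1 \/ cubP p q x = -1 <-> (x = 1 \/ x = -1) \/ (x ^ 2 = p ^ 2 \/ x ^ 2 = q ^ 2).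
Proof.
  assert (Hpq := pq_pos p q Hp Hq). assert (Hi : 0 < / (p * q)) by now apply Rinv_0_lt_compat.
  generalize (cubP_minus_1 p q Hp Hq x) (cubP_plus_1 p q Hp Hq x). unfold Rdiv. intros H1 H2.
  assert (Z : forall a b c : R, a * b * c * / (p * q) = 0 -> a = 0 \/ b = 0 \/ c = 0).
  { intros a b c H. apply Rmult_integral in H. destruct H as [H | H]; [| lra].
    apply Rmult_integral in H. destruct H as [H | H]; [| tauto]. apply Rmult_integral in H. tauto. }
  split.
  - intros [H | H]; rewrite H in H1, H2.
    + rewrite Rminus_diag in H1. symmetry in H1. apply Z in H1.
      destruct H1 as [A | [A | A]]; [left; left; lra | right; left | right; right];
      [replace x with (- p) by lra | replace x with (- q) by lra]; ring.
    + rewrite m1_plus_1 in H2. symmetry in H2. apply Z in H2.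
      destruct H2 as [A | [A | A]]; [left; right; lra | right; left | right; right];
      [replace x with p by lra | replace x with q by lra]; ring.
  - intros [[-> | ->] | [H | H]].
    + left. rewrite Rminus_diag, !Rmult_0_l in H1. lra.
    + right. rewrite m1_plus_1, !Rmult_0_l in H2. lra.
    + assert (A : (x + p) * (x - p) = 0) by (simpl in H; lra). apply Rmult_integral in A. destruct A as [A | A].
      * left. replace ((x - 1) * (x + p) * (x + q) * / (p * q)) with 0 in H1; [lra | rewrite A; ring].
      * right. replace ((x + 1) * (x - p) * (x - q) * / (p * q)) with 0 in H2; [lra | rewrite A; ring].
    + assert (A : (x + q) * (x - q) = 0) by (simpl in H; lra). apply Rmult_integral in A. destruct A as [A | A].
      * left. replace ((x - 1) * (x + p) * (x + q) * / (p * q)) with 0 in H1; [lra | rewrite A; ring].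
      * right. replace ((x + 1) * (x - p) * (x - q) * / (p * q)) with 0 in H2; [lra | rewrite A; ring].
Qed.

(** By [cubP_pm1] the orbit can reach 1 or -1 only through one of the points
    [p], [-p], [q], [-q]. *)
Definition hits (t r : R) : Prop := exists j, (1 <= j)%nat /\ orbit t j ^ 2 = r ^ 2.

Lemma hits_pm1 t r : (r = p \/ r = q) -> hits t r -> psi (- t) = 1 \/ psi (- t) = -1.
Proof.
  intros Hr (j & Hj & E). destruct j as [|j]; [lia |].
  assert (H : orbit t j = 1 \/ orbit t j = -1).
  { rewrite <- orbit_S. apply cubP_pm1. right. destruct Hr as [-> | ->]; tauto. }
  rewrite <- orbit_0. rewrite (orbit_pm1 t j 0 H ltac:(lia)). exact H.
Qed.

(** Along an orbit ending at [1] or [-1] all fibers are simple, except over the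
    last step before the fixed point; the points [p], [q] (up to sign) are the
    possible places for that step. *)
Lemma count_orbit t c n : c = 1 \/ c = -1 -> orbit t 0 = c ->
  orbit t n <> 1 -> orbit t n <> -1 -> (forall j, (j <= n)%nat -> -1 <= orbit t j <= 1) ->
  count (fun k => preim p q c n k = orbit t n) (3 ^ n) =
  (ind (exists j, (1 <= j <= n)%nat /\ (orbit t j ^ 2 = p ^ 2)%R) + ind (exists j, (1 <= j <= n)%nat /\ (orbit t j ^ 2 = q ^ 2)%R))%nat.
Proof.
  intros Hc H0.
  assert (Hcr : -1 <= c <= 1) by (destruct Hc; lra).
  induction n as [|n IH]; intros N1 N2 Hr.
  - exfalso. destruct Hc; lra.
  - rewrite count_preim_S, orbit_S by trivial. rewrite fiber_mult_eq by (rewrite orbit_S; apply Hr; lia).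
    assert (HS := orbit_S t n). assert (K := cubP_pm1 (orbit t (S n))). rewrite HS in K.
    destruct (classic (orbit t n = 1 \/ orbit t n = -1)) as [H | H].
    + assert (Hall := fun j Hj => orbit_pm1 t n j H Hj).
      assert (Hn : orbit t n = c) by (rewrite <- (Hall 0%nat ltac:(lia)); trivial).
      assert (Hcnt : forall m, (m <= n)%nat -> count (fun k => preim p q c m k = c) (3 ^ m) = 1%nat).
      { induction m as [|m IHm]; intros Hm.
        - simpl. now apply ind_true.
        - rewrite count_preim_S by trivial.
          assert (Ec : cubP p q c = c).
          { rewrite <- (Hall (S m)) in Hn by lia. rewrite <- Hn at 1. rewrite orbit_S. rewrite (Hall m) by lia. rewrite <- (Hall (S m)) by lia. trivial. }
          rewrite Ec, IHm by lia. rewrite fiber_mult_eq by (rewrite Ec; trivial).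
          destruct excluded_middle_informative as [[A B] | _]; [| lia]. exfalso.
          assert (c ^ 2 = 1) by (destruct Hc as [-> | ->]; ring). rewrite H1 in B. nra. }
      rewrite Hn, Hcnt by lia.
      assert (S1 : orbit t (S n) ^ 2 = p ^ 2 \/ orbit t (S n) ^ 2 = q ^ 2) by tauto.
      assert (Hsq : forall j, (j <= n)%nat -> orbit t j ^ 2 = 1).
      { intros j Hj. rewrite Hall, Hn by trivial. destruct Hc as [-> | ->]; ring. }
      assert (X : forall r, 0 < r < 1 -> ind (exists j, (1 <= j <= S n)%nat /\ orbit t j ^ 2 = r ^ 2) = ind (orbit t (S n) ^ 2 = r ^ 2)).
      { intros r Hr0. apply ind_iff. split.
        - intros (j & Hj & E). destruct (Nat.eq_dec j (S n)) as [-> | Nj]; trivial.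
          rewrite Hsq in E by lia. exfalso. nra.
        - intros E. exists (S n). split; [lia | trivial]. }
      rewrite !X by lra.
      assert (Hpq : p ^ 2 = q ^ 2 -> p = q) by (intros; nra).
      clear Hall Hsq X Hcnt K IH Hr.
      destruct excluded_middle_informative as [[A B] | NA].
      * rewrite !ind_true; trivial. now rewrite <- A.
      * destruct S1 as [S1 | S1].
        -- rewrite ind_true, ind_false; trivial. intros S2. apply NA. split; [apply Hpq; lra | trivial].
        -- rewrite ind_false, ind_true; trivial. intros S2. apply NA. split; [apply Hpq; lra | trivial].
    + rewrite IH; [| tauto | tauto | intros; apply Hr; lia].
      assert (Nb : orbit t (S n) ^ 2 <> p ^ 2 /\ orbit t (S n) ^ 2 <> q ^ 2) by tauto.
      destruct excluded_middle_informative as [[A B] | _]; [tauto |].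
      rewrite Nat.mul_1_r. f_equal; apply ind_iff; split; intros (j & Hj & E).
      * exists j. split; [lia | trivial].
      * exists j. split; [| trivial]. destruct (Nat.eq_dec j (S n)) as [-> | Nj]; [tauto | lia].
      * exists j. split; [lia | trivial].
      * exists j. split; [| trivial]. destruct (Nat.eq_dec j (S n)) as [-> | Nj]; [tauto | lia].
Qed.

Lemma preim_shift c n m k : (k < 3 ^ n)%nat -> preim p q c (n + m) k = preim p q (preim p q c n k) m 0.
Proof.
  intros Hk. induction m; [now rewrite Nat.add_0_r |].
  rewrite Nat.add_succ_r, preim_S, IHm by (apply lt_pow3_mono with n; trivial; lia).
  rewrite preim_S; trivial. apply pow3_pos.
Qed.

(** From level [n] on only [branch 0] is used. *)
Lemma iota_shift c n k : admissible c k -> (k < 3 ^ n)%nat ->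
  iota p q c k = iota p q (preim p q c n k) 0 / lam ^ n.
Proof.
  intros H Hk. assert (Hr : admissible (preim p q c n k) 0).
  { left. split; [apply preim_range; trivial; now apply (admissible_range c k) | now apply admissible_lt]. }
  assert (HL := lam_pow_pos p q Hp Hq).
  assert (L1 := iota_lim p q Hp Hq c k H). apply (is_lim_seq_incr_n _ n) in L1.
  assert (L2 := iota_lim p q Hp Hq _ _ Hr).
  apply (is_lim_seq_scal_r _ (/ lam ^ n)) in L2. simpl in L2.
  apply is_lim_seq_unique in L1. apply is_lim_seq_unique in L2.
  assert (E : Lim_seq (fun m => recip p q c (m + n) k) = Lim_seq (fun m => recip p q (preim p q c n k) m 0 * / lam ^ n)).
  { apply Lim_seq_ext. intros m. unfold recip. rewrite Nat.add_comm, preim_shift, pow_add by trivial.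
    assert (Hlt := admissible_lt p q Hp Hq (preim p q c n k) 0 m Hr (pow3_pos m)).
    assert (HLn := HL n). assert (HLm := HL m). field. repeat split; lra. }
  rewrite E, L2 in L1. inversion L1. reflexivity.
Qed.

(** By [iota_shift] both conditions concern the first zero over the point
    [preim c n k], the only one of its zeros that can be less than 1. *)
Lemma zero_iff_preim c n k t : admissible c k -> (k < 3 ^ n)%nat -> t / lam ^ n < 1 ->
  t * iota p q c k = 1 <-> preim p q c n k = orbit t n.
Proof.
  intros H Hk Ht. rewrite (iota_shift c n k) by trivial.
  assert (HL := lam_pow_pos p q Hp Hq n).
  set (r := preim p q c n k). assert (Hr : -1 <= r < 1).
  { split; [apply preim_range; trivial; now apply (admissible_range c k) | now apply admissible_lt]. }
  replace (t * (iota p q r 0 / lam ^ n)) with (t / lam ^ n * iota p q r 0) by (field; lra).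
  unfold orbit. split.
  - intros E. symmetry. apply (psiR_zeros p q Phi Hp Hq Hfun Hzero Hder); trivial. now exists 0%nat.
  - intros E. symmetry in E. apply (psiR_zeros p q Phi Hp Hq Hfun Hzero Hder) in E; trivial.
    destruct E as [[|j] E]; trivial. exfalso.
    assert (Hs := iota_sq_small p q Hp Hq r ltac:(lra) j).
    assert (B := inv_sq_le_1 j). cbv beta in Hs.
    set (y := iota p q _ _) in *. set (x := t / lam ^ n) in *. clearbody x y.
    assert (y <> 0) by (intros ->; lra). assert (0 < y) by lra. assert (x * y < y) by nra. lra.
Qed.

Lemma orbit_neq_1 t n : t <> 0 -> t / lam ^ n < 1 -> orbit t n <> 1.
Proof.
  intros Ht Hs E. assert (HL := lam_pow_pos p q Hp Hq n). unfold orbit in E.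
  apply (psiR_zeros_1 p q Phi Hp Hq Hfun Hzero Hder) in E.
  - destruct E as [j E]. assert (H := iota_sq_small p q Hp Hq 1 ltac:(lra) j).
    assert (B := inv_sq_le_1 j). cbv beta in H.
    set (y := iota p q _ _) in *. set (x := t / lam ^ n) in *. clearbody x y.
    assert (y <> 0) by (intros ->; lra). assert (0 < y) by lra. assert (x * y < y) by nra. lra.
  - unfold Rdiv. apply Rmult_integral_contrapositive_currified; trivial. apply Rinv_neq_0_compat. lra.
Qed.

Lemma orbit_to_1 t : is_lim_seq (orbit t) 1.
Proof.
  apply is_lim_seq_spec. intros eps. destruct (is_Cderive_continuous _ _ _ Hder (2 * eps)) as (d & Hd & H).
  { destruct eps; simpl; lra. }
  destruct (div_lam_pow_small p q Hp Hq (RtoC (- t)) d Hd) as [N HN].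
  exists N. intros n Hn. specialize (HN n Hn). unfold orbit, psiR.
  assert (HL := lam_pow_pos p q Hp Hq n).
  rewrite <- RtoC_pow, <- RtoC_div in HN by lra.
  replace (- t / lam ^ n) with (- (t / lam ^ n)) in HN by (field; lra).
  specialize (H (RtoC (- (t / lam ^ n)))). rewrite Hzero in H.
  replace (RtoC (- (t / lam ^ n)) - 0)%C with (RtoC (- (t / lam ^ n))) in H by ring.
  specialize (H HN). replace (Phi (RtoC (- (t / lam ^ n))) - 0)%C with (Phi (RtoC (- (t / lam ^ n)))) in H by ring.
  replace (1 + Re (Phi (RtoC (- (t / lam ^ n)))) / 2 - 1) with (/ 2 * Re (Phi (RtoC (- (t / lam ^ n))))) by field.
  rewrite Rabs_mult, (Rabs_pos_eq (/ 2)) by lra.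
  generalize (re_le_Cmod (Phi (RtoC (- (t / lam ^ n))))). simpl. simpl in H. lra.
Qed.

(** Beyond some level the orbit stays close to 1; up to that level the zeros equal to
    [t] are the preimages of 1 or -1 equal to the point of the orbit, and these are
    counted by [count_orbit]. *)
Lemma zero_count t l0 l4 : t <> 0 -> NoDup l0 -> NoDup l4 ->
  (forall k, In k l0 <-> t * iota p q 1 (S k) = 1) ->
  (forall k, In k l4 <-> t * iota p q (-1) k = 1) ->
  (length l0 + length l4 = ind (hits t p) + ind (hits t q))%nat.
Proof.
  intros Ht N0 N4 H0 H4.
  assert (Z0 := psiR_zeros_1 p q Phi Hp Hq Hfun Hzero Hder t Ht).
  assert (Z4 := psiR_zeros p q Phi Hp Hq Hfun Hzero Hder (-1) t ltac:(lra)).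
  assert (Hs0 := iota_sq_small p q Hp Hq 1 ltac:(lra)). assert (Hs4 := iota_m1_sq_small p q Hp Hq).
  assert (nil0 : psi (- t) <> 1 -> length l0 = 0%nat).
  { intros N. destruct l0 as [|k l0]; trivial. exfalso. apply N, Z0. exists k. apply H0. now left. }
  assert (nil4 : psi (- t) <> -1 -> length l4 = 0%nat).
  { intros N. destruct l4 as [|k l4]; trivial. exfalso. apply N, Z4. exists k. apply H4. now left. }
  destruct (classic (psi (- t) = 1 \/ psi (- t) = -1)) as [Hpm | Hpm].
  2:{ rewrite nil0, nil4, !ind_false; trivial; try tauto; intros Hh; apply Hpm; eapply hits_pm1; try exact Hh; tauto. }
  destruct (INR_unbounded (Rabs t + 1)) as [K HK].
  (* Beyond level [n] the orbit stays above [p] and [q], and all indices of zeros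
     equal to [t] are less than [3 ^ n]. *)
  assert (Hlim := orbit_to_1 t). apply is_lim_seq_spec in Hlim.
  assert (Hd : 0 < Rmin (1 - p) (1 - q)) by (apply Rmin_pos; lra).
  destruct (Hlim (mkposreal _ Hd)) as [N1 HN1]. simpl in HN1.
  destruct (div_lam_pow_small p q Hp Hq (RtoC t) 1 ltac:(lra)) as [N2 HN2].
  set (n := (S K + N1 + N2)%nat).
  assert (Hsm : forall m, (n <= m)%nat -> t / lam ^ m < 1).
  { intros m Hm. specialize (HN2 m ltac:(unfold n in *; lia)). assert (HL := lam_pow_pos p q Hp Hq m).
    rewrite <- RtoC_pow, <- RtoC_div, Cmod_R in HN2 by lra. generalize (Rle_abs (t / lam ^ m)). lra. }
  assert (Hnear : forall m, (n <= m)%nat -> p < orbit t m /\ q < orbit t m).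
  { intros m Hm. specialize (HN1 m ltac:(unfold n in *; lia)). apply Rabs_def2 in HN1.
    generalize (Rmin_l (1 - p) (1 - q)) (Rmin_r (1 - p) (1 - q)). lra. }
  assert (HKn : (S K < 3 ^ n)%nat) by (apply lt_pow3_mono with (S K); [apply nat_lt_pow3 | unfold n; lia]).
  assert (Hh : forall r, (r = p \/ r = q) -> ind (hits t r) = ind (exists j, (1 <= j <= n)%nat /\ orbit t j ^ 2 = r ^ 2)).
  { intros r Hr. apply ind_iff. split; intros (j & Hj & E).
    - exists j. split; trivial. split; [lia |]. apply Nat.nlt_ge. intros Hlt.
      destruct (Hnear j ltac:(lia)). assert (0 < r) by (destruct Hr; lra). assert (r < orbit t j) by (destruct Hr; lra). nra.
    - exists j. split; [lia | trivial]. }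
  rewrite !Hh by tauto. assert (Hne1 := orbit_neq_1 t n Ht (Hsm n (le_n n))).
  assert (Hnem1 : orbit t n <> -1) by (generalize (Hnear n (le_n n)); lra).
  assert (Hrange : forall c, c = 1 \/ c = -1 -> (exists k, preim p q c n k = orbit t n) -> forall j, (j <= n)%nat -> -1 <= orbit t j <= 1).
  { intros c Hc [k Ek].
    assert (G : forall i, (i <= n)%nat -> exists k, orbit t (n - i) = preim p q c (n - i) k).
    { induction i as [|i IHi]; intros Hi.
      - exists k. now rewrite Nat.sub_0_r.
      - destruct (IHi ltac:(lia)) as [k' E']. replace (n - i)%nat with (S (n - S i)) in E' by lia.
        exists (k' mod 3 ^ (n - S i))%nat. rewrite <- orbit_S, E'. cbn [preim]. apply branch_root; trivial.
        apply preim_range; trivial. destruct Hc; lra. }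
    intros j Hj. destruct (G (n - j)%nat ltac:(lia)) as [k' E']. replace (n - (n - j))%nat with j in E' by lia.
    rewrite E'. apply preim_range; trivial. destruct Hc; lra. }
  assert (Hzi := fun k H => zero_index_bound (fun k => iota p q 1 (S k)) t k Hs0 H).
  assert (Hzi4 := fun k H => zero_index_bound (iota p q (-1)) t k Hs4 H).
  assert (HKb : forall k, INR k + 1 <= Rabs t + 1 -> (k < K)%nat).
  { intros k Hk. apply INR_lt. lra. }
  destruct Hpm as [E | E].
  - rewrite nil4 by lra. rewrite Nat.add_0_r.
    apply Z0 in E as E'. destruct E' as [k0 Hk0].
    assert (Had : forall k, admissible 1 (S k)) by (intros; right; split; [trivial | lia]).
    rewrite <- (count_orbit t 1 n); trivial; [| tauto | now rewrite orbit_0 |].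
    2:{ apply (Hrange 1); [tauto |]. exists (S k0). apply zero_iff_preim; trivial.
        assert (k0 < K)%nat by now apply HKb, Hzi. lia. now apply Hsm. }
    rewrite <- (length_map S l0).
    rewrite (count_ext _ (fun k => preim p q 1 n k = orbit t n /\ (k < 3 ^ n)%nat)) by tauto.
    apply count_length; [| | tauto].
    + apply FinFun.Injective_map_NoDup; trivial. intros x y. lia.
    + intros k. rewrite in_map_iff. split.
      * intros (j & <- & Hj). apply H0 in Hj. assert (j < K)%nat by now apply HKb, Hzi.
        split; [| lia]. apply zero_iff_preim; trivial; [lia | now apply Hsm].
      * intros [Hk Hlt]. destruct k as [|j]; [rewrite preim_1_0 in Hk by trivial; lra |].
        exists j. split; trivial. apply H0. apply zero_iff_preim in Hk; trivial. now apply Hsm.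
  - rewrite nil0 by lra. rewrite Nat.add_0_l.
    apply Z4 in E as E'. destruct E' as [k0 Hk0].
    assert (Had : forall k, admissible (-1) k) by (intros; left; lra).
    rewrite <- (count_orbit t (-1) n); trivial; [| tauto | now rewrite orbit_0 |].
    2:{ apply (Hrange (-1)); [tauto |]. exists k0. apply zero_iff_preim; trivial.
        assert (k0 < K)%nat by now apply HKb, Hzi4. lia. now apply Hsm. }
    rewrite (count_ext _ (fun k => preim p q (-1) n k = orbit t n /\ (k < 3 ^ n)%nat)) by tauto.
    apply count_length; [trivial | | tauto].
    intros k. rewrite H4. split.
    + intros Hj. assert (k < K)%nat by now apply HKb, Hzi4.
      split; [| lia]. apply zero_iff_preim; trivial; [lia | now apply Hsm].
    + intros [Hk Hlt]. apply zero_iff_preim in Hk; trivial. now apply Hsm.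
Qed.

End Multiplicity.

(** * Integrals of complex-valued functions over half-lines and the line *)

Definition ccont (f : R -> C) : Prop :=
  forall x : R, continuous (fun t : R => Re (f t)) x /\ continuous (fun t : R => Im (f t)) x.

Definition CInt (f : R -> C) (a b : R) : C :=
  (RInt (fun t => Re (f t)) a b, RInt (fun t => Im (f t)) a b).

Lemma ccont_RtoC (g : R -> R) : (forall x, continuous g x) -> ccont (fun t => RtoC (g t)).
Proof. intros H x. split; simpl; [apply H | apply continuous_const]. Qed.

Lemma ccont_plus f g : ccont f -> ccont g -> ccont (fun t => f t + g t)%C.
Proof.
  intros Hf Hg x. destruct (Hf x), (Hg x). split.
  - now apply (continuous_plus (fun t => Re (f t)) (fun t => Re (g t))).
  - now apply (continuous_plus (fun t => Im (f t)) (fun t => Im (g t))).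
Qed.

Lemma ccont_mult f g : ccont f -> ccont g -> ccont (fun t => f t * g t)%C.
Proof.
  intros Hf Hg x. destruct (Hf x), (Hg x). split.
  - apply (continuous_minus (fun t => Re (f t) * Re (g t)) (fun t => Im (f t) * Im (g t))).
    + now apply (continuous_mult (fun t => Re (f t)) (fun t => Re (g t))).
    + now apply (continuous_mult (fun t => Im (f t)) (fun t => Im (g t))).
  - apply (continuous_plus (fun t => Re (f t) * Im (g t)) (fun t => Im (f t) * Re (g t))).
    + now apply (continuous_mult (fun t => Re (f t)) (fun t => Im (g t))).
    + now apply (continuous_mult (fun t => Im (f t)) (fun t => Re (g t))).
Qed.

Lemma ccont_const k : ccont (fun _ => k).
Proof. intros x. split; apply continuous_const. Qed.

Lemma ccont_minus f g : ccont f -> ccont g -> ccont (fun t => f t - g t)%C.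
Proof.
  intros Hf Hg x. destruct (Hf x), (Hg x). split.
  - now apply (continuous_minus (fun t => Re (f t)) (fun t => Re (g t))).
  - now apply (continuous_minus (fun t => Im (f t)) (fun t => Im (g t))).
Qed.

Lemma ccont_ext f g : (forall t, f t = g t) -> ccont f -> ccont g.
Proof.
  intros E H x. destruct (H x). split.
  - now apply (continuous_ext (fun t => Re (f t))); [intros; now rewrite E |].
  - now apply (continuous_ext (fun t => Im (f t))); [intros; now rewrite E |].
Qed.

Lemma ccont_comp f (g : R -> R) : ccont f -> (forall x, continuous g x) -> ccont (fun t => f (g t)).
Proof.
  intros Hf Hg x. destruct (Hf (g x)). split.
  - now apply (continuous_comp g (fun t => Re (f t))).
  - now apply (continuous_comp g (fun t => Im (f t))).
Qed.

Lemma ccont_Csum (f : nat -> R -> C) n : (forall k, ccont (f k)) -> ccont (fun t => Csum (fun k => f k t) n).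
Proof. intros H. induction n; simpl. apply ccont_const. now apply ccont_plus. Qed.

Lemma ccont_Cexp_line (s : C) : ccont (fun u : R => Cexp (s * u)).
Proof.
  intros x. destruct (is_derive_Cexp_line s x) as [H1 H2].
  split; apply (@ex_derive_continuous R_AbsRing R_NormedModule); eexists.
  - eapply is_derive_ext; [| exact H1]. intros t. cbv beta. now rewrite (Cmult_comm (RtoC t) s).
  - eapply is_derive_ext; [| exact H2]. intros t. cbv beta. now rewrite (Cmult_comm (RtoC t) s).
Qed.

Lemma continuous_affine (a b x : R) : continuous (fun t : R => a * t + b) x.
Proof. apply (@ex_derive_continuous R_AbsRing R_NormedModule). auto_derive. trivial. Qed.

Lemma ccont_Re_int f a b : ccont f -> ex_RInt (fun t => Re (f t)) a b.
Proof. intros H. apply (@ex_RInt_continuous R_CompleteNormedModule). intros; apply H. Qed.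

Lemma ccont_Im_int f a b : ccont f -> ex_RInt (fun t => Im (f t)) a b.
Proof. intros H. apply (@ex_RInt_continuous R_CompleteNormedModule). intros; apply H. Qed.

Lemma CInt_ext f g a b : (forall x, f x = g x) -> CInt f a b = CInt g a b.
Proof. intros H. unfold CInt. f_equal; apply RInt_ext; intros; now rewrite H. Qed.

Lemma CInt_plus f g a b : ccont f -> ccont g ->
  CInt (fun t => f t + g t)%C a b = (CInt f a b + CInt g a b)%C.
Proof.
  intros Hf Hg. unfold CInt, Cplus; simpl. f_equal.
  - apply (RInt_plus (V := R_CompleteNormedModule) (fun t => Re (f t)) (fun t => Re (g t))); now apply ccont_Re_int.
  - apply (RInt_plus (V := R_CompleteNormedModule) (fun t => Im (f t)) (fun t => Im (g t))); now apply ccont_Im_int.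
Qed.

Lemma CInt_scal k f a b : ccont f -> CInt (fun t => k * f t)%C a b = (k * CInt f a b)%C.
Proof.
  intros Hf.
  assert (H1 := RInt_correct (V := R_CompleteNormedModule) _ _ _ (ccont_Re_int f a b Hf)).
  assert (H2 := RInt_correct (V := R_CompleteNormedModule) _ _ _ (ccont_Im_int f a b Hf)).
  unfold CInt, Cmult; simpl. f_equal; apply is_RInt_unique.
  - apply (is_RInt_minus (V := R_NormedModule) (fun t => Re k * Re (f t)) (fun t => Im k * Im (f t)));
    now apply (is_RInt_scal (V := R_NormedModule)).
  - apply (is_RInt_plus (V := R_NormedModule) (fun t => Re k * Im (f t)) (fun t => Im k * Re (f t)));
    now apply (is_RInt_scal (V := R_NormedModule)).
Qed.

Lemma CInt_Chasles f a b c : ccont f -> (CInt f a b + CInt f b c)%C = CInt f a c.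
Proof.
  intros Hf. unfold CInt, Cplus; simpl. f_equal.
  - apply (RInt_Chasles (V := R_CompleteNormedModule)); now apply ccont_Re_int.
  - apply (RInt_Chasles (V := R_CompleteNormedModule)); now apply ccont_Im_int.
Qed.

Lemma CInt_norm f (g : R -> R) a b G : ccont f -> a <= b ->
  (forall x, a <= x <= b -> Cmod (f x) <= g x) -> is_RInt g a b G -> Cmod (CInt f a b) <= G.
Proof.
  intros Hf Hab Hg HG.
  assert (H1 := RInt_correct (V := R_CompleteNormedModule) _ _ _ (ccont_Re_int f a b Hf)).
  assert (H2 := RInt_correct (V := R_CompleteNormedModule) _ _ _ (ccont_Im_int f a b Hf)).
  assert (H : is_RInt (V := prod_NormedModule R_AbsRing R_NormedModule R_NormedModule) f a b (CInt f a b)).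
  { apply (is_RInt_fct_extend_pair (U := R_NormedModule) (V := R_NormedModule)); trivial. }
  assert (N : forall z : C, norm (V := prod_NormedModule R_AbsRing R_NormedModule R_NormedModule) z = Cmod z).
  { intros [x y]. unfold norm, Cmod; simpl. unfold prod_norm, norm; simpl. unfold abs; simpl. f_equal.
    rewrite !Rmult_1_r, <- !Rabs_mult, !Rabs_pos_eq; trivial; apply Rle_0_sqr. }
  rewrite <- N. apply (norm_RInt_le (V := prod_NormedModule R_AbsRing R_NormedModule R_NormedModule) f g a b); trivial.
  intros x Hx. rewrite N. now apply Hg.
Qed.

Lemma CInt_FTC (F f : R -> C) a b : ccont f ->
  (forall x : R, is_derive (fun t : R => Re (F t)) x (Re (f x)) /\ is_derive (fun t : R => Im (F t)) x (Im (f x))) ->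
  CInt f a b = (F b - F a)%C.
Proof.
  intros Hf HF. unfold CInt. unfold Cminus, Cplus, Copp; simpl. f_equal; apply is_RInt_unique.
  - apply (is_RInt_derive (V := R_CompleteNormedModule) (fun t => Re (F t))); intros; [apply HF | apply Hf].
  - apply (is_RInt_derive (V := R_CompleteNormedModule) (fun t => Im (F t))); intros; [apply HF | apply Hf].
Qed.

Lemma CInt_shift f w a b : ccont f -> CInt (fun u => f (u + w)) a b = CInt f (a + w) (b + w).
Proof.
  intros Hf. replace (a + w) with (1 * a + w) by ring. replace (b + w) with (1 * b + w) by ring.
  unfold CInt. f_equal; symmetry.
  - rewrite <- (RInt_comp_lin (V := R_CompleteNormedModule) (fun t => Re (f t)) 1 w a b) by now apply ccont_Re_int.
    apply (RInt_ext (V := R_CompleteNormedModule)). intros x _. unfold scal; simpl. unfold mult; simpl. rewrite !Rmult_1_l. reflexivity.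
  - rewrite <- (RInt_comp_lin (V := R_CompleteNormedModule) (fun t => Im (f t)) 1 w a b) by now apply ccont_Im_int.
    apply (RInt_ext (V := R_CompleteNormedModule)). intros x _. unfold scal; simpl. unfold mult; simpl. rewrite !Rmult_1_l. reflexivity.
Qed.

Lemma CInt_neg f a b : ccont f -> CInt (fun u => f (- u)) a b = (- CInt f (- a) (- b))%C.
Proof.
  intros Hf. replace (- a) with ((-1) * a + 0) by ring. replace (- b) with ((-1) * b + 0) by ring.
  unfold CInt, Copp; simpl. f_equal.
  - rewrite <- (RInt_comp_lin (V := R_CompleteNormedModule) (fun t => Re (f t)) (-1) 0 a b) by now apply ccont_Re_int.
    rewrite <- (RInt_opp (V := R_CompleteNormedModule)).
    + apply (RInt_ext (V := R_CompleteNormedModule)). intros x _. unfold opp, scal; simpl. unfold mult; simpl.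
      replace (-1 * x + 0) with (- x) by ring. ring.
    + apply (@ex_RInt_continuous R_CompleteNormedModule). intros.
      apply (continuous_scal_r (-1) (fun t : R => Re (f (-1 * t + 0)))).
      apply (continuous_comp (fun t : R => -1 * t + 0) (fun t => Re (f t))); [apply continuous_affine | apply Hf].
  - rewrite <- (RInt_comp_lin (V := R_CompleteNormedModule) (fun t => Im (f t)) (-1) 0 a b) by now apply ccont_Im_int.
    rewrite <- (RInt_opp (V := R_CompleteNormedModule)).
    + apply (RInt_ext (V := R_CompleteNormedModule)). intros x _. unfold opp, scal; simpl. unfold mult; simpl.
      replace (-1 * x + 0) with (- x) by ring. ring.
    + apply (@ex_RInt_continuous R_CompleteNormedModule). intros.
      apply (continuous_scal_r (-1) (fun t : R => Im (f (-1 * t + 0)))).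
      apply (continuous_comp (fun t : R => -1 * t + 0) (fun t => Im (f t))); [apply continuous_affine | apply Hf].
Qed.

Lemma is_RInt_exp_decay (K kap a b : R) : 0 < kap ->
  is_RInt (fun u => K * exp (- kap * u)) a b (K / kap * (exp (- kap * a) - exp (- kap * b))).
Proof.
  intros Hk.
  replace (K / kap * (exp (- kap * a) - exp (- kap * b)))
    with (minus (- K / kap * exp (- kap * b)) (- K / kap * exp (- kap * a)))
    by (unfold minus, plus, opp; simpl; field; lra).
  apply (is_RInt_derive (V := R_CompleteNormedModule) (fun u => - K / kap * exp (- kap * u))); intros x _.
  - auto_derive; trivial. field. lra.
  - apply (@ex_derive_continuous R_AbsRing R_NormedModule). auto_derive. trivial.
Qed.

Lemma CInt_decay f (K kap a b : R) : ccont f -> 0 < kap -> 0 <= K -> a <= b ->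
  (forall u, a <= u <= b -> Cmod (f u) <= K * exp (- kap * u)) ->
  Cmod (CInt f a b) <= K / kap * exp (- kap * a).
Proof.
  intros Hf Hk HK Hab H.
  eapply Rle_trans; [apply (CInt_norm f _ a b _ Hf Hab H), is_RInt_exp_decay; trivial |].
  apply Rmult_le_compat_l.
  - apply Rmult_le_pos; trivial. left. now apply Rinv_0_lt_compat.
  - generalize (exp_pos (- kap * b)). lra.
Qed.

(** ** Half-lines *)

Definition half_line_integral (f : R -> C) (l : C) : Prop :=
  forall eps, 0 < eps -> exists N : R, forall x, N <= x -> Cmod (CInt f 0 x - l) < eps.

Lemma half_line_integral_Clim f l : half_line_integral f l -> Clim (fun n => CInt f 0 (INR n)) l.
Proof.
  intros H eps Heps. destruct (H eps Heps) as [N HN]. destruct (INR_unbounded N) as [m Hm].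
  exists m. intros n Hn. apply HN. apply le_INR in Hn. lra.
Qed.

Lemma half_line_integral_unique f l l' : half_line_integral f l -> half_line_integral f l' -> l = l'.
Proof. intros H H'. eapply Clim_unique; apply half_line_integral_Clim; eassumption. Qed.

Lemma half_line_integral_ext f g l : (forall x, f x = g x) -> half_line_integral f l -> half_line_integral g l.
Proof.
  intros E H eps Heps. destruct (H eps Heps) as [N HN]. exists N. intros x Hx.
  rewrite <- (CInt_ext f g 0 x E). now apply HN.
Qed.

Lemma half_line_integral_plus f g l l' : ccont f -> ccont g -> half_line_integral f l -> half_line_integral g l' -> half_line_integral (fun t => f t + g t)%C (l + l').
Proof.
  intros Cf Cg H H' eps Heps. destruct (H (eps / 2)) as [N HN]; [lra |].
  destruct (H' (eps / 2)) as [N' HN']; [lra |]. exists (Rmax N N'). intros x Hx.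
  assert (N <= x /\ N' <= x) by (generalize (Rmax_l N N') (Rmax_r N N'); lra).
  rewrite CInt_plus by trivial.
  replace (CInt f 0 x + CInt g 0 x - (l + l'))%C with ((CInt f 0 x - l) + (CInt g 0 x - l'))%C by ring.
  eapply Rle_lt_trans; [apply Cmod_triangle |].
  specialize (HN x ltac:(tauto)). specialize (HN' x ltac:(tauto)). lra.
Qed.

Lemma half_line_integral_scal k f l : ccont f -> half_line_integral f l -> half_line_integral (fun t => k * f t)%C (k * l).
Proof.
  intros Cf H eps Heps. assert (Hk := Cmod_ge_0 k).
  destruct (H (eps / (Cmod k + 1))) as [N HN]; [apply Rdiv_lt_0_compat; lra |].
  exists N. intros x Hx. rewrite CInt_scal by trivial.
  replace (k * CInt f 0 x - k * l)%C with (k * (CInt f 0 x - l))%C by ring.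
  rewrite Cmod_mult. specialize (HN x Hx). apply (Rlt_div_r _ eps) in HN; [| lra].
  generalize (Cmod_ge_0 (CInt f 0 x - l)). nra.
Qed.

Lemma exp_decay_small (A kap eps : R) : 0 < kap -> 0 < eps -> exists N, 0 <= N /\ forall x, N <= x -> A * exp (- kap * x) < eps.
Proof.
  intros Hk He. assert (HA := Rabs_pos A).
  exists ((Rabs A / eps) / kap). split.
  - unfold Rdiv. repeat apply Rmult_le_pos; trivial; left; now apply Rinv_0_lt_compat.
  - intros x Hx. apply (Rle_div_l (Rabs A / eps)) in Hx; trivial.
    assert (Hexp := exp_ineq1_le (x * kap)).
    replace (- kap * x) with (- (x * kap)) by ring. rewrite exp_Ropp.
    assert (0 < exp (x * kap)) by apply exp_pos.
    apply Rle_lt_trans with (Rabs A * / exp (x * kap)).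
    { apply Rmult_le_compat_r; [left; now apply Rinv_0_lt_compat | apply Rle_abs]. }
    apply (Rlt_div_l (Rabs A) eps); trivial.
    apply (Rle_div_l (Rabs A)) in Hx; trivial. nra.
Qed.

Lemma half_line_integral_exists f (K kap : R) : ccont f -> 0 < kap -> 0 <= K ->
  (forall u, 0 <= u -> Cmod (f u) <= K * exp (- kap * u)) ->
  exists l, half_line_integral f l /\ Cmod l <= K / kap.
Proof.
  intros Cf Hk HK H.
  assert (G : forall a b, 0 <= a <= b -> Cmod (CInt f 0 b - CInt f 0 a) <= K / kap * exp (- kap * a)).
  { intros a b Hab. rewrite <- (CInt_Chasles f 0 a b Cf).
    replace (CInt f 0 a + CInt f a b - CInt f 0 a)%C with (CInt f a b) by ring.
    apply CInt_decay; trivial; [lra |]. intros; apply H; lra. }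
  destruct (Clim_cauchy (fun n => CInt f 0 (INR n))) as [l Hl].
  { intros eps Heps. destruct (exp_decay_small (K / kap) kap (eps / 2)) as (N & HN0 & HN); [trivial | lra |].
    destruct (INR_unbounded N) as [m Hm]. exists m.
    assert (G' : forall n, (m <= n)%nat -> Cmod (CInt f 0 (INR n) - CInt f 0 (INR m)) < eps / 2).
    { intros n Hn. apply le_INR in Hn. eapply Rle_lt_trans; [apply G; lra |]. apply HN. lra. }
    intros n n' Hn Hn'. assert (G1 := G' n Hn). assert (G2 := G' n' Hn').
    replace (CInt f 0 (INR n) - CInt f 0 (INR n'))%C
      with ((CInt f 0 (INR n) - CInt f 0 (INR m)) + - (CInt f 0 (INR n') - CInt f 0 (INR m)))%C by ring.
    eapply Rle_lt_trans; [apply Cmod_triangle |]. rewrite Cmod_opp. lra. }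
  exists l. split.
  - intros eps Heps. destruct (exp_decay_small (K / kap) kap (eps / 2)) as (N & HN0 & HN); [trivial | lra |].
    exists N. intros x Hx. destruct (INR_unbounded x) as [m Hm].
    assert (B : Cmod (l - CInt f 0 x) <= eps / 2); [| rewrite <- Cmod_opp; replace (- (CInt f 0 x - l))%C with (l - CInt f 0 x)%C by ring; lra].
    apply (Clim_le_dist _ _ _ _ m Hl). intros n Hn. apply le_INR in Hn.
    left. eapply Rle_lt_trans; [apply G; lra |]. now apply HN.
  - apply (Clim_le _ _ _ 0 Hl). intros n _. assert (HI := pos_INR n).
    replace (K / kap) with (K / kap * exp (- kap * 0)) by (rewrite Rmult_0_r, exp_0; ring).
    apply CInt_decay; trivial. intros; apply H; lra.
Qed.

Lemma half_line_integral_bound f l (K kap : R) : ccont f -> 0 < kap -> 0 <= K ->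
  (forall u, 0 <= u -> Cmod (f u) <= K * exp (- kap * u)) -> half_line_integral f l -> Cmod l <= K / kap.
Proof.
  intros Cf Hk HK H Hl. destruct (half_line_integral_exists f K kap Cf Hk HK H) as (l' & H1 & H2).
  now rewrite (half_line_integral_unique f l l' Hl H1).
Qed.

Lemma half_line_integral_zero : half_line_integral (fun _ => RtoC 0) (RtoC 0).
Proof.
  intros eps Heps. exists 0. intros x _. unfold CInt. simpl. rewrite !(RInt_const (V := R_CompleteNormedModule)).
  unfold scal; simpl. unfold mult; simpl. rewrite Rmult_0_r.
  replace ((0, 0) - 0)%C with (RtoC 0) by (unfold RtoC, Cminus, Cplus, Copp; simpl; f_equal; ring).
  now rewrite Cmod_0.
Qed.

Lemma half_line_integral_Csum (f : nat -> R -> C) (l : nat -> C) n : (forall k, ccont (f k)) -> (forall k, half_line_integral (f k) (l k)) ->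
  half_line_integral (fun t => Csum (fun k => f k t) n) (Csum l n).
Proof.
  intros Cf H. induction n; simpl; [apply half_line_integral_zero |].
  apply half_line_integral_plus; trivial. now apply ccont_Csum.
Qed.

Lemma half_line_integral_FTC (F f : R -> C) (K kap : R) : ccont f -> 0 < kap ->
  (forall x : R, is_derive (fun t : R => Re (F t)) x (Re (f x)) /\ is_derive (fun t : R => Im (F t)) x (Im (f x))) ->
  (forall u, 0 <= u -> Cmod (F u) <= K * exp (- kap * u)) -> half_line_integral f (- F 0).
Proof.
  intros Cf Hk HF HK eps Heps. destruct (exp_decay_small K kap eps Hk Heps) as (N & HN0 & HN).
  exists N. intros x Hx. rewrite (CInt_FTC F f 0 x Cf HF).
  replace (F x - F 0 - - F 0)%C with (F x) by ring.
  eapply Rle_lt_trans; [apply HK; lra | now apply HN].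
Qed.

Lemma Cmod_Cexp_line (s : C) (u : R) : Cmod (Cexp (s * u)) = exp (Re s * u).
Proof. rewrite Cmod_Cexp. f_equal. unfold Re, Cmult, RtoC; simpl. ring. Qed.

Lemma half_line_integral_Cexp (s : C) : 0 < Re s -> half_line_integral (fun u => Cexp (- s * u)) (/ s).
Proof.
  intros Hs. assert (Ns : s <> RtoC 0) by (intros ->; simpl in Hs; lra).
  replace (/ s)%C with (- (- / s * Cexp (- s * 0)))%C.
  2:{ replace (- s * 0)%C with (RtoC 0) by ring. rewrite Cexp_0. ring. }
  apply (half_line_integral_FTC (fun u => - / s * Cexp (- s * u))%C _ (Cmod (/ s)) (Re s)); trivial.
  - apply ccont_Cexp_line.
  - intros x. destruct (is_derive_Cexp_line (- s) x) as [H1 H2].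
    assert (E : forall z : C, z = (- / s * (- s * z))%C) by (intros; field; trivial).
    rewrite (E (Cexp (- s * x))). set (k := (- / s)%C). split.
    + apply (is_derive_ext (fun t : R => Re k * Re (Cexp (t * - s)) - Im k * Im (Cexp (t * - s)))).
      { intros t. rewrite (Cmult_comm (- s) (RtoC t)). reflexivity. }
      rewrite (Cmult_comm (- s) (RtoC x)).
      apply (is_derive_minus (V := R_NormedModule) (fun t : R => Re k * Re (Cexp (t * - s)))); now apply is_derive_scal.
    + apply (is_derive_ext (fun t : R => Re k * Im (Cexp (t * - s)) + Im k * Re (Cexp (t * - s)))).
      { intros t. rewrite (Cmult_comm (- s) (RtoC t)). reflexivity. }
      rewrite (Cmult_comm (- s) (RtoC x)).
      apply (is_derive_plus (V := R_NormedModule) (fun t : R => Re k * Im (Cexp (t * - s)))); now apply is_derive_scal.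
  - intros u _. rewrite Cmod_mult, Cmod_Cexp_line, Cmod_opp. apply Req_le. do 2 f_equal.
Qed.

Lemma exp_times_bound (eta u : R) : 0 < eta -> 0 <= u -> u <= / eta * exp (eta * u).
Proof.
  intros He Hu. assert (H := exp_ineq1_le (eta * u)).
  apply Rmult_le_reg_l with eta; trivial. rewrite <- Rmult_assoc, Rinv_r by lra. lra.
Qed.

Lemma half_line_integral_u_Cexp (s : C) : 0 < Re s -> half_line_integral (fun u => RtoC u * Cexp (- s * u))%C (/ s ^ 2).
Proof.
  intros Hs. assert (Ns : s <> RtoC 0) by (intros ->; simpl in Hs; lra).
  set (F := fun u : R => ((- / s * RtoC u - / s ^ 2) * Cexp (- s * u))%C).
  replace (/ s ^ 2)%C with (- F 0)%C.
  2:{ unfold F. replace (- s * 0)%C with (RtoC 0) by ring. rewrite Cexp_0. ring. }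
  apply (half_line_integral_FTC F _ (Cmod (/ s) * / (Re s / 2) + Cmod (/ s ^ 2)) (Re s / 2)).
  - apply ccont_mult; [apply ccont_RtoC; intros; apply continuous_id | apply ccont_Cexp_line].
  - lra.
  - intros x. destruct (is_derive_Cexp_line (- s) x) as [H1 H2].
    set (k := (- / s)%C). set (k2 := (/ s ^ 2)%C) in *.
    assert (E : (x * Cexp (- s * x))%C = (k * Cexp (x * - s) + (k * x - k2) * (- s * Cexp (x * - s)))%C).
    { unfold k, k2. rewrite (Cmult_comm (- s) (RtoC x)). field. trivial. }
    clearbody k2.
    rewrite E. unfold F. fold k. clearbody k. split.
    + apply (is_derive_ext (fun t : R => (Re k * t - Re k2) * Re (Cexp (t * - s)) - (Im k * t - Im k2) * Im (Cexp (t * - s)))).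
      { intros t. rewrite (Cmult_comm (- s) (RtoC t)). destruct k, k2, (Cexp (t * - s)).
        unfold Re, Im, Cmult, Cminus, Cplus, Copp, RtoC; simpl. ring. }
      evar (d : R). replace (Re (k * Cexp (x * - s) + (k * x - k2) * (- s * Cexp (x * - s)))) with d; unfold d.
      apply (is_derive_minus (V := R_NormedModule)); apply (is_derive_mult (K := R_AbsRing)).
      1, 4: auto_derive; [trivial | reflexivity].
      1, 3: eassumption. 1, 2: intros; apply Rmult_comm.
      destruct k, k2, (- s * Cexp (x * - s))%C, (Cexp (x * - s)).
      unfold Re, Im, Cmult, Cminus, Cplus, Copp, RtoC, minus, plus, opp, mult; simpl. ring.
    + apply (is_derive_ext (fun t : R => (Re k * t - Re k2) * Im (Cexp (t * - s)) + (Im k * t - Im k2) * Re (Cexp (t * - s)))).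
      { intros t. rewrite (Cmult_comm (- s) (RtoC t)). destruct k, k2, (Cexp (t * - s)).
        unfold Re, Im, Cmult, Cminus, Cplus, Copp, RtoC; simpl. ring. }
      evar (d : R). replace (Im (k * Cexp (x * - s) + (k * x - k2) * (- s * Cexp (x * - s)))) with d; unfold d.
      apply (is_derive_plus (V := R_NormedModule)); apply (is_derive_mult (K := R_AbsRing)).
      1, 4: auto_derive; [trivial | reflexivity].
      1, 3: eassumption. 1, 2: intros; apply Rmult_comm.
      destruct k, k2, (- s * Cexp (x * - s))%C, (Cexp (x * - s)).
      unfold Re, Im, Cmult, Cminus, Cplus, Copp, RtoC, minus, plus, opp, mult; simpl. ring.
  - intros u Hu. unfold F. rewrite Cmod_mult, Cmod_Cexp_line.
    assert (E : Re (- s) * u = - (Re s / 2) * u + - (Re s / 2 * u)) by (destruct s; simpl; field).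
    rewrite E, exp_plus, exp_Ropp.
    assert (B := exp_times_bound (Re s / 2) u ltac:(lra) Hu).
    assert (HX : 1 <= exp (Re s / 2 * u)) by (rewrite <- exp_0; apply exp_le_mono; nra).
    set (X := exp (Re s / 2 * u)) in *. set (Y := exp (- (Re s / 2) * u)).
    assert (HY : 0 < Y) by apply exp_pos.
    assert (HC : Cmod (- / s * RtoC u - / s ^ 2) <= (Cmod (/ s) * / (Re s / 2) + Cmod (/ s ^ 2)) * X).
    { eapply Rle_trans; [apply Cmod_triangle |]. rewrite Cmod_opp, Cmod_mult, Cmod_opp, Cmod_R, Rabs_pos_eq by trivial.
      generalize (Cmod_ge_0 (/ s)) (Cmod_ge_0 (/ s ^ 2)). intros. nra. }
    replace (Cmod (- / s * RtoC u - / s ^ 2) * (Y * / X)) with (Cmod (- / s * RtoC u - / s ^ 2) * / X * Y) by ring.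
    apply Rmult_le_compat_r; [lra |]. apply (Rle_div_l _ _ X); lra.
Qed.

(** ** The whole line *)

(** Both halves are required to converge separately. *)
Definition line_integral (f : R -> C) (l : C) : Prop :=
  exists l1 l2, half_line_integral f l1 /\ half_line_integral (fun v => f (- v)) l2 /\ l = (l1 + l2)%C.

Lemma line_integral_unique f l l' : line_integral f l -> line_integral f l' -> l = l'.
Proof.
  intros (l1 & l2 & H1 & H2 & ->) (m1 & m2 & G1 & G2 & ->).
  now rewrite (half_line_integral_unique _ _ _ H1 G1), (half_line_integral_unique _ _ _ H2 G2).
Qed.

Lemma line_integral_ext f g l : (forall x, f x = g x) -> line_integral f l -> line_integral g l.
Proof.
  intros E (l1 & l2 & H1 & H2 & ->). exists l1, l2. split; [now apply (half_line_integral_ext f) | split; [| trivial]].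
  apply (half_line_integral_ext (fun v => f (- v))); trivial.
Qed.

Lemma ccont_opp f : ccont f -> ccont (fun v => f (- v)).
Proof.
  intros H. apply (ccont_ext (fun v => f (-1 * v + 0))).
  - intros t. f_equal. ring.
  - apply ccont_comp; trivial. intros; apply continuous_affine.
Qed.

Lemma ccont_shift f w : ccont f -> ccont (fun v => f (v + w)).
Proof.
  intros H. apply (ccont_ext (fun v => f (1 * v + w))).
  - intros t. f_equal. ring.
  - apply ccont_comp; trivial. intros; apply continuous_affine.
Qed.

Lemma line_integral_plus f g l l' : ccont f -> ccont g -> line_integral f l -> line_integral g l' -> line_integral (fun t => f t + g t)%C (l + l').
Proof.
  intros Cf Cg (l1 & l2 & H1 & H2 & ->) (m1 & m2 & G1 & G2 & ->).
  exists (l1 + m1)%C, (l2 + m2)%C. split; [| split; [| ring]].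
  - now apply half_line_integral_plus.
  - apply half_line_integral_plus; trivial; now apply ccont_opp.
Qed.

Lemma line_integral_scal k f l : ccont f -> line_integral f l -> line_integral (fun t => k * f t)%C (k * l).
Proof.
  intros Cf (l1 & l2 & H1 & H2 & ->). exists (k * l1)%C, (k * l2)%C. split; [| split; [| ring]].
  - now apply half_line_integral_scal.
  - apply (half_line_integral_scal k (fun v => f (- v))); trivial; now apply ccont_opp.
Qed.

Lemma line_integral_Csum (f : nat -> R -> C) (l : nat -> C) n : (forall k, ccont (f k)) -> (forall k, line_integral (f k) (l k)) ->
  line_integral (fun t => Csum (fun k => f k t) n) (Csum l n).
Proof.
  intros Cf H. induction n; simpl.
  - exists (RtoC 0), (RtoC 0). split; [apply half_line_integral_zero | split; [apply half_line_integral_zero | ring]].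
  - apply line_integral_plus; trivial. now apply ccont_Csum.
Qed.

Lemma line_integral_shift f w l : ccont f -> line_integral f l -> line_integral (fun u => f (u + w)) l.
Proof.
  intros Cf (l1 & l2 & H1 & H2 & ->).
  exists (l1 - CInt f 0 w)%C, (l2 + CInt f 0 w)%C. split; [| split; [| ring]].
  - intros eps Heps. destruct (H1 eps Heps) as [N HN]. exists (N - w). intros x Hx.
    rewrite CInt_shift by trivial. rewrite Rplus_0_l. specialize (HN (x + w) ltac:(lra)).
    rewrite <- (CInt_Chasles f 0 w (x + w) Cf) in HN.
    replace (CInt f w (x + w) - (l1 - CInt f 0 w))%C with (CInt f 0 w + CInt f w (x + w) - l1)%C by ring. exact HN.
  - intros eps Heps. destruct (H2 eps Heps) as [N HN]. exists (N + w). intros x Hx.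
    specialize (HN (x - w) ltac:(lra)).
    assert (E : CInt (fun v => f (- v + w)) 0 x = (CInt (fun v => f (- v)%R) 0 (x - w)%R + CInt f 0 w)%C).
    { rewrite (CInt_neg (fun u => f (u + w)) 0 x) by now apply ccont_shift.
      rewrite (CInt_neg f) by trivial. rewrite CInt_shift by trivial.
      replace (- 0 + w) with w by ring. replace (- 0) with 0 by ring. replace (- (x - w)) with (- x + w) by ring.
      rewrite <- (CInt_Chasles f 0 w (- x + w) Cf). ring. }
    rewrite E. replace (CInt (fun v => f (- v)%R) 0 (x - w)%R + CInt f 0 w - (l2 + CInt f 0 w))%C
      with (CInt (fun v => f (- v)%R) 0 (x - w)%R - l2)%C by ring. exact HN.
Qed.

(** * The Mellin transform of [ln (1 + x)] *)

Definition Ccos (z : C) : C := ((Cexp (Ci * z) + Cexp (- Ci * z)) / 2)%C.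
Definition Csin (z : C) : C := ((Cexp (Ci * z) - Cexp (- Ci * z)) / (2 * Ci))%C.

Lemma Ci_neq_0 : Ci <> RtoC 0.
Proof. intros E. apply (f_equal Im) in E. simpl in E. lra. Qed.

Lemma two_neq_0 : RtoC 2 <> RtoC 0.
Proof. intros E. apply RtoC_inj in E. lra. Qed.

Ltac cfield := field; repeat split; auto using Ci_neq_0, two_neq_0.

Lemma Cexp_pi_mult k : Cexp (Ci * (PI * INR k)) = RtoC ((-1) ^ k) /\ Cexp (- Ci * (PI * INR k)) = RtoC ((-1) ^ k).
Proof.
  assert (H : forall k, cos (PI * INR k) = (-1) ^ k /\ sin (PI * INR k) = 0).
  { induction k0 as [|j [IH1 IH2]].
    - simpl. rewrite Rmult_0_r, cos_0, sin_0. split; trivial.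
    - rewrite S_INR. replace (PI * (INR j + 1)) with (PI * INR j + PI) by ring.
      rewrite neg_cos, neg_sin, IH1, IH2. simpl. split; ring. }
  destruct (H k) as [H1 H2]. rewrite <- RtoC_mult.
  assert (E : forall x : R, Cexp (Ci * x) = (cos x, sin x) /\ Cexp (- Ci * x) = (cos x, - sin x)).
  { intros x. unfold Cexp, Ci, Cmult, Copp, RtoC, Re, Im; simpl. split.
    - replace (0 * x - 1 * 0) with 0 by ring. replace (0 * 0 + 1 * x) with x by ring. rewrite exp_0. f_equal; ring.
    - replace (- 0 * x - - (1) * 0) with 0 by ring. replace (- 0 * 0 + - (1) * x) with (- x) by ring.
      rewrite exp_0, cos_neg, sin_neg. f_equal; ring. }
  destruct (E (PI * INR k)) as [-> ->]. rewrite H1, H2. split; unfold RtoC; f_equal; ring.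
Qed.

Lemma Csin_add_pi s k : Csin (PI * (s + INR k)) = (RtoC ((-1) ^ k) * Csin (PI * s))%C /\
  Csin (PI * (s - INR k)) = (RtoC ((-1) ^ k) * Csin (PI * s))%C.
Proof.
  destruct (Cexp_pi_mult k) as [E1 E2]. unfold Csin. split.
  - replace (Ci * (PI * (s + INR k)))%C with (Ci * (PI * s) + Ci * (PI * INR k))%C by ring.
    replace (- Ci * (PI * (s + INR k)))%C with (- Ci * (PI * s) + - Ci * (PI * INR k))%C by ring.
    rewrite !Cexp_plus, E1, E2. cfield.
  - replace (Ci * (PI * (s - INR k)))%C with (Ci * (PI * s) + - Ci * (PI * INR k))%C by ring.
    replace (- Ci * (PI * (s - INR k)))%C with (- Ci * (PI * s) + Ci * (PI * INR k))%C by ring.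
    rewrite !Cexp_plus, E1, E2. cfield.
Qed.

Lemma is_derive_Cexp_scal (k c : C) (x : R) :
  is_derive (fun t : R => Re (k * Cexp (c * t))) x (Re (k * c * Cexp (c * x))) /\
  is_derive (fun t : R => Im (k * Cexp (c * t))) x (Im (k * c * Cexp (c * x))).
Proof.
  destruct (is_derive_Cexp_line c x) as [H1 H2].
  replace (k * c * Cexp (c * x))%C with (k * (c * Cexp (x * c)))%C by (rewrite (Cmult_comm (RtoC x) c); ring).
  split.
  - apply (is_derive_ext (fun t : R => Re k * Re (Cexp (t * c)) - Im k * Im (Cexp (t * c)))).
    { intros t. rewrite (Cmult_comm c (RtoC t)). reflexivity. }
    apply (is_derive_minus (V := R_NormedModule) (fun t : R => Re k * Re (Cexp (t * c)))); now apply is_derive_scal.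
  - apply (is_derive_ext (fun t : R => Re k * Im (Cexp (t * c)) + Im k * Re (Cexp (t * c)))).
    { intros t. rewrite (Cmult_comm c (RtoC t)). reflexivity. }
    apply (is_derive_plus (V := R_NormedModule) (fun t : R => Re k * Im (Cexp (t * c)))); now apply is_derive_scal.
Qed.

Lemma ccont_Ccos_line a : ccont (fun x : R => Ccos (a * x)).
Proof.
  apply (ccont_ext (fun x : R => (/ 2) * (Cexp ((Ci * a) * x) + Cexp ((- Ci * a) * x)))%C).
  - intros t. unfold Ccos. rewrite !Cmult_assoc. cfield.
  - apply ccont_mult; [apply ccont_const | apply ccont_plus; apply ccont_Cexp_line].
Qed.

Lemma CInt_Ccos a : a <> RtoC 0 -> CInt (fun x : R => Ccos (a * x)) 0 PI = (Csin (PI * a) / a)%C.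
Proof.
  intros Ha.
  assert (N2 := two_neq_0). assert (Ni := Ci_neq_0).
  rewrite (CInt_FTC (fun x : R => Csin (PI * 0 + x * a) / a)%C).
  - unfold Csin. replace (PI * 0 + 0 * a)%C with (RtoC 0) by ring.
    replace (PI * 0 + PI * a)%C with (PI * a)%C by ring.
    replace (Ci * 0)%C with (RtoC 0) by ring. replace (- Ci * 0)%C with (RtoC 0) by ring. rewrite Cexp_0.
    cfield.
  - apply ccont_Ccos_line.
  - intros x. set (k := (/ (2 * Ci * a))%C).
    destruct (is_derive_Cexp_scal k (Ci * a) x) as [H1 H2]. destruct (is_derive_Cexp_scal (- k) (- Ci * a) x) as [H3 H4].
    assert (E : forall t : R, (Csin (PI * 0 + t * a) / a)%C = (k * Cexp (Ci * a * t) + - k * Cexp (- Ci * a * t))%C).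
    { intros t. unfold Csin, k. replace (PI * 0 + t * a)%C with (a * t)%C by ring. rewrite !Cmult_assoc.
      field. repeat split; trivial. }
    assert (E' : Ccos (a * x) = (k * (Ci * a) * Cexp (Ci * a * x) + - k * (- Ci * a) * Cexp (- Ci * a * x))%C).
    { unfold Ccos, k. rewrite !Cmult_assoc. field. repeat split; trivial. }
    rewrite E'. split.
    + apply (is_derive_ext (fun t : R => Re (k * Cexp (Ci * a * t)) + Re (- k * Cexp (- Ci * a * t)))).
      { intros t. rewrite E. reflexivity. }
      now apply (is_derive_plus (V := R_NormedModule)).
    + apply (is_derive_ext (fun t : R => Im (k * Cexp (Ci * a * t)) + Im (- k * Cexp (- Ci * a * t)))).
      { intros t. rewrite E. reflexivity. }
      now apply (is_derive_plus (V := R_NormedModule)).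
Qed.

Lemma Ccos_prod a (k : nat) (x : R) :
  (Ccos (a * x) * RtoC (2 * cos (INR k * x)) = Ccos ((a + INR k) * x) + Ccos ((a - INR k) * x))%C.
Proof.
  assert (E : forall y : R, (RtoC (2 * cos y) = Cexp (Ci * y) + Cexp (- Ci * y))%C).
  { intros y. unfold Cexp, Ci, Cmult, Cplus, Copp, RtoC, Re, Im; simpl.
    replace (0 * y - 1 * 0) with 0 by ring. replace (0 * 0 + 1 * y) with y by ring.
    replace (- 0 * y - - (1) * 0) with 0 by ring. replace (- 0 * 0 + - (1) * y) with (- y) by ring.
    rewrite exp_0, cos_neg, sin_neg. f_equal; ring. }
  rewrite E, RtoC_mult. unfold Ccos.
  replace (Ci * ((a + INR k) * x))%C with (Ci * (a * x) + Ci * (INR k * x))%C by ring.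
  replace (- Ci * ((a + INR k) * x))%C with (- Ci * (a * x) + - Ci * (INR k * x))%C by ring.
  replace (Ci * ((a - INR k) * x))%C with (Ci * (a * x) + - Ci * (INR k * x))%C by ring.
  replace (- Ci * ((a - INR k) * x))%C with (- Ci * (a * x) + Ci * (INR k * x))%C by ring.
  rewrite !Cexp_plus. cfield.
Qed.

Definition dirichlet (m : nat) (x : R) : R := 1 + Rsum (fun k => 2 * cos (INR (S k) * x)) m.

Lemma dirichlet_telescope m x : (1 - cos x) * dirichlet m x = cos (INR m * x) - cos (INR (S m) * x).
Proof.
  unfold dirichlet. induction m.
  - simpl. rewrite Rmult_0_l, cos_0, !Rmult_1_l. ring.
  - cbn [Rsum]. rewrite <- Rplus_assoc, Rmult_plus_distr_l, IHm.
    rewrite (S_INR (S m)), (S_INR m).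
    replace ((INR m + 1 + 1) * x) with ((INR m + 1) * x + x) by ring.
    replace (INR m * x) with ((INR m + 1) * x - x) by ring.
    rewrite cos_plus, cos_minus. ring.
Qed.

(** Summing the Dirichlet kernels once more gives the Fejer kernel. *)
Lemma fejer_telescope n x : (1 - cos x) * Rsum (fun m => dirichlet m x) n = 1 - cos (INR n * x).
Proof.
  induction n.
  - simpl. rewrite Rmult_0_l, cos_0. ring.
  - cbn [Rsum]. rewrite Rmult_plus_distr_l, IHn, dirichlet_telescope. ring.
Qed.

Lemma one_minus_cos_lower x : 0 <= x <= PI -> x ^ 2 / 16 <= 1 - cos x.
Proof.
  intros Hx. assert (HPI := PI_4). destruct (Rle_dec x 2) as [H2 | H2].
  - destruct (pre_cos_bound x 0 ltac:(lra) ltac:(lra)) as [_ H].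
    unfold cos_approx, cos_term in H. simpl in H.
    assert (x * x <= 4) by nra. assert (0 <= x * x) by nra.
    assert (cos x <= 1 - x * x / 2 + (x * x) * (x * x) / 24) by (eapply Rle_trans; [exact H |]; apply Req_le; field).
    nra.
  - assert (cos x <= 0).
    { apply cos_le_0; [| lra]. generalize PI2_3_2 PI_4. lra. }
    nra.
Qed.

Lemma fejer_bound n x : 0 < x <= PI -> Rabs (Rsum (fun m => dirichlet m x) n) <= 32 / x ^ 2.
Proof.
  intros Hx. assert (H := one_minus_cos_lower x ltac:(lra)).
  assert (Hx2 : 0 < x ^ 2) by (apply pow_lt; lra).
  assert (T := fejer_telescope n x). set (S := Rsum _ n) in *.
  assert (B := COS_bound (INR n * x)).
  apply (Rle_div_r _ 32); trivial.
  assert (Rabs S * (1 - cos x) <= 2).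
  { rewrite <- (Rabs_pos_eq (1 - cos x)) by lra. rewrite <- Rabs_mult, Rmult_comm, T. apply Rabs_le. lra. }
  generalize (Rabs_pos S). nra.
Qed.

(** If the limit were [l] the sums would grow like [n * l]. *)
Lemma Clim_zero_of_bounded_sums u l B : Clim u l -> (forall n, Cmod (Csum u n) <= B) -> l = RtoC 0.
Proof.
  intros Hl HB. apply Cmod_eq_0. apply Rle_antisym; [| apply Cmod_ge_0].
  apply Rnot_lt_le. intros Hpos.
  destruct (Hl (Cmod l / 2)) as [N HN]; [lra |].
  assert (G : forall n, Cmod (Csum u (N + n) - Csum u N - INR n * l) <= INR n * (Cmod l / 2)).
  { induction n.
    - rewrite Nat.add_0_r. simpl. replace (Csum u N - Csum u N - 0 * l)%C with (RtoC 0) by ring. rewrite Cmod_0. lra.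
    - rewrite Nat.add_succ_r. cbn [Csum]. rewrite S_INR, RtoC_plus.
      replace (Csum u (N + n) + u (N + n)%nat - Csum u N - (INR n + 1) * l)%C
        with ((Csum u (N + n) - Csum u N - INR n * l) + (u (N + n)%nat - l))%C by ring.
      eapply Rle_trans; [apply Cmod_triangle |]. specialize (HN (N + n)%nat ltac:(lia)). lra. }
  destruct (INR_unbounded (4 * B / (Cmod l))) as [n Hn].
  apply (Rlt_div_l (4 * B)) in Hn; trivial.
  specialize (G n). assert (B1 := HB (N + n)%nat). assert (B2 := HB N).
  assert (Cmod (INR n * l) <= INR n * (Cmod l / 2) + B + B).
  { replace (INR n * l)%C with (- (Csum u (N + n) - Csum u N - INR n * l) + Csum u (N + n) + - Csum u N)%C by ring.
    eapply Rle_trans; [apply Cmod_triangle |]. rewrite Cmod_opp.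
    apply Rplus_le_compat; trivial. eapply Rle_trans; [apply Cmod_triangle |]. rewrite Cmod_opp. lra. }
  rewrite Cmod_mult, Cmod_R, Rabs_pos_eq in H by apply pos_INR. lra.
Qed.

(** The partial sums of the series for [pi / (s sin (pi s))]. *)
Definition cosec_sum (s : C) (m : nat) : C :=
  (/ s ^ 2 + Csum (fun k => RtoC ((-1) ^ k / INR (S k)) * (/ (INR (S k) - s) + / (INR (S k) + s))) m)%C.

Lemma CInt_Csum f a b n : (forall k, ccont (f k)) ->
  CInt (fun x => Csum (fun k => f k x) n) a b = Csum (fun k => CInt (f k) a b) n.
Proof.
  intros H. induction n; simpl.
  - unfold CInt; simpl. rewrite !(RInt_const (V := R_CompleteNormedModule)).
    unfold scal; simpl; unfold mult; simpl. unfold RtoC. f_equal; ring.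
  - rewrite CInt_plus; trivial. now rewrite IHn. now apply ccont_Csum.
Qed.

Lemma RtoC_Rsum f n : RtoC (Rsum f n) = Csum (fun k => RtoC (f k)) n.
Proof. induction n; simpl; trivial. now rewrite RtoC_plus, IHn. Qed.

Lemma shift_neq_0 s (k : nat) : 0 < Re s < 1 -> (INR (S k) - s)%C <> RtoC 0 /\ (INR (S k) + s)%C <> RtoC 0.
Proof.
  intros Hs. assert (H := pos_INR k). rewrite S_INR. destruct s as [x y]. simpl in Hs.
  split; intros E; apply (f_equal Re) in E; simpl in E; lra.
Qed.

(** Integrate term by term: the frequencies [s + k] and [s - k] produce the partial
    fractions. *)
Lemma CInt_Ccos_dirichlet s m : 0 < Re s < 1 ->
  CInt (fun x => Ccos (s * x) * RtoC (dirichlet m x))%C 0 PI = (Csin (PI * s) * s * cosec_sum s m)%C.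
Proof.
  intros Hs. assert (Ns : s <> RtoC 0) by (intros ->; simpl in Hs; lra).
  assert (Cc : forall a, ccont (fun x : R => Ccos (a * x))) by apply ccont_Ccos_line.
  rewrite (CInt_ext _ (fun x => Ccos (s * x) + Csum (fun k => Ccos ((s + INR (S k)) * x) + Ccos ((s - INR (S k)) * x)) m)%C).
  2:{ intros x. unfold dirichlet. rewrite RtoC_plus, RtoC_Rsum, Cmult_plus_distr_l, Cmult_1_r. f_equal.
      rewrite <- Csum_scal. apply Csum_ext. intros k _. apply Ccos_prod. }
  rewrite CInt_plus; [| apply Cc | apply ccont_Csum; intros; now apply ccont_plus].
  rewrite CInt_Csum by (intros; now apply ccont_plus). rewrite CInt_Ccos by trivial.
  unfold cosec_sum. rewrite Cmult_plus_distr_l. f_equal; [field; trivial |].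
  rewrite <- Csum_scal. apply Csum_ext. intros k _.
  destruct (shift_neq_0 s k Hs) as [N1 N2].
  assert (N1' : (s - INR (S k))%C <> RtoC 0) by (intros E; apply N1; replace (INR (S k) - s)%C with (- (s - INR (S k)))%C by ring; rewrite E; ring).
  assert (N2' : (s + INR (S k))%C <> RtoC 0) by (rewrite Cplus_comm; trivial).
  rewrite CInt_plus, !CInt_Ccos by trivial.
  destruct (Csin_add_pi s (S k)) as [-> ->].
  assert (Nk : RtoC (INR (S k)) <> RtoC 0) by (intros E; apply RtoC_inj in E; generalize (pos_INR k); rewrite S_INR in E; lra).
  rewrite RtoC_div by (intros E; apply Nk; now rewrite E). cbn [pow]. rewrite RtoC_mult.
  replace (RtoC (-1)) with (- (1))%C by (rewrite <- RtoC_opp; f_equal; ring).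
  field. repeat split; trivial.
Qed.

Lemma ccont_dirichlet m : ccont (fun x => RtoC (dirichlet m x)).
Proof.
  apply ccont_RtoC. intros x. unfold dirichlet.
  apply (continuous_plus (fun _ : R => 1)); [apply continuous_const |].
  induction m; simpl; [apply continuous_const |].
  apply (continuous_plus (fun x : R => Rsum _ m)); [exact IHm |].
  apply (@ex_derive_continuous R_AbsRing R_NormedModule). auto_derive. trivial.
Qed.

Lemma CInt_dirichlet m : CInt (fun x => RtoC (dirichlet m x)) 0 PI = RtoC PI.
Proof.
  rewrite (CInt_FTC (fun x => RtoC (x + Rsum (fun k => 2 * / INR (S k) * sin (INR (S k) * x)) m))).
  - rewrite <- RtoC_minus. f_equal. assert (E : forall f, (forall k, f k = 0) -> Rsum f m = 0).
    { intros f Hf. induction m; simpl; trivial. rewrite IHm, Hf. ring. }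
    rewrite !E. ring.
    + intros. rewrite Rmult_0_r, sin_0. ring.
    + intros k. rewrite Rmult_comm, (Rmult_comm (INR (S k))). destruct (Cexp_pi_mult (S k)) as [E1 _].
      apply (f_equal Im) in E1. rewrite <- RtoC_mult in E1. simpl Im in E1 at 2.
      unfold Cexp, Ci, Cmult, RtoC, Re, Im in E1; cbn [fst snd] in E1.
      replace (0 * (PI * INR (S k)) - 1 * 0) with 0 in E1 by ring.
      replace (0 * 0 + 1 * (PI * INR (S k))) with (PI * INR (S k)) in E1 by ring.
      rewrite exp_0, Rmult_1_l in E1. rewrite E1. ring.
  - apply ccont_dirichlet.
  - intros x. split.
    + change (is_derive (fun t : R => t + Rsum (fun k => 2 * / INR (S k) * sin (INR (S k) * t)) m) x (dirichlet m x)).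
      unfold dirichlet. apply (is_derive_plus (V := R_NormedModule) (fun t : R => t)); [auto_derive; trivial |].
      induction m; cbn [Rsum]; [apply (is_derive_const (K := R_AbsRing) (V := R_NormedModule)) |].
      apply (is_derive_plus (V := R_NormedModule) (fun t : R => Rsum _ m)); [exact IHm |].
      assert (Na : INR (S m) <> 0) by (apply not_0_INR; lia). set (a := INR (S m)) in *. clearbody a.
      auto_derive; trivial. field. trivial.
    + change (is_derive (fun _ : R => 0) x 0). apply (is_derive_const (K := R_AbsRing) (V := R_NormedModule)).
Qed.

Lemma Ccos_minus_1 w : Cmod (Ccos w - 1) <= Cmod w ^ 2 * exp (Cmod w).
Proof.
  unfold Ccos.
  replace ((Cexp (Ci * w) + Cexp (- Ci * w)) / 2 - 1)%C
    with ((/ 2) * ((Cexp (Ci * w) - 1 - Ci * w) + (Cexp (- Ci * w) - 1 - (- Ci * w))))%C by cfield.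
  rewrite Cmod_mult, Cmod_inv, Cmod_R, Rabs_pos_eq by (try apply two_neq_0; lra).
  assert (H1 := Cexp_taylor1 (Ci * w)). assert (H2 := Cexp_taylor1 (- Ci * w)).
  assert (E1 : Cmod (Ci * w) = Cmod w) by (rewrite Cmod_mult, Cmod_Ci; ring).
  assert (E2 : Cmod (- Ci * w) = Cmod w) by (rewrite Cmod_mult, Cmod_opp, Cmod_Ci; ring).
  rewrite E1 in H1. rewrite E2 in H2.
  assert (T := Cmod_triangle (Cexp (Ci * w) - 1 - Ci * w) (Cexp (- Ci * w) - 1 - (- Ci * w))). lra.
Qed.

(** The sum of the first [n] Dirichlet kernels is [O(1 / x ^ 2)], which is compensated
    by the factor [cos (s * x) - 1]. *)
Lemma cosec_bounded s : 0 < Re s < 1 -> exists B, forall n,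
  Cmod (Csum (fun m => Csin (PI * s) * s * cosec_sum s m - PI) n)%C <= B.
Proof.
  intros Hs. exists ((PI - 0) * (32 * (Cmod s ^ 2 * exp (Cmod s * PI)))). intros n.
  assert (HPI := PI_RGT_0).
  assert (Cf : forall k, ccont (fun x : R => (Ccos (s * x) - 1) * RtoC (dirichlet k x))%C).
  { intros k. apply ccont_mult; [| apply ccont_dirichlet]. apply ccont_minus; [apply ccont_Ccos_line | apply ccont_const]. }
  assert (E : Csum (fun m => Csin (PI * s) * s * cosec_sum s m - PI)%C n =
    CInt (fun x => (Ccos (s * x) - 1) * RtoC (Rsum (fun m => dirichlet m x) n))%C 0 PI).
  { rewrite (CInt_ext _ (fun x => Csum (fun m => (Ccos (s * x) - 1) * RtoC (dirichlet m x))%C n)).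
    2:{ intros x. rewrite RtoC_Rsum, Csum_scal. reflexivity. }
    rewrite CInt_Csum by trivial. apply Csum_ext. intros m _.
    rewrite <- CInt_Ccos_dirichlet, <- (CInt_dirichlet m) by trivial.
    rewrite (CInt_ext (fun x => (Ccos (s * x) - 1) * RtoC (dirichlet m x))%C
      (fun x => Ccos (s * x) * RtoC (dirichlet m x) + (- (1)) * RtoC (dirichlet m x))%C) by (intros; ring).
    assert (C1 := ccont_dirichlet m). assert (C2 := ccont_Ccos_line s).
    rewrite CInt_plus, CInt_scal; trivial. ring. now apply ccont_mult.
    apply ccont_mult; trivial. apply ccont_const. }
  rewrite E. clear E.
  apply (CInt_norm _ (fun _ => 32 * (Cmod s ^ 2 * exp (Cmod s * PI)))).
  - apply (ccont_ext (fun x => Csum (fun m => (Ccos (s * x) - 1) * RtoC (dirichlet m x))%C n)).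
    + intros x. rewrite RtoC_Rsum, Csum_scal. reflexivity.
    + now apply ccont_Csum.
  - lra.
  - intros x Hx. rewrite Cmod_mult, Cmod_R.
    assert (HC := Ccos_minus_1 (s * x)). rewrite Cmod_mult, Cmod_R, (Rabs_pos_eq x) in HC by lra.
    assert (He : exp (Cmod s * x) <= exp (Cmod s * PI)).
    { apply exp_le_mono, Rmult_le_compat_l; [apply Cmod_ge_0 | lra]. }
    assert (Hep := exp_pos (Cmod s * x)). assert (Hs2 := pow2_ge_0 (Cmod s)).
    destruct (Req_dec x 0) as [-> | Nx].
    + assert (Cmod (Ccos (s * 0) - 1) = 0).
      { apply Rle_antisym; [| apply Cmod_ge_0]. eapply Rle_trans; [exact HC |].
        rewrite Rmult_0_r. apply Req_le. ring. }
      rewrite H, Rmult_0_l. repeat apply Rmult_le_pos; try lra; try apply Cmod_ge_0.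
    + assert (HF := fejer_bound n x ltac:(lra)).
      assert (Hx2 : 0 < x ^ 2) by (apply pow_lt; lra).
      rewrite Rpow_mult_distr in HC.
      replace (32 * (Cmod s ^ 2 * exp (Cmod s * PI))) with ((Cmod s ^ 2 * x ^ 2 * exp (Cmod s * PI)) * (32 / x ^ 2)) by (field; lra).
      apply Rmult_le_compat; [apply Cmod_ge_0 | apply Rabs_pos | | trivial].
      eapply Rle_trans; [exact HC |]. apply Rmult_le_compat_l; trivial. apply Rmult_le_pos; lra.
  - apply (is_RInt_const (V := R_NormedModule)).
Qed.

(** The partial fraction expansion of the cosecant.  The limit exists by
    assumption, and by [cosec_bounded] it is [PI] in the mean, hence it is [PI]. *)
Lemma cosec_limit s K : 0 < Re s < 1 -> Clim (cosec_sum s) K -> (Csin (PI * s) * s * K)%C = RtoC PI.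
Proof.
  intros Hs HK. destruct (cosec_bounded s Hs) as [B HB].
  assert (E : (Csin (PI * s) * s * K - PI)%C = RtoC 0).
  { apply (Clim_zero_of_bounded_sums (fun m => Csin (PI * s) * s * cosec_sum s m - PI)%C _ B); trivial.
    apply Clim_plus; [now apply Clim_scal | apply Clim_const]. }
  replace (Csin (PI * s) * s * K)%C with ((Csin (PI * s) * s * K - PI) + PI)%C by ring. rewrite E. ring.
Qed.

(** ** The logarithm *)

Lemma exp_INR n x : exp (INR n * x) = exp x ^ n.
Proof.
  induction n; [simpl; now rewrite Rmult_0_l, exp_0 |].
  rewrite S_INR, Rmult_plus_distr_r, exp_plus, IHn, Rmult_1_l. simpl. ring.
Qed.

Lemma is_derive_pow_div (n : nat) (c x : R) :
  is_derive (fun x : R => c / INR (S n) * x ^ S n) x (c * x ^ n).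
Proof.
  assert (NI : INR (S n) <> 0) by (apply not_0_INR; lia).
  replace (c * x ^ n) with (c / INR (S n) * (INR (S n) * 1 * x ^ pred (S n))) by (cbn [pred]; field; trivial).
  apply is_derive_scal. apply (is_derive_pow (fun x : R => x)). auto_derive; trivial.
Qed.

(** Apply the mean value theorem to the remainder plus or minus its bound. *)
Lemma ln_series_bound n t : 0 <= t <= 1 ->
  Rabs (ln (1 + t) - Rsum (fun k => (-1) ^ k / INR (S k) * t ^ S k) n) <= t ^ S n / INR (S n).
Proof.
  intros Ht. destruct (Req_dec t 0) as [-> | Nt].
  { assert (E : Rsum (fun k => (-1) ^ k / INR (S k) * 0 ^ S k) n = 0).
    { induction n; cbn [Rsum]; trivial. rewrite IHn, pow_i by lia. ring. }
    rewrite Rplus_0_r, ln_1. match goal with |- Rabs (0 - ?x) <= _ => change x with (Rsum (fun k => (-1) ^ k / INR (S k) * 0 ^ S k) n) end.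
    rewrite E, Rminus_0_r, Rabs_R0. unfold Rdiv. rewrite pow_i by lia. lra. }
  set (S' := fun x => Rsum (fun k => (-1) ^ k / INR (S k) * x ^ S k) n).
  assert (HS : forall x, 0 <= x -> is_derive S' x ((1 - (- x) ^ n) / (1 + x))).
  { intros x Hx. unfold S'. clear S'. induction n; cbn [Rsum].
    - replace ((1 - (- x) ^ 0) / (1 + x)) with 0 by (simpl; field; lra).
      apply (is_derive_const (K := R_AbsRing) (V := R_NormedModule)).
    - replace ((1 - (- x) ^ S n) / (1 + x)) with ((1 - (- x) ^ n) / (1 + x) + (-1) ^ n * x ^ n).
      2:{ rewrite <- Rpow_mult_distr. replace (-1 * x) with (- x) by ring. simpl. field. lra. }
      apply (is_derive_plus (V := R_NormedModule) (fun t : R => Rsum _ n)); [exact IHn |].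
      apply is_derive_pow_div. }
  assert (HD : forall e x, 0 <= x -> is_derive (fun x => 1 / INR (S n) * x ^ S n + e * (ln (1 + x) - S' x)) x
      (1 * x ^ n + e * (/ (1 + x) - (1 - (- x) ^ n) / (1 + x)))).
  { intros e x Hx. apply (is_derive_plus (V := R_NormedModule) (fun x : R => 1 / INR (S n) * x ^ S n)); [apply is_derive_pow_div |].
    apply is_derive_scal. apply (is_derive_minus (V := R_NormedModule) (fun x : R => ln (1 + x))); [| now apply HS].
    auto_derive; [lra | field; lra]. }
  assert (HR : forall e, e = 1 \/ e = -1 -> 0 <= 1 / INR (S n) * t ^ S n + e * (ln (1 + t) - S' t)).
  { intros e He.
    destruct (MVT_gen (fun x => 1 / INR (S n) * x ^ S n + e * (ln (1 + x) - S' x)) 0 t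
      (fun x => 1 * x ^ n + e * (/ (1 + x) - (1 - (- x) ^ n) / (1 + x)))) as (c & Hc & E).
    - intros x. rewrite Rmin_left, Rmax_right by lra. intros Hx. apply HD. lra.
    - intros x. rewrite Rmin_left, Rmax_right by lra. intros Hx.
      apply derivable_continuous_pt. eexists. apply is_derive_Reals, HD. lra.
    - rewrite Rmin_left, Rmax_right in Hc by lra.
      assert (E0 : S' 0 = 0).
      { unfold S'. clear. induction n; cbn [Rsum]; trivial. rewrite IHn, pow_i by lia. ring. }
      rewrite E0, Rplus_0_r, ln_1, pow_i, Rminus_0_r, !Rmult_0_r, Rplus_0_r, Rminus_0_r in E by lia.
      rewrite E. apply Rmult_le_pos; [| lra]. rewrite Rmult_1_l.
      replace (/ (1 + c) - (1 - (- c) ^ n) / (1 + c)) with ((- c) ^ n / (1 + c)) by (field; lra).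
      assert (Hcn : 0 <= c ^ n) by (apply pow_le; lra).
      assert (Habs : Rabs ((- c) ^ n / (1 + c)) <= c ^ n).
      { unfold Rdiv. rewrite Rabs_mult, <- RPow_abs, Rabs_Ropp, Rabs_pos_eq by lra.
        rewrite Rabs_pos_eq by (left; apply Rinv_0_lt_compat; lra).
        rewrite <- (Rmult_1_r (c ^ n)) at 2. apply Rmult_le_compat_l; trivial.
        rewrite <- Rinv_1. apply Rinv_le_contravar; lra. }
      apply Rabs_le_between in Habs. destruct He as [-> | ->]; lra. }
  apply Rabs_le. fold (S' t). generalize (HR 1 ltac:(lra)) (HR (-1) ltac:(lra)).
  replace (t ^ S n / INR (S n)) with (1 / INR (S n) * t ^ S n) by (field; apply not_0_INR; lia). lra.
Qed.

Lemma ln_1p_le y : 0 <= y -> 0 <= ln (1 + y) <= y.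
Proof.
  intros Hy. split.
  - rewrite <- ln_1. destruct Hy as [Hy | <-]; [left; apply ln_increasing; lra | rewrite Rplus_0_r; lra].
  - rewrite <- (ln_exp y) at 2. assert (H := exp_ineq1_le y).
    destruct (Req_dec (1 + y) (exp y)) as [-> | N]; [lra |]. left. apply ln_increasing; lra.
Qed.

Lemma continuous_ln_1p_exp (a x : R) : 0 <= a -> continuous (fun u : R => ln (1 + exp u * a)) x.
Proof.
  intros Ha. apply (@ex_derive_continuous R_AbsRing R_NormedModule). auto_derive.
  generalize (exp_pos x). nra.
Qed.

Lemma continuous_ln_1p_exp_neg (x : R) : continuous (fun u : R => ln (1 + exp (- u))) x.
Proof.
  apply (@ex_derive_continuous R_AbsRing R_NormedModule). auto_derive.
  generalize (exp_pos (- x)). lra.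
Qed.

Lemma Re_opp s : Re (- s) = - Re s.
Proof. reflexivity. Qed.

(** Integrate the alternating series term by term; its remainder after [n] terms
    is at most [exp (- (n + 1) * v) / (n + 1)]. *)
Lemma log_half_transform s : -1 < Re s < 1 -> exists l,
  half_line_integral (fun v => Cexp (s * v) * RtoC (ln (1 + exp (- v))))%C l /\
  Clim (Csum (fun k => RtoC ((-1) ^ k / INR (S k)) * / (INR (S k) - s))%C) l.
Proof.
  intros Hs.
  assert (Cf : ccont (fun v => Cexp (s * v) * RtoC (ln (1 + exp (- v))))%C).
  { apply ccont_mult; [apply ccont_Cexp_line | apply ccont_RtoC, continuous_ln_1p_exp_neg]. }
  assert (Hln : forall u, 0 <= u -> 0 <= ln (1 + exp (- u)) <= exp (- u)).
  { intros u _. apply ln_1p_le. left; apply exp_pos. }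
  destruct (half_line_integral_exists _ 1 (1 - Re s) Cf ltac:(lra) ltac:(lra)) as (l & Hl & _).
  { intros u Hu. rewrite Cmod_mult, Cmod_Cexp_line, Cmod_R, Rabs_pos_eq by now apply Hln.
    rewrite Rmult_1_l. replace (- (1 - Re s) * u) with (Re s * u + - u) by ring. rewrite exp_plus.
    apply Rmult_le_compat_l; [left; apply exp_pos | now apply Hln]. }
  exists l. split; trivial.
  set (g := fun k (v : R) => (RtoC ((-1) ^ k / INR (S k)) * Cexp (- (INR (S k) - s) * v))%C).
  assert (Cg : forall k, ccont (g k)) by (intros; apply ccont_mult; [apply ccont_const | apply ccont_Cexp_line]).
  assert (Hg : forall k, half_line_integral (g k) (RtoC ((-1) ^ k / INR (S k)) * / (INR (S k) - s))%C).
  { intros k. apply half_line_integral_scal; [apply ccont_Cexp_line |]. apply half_line_integral_Cexp.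
    rewrite S_INR. generalize (pos_INR k). destruct s; simpl in *. lra. }
  assert (G : forall n, Cmod (Csum (fun k => RtoC ((-1) ^ k / INR (S k)) * / (INR (S k) - s))%C n - l) <= / INR (S n) / (INR (S n) - Re s)).
  { intros n. assert (HI : 1 <= INR (S n)) by (rewrite S_INR; generalize (pos_INR n); lra).
    apply (half_line_integral_bound (fun v => Csum (fun k => g k v) n + (- (1)) * (Cexp (s * v) * RtoC (ln (1 + exp (- v)))))%C).
    - apply ccont_plus; [now apply ccont_Csum |]. apply ccont_mult; trivial. apply ccont_const.
    - lra.
    - left. apply Rinv_0_lt_compat. lra.
    - intros u Hu.
      replace (Csum (fun k => g k u) n + - (1) * (Cexp (s * u) * RtoC (ln (1 + exp (- u)))))%C
        with (Cexp (s * u) * RtoC (- (ln (1 + exp (- u)) - Rsum (fun k => (-1) ^ k / INR (S k) * exp (- u) ^ S k) n))%R)%C.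
      + rewrite Cmod_mult, Cmod_Cexp_line, Cmod_R, Rabs_Ropp.
        assert (Ht : 0 <= exp (- u) <= 1).
        { split; [left; apply exp_pos |]. rewrite <- exp_0. apply exp_le_mono. lra. }
        assert (B := ln_series_bound n (exp (- u)) Ht).
        replace (/ INR (S n) * exp (- (INR (S n) - Re s) * u)) with (exp (Re s * u) * (exp (- u) ^ S n / INR (S n))).
        * apply Rmult_le_compat_l; [left; apply exp_pos | exact B].
        * rewrite <- exp_INR. replace (- (INR (S n) - Re s) * u) with (Re s * u + INR (S n) * - u) by ring.
          rewrite exp_plus. unfold Rdiv. ring.
      + rewrite RtoC_opp, RtoC_minus, RtoC_Rsum.
        replace (Csum (fun k => g k u) n) with (Cexp (s * u) * Csum (fun k => RtoC ((-1) ^ k / INR (S k) * exp (- u) ^ S k)%R) n)%C; [ring |].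
        rewrite <- Csum_scal. apply Csum_ext. intros k _. unfold g.
        replace (- (INR (S k) - s) * u)%C with (s * u + RtoC (INR (S k) * - u))%C by (rewrite RtoC_mult, RtoC_opp; ring).
        rewrite Cexp_plus, Cexp_RtoC, exp_INR, RtoC_mult. ring.
    - replace (Csum (fun k => RtoC ((-1) ^ k / INR (S k)) * / (INR (S k) - s))%C n - l)%C
        with (Csum (fun k => RtoC ((-1) ^ k / INR (S k)) * / (INR (S k) - s))%C n + (- (1)) * l)%C by ring.
      apply half_line_integral_plus.
      + now apply ccont_Csum.
      + apply ccont_mult; trivial. apply ccont_const.
      + now apply half_line_integral_Csum.
      + now apply half_line_integral_scal. }
  intros eps Heps. destruct (inv_INR_small (eps * (1 - Re s) / 2)) as (N & HN & HNe).
  { apply Rdiv_lt_0_compat; [apply Rmult_lt_0_compat; lra | lra]. }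
  exists N. intros n Hn. eapply Rle_lt_trans; [apply G |].
  assert (0 < INR N) by now apply lt_0_INR.
  assert (INR N <= INR (S n)) by (apply le_INR; lia).
  assert (HI : 1 <= INR (S n)) by (rewrite S_INR; generalize (pos_INR n); lra).
  apply (Rlt_div_l _ eps); [lra |].
  assert (/ INR (S n) <= / INR N) by now apply Rinv_le_contravar. nra.
Qed.

(** On the left half-line [log_half_transform] applies directly; on the right one
    [ln (1 + exp u) = u + ln (1 + exp (- u))] gives the additional term [1 / s ^ 2]. *)
Lemma log_transform s : 0 < Re s < 1 -> exists K,
  line_integral (fun u => Cexp (- s * u) * RtoC (ln (1 + exp u)))%C K /\ (Csin (PI * s) * s * K)%C = RtoC PI.
Proof.
  intros Hs. destruct (log_half_transform s ltac:(lra)) as (l & Hl & Hl').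
  destruct (log_half_transform (- s) ltac:(rewrite Re_opp; lra)) as (m & Hm & Hm').
  exists (/ s ^ 2 + (m + l))%C. split.
  - exists (/ s ^ 2 + m)%C, l. split; [| split; [| ring]].
    + apply (half_line_integral_ext (fun u : R => RtoC u * Cexp (- s * u) + Cexp (- s * u) * RtoC (ln (1 + exp (- u))))%C).
      { intros u. rewrite Cmult_comm, <- Cmult_plus_distr_l, <- RtoC_plus. do 2 f_equal.
        rewrite <- (ln_exp u) at 1. rewrite <- ln_mult; [| apply exp_pos | generalize (exp_pos (- u)); lra].
        f_equal. rewrite Rmult_plus_distr_l, <- exp_plus, Rplus_opp_r, exp_0. ring. }
      apply half_line_integral_plus; trivial.
      * apply ccont_mult; [apply ccont_RtoC; intros; apply continuous_id | apply ccont_Cexp_line].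
      * apply ccont_mult; [apply ccont_Cexp_line | apply ccont_RtoC, continuous_ln_1p_exp_neg].
      * apply half_line_integral_u_Cexp. lra.
    + apply (half_line_integral_ext (fun v => Cexp (s * v) * RtoC (ln (1 + exp (- v))))%C); trivial.
      intros v. f_equal. f_equal. rewrite RtoC_opp. ring.
  - apply cosec_limit; trivial.
    apply (Clim_ext (fun n => / s ^ 2 + (Csum (fun k => RtoC ((-1) ^ k / INR (S k)) * / (INR (S k) - - s)) n
      + Csum (fun k => RtoC ((-1) ^ k / INR (S k)) * / (INR (S k) - s)) n))%C).
    { intros n. unfold cosec_sum. f_equal. induction n; cbn [Csum]; [ring |]. rewrite <- IHn.
      replace (INR (S n) - - s)%C with (INR (S n) + s)%C by ring. ring. }
    apply Clim_plus; [apply Clim_const |]. now apply Clim_plus.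
Qed.

(** * Dirichlet series over rapidly growing sequences *)

(** The power [(k + 1) ^ (- 3 / 2)], which dominates [nu ^ (- 3 / 4)] for the
    [k]-th zero [nu >= (k + 1) ^ 2]. *)
Definition weight (k : nat) : R := / ((INR k + 1) * sqrt (INR k + 1)).

Lemma weight_tail m n : (0 < m)%nat -> Rsum (fun k => weight (m + k)) n <= 2 * (/ sqrt (INR m) - / sqrt (INR (m + n))).
Proof.
  intros Hm. induction n; cbn [Rsum]. rewrite Nat.add_0_r. lra.
  replace (m + S n)%nat with (S (m + n)) by lia. unfold weight at 2. rewrite S_INR.
  assert (Hx : 1 <= INR (m + n)) by (change 1 with (INR 1); apply le_INR; lia).
  set (x := INR (m + n)) in *.
  assert (Sx := sqrt_lt_R0 x ltac:(lra)). assert (Sy := sqrt_lt_R0 (x + 1) ltac:(lra)).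
  assert (Ex := sqrt_sqrt x ltac:(lra)). assert (Ey := sqrt_sqrt (x + 1) ltac:(lra)).
  assert (Hle := sqrt_le_1_alt x (x + 1) ltac:(lra)).
  set (a := sqrt x) in *. set (b := sqrt (x + 1)) in *.
  assert (/ ((x + 1) * b) <= 2 * (/ a - / b)); [| lra].
  replace (2 * (/ a - / b)) with (2 * (b - a) / (a * b)) by (field; lra).
  rewrite <- Ey.
  assert (E1 : (b - a) * (b + a) = 1) by nra.
  assert (H1 : 1 <= 2 * (b - a) * b) by nra.
  apply (Rle_div_r _ (2 * (b - a))); [nra |].
  apply Rle_trans with (a * b * / (b * b * b)); [lra |].
  replace (a * b * / (b * b * b)) with (a / (b * b)) by (field; lra).
  apply (Rle_div_l a); [nra |]. nra.
Qed.

Lemma sq_small_weight ia k : sq_small ia -> 0 < ia k -> exp (3 / 4 * ln (ia k)) <= weight k.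
Proof.
  intros H Hpos. assert (HI := pos_INR k). destruct (H k) as [_ Hle].
  set (x := INR k + 1) in *. assert (Hx : 1 <= x) by (unfold x; lra).
  assert (E : weight k = exp (3 / 4 * ln (/ x ^ 2))).
  { unfold weight. fold x. rewrite ln_Rinv by (apply pow_lt; lra).
    simpl. rewrite Rmult_1_r, ln_mult by lra.
    replace (3 / 4 * - (ln x + ln x)) with (- (ln x + / 2 * ln x)) by field.
    rewrite exp_Ropp, exp_plus, exp_ln by lra. f_equal. f_equal.
    rewrite <- Rpower_sqrt by lra. reflexivity. }
  rewrite E. apply exp_le_mono. apply Rmult_le_compat_l; [lra |].
  destruct Hle as [Hle | <-]; [left; now apply ln_increasing | lra].
Qed.

Section Dirichlet.

Variable ia : nat -> R.
Hypothesis Hs : sq_small ia.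
Hypothesis Hpos : forall k, 0 < ia k.

Definition zterm (s : C) (k : nat) : C := Cpower (/ ia k) (- s).

Lemma ia_le_1 k : ia k <= 1.
Proof.
  eapply Rle_trans; [apply Hs |]. rewrite <- Rinv_1. apply Rinv_le_contravar; [lra |].
  generalize (pos_INR k). intros. simpl. nra.
Qed.

Lemma ln_nu_nonneg k : 0 <= ln (/ ia k).
Proof.
  rewrite <- ln_1. assert (H1 := ia_le_1 k). assert (H2 := Hpos k).
  destruct H1 as [H1 | ->]; [| rewrite Rinv_1; lra].
  left. apply ln_increasing; [lra |]. rewrite <- Rinv_1. apply Rinv_lt_contravar; lra.
Qed.

Lemma Cmod_zterm s k : Cmod (zterm s k) = exp (- Re s * ln (/ ia k)).
Proof.
  unfold zterm, Cpower. rewrite Cmod_Cexp. f_equal. unfold Re, Cmult, Copp, RtoC; simpl. ring.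
Qed.

Lemma zterm_weight s k : 3 / 4 <= Re s -> Cmod (zterm s k) <= weight k.
Proof.
  intros H. rewrite Cmod_zterm. eapply Rle_trans; [| now apply (sq_small_weight ia)].
  apply exp_le_mono. replace (ln (ia k)) with (- ln (/ ia k)) by (rewrite ln_Rinv; [ring | apply Hpos]).
  generalize (ln_nu_nonneg k). nra.
Qed.

Lemma weight_sum n : Rsum weight n <= 3.
Proof.
  destruct n; simpl; [lra |]. change (Rsum weight (S n) <= 3). change (S n) with (1 + n)%nat.
  rewrite Rsum_plus. assert (H := weight_tail 1 n ltac:(lia)).
  assert (0 < / sqrt (INR (1 + n))) by (apply Rinv_0_lt_compat, sqrt_lt_R0, lt_0_INR; lia).
  simpl (INR 1) in H. rewrite sqrt_1, Rinv_1 in H.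
  assert (weight 0 = 1) by (unfold weight; simpl; rewrite Rplus_0_l, sqrt_1; field).
  cbn [Rsum]. simpl in *. lra.
Qed.

Lemma inv_sqrt_small eps : 0 < eps -> exists m, (0 < m)%nat /\ / sqrt (INR m) <= eps.
Proof.
  intros H. destruct (inv_INR_small (eps * eps)) as (m & Hm & Hme); [nra |].
  exists m. split; trivial. assert (0 < INR m) by now apply lt_0_INR.
  rewrite <- sqrt_inv. rewrite <- (sqrt_square eps) by lra. now apply sqrt_le_1_alt.
Qed.

Lemma zsum_tail s m n : 3 / 4 <= Re s -> (0 < m)%nat ->
  Cmod (Csum (fun k => zterm s (m + k)) n) <= 2 * / sqrt (INR m).
Proof.
  intros H Hm. eapply Rle_trans; [apply Cmod_Csum |].
  eapply Rle_trans; [apply Rsum_le; intros; now apply zterm_weight |].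
  eapply Rle_trans; [now apply weight_tail |].
  assert (0 < / sqrt (INR (m + n))) by (apply Rinv_0_lt_compat, sqrt_lt_R0, lt_0_INR; lia). lra.
Qed.

Lemma zsum_exists s : 3 / 4 <= Re s -> exists l, Clim (Csum (zterm s)) l.
Proof.
  intros H. apply Clim_cauchy. intros eps Heps.
  destruct (inv_sqrt_small (eps / 5)) as (m & Hm & Hme); [lra |]. exists m.
  assert (G : forall n, (m <= n)%nat -> Cmod (Csum (zterm s) n - Csum (zterm s) m) <= 2 * (eps / 5)).
  { intros n Hn. replace n with (m + (n - m))%nat by lia. rewrite Csum_plus.
    replace (Csum (zterm s) m + Csum (fun k => zterm s (m + k)) (n - m) - Csum (zterm s) m)%C
      with (Csum (fun k => zterm s (m + k)) (n - m)) by ring.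
    eapply Rle_trans; [now apply zsum_tail | lra]. }
  intros n n' Hn Hn'. generalize (G n Hn) (G n' Hn').
  set (u := Csum _ n). set (v := Csum _ m). set (w := Csum _ n'). intros.
  replace (u - w)%C with ((u - v) + - (w - v))%C by ring.
  eapply Rle_lt_trans; [apply Cmod_triangle |]. rewrite Cmod_opp. lra.
Qed.

Definition zsum (s : C) : C := epsilon (inhabits (RtoC 0)) (Clim (Csum (zterm s))).

Lemma zsum_lim s : 3 / 4 <= Re s -> Clim (Csum (zterm s)) (zsum s).
Proof. intros H. unfold zsum. apply epsilon_spec. now apply zsum_exists. Qed.

Lemma sum_n_Rsum f n : sum_n f n = Rsum f (S n).
Proof.
  induction n; [rewrite sum_O; symmetry; apply Rplus_0_l |]. rewrite sum_Sn, IHn. reflexivity.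
Qed.

Lemma sum_n_Csum (f : nat -> C) n : @sum_n C_AbelianMonoid f n = Csum f (S n).
Proof.
  induction n; [rewrite sum_O; symmetry; apply Cplus_0_l |]. rewrite sum_Sn, IHn. reflexivity.
Qed.

Lemma Clim_is_series (f : nat -> C) l : Clim (Csum f) l -> @is_series C_AbsRing C_NormedModule f l.
Proof.
  intros H. unfold is_series. intros P HP.
  apply locally_Cmod in HP. destruct HP as (d & Hd & HP). destruct (H d Hd) as [N HN].
  exists N. intros n Hn. apply HP. rewrite sum_n_Csum. apply HN. lia.
Qed.

Lemma ex_series_bounded (f : nat -> R) B : (forall k, 0 <= f k) -> (forall n, Rsum f n <= B) -> ex_series f.
Proof.
  intros H HB. destruct (ex_finite_lim_seq_incr (sum_n f) B) as [l Hl].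
  - intros n. rewrite sum_Sn. change (sum_n f n <= sum_n f n + f (S n)). generalize (H (S n)). lra.
  - intros n. rewrite sum_n_Rsum. apply HB.
  - exists l. exact Hl.
Qed.

Lemma zterm_abs_series s : 3 / 4 <= Re s -> ex_series (fun k => Cmod (zterm s k)).
Proof.
  intros H. apply ex_series_bounded with 3; [intros; apply Cmod_ge_0 |].
  intros n. eapply Rle_trans; [| apply (weight_sum n)]. apply Rsum_le. intros. now apply zterm_weight.
Qed.

(** The factor [ln (1 / ia k) ^ 2] of the second derivative is absorbed by the room
    between [Re s] and [3 / 4]. *)
Lemma zterm_quadratic s h k : 3 / 4 < Re s -> Cmod h < (Re s - 3 / 4) / 2 ->
  Cmod (zterm (s + h) k - zterm s k - - RtoC (ln (/ ia k)) * zterm s k * h)%C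
  <= 16 / (Re s - 3 / 4) ^ 2 * weight k * Cmod h ^ 2.
Proof.
  intros H Hh. unfold zterm at 1, Cpower.
  set (l := ln (/ ia k)). assert (Hl : 0 <= l) by apply ln_nu_nonneg.
  replace (- (s + h) * l)%C with (- s * l + - h * l)%C by ring. rewrite Cexp_plus.
  change (Cexp (- s * l)) with (zterm s k).
  replace (zterm s k * Cexp (- h * l) - zterm s k - - l * zterm s k * h)%C
    with (zterm s k * (Cexp (- h * l) - 1 - (- h * l)))%C by ring.
  rewrite Cmod_mult, Cmod_zterm. fold l.
  set (eta := (Re s - 3 / 4) / 2) in *. assert (He : 0 < eta) by (unfold eta; lra).
  assert (T := Cexp_taylor1 (- h * l)). rewrite Cmod_mult, Cmod_opp, Cmod_R, Rabs_pos_eq in T by trivial.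
  assert (Hh0 := Cmod_ge_0 h).
  assert (X : l ^ 2 <= 4 / eta ^ 2 * exp (eta * l)).
  { assert (B := exp_times_bound (eta / 2) l ltac:(lra) Hl).
    apply Rle_trans with ((/ (eta / 2) * exp (eta / 2 * l)) ^ 2); [apply pow_incr; lra |].
    apply Req_le. rewrite Rpow_mult_distr. simpl. rewrite !Rmult_1_r, <- exp_plus.
    replace (eta / 2 * l + eta / 2 * l) with (eta * l) by field. field. lra. }
  assert (W : exp (- (3 / 4) * l) <= weight k).
  { eapply Rle_trans; [| now apply (sq_small_weight ia)]. apply exp_le_mono. unfold l.
    rewrite ln_Rinv by apply Hpos. lra. }
  apply Rle_trans with (exp (- Re s * l) * (Cmod h ^ 2 * (4 / eta ^ 2 * exp (eta * l)) * exp (eta * l))).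
  - apply Rmult_le_compat_l; [left; apply exp_pos |]. eapply Rle_trans; [exact T |].
    rewrite Rpow_mult_distr. apply Rmult_le_compat.
    + apply Rmult_le_pos; apply pow2_ge_0.
    + left; apply exp_pos.
    + apply Rmult_le_compat_l; [apply pow2_ge_0 | exact X].
    + apply exp_le_mono. nra.
  - replace (exp (- Re s * l) * (Cmod h ^ 2 * (4 / eta ^ 2 * exp (eta * l)) * exp (eta * l)))
      with (4 / eta ^ 2 * (exp (- Re s * l) * exp (eta * l) * exp (eta * l)) * Cmod h ^ 2) by ring.
    rewrite <- !exp_plus. replace (- Re s * l + eta * l + eta * l) with (- (3 / 4) * l) by (unfold eta; field).
    replace (16 / (Re s - 3 / 4) ^ 2) with (4 / eta ^ 2) by (unfold eta; field; lra).
    apply Rmult_le_compat_r; [apply pow2_ge_0 |]. apply Rmult_le_compat_l; trivial.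
    left. apply Rdiv_lt_0_compat; [lra | now apply pow_lt].
Qed.

Lemma zsum_derive s : 3 / 4 < Re s -> exists l, is_Cderive zsum s l.
Proof.
  intros H. set (eta := (Re s - 3 / 4) / 2). assert (He : 0 < eta) by (unfold eta; lra).
  set (M := 16 / (Re s - 3 / 4) ^ 2).
  assert (HM : 0 < M) by (apply Rdiv_lt_0_compat; [lra | apply pow_lt; lra]).
  apply (Clim_derive (fun n z => Csum (zterm z) n) zsum
    (fun n => Csum (fun k => - RtoC (ln (/ ia k)) * zterm s k)%C n) s eta (M * 3)); [trivial | lra | |].
  - intros z Hz. apply zsum_lim. assert (B := Re_minus_le z s). apply Rabs_le_between in B. unfold eta in *. lra.
  - intros n h Hh.
    replace (Csum (zterm (s + h)) n - Csum (zterm s) n - Csum (fun k => - RtoC (ln (/ ia k)) * zterm s k) n * h)%C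
      with (Csum (fun k => zterm (s + h) k - zterm s k - - RtoC (ln (/ ia k)) * zterm s k * h) n)%C.
    + eapply Rle_trans; [apply Cmod_Csum |].
      apply Rle_trans with (Rsum (fun k => (M * Cmod h ^ 2) * weight k) n).
      * apply Rsum_le. intros k _. eapply Rle_trans; [now apply zterm_quadratic |]. fold M. apply Req_le. ring.
      * rewrite Rsum_scal. replace (M * 3 * Cmod h ^ 2) with (M * Cmod h ^ 2 * 3) by ring.
        apply Rmult_le_compat_l; [| apply weight_sum]. apply Rmult_le_pos; [lra | apply pow2_ge_0].
    + induction n; simpl; [ring |]. rewrite IHn. ring.
Qed.

(** ** The Mellin identity *)

Variable L : R -> R.
Hypothesis HL : forall u, is_lim_seq (Rsum (fun k => ln (1 + exp u * ia k))) (L u).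
Hypothesis HLc : forall u, continuous L u.
Variable om : R.
Hypothesis Hom : 2 * ln 3 <= om.

(** For [om = ln lambda] the factor 3 cancels the growth of [L], because
    [exp (L u)] satisfies a cubic functional equation. *)
Definition defect (u : R) : R := L (u + om) - 3 * L u.

Lemma om_pos : 0 < om.
Proof. assert (0 < ln 3) by (rewrite <- ln_1; apply ln_increasing; lra). lra. Qed.

Lemma ln_1p_le_pow y : 0 < y -> ln (1 + y) <= 3 * exp (3 / 4 * ln y).
Proof.
  intros Hy. destruct (Rle_dec y 1) as [H1 | H1].
  - assert (ln y <= 0). { rewrite <- ln_1. destruct H1 as [H1 | ->]; [left; now apply ln_increasing | lra]. }
    assert (y <= exp (3 / 4 * ln y)). { rewrite <- (exp_ln y) at 1 by trivial. apply exp_le_mono. lra. }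
    generalize (ln_1p_le y ltac:(lra)). lra.
  - assert (Hl : 0 < ln y) by (rewrite <- ln_1; apply ln_increasing; lra).
    assert (ln (1 + y) <= ln (2 * y)) by (left; apply ln_increasing; lra).
    rewrite ln_mult in H by lra.
    assert (ln 2 < 1). { rewrite <- (ln_exp 1). apply ln_increasing; [lra |]. generalize exp_ineq1. intros E. specialize (E 1 ltac:(lra)). lra. }
    assert (B := exp_ineq1_le (3 / 4 * ln y)). lra.
Qed.

Definition Ltail (m : nat) (u : R) : R := L u - Rsum (fun k => ln (1 + exp u * ia k)) m.

(** Estimate [ln (1 + y)] by [y] on the left half-line and by a multiple of
    [y ^ (3 / 4)] on the right one. *)
Lemma Ltail_bound m u : (0 < m)%nat ->
  0 <= Ltail m u <= 6 / sqrt (INR m) * exp u /\ Ltail m u <= 6 / sqrt (INR m) * exp (3 / 4 * u).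
Proof.
  intros Hm. assert (Hu := exp_pos u).
  assert (Hterm : forall k, 0 <= ln (1 + exp u * ia k)).
  { intros k. apply ln_1p_le. generalize (Hpos k). nra. }
  assert (Hsq : 0 < / sqrt (INR m)) by (apply Rinv_0_lt_compat, sqrt_lt_R0, lt_0_INR; trivial).
  assert (G : forall n, 0 <= Rsum (fun k => ln (1 + exp u * ia (m + k)%nat)) n <= 6 / sqrt (INR m) * exp u /\
     Rsum (fun k => ln (1 + exp u * ia (m + k)%nat)) n <= 6 / sqrt (INR m) * exp (3 / 4 * u)).
  { intros n. assert (W := weight_tail m n Hm).
    assert (0 < / sqrt (INR (m + n))) by (apply Rinv_0_lt_compat, sqrt_lt_R0, lt_0_INR; lia).
    assert (W' : Rsum (fun k => weight (m + k)) n <= 2 * / sqrt (INR m)) by lra.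
    repeat split.
    - apply Rsum_pos. intros; apply Hterm.
    - apply Rle_trans with (Rsum (fun k => exp u * weight (m + k)) n).
      + apply Rsum_le. intros k _. eapply Rle_trans; [apply ln_1p_le; generalize (Hpos (m + k)); nra |].
        apply Rmult_le_compat_l; [lra |]. eapply Rle_trans; [| apply (sq_small_weight ia); [exact Hs | apply Hpos]].
        rewrite <- (exp_ln (ia (m + k)%nat)) at 1 by apply Hpos. apply exp_le_mono.
        assert (ln (ia (m + k)%nat) <= 0).
        { rewrite <- ln_1. destruct (ia_le_1 (m + k)) as [h | ->]; [left; apply ln_increasing; [apply Hpos | trivial] | lra]. }
        lra.
      + rewrite Rsum_scal. unfold Rdiv. nra.
    - apply Rle_trans with (Rsum (fun k => 3 * exp (3 / 4 * u) * weight (m + k)) n).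
      + apply Rsum_le. intros k _. eapply Rle_trans; [apply ln_1p_le_pow; generalize (Hpos (m + k)); nra |].
        rewrite ln_mult, ln_exp, Rmult_plus_distr_l, exp_plus by (trivial; apply Hpos).
        rewrite Rmult_assoc. apply Rmult_le_compat_l; [lra |]. apply Rmult_le_compat_l; [left; apply exp_pos |].
        apply sq_small_weight; trivial.
      + rewrite Rsum_scal. generalize (exp_pos (3 / 4 * u)). intros. unfold Rdiv. nra. }
  assert (Hlim : is_lim_seq (fun n => Rsum (fun k => ln (1 + exp u * ia (m + k)%nat)) n) (Ltail m u)).
  { unfold Ltail. apply (is_lim_seq_ext (fun n => Rsum (fun k => ln (1 + exp u * ia k)) (n + m) - Rsum (fun k => ln (1 + exp u * ia k)) m)).
    - intros n. rewrite Nat.add_comm, Rsum_plus. ring.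
    - apply (is_lim_seq_minus' _ _ (L u)); [| apply is_lim_seq_const].
      apply (is_lim_seq_incr_n (Rsum (fun k => ln (1 + exp u * ia k))) m). apply HL. }
  assert (Gle := fun B H => is_lim_seq_le _ (fun _ => B) _ B H Hlim (is_lim_seq_const B)).
  assert (Gge := fun B H => is_lim_seq_le (fun _ => B) _ B _ H (is_lim_seq_const B) Hlim).
  simpl in Gle, Gge. repeat split.
  - apply Gge. intros n. apply (G n).
  - apply Gle. intros n. apply (G n).
  - apply Gle. intros n. apply (G n).
Qed.

Lemma ccont_kernel s k : ccont (fun u => Cexp (- s * u) * RtoC (ln (1 + exp u * ia k)))%C.
Proof.
  apply ccont_mult; [apply ccont_Cexp_line |]. apply ccont_RtoC. intros x. apply continuous_ln_1p_exp. left. apply Hpos.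
Qed.

Lemma continuous_defect u : continuous defect u.
Proof.
  unfold defect. apply (continuous_minus (fun u => L (u + om)) (fun u => 3 * L u)).
  - apply (continuous_comp (fun u => u + om) L); [| apply HLc].
    apply (@ex_derive_continuous R_AbsRing R_NormedModule). auto_derive. trivial.
  - apply (continuous_scal_r 3 L). apply HLc.
Qed.

(** A translation of [u] by [ln (ia k)] multiplies the transform by [ia k ^ s], one by
    [om] multiplies it by [exp (om * s)]. *)
Lemma kernel_transform s K k : line_integral (fun u => Cexp (- s * u) * RtoC (ln (1 + exp u)))%C K ->
  line_integral (fun u => Cexp (- s * u) * RtoC (ln (1 + exp (u + om) * ia k) - 3 * ln (1 + exp u * ia k)))%C
    ((Cexp (om * s) - 3) * K * zterm s k).
Proof.
  intros HK. set (l := ln (/ ia k)).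
  assert (Cf : ccont (fun u => Cexp (- s * u) * RtoC (ln (1 + exp u)))%C).
  { apply ccont_mult; [apply ccont_Cexp_line |]. apply ccont_RtoC. intros x.
    apply (continuous_ext (fun u => ln (1 + exp u * 1))); [intros; now rewrite Rmult_1_r | apply continuous_ln_1p_exp; lra]. }
  assert (El : exp (- l) = ia k).
  { unfold l. rewrite ln_Rinv, Ropp_involutive, exp_ln by apply Hpos. reflexivity. }
  assert (H1 : line_integral (fun u => Cexp (- s * u) * RtoC (ln (1 + exp u * ia k)))%C (zterm s k * K)).
  { apply (line_integral_ext (fun u => zterm s k * (Cexp (- s * RtoC (u + - l)) * RtoC (ln (1 + exp (u + - l)))))%C).
    - intros u. rewrite exp_plus, El, Cmult_assoc. f_equal. unfold zterm, Cpower. fold l. rewrite <- Cexp_plus.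
      f_equal. rewrite RtoC_plus, RtoC_opp. ring.
    - apply line_integral_scal; [| now apply (line_integral_shift (fun u => Cexp (- s * u) * RtoC (ln (1 + exp u)))%C)].
      now apply (ccont_shift (fun u => Cexp (- s * u) * RtoC (ln (1 + exp u)))%C). }
  assert (C1 := ccont_kernel s k).
  apply (line_integral_ext (fun u => Cexp (om * s) * (Cexp (- s * RtoC (u + om)) * RtoC (ln (1 + exp (u + om) * ia k)))
    + - RtoC 3 * (Cexp (- s * u) * RtoC (ln (1 + exp u * ia k))))%C).
  { intros u. rewrite RtoC_minus, RtoC_mult, Cmult_assoc, <- Cexp_plus.
    replace (om * s + - s * RtoC (u + om))%C with (- s * u)%C by (rewrite RtoC_plus; ring). ring. }
  replace ((Cexp (om * s) - 3) * K * zterm s k)%C with (Cexp (om * s) * (zterm s k * K) + - RtoC 3 * (zterm s k * K))%C by ring.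
  assert (C2 := ccont_shift _ om C1). assert (H2 := line_integral_shift _ om _ C1 H1).
  apply line_integral_plus.
  - now apply ccont_mult; [apply ccont_const |].
  - now apply ccont_mult; [apply ccont_const |].
  - exact (line_integral_scal _ _ _ C2 H2).
  - exact (line_integral_scal _ _ _ C1 H1).
Qed.

(** Summing the transforms of the single factors; the tails are controlled by
    [e ^ u] on the left and [e ^ (3 u / 4)] on the right. *)
Lemma defect_transform s : 3 / 4 < Re s < 1 -> exists X,
  line_integral (fun u => Cexp (- s * u) * RtoC (defect u))%C X /\
  (X * (Csin (PI * s) * s) = (Cexp (om * s) - 3) * PI * zsum s)%C.
Proof.
  intros Hr. destruct (log_transform s ltac:(lra)) as (K & HK & EK).
  set (kap := Rmin (Re s - 3 / 4) (1 - Re s)).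
  assert (Hk : 0 < kap) by (apply Rmin_pos; lra).
  assert (Hk1 : kap <= Re s - 3 / 4) by apply Rmin_l. assert (Hk2 : kap <= 1 - Re s) by apply Rmin_r.
  set (g := fun k u => (Cexp (- s * RtoC u) * RtoC (ln (1 + exp (u + om) * ia k) - 3 * ln (1 + exp u * ia k)))%C).
  assert (Cg : forall k, ccont (g k)).
  { intros k. apply ccont_mult; [apply ccont_Cexp_line |]. apply ccont_RtoC. intros x.
    apply (continuous_minus (fun u => ln (1 + exp (u + om) * ia k)) (fun u => 3 * ln (1 + exp u * ia k))).
    - apply (continuous_comp (fun u => u + om) (fun u => ln (1 + exp u * ia k))).
      + apply (@ex_derive_continuous R_AbsRing R_NormedModule). auto_derive. trivial.
      + apply continuous_ln_1p_exp. left; apply Hpos.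
    - apply (continuous_scal_r 3 (fun u => ln (1 + exp u * ia k))). apply continuous_ln_1p_exp. left; apply Hpos. }
  set (c := ((Cexp (om * s) - 3) * K)%C).
  assert (Wg : forall k, line_integral (g k) (c * zterm s k)) by (intros; now apply kernel_transform).
  assert (Wsum := fun m => line_integral_Csum g _ m Cg Wg).
  assert (Cd : ccont (fun u => Cexp (- s * u) * RtoC (defect u))%C).
  { apply ccont_mult; [apply ccont_Cexp_line | apply ccont_RtoC, continuous_defect]. }
  (* What the first [m] factors leave: it decays on both sides, with a constant of
     order [1 / sqrt m]. *)
  set (rem := fun m u => (Cexp (- s * RtoC u) * RtoC (defect u) + - (1) * Csum (fun k => g k u) m)%C).
  assert (CR : forall m, ccont (rem m)).
  { intros m. apply ccont_plus; trivial. apply ccont_mult; [apply ccont_const | now apply ccont_Csum]. }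
  assert (ER : forall m u, rem m u = (Cexp (- s * RtoC u) * RtoC (Ltail m (u + om) - 3 * Ltail m u))%C).
  { intros m u. unfold rem, g, Ltail, defect. rewrite Csum_scal, <- RtoC_Rsum.
    assert (E : forall (f h : nat -> R), Rsum (fun k => f k - 3 * h k) m = Rsum f m - 3 * Rsum h m).
    { intros f h. induction m; simpl; [ring |]. rewrite IHm. ring. }
    rewrite E. rewrite !RtoC_minus, !RtoC_mult, !RtoC_minus. ring. }
  set (B := fun m => (exp om + 3) * (6 / sqrt (INR m))).
  assert (HB : forall m, (0 < m)%nat -> 0 <= B m).
  { intros m Hm. apply Rmult_le_pos; [generalize (exp_pos om); lra |]. left. apply Rdiv_lt_0_compat; [lra | apply sqrt_lt_R0, lt_0_INR; trivial]. }
  assert (HR : forall m u, (0 < m)%nat -> Cmod (rem m u) <= B m * exp (- kap * Rabs u)).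
  { intros m u Hm. rewrite ER, Cmod_mult, Cmod_Cexp_line, Cmod_R, Re_opp.
    destruct (Ltail_bound m u Hm) as [[A1 A2] A3]. destruct (Ltail_bound m (u + om) Hm) as [[D1 D2] D3].
    assert (Hq : 0 < 6 / sqrt (INR m)) by (apply Rdiv_lt_0_compat; [lra | apply sqrt_lt_R0, lt_0_INR; trivial]).
    unfold B. set (t := 6 / sqrt (INR m)) in *. assert (Hom0 := om_pos).
    assert (G : forall sg, 0 < sg <= 1 -> Ltail m u <= t * exp (sg * u) -> Ltail m (u + om) <= t * exp (sg * (u + om)) ->
      exp (- Re s * u) * Rabs (Ltail m (u + om) - 3 * Ltail m u) <= (exp om + 3) * t * exp ((sg - Re s) * u)).
    { intros sg Hsg G1 G2.
      replace ((sg - Re s) * u) with (- Re s * u + sg * u) by ring. rewrite exp_plus.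
      replace ((exp om + 3) * t * (exp (- Re s * u) * exp (sg * u))) with (exp (- Re s * u) * ((exp om + 3) * t * exp (sg * u))) by ring.
      apply Rmult_le_compat_l; [left; apply exp_pos |].
      rewrite Rmult_plus_distr_l, exp_plus in G2.
      assert (exp (sg * om) <= exp om) by (apply exp_le_mono; nra).
      assert (0 < t * exp (sg * u)) by (apply Rmult_lt_0_compat; [trivial | apply exp_pos]).
      assert (t * (exp (sg * u) * exp (sg * om)) <= t * exp (sg * u) * exp om) by (rewrite <- Rmult_assoc; apply Rmult_le_compat_l; lra).
      apply Rabs_le. split; nra. }
    destruct (Rle_dec 0 u) as [Hu | Hu].
    - rewrite (Rabs_pos_eq u) by trivial. eapply Rle_trans; [apply (G (3 / 4)); [lra | trivial | trivial] |].
      apply Rmult_le_compat_l; [apply Rmult_le_pos; [generalize (exp_pos om); lra | lra] |]. apply exp_le_mono. nra.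
    - rewrite (Rabs_left u) by lra. eapply Rle_trans; [apply (G 1); [lra | rewrite Rmult_1_l; trivial | rewrite Rmult_1_l; trivial] |].
      apply Rmult_le_compat_l; [apply Rmult_le_pos; [generalize (exp_pos om); lra | lra] |]. apply exp_le_mono. nra. }
  assert (HR1 : forall m u, (0 < m)%nat -> 0 <= u -> Cmod (rem m u) <= B m * exp (- kap * u)).
  { intros m u Hm Hu. rewrite <- (Rabs_pos_eq u) at 2 by trivial. now apply HR. }
  assert (HR2 : forall m u, (0 < m)%nat -> 0 <= u -> Cmod (rem m (- u)) <= B m * exp (- kap * u)).
  { intros m u Hm Hu. rewrite <- (Rabs_pos_eq u) at 2 by trivial. rewrite <- Rabs_Ropp. now apply HR. }
  assert (WR : forall m, (0 < m)%nat -> exists y, line_integral (rem m) y /\ Cmod y <= 2 * B m / kap).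
  { intros m Hm.
    destruct (half_line_integral_exists (rem m) (B m) kap (CR m) Hk (HB m Hm) (fun u => HR1 m u Hm)) as (l1 & H1 & H1').
    destruct (half_line_integral_exists (fun v => rem m (- v)) (B m) kap (ccont_opp _ (CR m)) Hk (HB m Hm) (fun u => HR2 m u Hm)) as (l2 & H2 & H2').
    exists (l1 + l2)%C. split; [now exists l1, l2 |]. eapply Rle_trans; [apply Cmod_triangle |]. lra. }
  destruct (WR 1%nat ltac:(lia)) as (y1 & Hy1 & _).
  set (X := (y1 + Csum (fun k => c * zterm s k) 1)%C).
  assert (HX : line_integral (fun u => Cexp (- s * u) * RtoC (defect u))%C X).
  { apply (line_integral_ext (fun u => rem 1%nat u + Csum (fun k => g k u) 1)%C); [intros u; unfold rem; ring |].
    apply line_integral_plus; trivial. now apply ccont_Csum. }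
  exists X. split; trivial.
  assert (EX : X = (c * zsum s)%C).
  { apply (Clim_unique (fun m => Csum (fun k => c * zterm s k)%C m)).
    - intros eps Heps. set (e := eps * kap / (13 * (exp om + 3))).
      assert (Hep := exp_pos om).
      assert (He : 0 < e) by (apply Rdiv_lt_0_compat; nra).
      destruct (inv_sqrt_small e He) as (N & HN & HNe). exists N. intros n Hn.
      destruct (WR n ltac:(lia)) as (y & Hy & Hyb).
      assert (Ey : y = (X + - (1) * Csum (fun k => c * zterm s k) n)%C).
      { eapply line_integral_unique; [exact Hy |]. apply line_integral_plus; trivial.
        - apply ccont_mult; [apply ccont_const | now apply ccont_Csum].
        - apply line_integral_scal; trivial. now apply ccont_Csum. }
      replace (Csum (fun k => c * zterm s k) n - X)%C with (- y)%C by (rewrite Ey; ring).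
      rewrite Cmod_opp. eapply Rle_lt_trans; [exact Hyb |].
      apply (Rlt_div_l _ eps); trivial. unfold B.
      assert (/ sqrt (INR n) <= e).
      { eapply Rle_trans; [| exact HNe]. apply Rinv_le_contravar; [apply sqrt_lt_R0, lt_0_INR; trivial |].
        apply sqrt_le_1_alt. now apply le_INR. }
      replace (2 * ((exp om + 3) * (6 / sqrt (INR n)))) with (12 * (exp om + 3) * / sqrt (INR n)) by (field; apply Rgt_not_eq, sqrt_lt_R0, lt_0_INR; lia).
      apply Rle_lt_trans with (12 * (exp om + 3) * e); [apply Rmult_le_compat_l; lra |].
      unfold e. replace (12 * (exp om + 3) * (eps * kap / (13 * (exp om + 3)))) with (12 / 13 * (eps * kap)) by (field; lra). nra.
    - apply (Clim_ext (fun m => c * Csum (zterm s) m)%C); [intros; now rewrite Csum_scal |].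
      apply Clim_scal, zsum_lim. lra. }
  rewrite EX. unfold c.
  replace ((Cexp (om * s) - 3) * K * zsum s * (Csin (PI * s) * s))%C
    with ((Cexp (om * s) - 3) * (Csin (PI * s) * s * K) * zsum s)%C by ring.
  now rewrite EK.
Qed.

End Dirichlet.

(** * Meromorphic continuation *)

Definition laplace (g : R -> R) (s : C) : C :=
  epsilon (inhabits (RtoC 0)) (half_line_integral (fun v => Cexp (s * v) * RtoC (g v))%C).

Section Laplace.

Variables (g : R -> R) (K kap : R).
Hypothesis Hg : forall u, continuous g u.
Hypothesis HK : 0 <= K.
Hypothesis Hdec : forall u, 0 <= u -> Rabs (g u) <= K * exp (- kap * u).

Lemma ccont_laplace s : ccont (fun v => Cexp (s * v) * RtoC (g v))%C.
Proof. apply ccont_mult; [apply ccont_Cexp_line | now apply ccont_RtoC]. Qed.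

Lemma laplace_moment n s : Re s < kap -> exists l,
  half_line_integral (fun v => RtoC (v ^ n) * (Cexp (s * v) * RtoC (g v)))%C l.
Proof.
  intros H. set (eta := (kap - Re s) / 2). assert (He : 0 < eta) by (unfold eta; lra).
  assert (Cf : ccont (fun v => RtoC (v ^ n) * (Cexp (s * v) * RtoC (g v)))%C).
  { apply ccont_mult; [| apply ccont_laplace]. apply ccont_RtoC. intros x.
    apply (@ex_derive_continuous R_AbsRing R_NormedModule). auto_derive. trivial. }
  set (e := eta / (INR n + 1)). assert (Hn := pos_INR n).
  assert (Hee : 0 < e) by (apply Rdiv_lt_0_compat; lra).
  destruct (half_line_integral_exists _ ((/ e) ^ n * K) eta Cf He) as (l & Hl & _); [| | now exists l].
  - apply Rmult_le_pos; trivial. apply pow_le. left. now apply Rinv_0_lt_compat.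
  - intros u Hu. rewrite !Cmod_mult, Cmod_Cexp_line, !Cmod_R, Rabs_pos_eq by now apply pow_le.
    assert (B : u ^ n <= (/ e) ^ n * exp (eta * u)).
    { apply Rle_trans with ((/ e * exp (e * u)) ^ n).
      - apply pow_incr. split; trivial. now apply exp_times_bound.
      - rewrite Rpow_mult_distr, <- exp_INR. apply Rmult_le_compat_l.
        + apply pow_le. left. now apply Rinv_0_lt_compat.
        + apply exp_le_mono. rewrite <- Rmult_assoc. apply Rmult_le_compat_r; trivial.
          unfold e. replace (INR n * (eta / (INR n + 1))) with (eta * (INR n / (INR n + 1))) by (field; lra).
          assert (INR n / (INR n + 1) <= 1) by (apply Rle_div_l; lra). nra. }
    replace ((/ e) ^ n * K * exp (- eta * u)) with ((/ e) ^ n * exp (eta * u) * (exp (Re s * u) * (K * exp (- kap * u)))).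
    + apply Rmult_le_compat; [now apply pow_le | | exact B |].
      * apply Rmult_le_pos; [left; apply exp_pos | apply Rabs_pos].
      * apply Rmult_le_compat_l; [left; apply exp_pos | now apply Hdec].
    + replace (- eta * u) with (eta * u + Re s * u + - kap * u) by (unfold eta; field). rewrite !exp_plus. ring.
Qed.

Lemma laplace_isH s : Re s < kap -> half_line_integral (fun v => Cexp (s * v) * RtoC (g v))%C (laplace g s).
Proof.
  intros H. unfold laplace. apply epsilon_spec. destruct (laplace_moment 0 s H) as [l Hl].
  exists l. revert Hl. apply half_line_integral_ext. intros v. simpl. ring.
Qed.

(** Expand [exp (h * v)] to second order under the integral; the third moments are
    finite because of the exponential decay. *)
Lemma laplace_cubic a : Re a < kap -> exists c d, cubic (laplace g) a c d.
Proof.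
  intros Ha. destruct (laplace_moment 1 a Ha) as [c Hc]. destruct (laplace_moment 2 a Ha) as [d Hd].
  (* The margin [4 * eta] of decay pays for [v ^ 3], for [exp (h * v)] and for the
     convergence of the integral. *)
  set (eta := (kap - Re a) / 4). assert (He : 0 < eta) by (unfold eta; lra).
  exists c, (/ 2 * d)%C. exists eta, ((3 / eta) ^ 3 * K / eta).
  assert (H3 : 0 <= (3 / eta) ^ 3) by (apply pow_le; left; apply Rdiv_lt_0_compat; lra).
  split; [trivial | split].
  { apply Rmult_le_pos; [apply Rmult_le_pos; trivial | left; now apply Rinv_0_lt_compat]. }
  intros h Hh. assert (Hh0 := Cmod_ge_0 h).
  assert (Hah : Re (a + h) < kap).
  { assert (B := re_le_Cmod h). apply Rabs_le_between in B. change (Re (a + h)) with (Re a + Re h). unfold eta in *. lra. }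
  set (f := fun v => (Cexp (a * RtoC v) * RtoC (g v))%C).
  assert (Cf : ccont f) by apply ccont_laplace.
  assert (Cp : forall n, ccont (fun v => RtoC (v ^ n) * f v)%C).
  { intros n. apply ccont_mult; trivial. apply ccont_RtoC. intros x.
    apply (@ex_derive_continuous R_AbsRing R_NormedModule). auto_derive. trivial. }
  set (big := fun v : R => (Cexp ((a + h) * v) * RtoC (g v) + (- (1)) * f v + (- h) * (RtoC (v ^ 1) * f v) + (- h ^ 2 / 2) * (RtoC (v ^ 2) * f v))%C).
  assert (H : ccont big /\ half_line_integral big
    (laplace g (a + h) + (- (1)) * laplace g a + (- h) * c + (- h ^ 2 / 2) * d)%C).
  { set (f0 := fun v : R => (Cexp ((a + h) * v) * RtoC (g v))%C).
    assert (C0 : ccont f0) by apply ccont_laplace.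
    assert (Cs : forall (k : C) F, ccont F -> ccont (fun v : R => k * F v)%C).
    { intros k F HF. apply ccont_mult; [apply ccont_const | exact HF]. }
    assert (C1 := Cs (- (1))%C _ Cf). assert (C2 := Cs (- h)%C _ (Cp 1%nat)).
    assert (C3 := Cs (- h ^ 2 / 2)%C _ (Cp 2%nat)).
    assert (C4 := ccont_plus _ _ C0 C1). assert (C5 := ccont_plus _ _ C4 C2).
    assert (I0 : half_line_integral f0 (laplace g (a + h))) by (apply laplace_isH; exact Hah).
    assert (I1 : half_line_integral f (laplace g a)) by (apply laplace_isH; exact Ha).
    assert (J1 := half_line_integral_scal (- (1))%C _ _ Cf I1). assert (J2 := half_line_integral_scal (- h)%C _ _ (Cp 1%nat) Hc).
    assert (J3 := half_line_integral_scal (- h ^ 2 / 2)%C _ _ (Cp 2%nat) Hd).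
    split; [exact (ccont_plus _ _ C5 C3) |].
    exact (half_line_integral_plus _ _ _ _ C5 C3 (half_line_integral_plus _ _ _ _ C4 C2 (half_line_integral_plus _ _ _ _ C0 C1 I0 J1) J2) J3). }
  destruct H as [CH H].
  replace (laplace g (a + h) - laplace g a - c * h - / 2 * d * h ^ 2)%C
    with (laplace g (a + h) + - (1) * laplace g a + - h * c + - h ^ 2 / 2 * d)%C by cfield.
  replace ((3 / eta) ^ 3 * K / eta * Cmod h ^ 3) with (((3 / eta) ^ 3 * K * Cmod h ^ 3) / eta) by (unfold Rdiv; ring).
  refine (half_line_integral_bound _ _ _ _ _ He _ _ H).
  - exact CH.
  - apply Rmult_le_pos; [apply Rmult_le_pos; trivial | apply pow_le; trivial].
  - intros u Hu. unfold big.
    replace (Cexp ((a + h) * u) * g u + - (1) * f u + - h * (RtoC (u ^ 1) * f u) + - h ^ 2 / 2 * (RtoC (u ^ 2) * f u))%C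
      with (f u * (Cexp (h * u) - 1 - h * u - (h * u) ^ 2 / 2))%C.
    2:{ unfold f. rewrite Cmult_plus_distr_r, Cexp_plus, !RtoC_pow. cfield. }
    unfold f. rewrite !Cmod_mult, Cmod_Cexp_line, Cmod_R.
    assert (T := Cexp_taylor2 (h * u)). rewrite Cmod_mult, Cmod_R, Rabs_pos_eq in T by trivial.
    assert (B : u ^ 3 <= (3 / eta) ^ 3 * exp (eta * u)).
    { apply Rle_trans with ((/ (eta / 3) * exp (eta / 3 * u)) ^ 3).
      - apply pow_incr. split; trivial. apply exp_times_bound; trivial. lra.
      - rewrite Rpow_mult_distr, <- exp_INR. apply Req_le. f_equal; [f_equal; field; lra |].
        f_equal. simpl. field. }
    assert (T' : Cmod (Cexp (h * u) - 1 - h * u - (h * u) ^ 2 / 2) <= Cmod h ^ 3 * ((3 / eta) ^ 3 * exp (eta * u)) * exp (eta * u)).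
    { eapply Rle_trans; [exact T |]. rewrite Rpow_mult_distr. apply Rmult_le_compat.
      - apply Rmult_le_pos; apply pow_le; trivial.
      - left; apply exp_pos.
      - apply Rmult_le_compat_l; [apply pow_le; trivial | exact B].
      - apply exp_le_mono. nra. }
    apply Rle_trans with (exp (Re a * u) * (K * exp (- kap * u)) * (Cmod h ^ 3 * ((3 / eta) ^ 3 * exp (eta * u)) * exp (eta * u))).
    + apply Rmult_le_compat; [| apply Cmod_ge_0 | | exact T'].
      * apply Rmult_le_pos; [left; apply exp_pos | apply Rabs_pos].
      * apply Rmult_le_compat_l; [left; apply exp_pos | now apply Hdec].
    + replace (exp (Re a * u) * (K * exp (- kap * u)) * (Cmod h ^ 3 * ((3 / eta) ^ 3 * exp (eta * u)) * exp (eta * u)))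
        with ((3 / eta) ^ 3 * K * Cmod h ^ 3 * (exp (Re a * u) * exp (- kap * u) * exp (eta * u) * exp (eta * u))) by ring.
      rewrite <- !exp_plus. apply Rmult_le_compat_l.
      * apply Rmult_le_pos; [apply Rmult_le_pos; trivial | apply pow_le; trivial].
      * apply exp_le_mono. unfold eta. nra.
Qed.

End Laplace.

Lemma cubic_reflect f a c d : cubic f (- a) c d -> cubic (fun z => f (- z)%C) a (- c) d.
Proof.
  intros (r & M & Hr & HM & H). exists r, M. split; [trivial | split; [trivial |]]. intros h Hh.
  rewrite <- Cmod_opp in Hh. specialize (H (- h)%C Hh). rewrite Cmod_opp in H.
  replace (- (a + h))%C with (- a + - h)%C by ring.
  replace (f (- a + - h) - f (- a) - - c * h - d * h ^ 2)%C
    with (f (- a + - h) - f (- a) - c * - h - d * (- h) ^ 2)%C by ring. exact H.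
Qed.

Lemma Csin_pi_cubic a : exists c d, cubic (fun z => Csin (PI * z) / PI)%C a c d /\
  (a = RtoC 0 -> c = RtoC 1 /\ d = RtoC 0).
Proof.
  assert (NPI : RtoC PI <> RtoC 0) by (intros E; apply RtoC_inj in E; generalize PI_RGT_0; lra).
  assert (H := cubic_mult _ _ a _ _ _ _ (cubic_const (/ (2 * Ci * PI))%C a)
    (cubic_plus _ _ a _ _ _ _ (cubic_Cexp_scal (Ci * PI) a)
      (cubic_mult _ _ a _ _ _ _ (cubic_const (- (1))%C a) (cubic_Cexp_scal (- Ci * PI) a)))).
  eexists. eexists. split.
  - eapply cubic_ext; [| exact H]. exists 1. split; [lra |]. intros z _. cbv beta. unfold Csin.
    rewrite !Cmult_assoc. cfield.
  - intros ->. replace (Ci * PI * 0)%C with (RtoC 0) by ring. replace (- Ci * PI * 0)%C with (RtoC 0) by ring.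
    rewrite Cexp_0. split; cfield.
Qed.

(** Patched at 0, where it has to be differentiable with derivative 0. *)
Definition sinc : C -> C := patch 0 1 (fun z => (Csin (PI * z) / PI - Csin (PI * 0) / PI) / (z - 0))%C.

Lemma Csin_0 : Csin (PI * 0) = RtoC 0.
Proof.
  unfold Csin. replace (Ci * (PI * 0))%C with (RtoC 0) by ring. replace (- Ci * (PI * 0))%C with (RtoC 0) by ring.
  unfold Cdiv. ring.
Qed.

Lemma sinc_neq_0 z : z <> RtoC 0 -> sinc z = (Csin (PI * z) / (PI * z))%C.
Proof.
  intros H. unfold sinc. rewrite patch_off, Csin_0 by trivial.
  assert (NPI : RtoC PI <> RtoC 0) by (intros E; apply RtoC_inj in E; generalize PI_RGT_0; lra).
  field. split; trivial.
Qed.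

Lemma sinc_0 : sinc 0 = RtoC 1.
Proof. apply patch_at. Qed.

Lemma sinc_derive_0 : is_Cderive sinc (RtoC 0) (RtoC 0).
Proof.
  destruct (Csin_pi_cubic 0) as (c & d & H & E). destruct (E eq_refl) as [-> ->].
  exact (cubic_divided _ _ _ _ H).
Qed.

Lemma sinc_cubic a : a <> RtoC 0 -> exists c d, cubic sinc a c d.
Proof.
  intros Ha. destruct (Csin_pi_cubic a) as (c & d & H & _).
  assert (NPI : RtoC PI <> RtoC 0) by (intros E; apply RtoC_inj in E; generalize PI_RGT_0; lra).
  eexists. eexists. eapply cubic_ext; [| exact (cubic_mult _ _ _ _ _ _ _ H (cubic_inv a Ha))].
  exists (Cmod a). split; [now apply Cmod_gt_0 |]. intros z Hz. cbv beta.
  assert (Nz : z <> RtoC 0).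
  { intros ->. replace (0 - a)%C with (- a)%C in Hz by ring. rewrite Cmod_opp in Hz. lra. }
  rewrite sinc_neq_0 by trivial. field. split; trivial.
Qed.

Section Numerator.

Variables (E : R -> R) (a e0 : R).
Hypothesis HE : forall u, continuous E u.
Definition remainder (u : R) : R := E u - 2 * a * u - e0.
Hypothesis Hneg : exists K, 0 <= K /\ forall u, 0 <= u -> Rabs (E (- u)) <= K * exp (- 1 * u).
Hypothesis Hrem : forall kap, exists K, 0 <= K /\ forall u, 0 <= u -> Rabs (remainder u) <= K * exp (- kap * u).

(** What is left of the transform of [E] when the affine part at [+oo] is
    integrated in closed form. *)
Definition mellinJ (s : C) : C := (laplace (fun v => E (- v)%R) s + laplace remainder (- s))%C.
(** The product of the zeta function and its denominator: the factor
    [sin (PI * s) * s / PI] of the transform cancels the poles of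
    [2 * a / s ^ 2 + e0 / s] at 0. *)
Definition numer (s : C) : C := (sinc s * (s ^ 2 * mellinJ s + 2 * a + e0 * s))%C.

Lemma continuous_E_neg u : continuous (fun v => E (- v)) u.
Proof.
  apply (continuous_comp (fun v => - v) E); [| apply HE].
  apply (@ex_derive_continuous R_AbsRing R_NormedModule). auto_derive. trivial.
Qed.

Lemma continuous_remainder u : continuous remainder u.
Proof.
  unfold remainder. apply (continuous_ext (fun u => E u + ((-2 * a) * u + - e0))); [intros; simpl; ring |].
  apply (continuous_plus E); [apply HE | apply continuous_affine].
Qed.

Lemma mellinJ_cubic s : Re s < 1 -> exists c d, cubic mellinJ s c d.
Proof.
  intros Hs. destruct Hneg as (K & HK & H). destruct (Hrem (Re (- s) + 1)) as (K' & HK' & H').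
  destruct (laplace_cubic _ K 1 continuous_E_neg HK H s Hs) as (c & d & H1).
  destruct (laplace_cubic _ K' (Re (- s) + 1) continuous_remainder HK' H' (- s) ltac:(lra)) as (c' & d' & H2).
  eexists. eexists. apply cubic_plus; [exact H1 |]. apply cubic_reflect. exact H2.
Qed.

Lemma mellinJ_eq s X : 0 < Re s < 1 -> line_integral (fun u => Cexp (- s * u) * RtoC (E u))%C X ->
  X = (mellinJ s + 2 * a / s ^ 2 + e0 / s)%C.
Proof.
  intros Hs HX. apply (line_integral_unique _ _ _ HX).
  destruct Hneg as (K & HK & H). destruct (Hrem 1) as (K' & HK' & H').
  assert (Ns : s <> RtoC 0) by (intros ->; simpl in Hs; lra).
  exists (laplace remainder (- s) + ((2 * a) * / s ^ 2 + e0 * / s))%C, (laplace (fun v => E (- v)%R) s).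
  split; [| split].
  - apply (half_line_integral_ext (fun u => Cexp (- s * u) * RtoC (remainder u) + ((2 * a) * (RtoC u * Cexp (- s * u)) + e0 * Cexp (- s * u)))%C).
    { intros u. unfold remainder. rewrite !RtoC_minus, !RtoC_mult. ring. }
    assert (C1 : ccont (fun u => RtoC u * Cexp (- s * u))%C).
    { apply ccont_mult; [apply ccont_RtoC; intros; apply continuous_id | apply ccont_Cexp_line]. }
    assert (C2 := ccont_Cexp_line (- s)).
    apply half_line_integral_plus.
    + apply ccont_laplace, continuous_remainder.
    + apply ccont_plus; apply ccont_mult; trivial; apply ccont_const.
    + apply (laplace_isH _ K' 1); trivial; [apply continuous_remainder | rewrite Re_opp; lra].
    + apply half_line_integral_plus; try (apply ccont_mult; trivial; apply ccont_const).
      * apply half_line_integral_scal; trivial. apply half_line_integral_u_Cexp; lra.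
      * apply half_line_integral_scal; trivial. apply half_line_integral_Cexp; lra.
  - apply (half_line_integral_ext (fun v => Cexp (s * v) * RtoC (E (- v)))%C).
    { intros v. rewrite RtoC_opp. do 2 f_equal. ring. }
    apply (laplace_isH _ K 1); trivial; [apply continuous_E_neg | lra].
  - unfold mellinJ, Cdiv. ring.
Qed.

Lemma numer_cubic s : Re s < 1 -> s <> RtoC 0 -> exists c d, cubic numer s c d.
Proof.
  intros Hs Ns. destruct (mellinJ_cubic s Hs) as (c & d & H). destruct (sinc_cubic s Ns) as (c' & d' & H').
  eexists. eexists. apply cubic_mult; [exact H' |].
  apply cubic_plus; [apply cubic_plus |].
  - apply cubic_mult; [| exact H]. apply cubic_mult; [apply cubic_id |]. apply cubic_mult; [apply cubic_id | apply cubic_const].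
  - apply cubic_const.
  - apply cubic_mult; [apply cubic_const | apply cubic_id].
Qed.

Lemma numer_0 : numer 0 = (2 * a)%C.
Proof. unfold numer. rewrite sinc_0. ring. Qed.

Lemma numer_derive_0 : is_Cderive numer (RtoC 0) (RtoC e0).
Proof.
  destruct (mellinJ_cubic 0) as (c & d & H); [simpl; lra |]. apply cubic_derive in H.
  assert (G : is_Cderive (fun s => s ^ 2 * mellinJ s + 2 * a + e0 * s)%C (RtoC 0)
    (((1 * (0 * 1) + 0 * (1 * 1 + 0 * 0)) * mellinJ 0 + 0 * (0 * 1) * c) + 0 + (0 * 0 + e0 * 1))%C).
  { apply is_Cderive_plus; [apply is_Cderive_plus |].
    - apply (is_Cderive_mult (fun s => s ^ 2)%C mellinJ); trivial.
      apply (is_Cderive_mult (fun s => s) (fun s => s * 1)%C); [apply is_Cderive_id |].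
      apply (is_Cderive_mult (fun s => s) (fun s => 1)%C); [apply is_Cderive_id | apply is_Cderive_const].
    - apply is_Cderive_const.
    - apply (is_Cderive_mult (fun s => e0) (fun s => s)); [apply is_Cderive_const | apply is_Cderive_id]. }
  assert (G' := is_Cderive_mult sinc _ _ _ _ sinc_derive_0 G). cbv beta in G'. rewrite sinc_0 in G'.
  refine (eq_ind _ (fun l => is_Cderive (numer) (RtoC 0) l) G' _ _). match goal with |- ?x = ?y => change (@eq C x y) end. ring.
Qed.

End Numerator.

(** ** Dividing by [lambda ^ s - 3] *)

Section Quotient.

Variable om : R.
Hypothesis Hom : 2 * ln 3 <= om.

Definition denom (s : C) : C := (Cexp (om * s) - 3)%C.

Lemma denom_cubic s : exists d, cubic denom s (om * Cexp (om * s)) d.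
Proof.
  destruct (cubic_plus _ _ s _ _ _ _ (cubic_Cexp_scal om s) (cubic_const (- RtoC 3)%C s)) as (r & M & H).
  eexists. exists r, M. destruct H as (H1 & H2 & H3). split; [trivial | split; [trivial |]]. intros h Hh.
  specialize (H3 h Hh). cbv beta in H3. unfold denom.
  rewrite Cplus_0_r in H3. exact H3.
Qed.

Lemma denom_zero_Re s : denom s = RtoC 0 -> Re s = ln 3 / om /\ 0 < Re s < 3 / 4.
Proof.
  intros E. assert (H3 : 0 < ln 3) by (rewrite <- ln_1; apply ln_increasing; lra).
  assert (E' : Cexp (om * s) = RtoC 3).
  { replace (Cexp (om * s)) with (denom s + 3)%C by (unfold denom; ring). rewrite E. ring. }
  apply (f_equal Cmod) in E'. rewrite Cmod_Cexp, Cmod_R, Rabs_pos_eq in E' by lra.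
  apply (f_equal ln) in E'. rewrite ln_exp in E'.
  assert (E2 : om * Re s = ln 3) by (rewrite <- E'; unfold Re, Cmult, RtoC; simpl; ring).
  split; [rewrite <- E2; field; lra |]. split; [nra |].
  assert (om * Re s < om * (3 / 4)) by lra. nra.
Qed.

Lemma denom_simple s : denom s = RtoC 0 -> (om * Cexp (om * s))%C <> RtoC 0.
Proof.
  intros _. apply Cmult_neq_0; [| apply Cexp_neq_0]. intros E. apply RtoC_inj in E.
  assert (H3 : 0 < ln 3) by (rewrite <- ln_1; apply ln_increasing; lra). lra.
Qed.

(** The continuation of [S]: the quotient to the left of 1, with the removable
    singularities of the quotient removed. *)
Definition continuation (N S : C -> C) (s : C) : C :=
  if Rlt_dec (Re s) 1 then
    if excluded_middle_informative (denom s = RtoC 0)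
    then (C_derive N s / (om * Cexp (om * s)))%C
    else (N s / denom s)%C
  else S s.

Section Continuation.

Variables N S : C -> C.
Hypothesis HN : forall s, Re s < 1 -> s <> RtoC 0 -> exists c d, cubic N s c d.
Variable dN0 : C.
Hypothesis HN0 : is_Cderive N (RtoC 0) dN0.
Hypothesis HS : forall s, 3 / 4 < Re s -> exists l, is_Cderive S s l.
Hypothesis HNS : forall s, 3 / 4 < Re s < 1 -> (S s * denom s = N s)%C.

Lemma HN_derive s : Re s < 1 -> exists l, is_Cderive N s l.
Proof.
  intros Hs. destruct (classic (s = RtoC 0)) as [-> | Ns]; [now exists dN0 |].
  destruct (HN s Hs Ns) as (c & d & H). exists c. now apply cubic_derive in H.
Qed.

Lemma denom_derive s : is_Cderive denom s (om * Cexp (om * s))%C.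
Proof. destruct (denom_cubic s) as [d H]. now apply cubic_derive in H. Qed.

Lemma Re_near s z d : Cmod (z - s) < d -> Re s - d < Re z < Re s + d.
Proof. intros H. assert (B := Re_minus_le z s). apply Rabs_le_between in B. lra. Qed.

Lemma continuation_right s : 3 / 4 < Re s -> continuation N S s = S s.
Proof.
  intros Hs. unfold continuation. destruct (Rlt_dec (Re s) 1); trivial.
  destruct (excluded_middle_informative (denom s = RtoC 0)) as [E | NE].
  - apply denom_zero_Re in E. lra.
  - rewrite <- HNS by lra. field. trivial.
Qed.

Lemma continuation_left s : Re s < 1 -> denom s <> RtoC 0 -> continuation N S s = (N s / denom s)%C.
Proof.
  intros Hs NE. unfold continuation. destruct (Rlt_dec (Re s) 1); [| contradiction].
  destruct (excluded_middle_informative (denom s = RtoC 0)); [contradiction | trivial].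
Qed.

Lemma continuation_zero s : denom s = RtoC 0 -> continuation N S s = (C_derive N s / (om * Cexp (om * s)))%C.
Proof.
  intros E. assert (H := denom_zero_Re s E). unfold continuation. destruct (Rlt_dec (Re s) 1); [| lra].
  destruct (excluded_middle_informative (denom s = RtoC 0)); [trivial | contradiction].
Qed.

Lemma continuation_derive_left s : Re s < 1 -> denom s <> RtoC 0 ->
  forall l, is_Cderive N s l -> is_Cderive (continuation N S) s ((l * denom s - N s * (om * Cexp (om * s))) / denom s ^ 2)%C.
Proof.
  intros Hs NE l Hl.
  destruct (is_Cderive_nonzero denom s _ (denom_derive s) NE) as (d & Hd & Hnz).
  apply (is_Cderive_ext (fun z => N z / denom z)%C).
  - exists (Rmin d (1 - Re s)). split; [apply Rmin_pos; lra |]. intros z Hz.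
    assert (Cmod (z - s) < d) by (eapply Rlt_le_trans; [exact Hz | apply Rmin_l]).
    assert (Hz2 : Cmod (z - s) < 1 - Re s) by (eapply Rlt_le_trans; [exact Hz | apply Rmin_r]).
    apply Re_near in Hz2. symmetry. apply continuation_left; [lra | now apply Hnz].
  - apply is_Cderive_div; trivial. apply denom_derive.
Qed.

Lemma continuation_derive s : 3 / 4 < Re s \/ Re s < 1 /\ denom s <> RtoC 0 ->
  exists l, is_Cderive (continuation N S) s l.
Proof.
  intros [Hs | [Hs NE]].
  - destruct (HS s Hs) as [l Hl]. exists l. apply (is_Cderive_ext S); trivial.
    exists (Re s - 3 / 4). split; [lra |]. intros z Hz. apply Re_near in Hz.
    symmetry. apply continuation_right. lra.
  - destruct (HN_derive s Hs) as [l Hl]. eexists. exact (continuation_derive_left s Hs NE l Hl).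
Qed.

Lemma continuation_regular s : 3 / 4 < Re s \/ Re s < 1 /\ denom s <> RtoC 0 ->
  holomorphic_at (continuation N S) s.
Proof.
  intros H. apply holomorphic_at_intro. destruct H as [Hs | [Hs NE]].
  - exists (Re s - 3 / 4). split; [lra |]. intros z Hz. apply Re_near in Hz.
    apply continuation_derive. left. lra.
  - destruct (is_Cderive_nonzero denom s _ (denom_derive s) NE) as (d & Hd & Hnz).
    exists (Rmin d (1 - Re s)). split; [apply Rmin_pos; lra |]. intros z Hz.
    assert (Cmod (z - s) < d) by (eapply Rlt_le_trans; [exact Hz | apply Rmin_l]).
    assert (Hz2 : Cmod (z - s) < 1 - Re s) by (eapply Rlt_le_trans; [exact Hz | apply Rmin_r]).
    apply Re_near in Hz2. apply continuation_derive. right. split; [lra | now apply Hnz].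
Qed.

Lemma denom_isolated s : denom s = RtoC 0 -> exists d, 0 < d /\ Re s + d <= 1 /\
  forall z, Cmod (z - s) < d -> z <> s -> denom z <> RtoC 0.
Proof.
  intros E. destruct (denom_cubic s) as [d2 Hc].
  destruct (cubic_quadratic _ _ _ _ Hc) as (r & M & Hr & HM & H).
  assert (Hk := denom_simple s E). apply Cmod_gt_0 in Hk. set (k := (om * Cexp (om * s))%C) in *.
  assert (Hre := denom_zero_Re s E).
  exists (Rmin (Rmin r (1 - Re s)) (Cmod k / (2 * (M + 1)))). split; [| split].
  - repeat apply Rmin_pos; try lra. apply Rdiv_lt_0_compat; lra.
  - generalize (Rmin_l (Rmin r (1 - Re s)) (Cmod k / (2 * (M + 1)))) (Rmin_r r (1 - Re s)). lra.
  - intros z Hz Nz.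
    assert (Hz1 : Cmod (z - s) < r).
    { generalize (Rmin_l (Rmin r (1 - Re s)) (Cmod k / (2 * (M + 1)))) (Rmin_l r (1 - Re s)). lra. }
    assert (Hz2 : Cmod (z - s) * (2 * (M + 1)) < Cmod k).
    { apply Rlt_div_r; [lra |]. generalize (Rmin_r (Rmin r (1 - Re s)) (Cmod k / (2 * (M + 1)))). lra. }
    specialize (H _ Hz1). rewrite (Cplus_minus_r s z), E in H. intros E0. rewrite E0 in H.
    replace (0 - 0 - k * (z - s))%C with (- (k * (z - s)))%C in H by ring.
    rewrite Cmod_opp, Cmod_mult in H.
    assert (0 < Cmod (z - s)).
    { apply Cmod_gt_0. intros E1. apply Nz. rewrite <- (Cplus_minus_r s z), E1. ring. }
    simpl in H. nra.
Qed.

(** The zeros of the denominator are simple. *)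
Lemma divided_denom s : denom s = RtoC 0 ->
  exists g, holomorphic_at g s /\ g s <> RtoC 0 /\ g s = (om * Cexp (om * s))%C /\
    (forall z, z <> s -> g z = (denom z / (z - s))%C) /\
    (exists l, is_Cderive g s l) /\ exists d, 0 < d /\ forall z, Cmod (z - s) < d -> g z <> RtoC 0 /\ exists l, is_Cderive g z l.
Proof.
  intros E. destruct (denom_cubic s) as [d2 Hc]. assert (Hd := cubic_divided _ _ _ _ Hc).
  set (g := patch s (om * Cexp (om * s)) (fun z => (denom z - denom s) / (z - s))%C) in *.
  assert (Hgz : forall z, z <> s -> g z = (denom z / (z - s))%C).
  { intros z Hz. unfold g. rewrite patch_off, E by trivial. f_equal. ring. }
  assert (Hgs : g s = (om * Cexp (om * s))%C) by apply patch_at.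
  assert (Hnz : g s <> RtoC 0) by (rewrite Hgs; now apply denom_simple).
  destruct (is_Cderive_nonzero g s _ Hd Hnz) as (r & Hr & Hrz).
  assert (Hall : forall z, Cmod (z - s) < r -> exists l, is_Cderive g z l).
  { intros z Hz. destruct (classic (z = s)) as [-> | Nz]; [now exists d2 |].
    assert (Hzs : 0 < Cmod (z - s)).
    { apply Cmod_gt_0. intros E1. apply Nz. rewrite <- (Cplus_minus_r s z), E1. ring. }
    eexists. apply (is_Cderive_ext (fun z => denom z / (z - s))%C).
    - exists (Cmod (z - s)). split; trivial. intros y Hy. symmetry. apply Hgz. intros ->.
      replace (s - z)%C with (- (z - s))%C in Hy by ring. rewrite Cmod_opp in Hy. lra.
    - apply is_Cderive_div; [apply denom_derive | | now apply Cmod_gt_0].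
      apply (is_Cderive_plus (fun z => z) (fun _ => - s)%C); [apply is_Cderive_id | apply is_Cderive_const]. }
  exists g. repeat split; trivial.
  - apply holomorphic_at_intro. now exists r.
  - now exists d2.
  - exists r. split; trivial. intros z Hz. split; [now apply Hrz | now apply Hall].
Qed.

(** A simple pole: divide the denominator by [z - s]. *)
Lemma continuation_pole s : denom s = RtoC 0 -> N s <> RtoC 0 -> pole (continuation N S) s.
Proof.
  intros E HNs. destruct (divided_denom s E) as (g & Hg & Hg0 & _ & Hgz & _ & d & Hd & Hgd).
  destruct (denom_isolated s E) as (d' & Hd' & Hd1 & Hiso).
  exists 1%nat, (fun z => N z / g z)%C. split; [lia | split; [| split]].
  - apply holomorphic_at_intro. exists (Rmin d d'). split; [now apply Rmin_pos |]. intros z Hz.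
    assert (Hz1 : Cmod (z - s) < d) by (eapply Rlt_le_trans; [exact Hz | apply Rmin_l]).
    assert (Hz2 : Cmod (z - s) < d') by (eapply Rlt_le_trans; [exact Hz | apply Rmin_r]).
    destruct (Hgd z Hz1) as [Hn [l Hl]]. apply Re_near in Hz2.
    destruct (HN_derive z ltac:(lra)) as [l' Hl']. eexists. now apply is_Cderive_div; [exact Hl' | exact Hl |].
  - unfold Cdiv. apply Cmult_neq_0; trivial. intros E1.
    apply (f_equal (fun x => x * g s)%C) in E1. rewrite Cinv_l in E1 by trivial.
    replace (0 * g s)%C with (RtoC 0) in E1 by ring. apply RtoC_inj in E1. lra.
  - apply locally'_Cmod. exists d'. split; trivial. intros z Hz Nz.
    assert (Hz' := Re_near _ _ _ Hz). rewrite continuation_left by (try lra; now apply Hiso).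
    assert (Hn := Hiso z Hz Nz). rewrite Hgz by trivial.
    assert (z - s <> 0)%C. { intros E1. apply Nz. rewrite <- (Cplus_minus_r s z), E1. ring. }
    simpl. field. repeat split; trivial.
Qed.

(** Divide numerator and denominator by [z - s]. *)
Lemma continuation_removable s : denom s = RtoC 0 -> N s = RtoC 0 -> holomorphic_at (continuation N S) s.
Proof.
  intros E HNs. destruct (divided_denom s E) as (g & Hg & Hg0 & Hgs & Hgz & (lg & Hlg) & d & Hd & Hgd).
  destruct (denom_isolated s E) as (d' & Hd' & Hd1 & Hiso). assert (Hre := denom_zero_Re s E).
  assert (Ns : s <> RtoC 0) by (intros ->; simpl in Hre; lra).
  destruct (HN s ltac:(lra) Ns) as (c & d2 & Hc).
  assert (Hdc := cubic_divided _ _ _ _ Hc).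
  set (n := patch s c (fun z => (N z - N s) / (z - s))%C) in *.
  apply holomorphic_at_intro. exists (Rmin d d'). split; [now apply Rmin_pos |]. intros z Hz.
  assert (Hz1 : Cmod (z - s) < d) by (eapply Rlt_le_trans; [exact Hz | apply Rmin_l]).
  assert (Hz2 : Cmod (z - s) < d') by (eapply Rlt_le_trans; [exact Hz | apply Rmin_r]).
  destruct (classic (z = s)) as [-> | Nz].
  - eexists. apply (is_Cderive_ext (fun z => n z / g z)%C); [| apply is_Cderive_div; [exact Hdc | exact Hlg | trivial]].
    exists d'. split; trivial. intros y Hy. destruct (classic (y = s)) as [-> | Ny].
    + rewrite continuation_zero, Hgs by trivial. unfold n. rewrite patch_at. f_equal.
      symmetry. apply is_C_derive_unique. now apply cubic_derive in Hc.
    + assert (Hy' := Re_near _ _ _ Hy). rewrite continuation_left by (try lra; now apply Hiso).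
      unfold n. rewrite patch_off, Hgz, HNs by trivial. assert (Hn := Hiso y Hy Ny).
      assert (y - s <> 0)%C. { intros E1. apply Ny. rewrite <- (Cplus_minus_r s y), E1. ring. }
      field. split; trivial.
  - apply continuation_derive. right. assert (Hz' := Re_near _ _ _ Hz2). split; [lra | now apply Hiso].
Qed.

Lemma continuation_meromorphic : meromorphic (continuation N S).
Proof.
  intros s. destruct (classic (denom s = RtoC 0)) as [E | NE].
  - destruct (classic (N s = RtoC 0)) as [H | H].
    + left. now apply continuation_removable. + right. now apply continuation_pole.
  - left. apply continuation_regular. destruct (Rlt_dec (Re s) 1); [right; tauto | left; lra].
Qed.

End Continuation.
End Quotient.

(** * Growth of the products on the positive axis *)

Section LogProduct.

Variable ia : nat -> R.
Hypothesis Hs : sq_small ia.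
Hypothesis Hpos : forall k, 0 < ia k.

Definition logprod (u : R) : R := ln (Re (eprod ia (RtoC (exp u)))).

Lemma Cprod_exp u n :
  Cprod (fun k => 1 + RtoC (exp u) * RtoC (ia k))%C n = RtoC (exp (Rsum (fun k => ln (1 + exp u * ia k)) n)).
Proof.
  induction n; cbn [Cprod Rsum]; [now rewrite exp_0 |].
  rewrite IHn, exp_plus, RtoC_mult. f_equal. rewrite exp_ln, RtoC_plus, RtoC_mult; trivial.
  generalize (exp_pos u) (Hpos n). nra.
Qed.

Lemma log_term_pos u k : 0 <= ln (1 + exp u * ia k) <= exp u * ia k.
Proof. apply ln_1p_le. generalize (exp_pos u) (Hpos k). nra. Qed.

Lemma eprod_pos u : 1 <= Re (eprod ia (RtoC (exp u))).
Proof.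
  apply (lim_seq_ge_from _ _ 1 0 (Clim_Re _ _ (eprod_lim ia (RtoC (exp u)) Hs))). intros n _.
  rewrite Cprod_exp. change (1 <= exp (Rsum (fun k => ln (1 + exp u * ia k)) n)).
  rewrite <- exp_0 at 1. apply exp_le_mono, Rsum_pos. intros; apply log_term_pos.
Qed.

Lemma exp_logprod u : exp (logprod u) = Re (eprod ia (RtoC (exp u))).
Proof. unfold logprod. apply exp_ln. generalize (eprod_pos u). lra. Qed.

Lemma logprod_lim u : is_lim_seq (Rsum (fun k => ln (1 + exp u * ia k))) (logprod u).
Proof.
  assert (H := Clim_Re _ _ (eprod_lim ia (RtoC (exp u)) Hs)). assert (Hp := eprod_pos u).
  apply (is_lim_seq_continuous ln) in H.
  - revert H. apply is_lim_seq_ext. intros n. rewrite Cprod_exp. simpl Re. apply ln_exp.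
  - apply derivable_continuous_pt. exists (/ Re (eprod ia (RtoC (exp u)))). apply derivable_pt_lim_ln. lra.
Qed.

Lemma continuous_logprod u : continuous logprod u.
Proof.
  unfold logprod. assert (Hp := eprod_pos u).
  apply (continuous_comp (fun u => Re (eprod ia (RtoC (exp u)))) ln).
  - destruct (eprod_derive ia (RtoC (exp u)) Hs) as [l Hl].
    assert (Hc : continuous exp u) by (apply (@ex_derive_continuous R_AbsRing R_NormedModule); auto_derive; trivial).
    intros P HP. destruct HP as [eps HP].
    destruct (is_Cderive_continuous _ _ _ Hl eps (cond_pos eps)) as (d & Hd & H).
    assert (HN : locally (exp u) (fun y => Rabs (y - exp u) < d)) by (exists (mkposreal d Hd); intros y Hy; exact Hy).
    specialize (Hc _ HN). unfold filtermap in *. revert Hc. apply filter_imp. intros v Hv. apply HP.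
    change (Rabs (Re (eprod ia (RtoC (exp v))) - Re (eprod ia (RtoC (exp u)))) < eps).
    eapply Rle_lt_trans; [apply Re_minus_le | apply H]. now rewrite <- RtoC_minus, Cmod_R.
  - apply (@ex_derive_continuous R_AbsRing R_NormedModule). auto_derive. lra.
Qed.

Lemma logprod_upper u : 0 <= logprod u <= 2 * exp u.
Proof.
  split.
  - apply (lim_seq_ge_from _ _ 0 0 (logprod_lim u)). intros n _. apply Rsum_pos. intros; apply log_term_pos.
  - apply (lim_seq_le_from _ _ _ 0 (logprod_lim u)). intros n _.
    apply Rle_trans with (Rsum (fun k => exp u * ia k) n).
    + apply Rsum_le. intros; apply log_term_pos.
    + rewrite Rsum_scal. generalize (sq_small_sum ia n Hs) (exp_pos u). nra.
Qed.

(** The product contains [m] factors [1 + exp u * ia k] for every [m]. *)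
Lemma exp_logprod_lower kap : exists K, 0 <= K /\ forall u, 0 <= u -> exp (- logprod u) <= K * exp (- kap * u).
Proof.
  destruct (INR_unbounded kap) as [m Hm].
  exists (exp (- Rsum (fun k => ln (ia k)) m)). split; [left; apply exp_pos |]. intros u Hu.
  rewrite <- exp_plus. apply exp_le_mono.
  assert (H : INR m * u + Rsum (fun k => ln (ia k)) m <= logprod u).
  { apply (lim_seq_ge_from _ _ _ m (logprod_lim u)). intros n Hn.
    apply Rle_trans with (Rsum (fun k => ln (1 + exp u * ia k)) m).
    - clear Hn. assert (E : INR m * u + Rsum (fun k => ln (ia k)) m = Rsum (fun k => u + ln (ia k)) m).
      { clear Hm. induction m; [simpl; ring |]. cbn [Rsum]. rewrite <- IHm, S_INR. ring. }
      rewrite E. apply Rsum_le. intros k _. rewrite <- (ln_exp u) at 1.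
      rewrite <- ln_mult by (apply exp_pos || apply Hpos). left. apply ln_increasing; [| lra].
      apply Rmult_lt_0_compat; [apply exp_pos | apply Hpos].
    - replace n with (m + (n - m))%nat by lia. rewrite Rsum_plus.
      assert (0 <= Rsum (fun k => ln (1 + exp u * ia (m + k)%nat)) (n - m)) by (apply Rsum_pos; intros; apply log_term_pos).
      lra. }
  nra.
Qed.

Lemma defect_neg om : 0 <= om -> exists K, 0 <= K /\ forall u, 0 <= u -> Rabs (defect logprod om (- u)) <= K * exp (- 1 * u).
Proof.
  intros Hom. exists (2 * exp om + 6). split; [generalize (exp_pos om); lra |]. intros u Hu. unfold defect.
  assert (H1 := logprod_upper (- u + om)). assert (H2 := logprod_upper (- u)).
  rewrite exp_plus in H1. replace (- 1 * u) with (- u) by ring.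
  assert (H3 := exp_pos (- u)). assert (H4 := exp_pos om). apply Rabs_le. split; nra.
Qed.

End LogProduct.

Lemma list_of_zeros ia t : sq_small ia -> exists l, NoDup l /\ forall k, In k l <-> t * ia k = 1.
Proof.
  intros H. destruct (INR_unbounded (Rabs t + 1)) as [K HK].
  exists (filter (fun k => if Req_dec_T (t * ia k) 1 then true else false) (seq 0 K)). split.
  - apply NoDup_filter, seq_NoDup.
  - intros k. rewrite filter_In, in_seq. destruct (Req_dec_T (t * ia k) 1) as [E | N].
    + split; [trivial |]. intros _. split; trivial. assert (B := zero_index_bound ia t k H E).
      assert (k < K)%nat by (apply INR_lt; lra). lia.
    + split; [intros [_ F]; discriminate | contradiction].
Qed.

Section Zetas.

Variables (p q : R) (Phi : C -> C).
Hypothesis Hp : 0 < p < 1.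
Hypothesis Hq : q = 1 - p.
Hypothesis Hfun : forall z : C, Phi (RtoC (lambda p q) * z)%C = Rpoly p q (Phi z).
Hypothesis Hzero : Phi (RtoC 0) = RtoC 0.
Hypothesis Hder : is_Cderive Phi (RtoC 0) (RtoC 1).

Local Notation lam := (lambda p q).

(** The reciprocals of the positive [t] with [Phi (- t) = 0]; those of [ia4] belong to
    [Phi (- t) = - 4]. *)
Definition ia0 (k : nat) : R := iota p q 1 (S k).
Definition ia4 (k : nat) : R := iota p q (-1) k.
Definition om : R := ln lam.

Lemma ia0_small : sq_small ia0.
Proof. apply iota_sq_small; trivial. lra. Qed.
Lemma ia4_small : sq_small ia4.
Proof. now apply iota_m1_sq_small. Qed.
Lemma ia0_pos k : 0 < ia0 k.
Proof. apply iota_pos; trivial. right. split; [trivial | lia]. Qed.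
Lemma ia4_pos k : 0 < ia4 k.
Proof. apply iota_pos; trivial. left. lra. Qed.

Lemma om_ge : 2 * ln 3 <= om.
Proof.
  replace (2 * ln 3) with (ln (3 * 3)) by (rewrite ln_mult by lra; ring).
  assert (H := lambda_ge_9 p q Hp Hq). unfold om.
  destruct (Req_dec lam (3 * 3)) as [-> | N]; [lra |]. left. apply ln_increasing; lra.
Qed.

Lemma exp_om : exp om = lam.
Proof. apply exp_ln. generalize (lambda_ge_9 p q Hp Hq). lra. Qed.

Definition RpolyR (y : R) : R := 1 / (p * q) * y * (y ^ 2 / 4 + 3 * y / 2 + 2 + p * q).

Lemma Rpoly_real y : Rpoly p q (RtoC y) = RtoC (RpolyR y).
Proof.
  unfold Rpoly, RpolyR. assert (Hpq := pq_pos p q Hp Hq).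
  rewrite !RtoC_mult, !RtoC_plus, !RtoC_div, !RtoC_mult, RtoC_pow by lra. reflexivity.
Qed.

Lemma Phi_exp_fun u : Re (Phi (RtoC (exp (u + om)))) = RpolyR (Re (Phi (RtoC (exp u)))).
Proof.
  rewrite exp_plus, exp_om, Rmult_comm, RtoC_mult, Hfun.
  rewrite (Phi_real p q Phi Hp Hq Hfun Hzero Hder), Rpoly_real. reflexivity.
Qed.

Lemma Phi_exp_0 u : Re (Phi (RtoC (exp u))) = exp (u + logprod ia0 u).
Proof.
  rewrite (Phi_product p q Phi Hp Hq Hfun Hzero Hder), exp_plus, exp_logprod by (apply ia0_small || apply ia0_pos).
  fold ia0. rewrite (eprod_real _ (exp u) ia0_small), <- RtoC_mult. reflexivity.
Qed.

Lemma Phi_exp_4 u : Re (Phi (RtoC (exp u))) = 4 * (exp (logprod ia4 u) - 1).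
Proof.
  rewrite exp_logprod by (apply ia4_small || apply ia4_pos).
  assert (H : _ = eprod ia4 _) by exact (Phi_product_4 p q Phi Hp Hq Hfun Hzero Hder (RtoC (exp u))).
  rewrite <- H.
  rewrite (Phi_real p q Phi Hp Hq Hfun Hzero Hder). rewrite <- RtoC_div, <- RtoC_plus by lra. simpl Re. field.
Qed.

Lemma ln_ratio_bound w c : 0 < c <= 1 -> c <= w -> Rabs (ln w) <= Rabs (w - 1) / c.
Proof.
  intros Hc Hw. assert (0 < w) by lra.
  assert (H1 : ln w <= w - 1).
  { rewrite <- (ln_exp (w - 1)). assert (E := exp_ineq1_le (w - 1)).
    destruct (Req_dec w (exp (w - 1))) as [<- | N]; [lra |]. left. apply ln_increasing; lra. }
  assert (H2 : - ln w <= / w - 1).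
  { rewrite <- ln_Rinv by trivial. rewrite <- (ln_exp (/ w - 1)). assert (E := exp_ineq1_le (/ w - 1)).
    assert (0 < / w) by now apply Rinv_0_lt_compat.
    destruct (Req_dec (/ w) (exp (/ w - 1))) as [<- | N]; [lra |]. left. apply ln_increasing; lra. }
  apply (Rle_div_r _ (Rabs (w - 1))); [lra |].
  destruct (Rle_dec 1 w) as [G | G].
  - assert (0 <= ln w). { rewrite <- ln_1. destruct G as [G | <-]; [left; apply ln_increasing; lra | lra]. }
    rewrite !Rabs_pos_eq by lra. nra.
  - assert (ln w < 0). { rewrite <- ln_1. apply ln_increasing; lra. }
    rewrite !Rabs_left by lra.
    assert (E : (/ w - 1) * c <= 1 - w).
    { replace (/ w - 1) with ((1 - w) * / w) by (field; lra).
      assert (c * / w <= 1). { apply (Rle_div_l c); lra. }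
      rewrite Rmult_assoc, (Rmult_comm (/ w)). nra. }
    nra.
Qed.

Definition E0 : R -> R := defect (logprod ia0) om.
Definition E4 : R -> R := defect (logprod ia4) om.
(** The constant term at [+oo] of the defect; it contains [- om] because
    [Phi z] has the additional factor [z]. *)
Definition c0 : R := - ln (4 * (p * q)) - om.
Definition c4 : R := ln (4 / (p * q)).

(** Taking logarithms in the functional equation, [Rpoly] contributes the logarithm
    of its leading term, which is affine in [u] and [L u], and that of
    [1 + O(1 / Phi)], and [Phi] grows faster than every power. *)
Lemma E0_remainder kap : exists K, 0 <= K /\ forall u, 0 <= u -> Rabs (remainder E0 1 c0 u) <= K * exp (- kap * u).
Proof.
  destruct (exp_logprod_lower ia0 ia0_small ia0_pos kap) as (K & HK & H).
  assert (Hpq := pq_pos p q Hp Hq). assert (Hle := pq_le p q Hq).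
  exists (15 * K). split; [lra |]. intros u Hu. specialize (H u Hu).
  apply Rle_trans with (15 * exp (- logprod ia0 u)); [| nra].
  assert (F := Phi_exp_fun u). rewrite !Phi_exp_0 in F.
  set (L := logprod ia0 u) in *. set (Y := exp (u + L)) in *.
  assert (HY0 : 0 < Y) by apply exp_pos.
  assert (HL0 : 0 <= L) by (apply (logprod_upper ia0 ia0_small ia0_pos)).
  assert (HY1 : 1 <= Y). { unfold Y. rewrite <- exp_0. apply exp_le_mono. lra. }
  set (w := 1 + 6 / Y + (8 + 4 * (p * q)) / Y ^ 2).
  assert (Hi : 0 < / Y <= 1).
  { split; [now apply Rinv_0_lt_compat |]. rewrite <- Rinv_1. apply Rinv_le_contravar; lra. }
  assert (Ew : w - 1 = 6 * / Y + (8 + 4 * (p * q)) * (/ Y * / Y)) by (unfold w; field; lra).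
  assert (Hw : 0 <= w - 1 <= 15 * / Y) by (rewrite Ew; split; nra).
  assert (ER : RpolyR Y = w * (/ (4 * (p * q)) * (Y * (Y * Y)))).
  { unfold RpolyR, w. field. split; lra. }
  assert (Er : remainder E0 1 c0 u = ln w).
  { unfold remainder, E0, defect. fold L.
    apply (f_equal ln) in F. rewrite ln_exp, ER in F.
    assert (0 < / (4 * (p * q))) by (apply Rinv_0_lt_compat; lra).
    assert (0 < Y * Y) by nra. assert (0 < Y * (Y * Y)) by nra.
    rewrite !ln_mult in F; trivial; try lra; try (apply Rmult_lt_0_compat; trivial).
    rewrite ln_Rinv in F by lra. unfold Y in F. rewrite !ln_exp in F. fold L in F.
    unfold c0. lra. }
  rewrite Er. eapply Rle_trans; [apply (ln_ratio_bound w 1); lra |].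
  rewrite Rdiv_1_r, Rabs_pos_eq by lra. eapply Rle_trans; [apply Hw |]. apply Rmult_le_compat_l; [lra |].
  unfold Y. rewrite <- exp_Ropp. apply exp_le_mono. lra.
Qed.

(** As for [E0_remainder], now in terms of [1 + Phi / 4], which is the product itself;
    the quotient by the leading term is bounded below by [p * q / 4]. *)
Lemma E4_remainder kap : exists K, 0 <= K /\ forall u, 0 <= u -> Rabs (remainder E4 0 c4 u) <= K * exp (- kap * u).
Proof.
  destruct (exp_logprod_lower ia4 ia4_small ia4_pos kap) as (K & HK & H).
  assert (Hpq := pq_pos p q Hp Hq). assert (Hle := pq_le p q Hq).
  exists (3 / (p * q / 4) * K). assert (H3 : 0 < 3 / (p * q / 4)) by (apply Rdiv_lt_0_compat; lra).
  split; [nra |]. intros u Hu. specialize (H u Hu).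
  apply Rle_trans with (3 / (p * q / 4) * exp (- logprod ia4 u)); [| nra].
  assert (F := Phi_exp_fun u). rewrite !Phi_exp_4 in F.
  set (L := logprod ia4 u) in *. set (Y := exp L) in *.
  assert (HY0 : 0 < Y) by apply exp_pos.
  assert (HL0 : 0 <= L) by (apply (logprod_upper ia4 ia4_small ia4_pos)).
  assert (HY1 : 1 <= Y). { unfold Y. rewrite <- exp_0. now apply exp_le_mono. }
  set (w := 1 - 6 / 4 / Y + (2 + p * q) / 4 / Y ^ 2).
  assert (Hi : 0 < / Y <= 1).
  { split; [now apply Rinv_0_lt_compat |]. rewrite <- Rinv_1. apply Rinv_le_contravar; lra. }
  assert (Ew : w = 1 - 3 / 2 * / Y + (2 + p * q) / 4 * (/ Y * / Y)) by (unfold w; field; lra).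
  set (v := / Y) in *.
  assert (Hw1 : p * q / 4 <= w).
  { assert (G : 0 <= (1 - v) * (1 - v / 2 - p * q / 4 * (1 + v))) by (apply Rmult_le_pos; nra).
    rewrite Ew. nra. }
  assert (Hw2 : Rabs (w - 1) <= 3 * v) by (rewrite Ew; apply Rabs_le; split; nra).
  assert (ER : 1 + RpolyR (4 * (Y - 1)) / 4 = w * (4 / (p * q) * (Y * (Y * Y)))).
  { unfold RpolyR, w. field. split; lra. }
  assert (Er : remainder E4 0 c4 u = ln w).
  { unfold remainder, E4, defect. fold L.
    assert (F' : exp (logprod ia4 (u + om)) = w * (4 / (p * q) * (Y * (Y * Y)))) by (rewrite <- ER, <- F; field).
    apply (f_equal ln) in F'. rewrite ln_exp in F'.
    assert (0 < 4 / (p * q)) by (apply Rdiv_lt_0_compat; lra).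
    assert (0 < Y * Y) by nra. assert (0 < Y * (Y * Y)) by nra.
    rewrite !ln_mult in F'; trivial; try lra; try (apply Rmult_lt_0_compat; trivial).
    unfold Y in F'. rewrite !ln_exp in F'. fold L in F'. unfold c4. lra. }
  rewrite Er. eapply Rle_trans; [apply (ln_ratio_bound w (p * q / 4)); lra |].
  replace (exp (- L)) with v by (unfold v, Y; now rewrite exp_Ropp).
  replace (3 / (p * q / 4) * v) with (3 * v * / (p * q / 4)) by (unfold Rdiv; ring).
  apply Rmult_le_compat_r; [left; apply Rinv_0_lt_compat; lra | exact Hw2].
Qed.

Definition N0 : C -> C := numer E0 1 c0.
Definition N4 : C -> C := numer E4 0 c4.

Lemma om_nonneg : 0 <= om.
Proof. assert (0 < ln 3) by (rewrite <- ln_1; apply ln_increasing; lra). generalize om_ge. lra. Qed.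

Lemma E0_neg : exists K, 0 <= K /\ forall u, 0 <= u -> Rabs (E0 (- u)) <= K * exp (- 1 * u).
Proof. apply defect_neg; [apply ia0_small | apply ia0_pos | apply om_nonneg]. Qed.
Lemma E4_neg : exists K, 0 <= K /\ forall u, 0 <= u -> Rabs (E4 (- u)) <= K * exp (- 1 * u).
Proof. apply defect_neg; [apply ia4_small | apply ia4_pos | apply om_nonneg]. Qed.

Lemma E0_continuous u : continuous E0 u.
Proof. apply continuous_defect. intros. apply continuous_logprod; [apply ia0_small | apply ia0_pos]. Qed.
Lemma E4_continuous u : continuous E4 u.
Proof. apply continuous_defect. intros. apply continuous_logprod; [apply ia4_small | apply ia4_pos]. Qed.

(** On the strip both sides are the transform of the defect times
    [sin (PI * s) * s / PI]. *)
Lemma numer_identity ia E a e0 (s : C) :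
  sq_small ia -> (forall k, 0 < ia k) -> E = defect (logprod ia) om ->
  (forall kap, exists K, 0 <= K /\ forall u, 0 <= u -> Rabs (remainder E a e0 u) <= K * exp (- kap * u)) ->
  3 / 4 < Re s < 1 -> (zsum ia s * denom om s)%C = numer E a e0 s.
Proof.
  intros Hs Hpos -> Hrem Hr.
  assert (Hc := continuous_logprod ia Hs Hpos).
  destruct (defect_transform ia Hs Hpos (logprod ia) (logprod_lim ia Hs Hpos) Hc om om_ge s Hr) as (X & HX & EX).
  apply (mellinJ_eq _ a e0 (fun u => continuous_defect (logprod ia) Hc om u)
    (defect_neg ia Hs Hpos om om_nonneg) Hrem) in HX; [| lra].
  assert (Ns : s <> RtoC 0) by (intros ->; simpl in Hr; lra).
  assert (NPI : RtoC PI <> RtoC 0) by (intros E0; apply RtoC_inj in E0; generalize PI_RGT_0; lra).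
  unfold numer. rewrite sinc_neq_0 by trivial. unfold denom.
  replace (zsum ia s * (Cexp (om * s) - 3))%C with (((Cexp (om * s) - 3) * PI * zsum ia s) / PI)%C by (field; trivial).
  rewrite <- EX, HX. field. split; trivial.
Qed.

Lemma numer_identity_0 s : 3 / 4 < Re s < 1 -> (zsum ia0 s * denom om s)%C = N0 s.
Proof. intros. apply numer_identity; trivial; [apply ia0_small | apply ia0_pos | apply E0_remainder]. Qed.
Lemma numer_identity_4 s : 3 / 4 < Re s < 1 -> (zsum ia4 s * denom om s)%C = N4 s.
Proof. intros. apply numer_identity; trivial; [apply ia4_small | apply ia4_pos | apply E4_remainder]. Qed.

Lemma N0_cubic s : Re s < 1 -> s <> RtoC 0 -> exists c d, cubic N0 s c d.
Proof. apply numer_cubic; [apply E0_continuous | apply E0_neg | apply E0_remainder]. Qed.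
Lemma N4_cubic s : Re s < 1 -> s <> RtoC 0 -> exists c d, cubic N4 s c d.
Proof. apply numer_cubic; [apply E4_continuous | apply E4_neg | apply E4_remainder]. Qed.

Lemma N0_derive_0 : is_Cderive N0 (RtoC 0) (RtoC c0).
Proof. apply numer_derive_0; [apply E0_continuous | apply E0_neg | apply E0_remainder]. Qed.
Lemma N4_derive_0 : is_Cderive N4 (RtoC 0) (RtoC c4).
Proof. apply numer_derive_0; [apply E4_continuous | apply E4_neg | apply E4_remainder]. Qed.

Definition zeta0 : C -> C := continuation om N0 (zsum ia0).
Definition zeta4 : C -> C := continuation om N4 (zsum ia4).
Definition zetaL : C -> C :=
  continuation om (fun s => N0 s + N4 s)%C (fun s => zsum ia0 s + zsum ia4 s)%C.

Lemma NL_cubic s : Re s < 1 -> s <> RtoC 0 -> exists c d, cubic (fun s => N0 s + N4 s)%C s c d.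
Proof.
  intros H1 H2. destruct (N0_cubic s H1 H2) as (c & d & H). destruct (N4_cubic s H1 H2) as (c' & d' & H').
  eexists. eexists. apply cubic_plus; eassumption.
Qed.

Lemma NL_derive_0 : is_Cderive (fun s => N0 s + N4 s)%C (RtoC 0) (RtoC (c0 + c4)).
Proof. rewrite RtoC_plus. apply is_Cderive_plus; [apply N0_derive_0 | apply N4_derive_0]. Qed.

Lemma SL_derive s : 3 / 4 < Re s -> exists l, is_Cderive (fun s => zsum ia0 s + zsum ia4 s)%C s l.
Proof.
  intros H. destruct (zsum_derive ia0 ia0_small ia0_pos s H) as [l Hl].
  destruct (zsum_derive ia4 ia4_small ia4_pos s H) as [l' Hl']. exists (l + l')%C. exact (is_Cderive_plus _ _ _ _ _ Hl Hl').
Qed.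

Lemma SL_identity s : 3 / 4 < Re s < 1 -> ((zsum ia0 s + zsum ia4 s) * denom om s)%C = (N0 s + N4 s)%C.
Proof. intros H. rewrite <- numer_identity_0, <- numer_identity_4 by trivial. ring. Qed.

Lemma zeta0_meromorphic : meromorphic zeta0.
Proof.
  apply (continuation_meromorphic om om_ge N0 _ N0_cubic _ N0_derive_0).
  - apply zsum_derive; [apply ia0_small | apply ia0_pos].
  - apply numer_identity_0.
Qed.

Lemma zeta4_meromorphic : meromorphic zeta4.
Proof.
  apply (continuation_meromorphic om om_ge N4 _ N4_cubic _ N4_derive_0).
  - apply zsum_derive; [apply ia4_small | apply ia4_pos].
  - apply numer_identity_4.
Qed.

Lemma zetaL_meromorphic : meromorphic zetaL.
Proof. exact (continuation_meromorphic om om_ge _ _ NL_cubic _ NL_derive_0 SL_derive SL_identity). Qed.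

(** At a zero of the denominator where neither summand has a pole, all three
    functions are defined by the derivatives of their numerators, which add up. *)
Lemma zeta_sum s : ~ pole zeta0 s -> ~ pole zeta4 s -> zetaL s = (zeta0 s + zeta4 s)%C.
Proof.
  intros P0 P4. destruct (classic (denom om s = RtoC 0)) as [E | NE].
  - unfold zetaL, zeta0, zeta4. rewrite !(continuation_zero om om_ge) by trivial.
    assert (Hre := denom_zero_Re om om_ge s E).
    assert (Ns : s <> RtoC 0) by (intros ->; simpl in Hre; lra).
    destruct (N0_cubic s ltac:(lra) Ns) as (c & d & H). destruct (N4_cubic s ltac:(lra) Ns) as (c' & d' & H').
    apply cubic_derive in H. apply cubic_derive in H'.
    rewrite (is_C_derive_unique _ _ _ H), (is_C_derive_unique _ _ _ H').
    assert (HL : C_derive (fun s : C => (N0 s + N4 s)%C) s = (c + c')%C)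
      by exact (is_C_derive_unique _ _ _ (is_Cderive_plus _ _ _ _ _ H H')).
    rewrite HL.
    assert (Hk := denom_simple om om_ge s E). field.
    split; [apply Cexp_neq_0 |]. intros E1. apply Hk. rewrite E1. ring.
  - unfold zetaL, zeta0, zeta4. destruct (Rlt_dec (Re s) 1) as [H | H].
    + rewrite !continuation_left by trivial. field. trivial.
    + rewrite (continuation_right om om_ge _ _ SL_identity), (continuation_right om om_ge _ _ numer_identity_0),
        (continuation_right om om_ge _ _ numer_identity_4) by lra. reflexivity.
Qed.

(** The denominator vanishes only on a vertical line to the right of the axis. *)
Lemma zetaL_imaginary_axis (y : R) : ~ pole zetaL (0, y).
Proof.
  apply holomorphic_not_pole.
  apply (continuation_regular om om_ge _ _ NL_cubic _ NL_derive_0 SL_derive SL_identity).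
  right. split; [simpl; lra |]. intros E. apply (denom_zero_Re om om_ge) in E. simpl in E. lra.
Qed.

(** The quotient rule at 0: the denominator is -2 there, with derivative
    [ln lambda], and the numerator is 2 with derivative [c0 + c4]. *)
Lemma zetaL_det : is_regularized_det zetaL (RtoC (1 / (p * q))).
Proof.
  assert (Hpq := pq_pos p q Hp Hq).
  assert (D0 : denom om 0 = RtoC (-2)).
  { unfold denom. replace (om * 0)%C with (RtoC 0) by ring. rewrite Cexp_0, <- RtoC_minus. f_equal. ring. }
  assert (ND : denom om 0 <> RtoC 0) by (rewrite D0; apply RtoC_neq_0; lra).
  assert (H := continuation_derive_left om _ (fun s => zsum ia0 s + zsum ia4 s)%C 0 ltac:(simpl; lra) ND _ NL_derive_0).
  eexists. split; [exact H |].
  assert (E : (((c0 + c4)%R * denom om 0 - (N0 0 + N4 0) * (om * Cexp (om * 0))) / denom om 0 ^ 2)%C = RtoC (ln (p * q))).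
  { replace (om * 0)%C with (RtoC 0) by ring. unfold N0, N4. rewrite !numer_0, Cexp_0, D0.
    replace (2 * 1 + 2 * 0)%C with (RtoC 2) by ring.
    replace ((c0 + c4)%R * -2 - 2 * (om * 1))%C with (RtoC ((c0 + c4) * -2 - 2 * om)).
    2:{ rewrite RtoC_minus, !RtoC_mult. ring. }
    rewrite <- RtoC_pow. rewrite <- RtoC_div by (simpl; lra). f_equal.
    unfold c0, c4. assert (H4 : ln (4 / (p * q)) = ln (4 * (p * q)) - 2 * ln (p * q)).
    { unfold Rdiv. rewrite (ln_mult 4 (/ (p * q))), (ln_mult 4 (p * q)), ln_Rinv by (try apply Rinv_0_lt_compat; lra). ring. }
    rewrite H4. field. }
  assert (Goal2 : forall l, l = RtoC (ln (p * q)) -> Cexp (- l)%C = RtoC (1 / (p * q))).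
  { intros l ->. rewrite <- RtoC_opp, Cexp_RtoC, exp_Ropp, exp_ln by trivial. f_equal. field. split; lra. }
  apply Goal2. rewrite <- E. rewrite RtoC_plus. reflexivity.
Qed.

Lemma zero_enumeration ia : sq_small ia -> (forall k, 0 < ia k) -> forall (mult : R -> nat -> Prop) ,
  (forall t l, 0 < t -> NoDup l -> (forall k, In k l <-> t * ia k = 1) -> mult t (length l)) ->
  enumerates (fun t => 0 < t) mult (fun k => / ia k).
Proof.
  intros Hs Hpos mult Hm. split; [intros k; now apply Rinv_0_lt_compat |].
  intros t Ht. destruct (list_of_zeros ia t Hs) as (l & Hl & Hk). exists l. split; [trivial | split; [| now apply Hm]].
  intros k. rewrite Hk. specialize (Hpos k). split.
  - intros E. apply Rmult_eq_reg_r with (ia k); [| lra]. rewrite E. field. lra.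
  - intros <-. field. lra.
Qed.

Lemma zeta0_spec : is_polynomial_zeta Phi (RtoC 0) zeta0.
Proof.
  split; [apply zeta0_meromorphic |]. exists (fun k => / ia0 k), (3 / 4). split.
  - apply zero_enumeration; [apply ia0_small | apply ia0_pos |]. intros t l Ht Hl Hk.
    apply (eprod_zero_order ia0 t l _ Copp ia0_small Hl ltac:(lra) Hk).
    + intros z. rewrite (Phi_product p q Phi Hp Hq Hfun Hzero Hder). unfold ia0. ring.
    + intros z. eexists. apply (is_Cderive_ext (fun z => (- (1)) * z)%C).
      { exists 1. split; [lra | intros; ring]. }
      apply (is_Cderive_mult (fun _ => - (1))%C (fun z => z)); [apply is_Cderive_const | apply is_Cderive_id].
    + rewrite <- RtoC_opp. apply RtoC_neq_0. lra.
  - intros s Hs. unfold zeta0. rewrite (continuation_right om om_ge _ _ numer_identity_0) by trivial. split.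
    + apply (zterm_abs_series ia0 ia0_small ia0_pos). lra.
    + apply Clim_is_series. apply (zsum_lim ia0 ia0_small ia0_pos). lra.
Qed.

Lemma zeta4_spec : is_polynomial_zeta Phi (RtoC (-4)) zeta4.
Proof.
  split; [apply zeta4_meromorphic |]. exists (fun k => / ia4 k), (3 / 4). split.
  - apply zero_enumeration; [apply ia4_small | apply ia4_pos |]. intros t l Ht Hl Hk.
    apply (eprod_zero_order ia4 t l _ (fun _ => RtoC 4) ia4_small Hl ltac:(lra) Hk).
    + intros z. unfold ia4. change (fun k => iota p q (-1) k) with (iota p q (-1)).
      rewrite <- (Phi_product_4 p q Phi Hp Hq Hfun Hzero Hder).
      replace (RtoC (-4)) with (- RtoC 4)%C by (rewrite <- RtoC_opp; f_equal; ring). field.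
    + intros z. eexists. apply is_Cderive_const.
    + apply RtoC_neq_0. lra.
  - intros s Hs. unfold zeta4. rewrite (continuation_right om om_ge _ _ numer_identity_4) by trivial. split.
    + apply (zterm_abs_series ia4 ia4_small ia4_pos). lra.
    + apply Clim_is_series. apply (zsum_lim ia4 ia4_small ia4_pos). lra.
Qed.

(** ** The spectral zeta function *)

Definition interleave {A} (f g : nat -> A) (n : nat) : A :=
  if Nat.even n then f (n / 2)%nat else g (n / 2)%nat.

Lemma interleave_even {A} (f g : nat -> A) k : interleave f g (2 * k) = f k.
Proof.
  unfold interleave. rewrite Nat.even_mul. simpl orb. rewrite Nat.mul_comm, Nat.div_mul by lia. reflexivity.
Qed.

Lemma interleave_odd {A} (f g : nat -> A) k : interleave f g (2 * k + 1) = g k.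
Proof.
  unfold interleave. replace (Nat.even (2 * k + 1)) with false by (rewrite Nat.even_add, Nat.even_mul; reflexivity).
  replace (2 * k + 1)%nat with (1 + k * 2)%nat by lia. rewrite Nat.div_add by lia. reflexivity.
Qed.

Lemma Csum_interleave f g n : Csum (interleave f g) (2 * n) = (Csum f n + Csum g n)%C.
Proof.
  induction n; [simpl; ring |]. replace (2 * S n)%nat with (S (S (2 * n))) by lia. cbn [Csum].
  rewrite IHn, interleave_even. replace (S (2 * n)) with (2 * n + 1)%nat by lia. rewrite interleave_odd. ring.
Qed.

Lemma Rsum_interleave f g n : Rsum (interleave f g) (2 * n) = Rsum f n + Rsum g n.
Proof.
  induction n; [simpl; ring |]. replace (2 * S n)%nat with (S (S (2 * n))) by lia. cbn [Rsum].
  rewrite IHn, interleave_even. replace (S (2 * n)) with (2 * n + 1)%nat by lia. rewrite interleave_odd. ring.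
Qed.

Lemma Clim_interleave f g l l' : Clim (Csum f) l -> Clim (Csum g) l' -> Clim (Csum (interleave f g)) (l + l').
Proof.
  intros Hf Hg. assert (Hfg := Clim_plus _ _ _ _ Hf Hg).
  assert (Hfg' := Clim_plus _ _ _ _ (Clim_shift _ _ 1 Hf) Hg).
  intros eps Heps. destruct (Hfg eps Heps) as [N HN]. destruct (Hfg' eps Heps) as [N' HN'].
  exists (2 * (N + N'))%nat. intros n Hn.
  destruct (Nat.Even_or_Odd n) as [[k ->] | [k ->]].
  - rewrite Csum_interleave. apply HN. lia.
  - replace (2 * k + 1)%nat with (S (2 * k)) by lia. cbn [Csum]. rewrite Csum_interleave, interleave_even.
    replace (Csum f k + Csum g k + f k)%C with (Csum f (k + 1) + Csum g k)%C.
    + apply HN'. lia.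
    + rewrite Nat.add_1_r. cbn [Csum]. ring.
Qed.

(** The eigenvalues are enumerated by taking the zeros of [Phi] and of [Phi + 4]
    alternately.  The premise is the dimension of the eigenspaces; with
    [zero_count] it matches the number of indices of the enumeration. *)
Lemma zetaL_spec :
  (forall t, t <> 0 -> eigenvalue_mult p q t (ind (hits p q Phi t p) + ind (hits p q Phi t q))) ->
  is_spectral_zeta p q zetaL.
Proof.
  intros Hspec. split; [apply zetaL_meromorphic |].
  exists (interleave (fun k => / ia0 k) (fun k => / ia4 k)), (3 / 4). split; [split |].
  - intros n. unfold interleave. destruct (Nat.even n); apply Rinv_neq_0_compat, Rgt_not_eq; [apply ia0_pos | apply ia4_pos].
  - intros t Ht. destruct (list_of_zeros ia0 t ia0_small) as (l0 & Hn0 & Hk0).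
    destruct (list_of_zeros ia4 t ia4_small) as (l4 & Hn4 & Hk4).
    assert (Inv : forall x, 0 < x -> t * x = 1 <-> / x = t).
    { intros x Hx. split; [| intros <-; field; lra]. intros E. apply Rmult_eq_reg_r with x; [| lra]. rewrite E. field. lra. }
    exists (map (fun k => 2 * k)%nat l0 ++ map (fun k => 2 * k + 1)%nat l4). split; [| split].
    + apply NoDup_app.
      * apply FinFun.Injective_map_NoDup; trivial. intros x y. lia.
      * apply FinFun.Injective_map_NoDup; trivial. intros x y. lia.
      * intros x Hx Hx'. apply in_map_iff in Hx. apply in_map_iff in Hx'.
        destruct Hx as (y & Hy & _). destruct Hx' as (y' & Hy' & _). lia.
    + intros n. rewrite in_app_iff, !in_map_iff. destruct (Nat.Even_or_Odd n) as [[k ->] | [k ->]].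
      * rewrite interleave_even, <- Inv, <- Hk0 by apply ia0_pos. split.
        -- intros [(y & Hy & H) | (y & Hy & H)]; [| lia]. now replace k with y by lia.
        -- intros H. left. now exists k.
      * rewrite interleave_odd, <- Inv, <- Hk4 by apply ia4_pos. split.
        -- intros [(y & Hy & H) | (y & Hy & H)]; [lia |]. now replace k with y by lia.
        -- intros H. right. now exists k.
    + rewrite length_app, !length_map.
      rewrite (zero_count p q Phi Hp Hq Hfun Hzero Hder t l0 l4) by trivial. now apply Hspec.
  - intros s Hs. unfold zetaL. rewrite (continuation_right om om_ge _ _ SL_identity) by trivial.
    assert (E : forall n, Cpower (interleave (fun k => / ia0 k) (fun k => / ia4 k) n) (- s)%C = interleave (zterm ia0 s) (zterm ia4 s) n).
    { intros n. unfold interleave. now destruct (Nat.even n). }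
    split.
    + apply ex_series_bounded with 6; [intros; apply Cmod_ge_0 |]. intros n.
      apply Rle_trans with (Rsum (fun k => Cmod (Cpower (interleave (fun k => / ia0 k) (fun k => / ia4 k) k) (- s)%C)) (2 * n)).
      { replace (2 * n)%nat with (n + n)%nat by lia. rewrite Rsum_plus.
        assert (0 <= Rsum (fun k => Cmod (Cpower (interleave (fun k => / ia0 k) (fun k => / ia4 k) (n + k)) (- s)%C)) n)
          by (apply Rsum_pos; intros; apply Cmod_ge_0). lra. }
      rewrite (Rsum_ext _ (interleave (fun k => Cmod (zterm ia0 s k)) (fun k => Cmod (zterm ia4 s k)))).
      2:{ intros k _. rewrite E. unfold interleave. now destruct (Nat.even k). }
      rewrite Rsum_interleave.
      assert (B0 : Rsum (fun k => Cmod (zterm ia0 s k)) n <= 3).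
      { eapply Rle_trans; [| apply (weight_sum n)]. apply Rsum_le. intros. apply (zterm_weight ia0 ia0_small ia0_pos). lra. }
      assert (B4 : Rsum (fun k => Cmod (zterm ia4 s k)) n <= 3).
      { eapply Rle_trans; [| apply (weight_sum n)]. apply Rsum_le. intros. apply (zterm_weight ia4 ia4_small ia4_pos). lra. }
      lra.
    + apply Clim_is_series. apply (Clim_ext (Csum (interleave (zterm ia0 s) (zterm ia4 s)))).
      { intros n. apply Csum_ext. intros k _. now rewrite E. }
      apply Clim_interleave; [apply (zsum_lim ia0 ia0_small ia0_pos); lra | apply (zsum_lim ia4 ia4_small ia4_pos); lra].
Qed.

End Zetas.

(** * Geometry of the vertex sets *)

(** The length of the [k]-th cell of level [n], read off from the base 3
    digits of [k]; the innermost map is the last digit, while [V] peels off the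
    outermost one. *)
Fixpoint cell_length (p q : R) (n k : nat) : R :=
  match n with
  | O => 1
  | S n => (if Nat.eqb (k mod 3) 1 then q / (1 + p) else p / (1 + p)) * cell_length p q n (k / 3)
  end.

Definition position (p q : R) (n k : nat) : R := Rsum (cell_length p q n) k.

Lemma digit_div k i : (i < 3)%nat -> ((3 * k + i) / 3 = k /\ (3 * k + i) mod 3 = i)%nat.
Proof.
  intros H. split.
  - symmetry. apply (Nat.div_unique _ 3 k i); lia.
  - symmetry. apply (Nat.mod_unique _ 3 k i); lia.
Qed.

Lemma digit_decomp k : exists j i, (i < 3)%nat /\ k = (3 * j + i)%nat.
Proof. exists (k / 3)%nat, (k mod 3)%nat. split; [apply Nat.mod_upper_bound; lia | apply Nat.div_mod; lia]. Qed.

Lemma Rsum_thirds f n : Rsum f (3 * n) = Rsum (fun k => f (3 * k)%nat + f (3 * k + 1)%nat + f (3 * k + 2)%nat) n.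
Proof.
  induction n; [reflexivity |]. replace (3 * S n)%nat with (S (S (S (3 * n)))) by lia. cbn [Rsum].
  rewrite IHn. replace (S (S (3 * n))) with (3 * n + 2)%nat by lia. replace (S (3 * n)) with (3 * n + 1)%nat by lia. ring.
Qed.

Section Geometry.

Variables p q : R.
Hypothesis Hp : 0 < p < 1.
Hypothesis Hq : q = 1 - p.

Local Notation cell := (cell_length p q).
Local Notation pos := (position p q).

Lemma cell_0 n k : cell (S n) (3 * k) = p / (1 + p) * cell n k.
Proof. cbn [cell_length]. destruct (digit_div k 0 ltac:(lia)) as [E1 E2]. rewrite Nat.add_0_r in *. now rewrite E1, E2. Qed.
Lemma cell_1 n k : cell (S n) (3 * k + 1) = q / (1 + p) * cell n k.
Proof. cbn [cell_length]. destruct (digit_div k 1 ltac:(lia)) as [E1 E2]. now rewrite E1, E2. Qed.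
Lemma cell_2 n k : cell (S n) (3 * k + 2) = p / (1 + p) * cell n k.
Proof. cbn [cell_length]. destruct (digit_div k 2 ltac:(lia)) as [E1 E2]. now rewrite E1, E2. Qed.

Lemma cell_pos n k : 0 < cell n k.
Proof.
  revert k. induction n; intros k; cbn [cell_length]; [lra |]. apply Rmult_lt_0_compat; trivial.
  destruct Nat.eqb; apply Rdiv_lt_0_compat; lra.
Qed.

(** The three subdivision ratios add up to 1. *)
Lemma pos_thirds n k : pos (S n) (3 * k) = pos n k.
Proof.
  unfold position. rewrite Rsum_thirds. apply Rsum_ext. intros j _.
  rewrite cell_0, cell_1, cell_2. rewrite Hq. field. lra.
Qed.

Lemma pos_level n m k : pos (n + m) (3 ^ m * k) = pos n k.
Proof.
  revert k. induction m; intros k; [now rewrite Nat.add_0_r, Nat.mul_1_l |].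
  rewrite <- plus_n_Sm. replace (3 ^ S m * k)%nat with (3 * (3 ^ m * k))%nat by (simpl; lia).
  now rewrite pos_thirds.
Qed.

Lemma pos_succ n k : pos n (S k) = pos n k + cell n k.
Proof. reflexivity. Qed.

Lemma pos_last n : pos n (3 ^ n) = 1.
Proof.
  assert (H := pos_level 0 n 1). rewrite Nat.mul_1_r, Nat.add_0_l in H. rewrite H. unfold position. simpl. ring.
Qed.

Lemma pos_increasing n j k : (j <= k)%nat -> pos n j <= pos n k.
Proof.
  induction 1; [lra |]. rewrite pos_succ. generalize (cell_pos n m). lra.
Qed.

Lemma pos_unit n k : (k <= 3 ^ n)%nat -> 0 <= pos n k <= 1.
Proof.
  intros H. split; [| rewrite <- (pos_last n); now apply pos_increasing].
  apply Rsum_pos. intros. left. apply cell_pos.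
Qed.

(** Subdividing a cell multiplies the inverse length by
    [2 * (1 + p) / p + (1 + p) / q = lambda]. *)
Lemma cell_sum_inv n : Rsum (fun k => / cell n k) (3 ^ n) = lambda p q ^ n.
Proof.
  induction n; [simpl; field |]. replace (3 ^ S n)%nat with (3 * 3 ^ n)%nat by reflexivity.
  rewrite Rsum_thirds. transitivity (lambda p q * Rsum (fun k => / cell n k) (3 ^ n)); [| rewrite IHn; reflexivity].
  rewrite <- Rsum_scal. apply Rsum_ext. intros k _. rewrite cell_0, cell_1, cell_2, lambda_eq by trivial.
  assert (H := cell_pos n k). generalize dependent (cell n k). intros y Hy. rewrite Hq. field. repeat split; lra.
Qed.

Lemma inv_cell_le n k : (k < 3 ^ n)%nat -> / cell n k <= lambda p q ^ n.
Proof.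
  intros H. rewrite <- cell_sum_inv. replace (3 ^ n)%nat with (S k + (3 ^ n - S k))%nat by lia.
  rewrite Rsum_plus. cbn [Rsum].
  assert (G : forall j, 0 <= / cell n j) by (intros j; left; apply Rinv_0_lt_compat, cell_pos).
  assert (0 <= Rsum (fun k => / cell n k) k) by (apply Rsum_pos; auto).
  assert (0 <= Rsum (fun j => / cell n (S k + j)) (3 ^ n - S k)) by (apply Rsum_pos; auto). lra.
Qed.

Lemma cell_small n k : cell n k <= Rmax p q ^ n.
Proof.
  revert k. induction n; intros k; cbn [cell_length]; [simpl; lra |].
  assert (Hc := cell_pos n (k / 3)). specialize (IHn (k / 3)%nat).
  assert (B : forall x, 0 < x -> x / (1 + p) <= x) by (intros; apply Rle_div_l; nra).
  simpl pow. apply Rmult_le_compat; trivial; [| lra |].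
  - destruct Nat.eqb; left; apply Rdiv_lt_0_compat; lra.
  - destruct Nat.eqb; [apply Rle_trans with q; [apply B; lra | apply Rmax_r] | apply Rle_trans with p; [apply B; lra | apply Rmax_l]].
Qed.

(** Across a vertex of level [n] the two lengths are in ratio [p : q]; deeper
    levels scale both neighbours of an old vertex by the same factor. *)
Lemma cell_ratio n k : (S k < 3 ^ n)%nat ->
  p * cell n k = q * cell n (S k) \/ q * cell n k = p * cell n (S k).
Proof.
  revert k. induction n; intros k H; [simpl in H; lia |].
  destruct (digit_decomp k) as (j & i & Hi & ->).
  destruct i as [|[|[|i]]]; [| | | lia].
  - replace (S (3 * j + 0)) with (3 * j + 1)%nat by lia. rewrite Nat.add_0_r, cell_0, cell_1. right. field. lra.
  - replace (S (3 * j + 1)) with (3 * j + 2)%nat by lia. rewrite cell_1, cell_2. left. field. lra.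
  - replace (S (3 * j + 2)) with (3 * S j)%nat by lia. rewrite cell_2, cell_0.
    assert (Hj : (S j < 3 ^ n)%nat) by (simpl in H; lia).
    assert (E : forall x y u v, x * u = y * v -> x * (p / (1 + p) * u) = y * (p / (1 + p) * v)).
    { intros x y u v E. transitivity (p / (1 + p) * (x * u)); [ring | rewrite E; ring]. }
    destruct (IHn j Hj) as [E1 | E1]; [left | right]; now apply E.
Qed.

Lemma cell_outer n i k : (i < 3)%nat -> (k < 3 ^ n)%nat ->
  cell (S n) (i * 3 ^ n + k) = (if Nat.eqb i 1 then q / (1 + p) else p / (1 + p)) * cell n k.
Proof.
  revert k. induction n; intros k Hi Hk.
  - assert (k = 0)%nat as -> by (simpl in Hk; lia). cbn [cell_length]. simpl (3 ^ 0)%nat.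
    rewrite Nat.mul_1_r, Nat.add_0_r, Nat.mod_small by trivial. reflexivity.
  - destruct (digit_decomp k) as (j & d & Hd & ->).
    assert (Hj : (j < 3 ^ n)%nat) by (simpl in Hk; lia).
    change (cell (S (S n)) (i * 3 ^ S n + (3 * j + d)))
      with ((if Nat.eqb ((i * 3 ^ S n + (3 * j + d)) mod 3) 1 then q / (1 + p) else p / (1 + p))
            * cell (S n) ((i * 3 ^ S n + (3 * j + d)) / 3)).
    replace (i * 3 ^ S n + (3 * j + d))%nat with (3 * (i * 3 ^ n + j) + d)%nat by (simpl; lia).
    destruct (digit_div (i * 3 ^ n + j) d Hd) as [-> ->]. rewrite IHn by trivial.
    cbn [cell_length]. destruct (digit_div j d Hd) as [-> ->]. ring.
Qed.

Lemma pos_outer n i k : (i < 3)%nat -> (k <= 3 ^ n)%nat ->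
  pos (S n) (i * 3 ^ n + k) = pos (S n) (i * 3 ^ n) + (if Nat.eqb i 1 then q / (1 + p) else p / (1 + p)) * pos n k.
Proof.
  intros Hi Hk. unfold position at 1. rewrite Rsum_plus. unfold position. f_equal. rewrite <- Rsum_scal.
  apply Rsum_ext. intros j Hj. apply cell_outer; lia.
Qed.

Lemma V_length n : length (V p q n) = S (3 ^ n).
Proof.
  induction n; [reflexivity |]. cbn [V]. rewrite !length_app, !length_tl, !length_map, IHn. simpl. lia.
Qed.

Lemma nth_map_V F n k : (k <= 3 ^ n)%nat -> nth k (map F (V p q n)) 0 = F (vertex p q n k).
Proof.
  intros H. rewrite (nth_indep _ 0 (F 0)) by (rewrite length_map, V_length; lia). apply map_nth.
Qed.

Lemma nth_tl {A} (l : list A) k d : nth k (tl l) d = nth (S k) l d.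
Proof. destruct l; [now destruct k | reflexivity]. Qed.

(** The recursion of [V] adds leading digits, that of [position] trailing ones. *)
Lemma vertex_pos n k : (k <= 3 ^ n)%nat -> vertex p q n k = pos n k.
Proof.
  revert k. induction n; intros k H.
  - simpl in H. unfold vertex, position. destruct k as [|[|k]]; [reflexivity | simpl; ring | lia].
  - assert (H3 : (3 ^ S n = 3 ^ n + 3 ^ n + 3 ^ n)%nat) by (simpl; lia).
    assert (P1 : pos (S n) (3 ^ n) = p / (1 + p)).
    { assert (E := pos_outer n 0 (3 ^ n) ltac:(lia) (le_n _)). simpl Nat.add in E. rewrite E, pos_last.
      unfold position. simpl. ring. }
    assert (P2 : pos (S n) (2 * 3 ^ n) = 1 / (1 + p)).
    { assert (E := pos_outer n 1 (3 ^ n) ltac:(lia) (le_n _)). rewrite Nat.mul_1_l, P1, pos_last in E.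
      replace (2 * 3 ^ n)%nat with (3 ^ n + 3 ^ n)%nat by lia. rewrite E. simpl. rewrite Hq. field. lra. }
    unfold vertex. cbn [V].
    destruct (le_lt_dec k (3 ^ n)) as [Hk | Hk].
    + rewrite app_nth1 by (rewrite length_map, V_length; lia). rewrite nth_map_V, IHn by trivial.
      assert (E := pos_outer n 0 k ltac:(lia) Hk). simpl Nat.add in E. rewrite E.
      unfold F1, similitude, position. simpl. ring.
    + rewrite app_nth2 by (rewrite length_map, V_length; lia). rewrite length_map, V_length.
      destruct (le_lt_dec k (2 * 3 ^ n)) as [Hk2 | Hk2].
      * rewrite app_nth1 by (rewrite length_tl, length_map, V_length; lia).
        rewrite nth_tl, nth_map_V, IHn by lia.
        assert (E := pos_outer n 1 (k - 3 ^ n) ltac:(lia) ltac:(lia)). rewrite Nat.mul_1_l in E.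
        replace (3 ^ n + (k - 3 ^ n))%nat with k in E by lia. rewrite E, P1.
        replace (S (k - S (3 ^ n))) with (k - 3 ^ n)%nat by lia.
        unfold F2, similitude. simpl. rewrite Hq. field. lra.
      * rewrite app_nth2 by (rewrite length_tl, length_map, V_length; lia).
        rewrite length_tl, length_map, V_length, nth_tl, nth_map_V, IHn by lia.
        assert (E := pos_outer n 2 (k - 2 * 3 ^ n) ltac:(lia) ltac:(lia)).
        replace (2 * 3 ^ n + (k - 2 * 3 ^ n))%nat with k in E by lia. rewrite E, P2.
        replace (S (k - S (3 ^ n) - (S (3 ^ n) - 1))) with (k - 2 * 3 ^ n)%nat by lia.
        unfold F3, similitude. simpl. field. lra.
Qed.

Lemma vertex_thirds n k : (k <= 3 ^ n)%nat -> vertex p q (S n) (3 * k) = vertex p q n k.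
Proof. intros H. rewrite !vertex_pos by (simpl; lia). apply pos_thirds. Qed.

(** ** The Laplacian in terms of the cell lengths *)

Definition wleft (n k : nat) : R := cell n k / (cell n (k - 1) + cell n k).

Lemma wleft_bounds n k : 0 <= wleft n k <= 1.
Proof.
  unfold wleft. generalize (cell_pos n k) (cell_pos n (k - 1)). intros.
  split; [left; apply Rdiv_lt_0_compat; lra | apply Rle_div_l; lra].
Qed.

Lemma Delta_left f n c : Delta p q n f c 0 / 2 =
  / 2 * f true (vertex p q n 1) + / 2 * f false (vertex p q n 1) - f c (vertex p q n 0).
Proof. unfold Delta. simpl Nat.eqb. cbv iota. field. Qed.

Lemma Delta_right f n c : Delta p q n f c (3 ^ n) / 2 =
  / 2 * f true (vertex p q n (3 ^ n - 1)) + / 2 * f false (vertex p q n (3 ^ n - 1)) - f c (vertex p q n (3 ^ n)).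
Proof.
  unfold Delta. assert (3 ^ n <> 0)%nat by (apply Nat.pow_nonzero; lia).
  destruct (Nat.eqb_spec (3 ^ n) 0); [lia |]. rewrite Nat.eqb_refl. field.
Qed.

Lemma Delta_interior f n c k : (0 < k < 3 ^ n)%nat -> Delta p q n f c k / 2 =
  wleft n k * f c (vertex p q n (k - 1)) + (1 - wleft n k) * f c (vertex p q n (S k)) - f c (vertex p q n k).
Proof.
  intros H. unfold Delta. destruct (Nat.eqb_spec k 0); [lia |]. destruct (Nat.eqb_spec k (3 ^ n)); [lia |].
  rewrite Nat.add_1_r. assert (Hr := cell_ratio n (k - 1)). replace (S (k - 1)) with k in Hr by lia.
  specialize (Hr ltac:(lia)). assert (E1 := pos_succ n (k - 1)). replace (S (k - 1)) with k in E1 by lia.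
  assert (E2 := pos_succ n k). unfold prob_left, prob_right.
  rewrite (vertex_pos n (k - 1)), (vertex_pos n k), (vertex_pos n (S k)) by lia.
  replace (pos n k - pos n (k - 1)) with (cell n (k - 1)) by lra.
  replace (pos n (S k) - pos n k) with (cell n k) by lra.
  generalize (cell_pos n (k - 1)) (cell_pos n k). unfold wleft.
  generalize (f c (pos n (k - 1))) (f c (pos n k)) (f c (pos n (S k))). revert Hr.
  generalize (cell n (k - 1)) (cell n k). intros l r Hr yl y yr Hl Hr0.
  assert (Ew : forall w, w * l = (1 - w) * r -> r / (l + r) = w).
  { intros w E. apply Rmult_eq_reg_r with (l + r); [| lra]. unfold Rdiv. rewrite Rmult_assoc, Rinv_l by lra. lra. }
  destruct Req_dec_T as [E | NE].
  - rewrite (Ew p) by (rewrite <- Hq; exact E). rewrite Hq. field.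
  - destruct Hr as [Hr | Hr]; [contradiction |].
    rewrite (Ew q) by (rewrite Hr, Hq; ring). rewrite Hq. field.
Qed.

Lemma wleft_0 n k : (0 < k)%nat -> wleft (S n) (3 * k) = wleft n k.
Proof.
  intros H. unfold wleft. replace (3 * k - 1)%nat with (3 * (k - 1) + 2)%nat by lia. rewrite cell_0, cell_2.
  generalize (cell_pos n k) (cell_pos n (k - 1)). generalize (cell n k) (cell n (k - 1)). intros x y Hx Hy.
  assert (0 < p * (y + x)) by nra. field. repeat split; lra.
Qed.

Lemma wleft_1 n k : wleft (S n) (3 * k + 1) = q.
Proof.
  unfold wleft. replace (3 * k + 1 - 1)%nat with (3 * k)%nat by lia. rewrite cell_0, cell_1.
  generalize (cell_pos n k). generalize (cell n k). intros y Hy. rewrite Hq. field. repeat split; lra.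
Qed.

Lemma wleft_2 n k : wleft (S n) (3 * k + 2) = p.
Proof.
  unfold wleft. replace (3 * k + 2 - 1)%nat with (3 * k + 1)%nat by lia. rewrite cell_2, cell_1.
  generalize (cell_pos n k). generalize (cell n k). intros y Hy. rewrite Hq. field. repeat split; lra.
Qed.

(** ** Density *)

Lemma vertex_dense x d : unit_itv x -> 0 < d -> forall N, exists n k, (N <= n)%nat /\ (k <= 3 ^ n)%nat /\ Rabs (vertex p q n k - x) < d.
Proof.
  intros [Hx0 Hx1] Hd N. assert (HM := Mx_bounds p q Hp Hq).
  destruct (pow_lt_1_zero (Rmax p q) ltac:(rewrite Rabs_pos_eq; lra) d Hd) as [m Hm].
  set (n := (N + m)%nat). specialize (Hm n ltac:(unfold n; lia)).
  rewrite Rabs_pos_eq in Hm by (apply pow_le; lra).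
  assert (G : forall j, x <= pos n j -> exists k, (k <= j)%nat /\ Rabs (pos n k - x) < d).
  { induction j; intros H.
    - exists 0%nat. split; [lia |]. unfold position in *. cbn [Rsum] in *. replace (0 - x) with 0 by lra. now rewrite Rabs_R0.
    - destruct (Rle_dec x (pos n j)) as [Hj | Hj].
      + destruct (IHj Hj) as (k & Hk & HH). exists k. split; [lia | trivial].
      + exists (S j). split; [lia |]. rewrite pos_succ in *. generalize (cell_small n j). intros.
        rewrite Rabs_pos_eq; lra. }
  destruct (G (3 ^ n)%nat) as (k & Hk & HH); [rewrite pos_last; lra |].
  exists n, k. split; [unfold n; lia | split; [trivial |]]. now rewrite vertex_pos.
Qed.

End Geometry.

(** * Spectral decimation *)

Lemma continuous_on_unit_eps g : continuous_on unit_itv g -> forall x, unit_itv x -> forall eps, 0 < eps ->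
  exists d, 0 < d /\ forall y, unit_itv y -> Rabs (y - x) < d -> Rabs (g y - g x) < eps.
Proof.
  intros H x Hx eps Heps. specialize (H x Hx (fun v => Rabs (v - g x) < eps)).
  assert (L : locally (g x) (fun v => Rabs (v - g x) < eps)) by (exists (mkposreal eps Heps); intros v Hv; exact Hv).
  specialize (H L). destruct H as [d H]. exists d. split; [apply cond_pos |]. intros y Hy Hd. apply H; trivial.
Qed.

Lemma lipschitz_continuous_on g L : 0 < L -> (forall x y, Rabs (g y - g x) <= L * Rabs (y - x)) -> continuous_on unit_itv g.
Proof.
  intros HL H x Hx P [eps HP].
  assert (Hd : 0 < eps / L) by (apply Rdiv_lt_0_compat; [apply cond_pos | trivial]).
  exists (mkposreal _ Hd). intros y Hy _. apply HP.
  change (Rabs (y - x) < eps / L) in Hy. change (Rabs (g y - g x) < eps).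
  eapply Rle_lt_trans; [apply H |]. rewrite Rmult_comm. now apply Rlt_div_r.
Qed.

Lemma continuous_on_unit_bounded g : continuous_on unit_itv g -> exists B, 0 < B /\ forall x, unit_itv x -> Rabs (g x) <= B.
Proof.
  intros H. set (cl := fun x => Rmax 0 (Rmin 1 x)).
  assert (Hcl : forall x, unit_itv (cl x)).
  { intros x. unfold cl, unit_itv. split; [apply Rmax_l |]. apply Rmax_lub; [lra | apply Rmin_l]. }
  assert (Hlip : forall x y, Rabs (cl y - cl x) <= Rabs (y - x)).
  { intros x y. unfold cl, Rmax, Rmin. repeat destruct Rle_dec; unfold Rabs; repeat destruct Rcase_abs; lra. }
  assert (Hid : forall x, unit_itv x -> cl x = x).
  { intros x [H1 H2]. unfold cl, Rmax, Rmin. repeat destruct Rle_dec; lra. }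
  assert (Hc : forall x, continuity_pt (fun x => Rabs (g (cl x))) x).
  { intros x eps Heps. destruct (continuous_on_unit_eps g H (cl x) (Hcl x) eps Heps) as (d & Hd & HH).
    exists d. split; trivial. intros y [_ Hy]. simpl in Hy. unfold Rdist in Hy. simpl. unfold Rdist.
    eapply Rle_lt_trans; [apply Rabs_triang_inv2 |]. apply HH; trivial.
    eapply Rle_lt_trans; [apply Hlip | exact Hy]. }
  destruct (continuity_ab_maj _ 0 1 ltac:(lra) (fun x _ => Hc x)) as (M & HM & _).
  exists (Rabs (g (cl M)) + 1). split; [generalize (Rabs_pos (g (cl M))); lra |]. intros x Hx.
  specialize (HM x Hx). cbv beta in HM. rewrite (Hid x Hx) in HM. lra.
Qed.

Section Decimation.

Variables p q : R.
Hypothesis Hp : 0 < p < 1.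
Hypothesis Hq : q = 1 - p.

Local Notation lam := (lambda p q).
Local Notation wleft := (wleft p q).

(** By [cubP_minus_1] the factor by which [cubP] expands the distance to 1. *)
Definition growth (x : R) : R := (x + p) * (x + q) / (p * q).

(** One subdivision step: the residuals at the two new vertices of a cell
    express its far end value by the near one, and averaging over the two cells
    at [y] eliminates the new values. *)
Lemma residual_step w1 w2 y A1 A2 A3 B1 B2 B3 x E :
  0 <= w1 -> 0 <= w2 -> w1 + w2 = 1 -> p <= x ->
  Rabs (q * y + p * A2 - x * A1) <= E -> Rabs (p * A1 + q * A3 - x * A2) <= E ->
  Rabs (q * y + p * B2 - x * B1) <= E -> Rabs (p * B1 + q * B3 - x * B2) <= E ->
  Rabs (w1 * A1 + w2 * B1 - x * y) <= E ->
  Rabs (w1 * A3 + w2 * B3 - cubP p q x * y) <= growth x * E.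
Proof.
  intros Hw1 Hw2 Hw Hx. assert (Hpq := pq_pos p q Hp Hq).
  set (rA1 := q * y + p * A2 - x * A1). set (rA2 := p * A1 + q * A3 - x * A2).
  set (rB1 := q * y + p * B2 - x * B1). set (rB2 := p * B1 + q * B3 - x * B2).
  set (r0 := w1 * A1 + w2 * B1 - x * y). intros H1 H2 H3 H4 H0.
  assert (E1 : w1 * A3 + w2 * B3 - cubP p q x * y =
    (w1 * (x * rA1 + p * rA2) + w2 * (x * rB1 + p * rB2) + (x * x - p * p) * r0) / (p * q)).
  { unfold rA1, rA2, rB1, rB2, r0, cubP. replace w2 with (1 - w1) by lra. rewrite Hq. field. split; lra. }
  assert (B : forall r r', Rabs r <= E -> Rabs r' <= E -> - ((x + p) * E) <= x * r + p * r' <= (x + p) * E).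
  { intros r r' Hr Hr'. apply Rabs_le_between in Hr. apply Rabs_le_between in Hr'. split; nra. }
  assert (BA := B _ _ H1 H2). assert (BB := B _ _ H3 H4). apply Rabs_le_between in H0.
  assert (Hxx : 0 <= x * x - p * p) by nra.
  rewrite E1. clear E1. unfold growth. unfold Rdiv. rewrite Rabs_mult, (Rabs_pos_eq (/ (p * q))) by (left; now apply Rinv_0_lt_compat).
  rewrite (Rmult_comm _ (/ _)), (Rmult_comm _ (/ _)), Rmult_assoc.
  apply Rmult_le_compat_l; [left; now apply Rinv_0_lt_compat |].
  replace ((x + p) * (x + q) * E) with (w1 * ((x + p) * E) + w2 * ((x + p) * E) + (x * x - p * p) * E).
  2:{ replace w2 with (1 - w1) by lra. rewrite Hq. ring. }
  generalize dependent (x * rA1 + p * rA2). generalize dependent (x * rB1 + p * rB2).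
  generalize dependent (x * x - p * p). generalize ((x + p) * E). intros F d Hd u Hu v Hv.
  apply Rabs_le. split; nra.
Qed.

Variables (a : nat -> R) (N : nat) (t : R).
Hypothesis Ha : forall n, cubP p q (a (S n)) = a n.
Hypothesis Hap : forall n, (N <= n)%nat -> p <= a n.
Hypothesis Ht : t <> 0.
Hypothesis Hlim : is_lim_seq (fun n => lam ^ n * (2 * (a n - 1))) (- t).

(** Half the defect of the discrete eigenvalue equation with eigenvalue
    [2 (1 - a n)]. *)
Definition residual (f : dfun) (n : nat) (c : bool) (k : nat) : R :=
  Delta p q n f c k / 2 - (a n - 1) * f c (vertex p q n k).

Lemma residual_left f n c : residual f n c 0 =
  / 2 * f true (vertex p q n 1) + / 2 * f false (vertex p q n 1) - a n * f c (vertex p q n 0).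
Proof. unfold residual. rewrite Delta_left. ring. Qed.

Lemma residual_right f n c : residual f n c (3 ^ n) =
  / 2 * f true (vertex p q n (3 ^ n - 1)) + / 2 * f false (vertex p q n (3 ^ n - 1)) - a n * f c (vertex p q n (3 ^ n)).
Proof. unfold residual. rewrite Delta_right. ring. Qed.

Lemma residual_interior f n c k : (0 < k < 3 ^ n)%nat -> residual f n c k =
  wleft n k * f c (vertex p q n (k - 1)) + (1 - wleft n k) * f c (vertex p q n (S k)) - a n * f c (vertex p q n k).
Proof. intros H. unfold residual. rewrite Delta_interior by trivial. ring. Qed.

Lemma residual_decimation f n E : f true 0 = f false 0 -> f true 1 = f false 1 -> p <= a (S n) ->
  (forall c k, (k <= 3 ^ S n)%nat -> Rabs (residual f (S n) c k) <= E) ->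
  forall c k, (k <= 3 ^ n)%nat -> Rabs (residual f n c k) <= growth (a (S n)) * E.
Proof.
  intros F0 F1 HaS H.
  assert (H3 : (3 ^ S n = 3 * 3 ^ n)%nat) by reflexivity.
  assert (H0 : (0 < 3 ^ n)%nat) by (apply Nat.neq_0_lt_0, Nat.pow_nonzero; lia).
  set (Y := fun c k => f c (vertex p q (S n) k)).
  assert (HY : forall c k, (k <= 3 ^ n)%nat -> f c (vertex p q n k) = Y c (3 * k)%nat).
  { intros c k Hk. unfold Y. now rewrite vertex_thirds. }
  assert (R1 : forall c k, (k < 3 ^ n)%nat -> Rabs (q * Y c (3 * k)%nat + p * Y c (3 * k + 2)%nat - a (S n) * Y c (3 * k + 1)%nat) <= E).
  { intros c k Hk. specialize (H c (3 * k + 1)%nat ltac:(lia)).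
    rewrite residual_interior, wleft_1 in H by (trivial; lia).
    replace (3 * k + 1 - 1)%nat with (3 * k)%nat in H by lia. replace (S (3 * k + 1)) with (3 * k + 2)%nat in H by lia.
    replace (1 - q) with p in H by lra. exact H. }
  assert (R2 : forall c k, (k < 3 ^ n)%nat -> Rabs (p * Y c (3 * k + 1)%nat + q * Y c (3 * S k)%nat - a (S n) * Y c (3 * k + 2)%nat) <= E).
  { intros c k Hk. specialize (H c (3 * k + 2)%nat ltac:(lia)).
    rewrite residual_interior, wleft_2 in H by (trivial; lia).
    replace (3 * k + 2 - 1)%nat with (3 * k + 1)%nat in H by lia. replace (S (3 * k + 2)) with (3 * S k)%nat in H by lia.
    replace (1 - p) with q in H by lra. exact H. }
  assert (R1' : forall c k, (k < 3 ^ n)%nat -> Rabs (q * Y c (3 * S k)%nat + p * Y c (3 * k + 1)%nat - a (S n) * Y c (3 * k + 2)%nat) <= E).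
  { intros c k Hk. rewrite (Rplus_comm (q * _)). now apply R2. }
  assert (R2' : forall c k, (k < 3 ^ n)%nat -> Rabs (p * Y c (3 * k + 2)%nat + q * Y c (3 * k)%nat - a (S n) * Y c (3 * k + 1)%nat) <= E).
  { intros c k Hk. rewrite (Rplus_comm (p * _)). now apply R1. }
  intros c k Hk. destruct (Nat.eq_dec k 0) as [-> | K0]; [| destruct (Nat.eq_dec k (3 ^ n)) as [-> | K1]].
  - rewrite residual_left, !HY, <- Ha by lia. assert (Hc : forall c', Y c' (3 * 0)%nat = Y c (3 * 0)%nat).
    { unfold Y. rewrite vertex_thirds, vertex_pos by (trivial; lia). change (position p q n 0) with 0. intros []; destruct c; auto. }
    apply (residual_step _ _ _ (Y true (3 * 0 + 1)%nat) (Y true (3 * 0 + 2)%nat) _ (Y false (3 * 0 + 1)%nat) (Y false (3 * 0 + 2)%nat)); trivial; try lra.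
    + rewrite <- (Hc true). now apply R1.
    + now apply (R2 true 0%nat).
    + rewrite <- (Hc false). now apply R1.
    + now apply (R2 false 0%nat).
    + specialize (H c 0%nat ltac:(lia)). rewrite residual_left in H. exact H.
  - set (m := (3 ^ n - 1)%nat). assert (Em : (3 ^ n = S m)%nat) by (unfold m; lia).
    rewrite residual_right. fold m. rewrite !HY, <- Ha by (unfold m; lia).
    assert (Hc : forall c', Y c' (3 * 3 ^ n)%nat = Y c (3 * 3 ^ n)%nat).
    { unfold Y. rewrite vertex_thirds, vertex_pos, pos_last by (trivial; lia). intros []; destruct c; auto. }
    apply (residual_step _ _ _ (Y true (3 * m + 2)%nat) (Y true (3 * m + 1)%nat) _ (Y false (3 * m + 2)%nat) (Y false (3 * m + 1)%nat)); trivial; try lra.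
    + rewrite <- (Hc true), Em. apply R1'. lia.
    + apply (R2' true m). lia.
    + rewrite <- (Hc false), Em. apply R1'. lia.
    + apply (R2' false m). lia.
    + specialize (H c (3 ^ S n)%nat ltac:(lia)). rewrite residual_right in H.
      replace (3 ^ S n - 1)%nat with (3 * m + 2)%nat in H by (unfold m; lia). exact H.
  - assert (Hw := wleft_bounds p q Hp Hq n k). set (m := (k - 1)%nat). assert (Em : k = S m) by (unfold m; lia).
    rewrite residual_interior by lia. fold m. rewrite !HY, <- Ha by (unfold m; lia).
    apply (residual_step _ _ _ (Y c (3 * m + 2)%nat) (Y c (3 * m + 1)%nat) _ (Y c (3 * k + 1)%nat) (Y c (3 * k + 2)%nat)); trivial; try lra.
    + rewrite Em. apply R1'. lia.
    + apply R2'. lia.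
    + apply R1. lia.
    + apply R2. lia.
    + specialize (H c (3 * k)%nat ltac:(lia)). rewrite residual_interior, wleft_0 in H by (trivial; lia).
      replace (3 * k - 1)%nat with (3 * m + 2)%nat in H by (unfold m; lia).
      replace (S (3 * k)) with (3 * k + 1)%nat in H by lia. exact H.
Qed.

Lemma a_minus_1_growth n : (N <= S n)%nat -> Rabs (a n - 1) = growth (a (S n)) * Rabs (a (S n) - 1).
Proof.
  intros H. assert (Hpq := pq_pos p q Hp Hq). rewrite <- Ha, cubP_minus_1 by trivial. specialize (Hap (S n) H).
  replace ((a (S n) - 1) * (a (S n) + p) * (a (S n) + q) / (p * q)) with (growth (a (S n)) * (a (S n) - 1)) by (unfold growth; field; split; lra).
  rewrite Rabs_mult. f_equal. apply Rabs_pos_eq. unfold growth. left. apply Rdiv_lt_0_compat; trivial.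
  apply Rmult_lt_0_compat; lra.
Qed.

(** The factor lost in one decimation step is exactly the ratio of consecutive
    eigenvalues, so residuals of relative size [o(1)] vanish. *)
Lemma residual_vanishes f : f true 0 = f false 0 -> f true 1 = f false 1 ->
  (forall eps, 0 < eps -> exists M, forall n c k, (M <= n)%nat -> (k <= 3 ^ n)%nat -> Rabs (residual f n c k) <= eps * Rabs (a n - 1)) ->
  forall n c k, (N <= n)%nat -> (k <= 3 ^ n)%nat -> residual f n c k = 0.
Proof.
  intros F0 F1 H n c k Hn Hk.
  assert (G : forall eps, 0 < eps -> Rabs (residual f n c k) <= eps * Rabs (a n - 1)).
  { intros eps Heps. destruct (H eps Heps) as [M HM].
    assert (D : forall m, (m <= M)%nat -> forall j, (N <= j)%nat -> (M - m <= j)%nat ->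
      forall c k, (k <= 3 ^ j)%nat -> Rabs (residual f j c k) <= eps * Rabs (a j - 1)).
    { induction m; intros Hm j Hj HjM.
      - intros c' k' Hk'. apply HM; trivial. lia.
      - destruct (le_lt_dec (M - m) j) as [Hl | Hl]; [apply IHm; trivial; lia |].
        intros c' k' Hk'. rewrite a_minus_1_growth by lia. rewrite <- Rmult_assoc, (Rmult_comm eps), Rmult_assoc.
        apply residual_decimation; trivial; [apply Hap; lia |]. apply IHm; lia. }
    apply (D M); trivial; lia. }
  assert (Rabs (residual f n c k) = 0).
  { apply Rle_antisym; [| apply Rabs_pos]. apply le_epsilon. intros eps Heps.
    assert (P := Rabs_pos (a n - 1)).
    eapply Rle_trans; [apply (G (eps / (Rabs (a n - 1) + 1))); apply Rdiv_lt_0_compat; lra |].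
    replace (eps / (Rabs (a n - 1) + 1) * Rabs (a n - 1)) with (eps * (Rabs (a n - 1) / (Rabs (a n - 1) + 1))) by (field; lra).
    assert (Rabs (a n - 1) / (Rabs (a n - 1) + 1) <= 1) by (apply Rle_div_l; lra). nra. }
  destruct (Req_dec (residual f n c k) 0) as [E | E]; trivial. now apply Rabs_no_R0 in E.
Qed.

Lemma Laplacian_residual f n c k : lam ^ n * - Delta p q n f c k - t * f c (vertex p q n k) =
  - (2 * lam ^ n * residual f n c k) - (lam ^ n * (2 * (a n - 1)) - - t) * f c (vertex p q n k).
Proof. unfold residual. field. Qed.

Lemma continuous_double_bounded f : continuous_double f -> exists B, 0 < B /\ forall c x, unit_itv x -> Rabs (f c x) <= B.
Proof.
  intros [H _]. destruct (continuous_on_unit_bounded _ (H true)) as (B & HB & H1).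
  destruct (continuous_on_unit_bounded _ (H false)) as (B' & HB' & H2).
  exists (B + B'). split; [lra |]. intros [] x Hx; [specialize (H1 x Hx) | specialize (H2 x Hx)]; lra.
Qed.

Lemma vertex_unit n k : (k <= 3 ^ n)%nat -> unit_itv (vertex p q n k).
Proof. intros H. rewrite vertex_pos by trivial. now apply pos_unit. Qed.

Lemma eigenfunction_residual f : eigenfunction p q t f -> forall n c k, (N <= n)%nat -> (k <= 3 ^ n)%nat -> residual f n c k = 0.
Proof.
  intros (Hf & _ & H). assert (Hf' := Hf). destruct Hf as (_ & F0 & F1). apply residual_vanishes; trivial.
  destruct (continuous_double_bounded f Hf') as (B & HB & Hbd).
  intros eps Heps. apply is_lim_seq_spec in Hlim.
  assert (HT : 0 < Rabs t) by now apply Rabs_pos_lt.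
  assert (He1 : 0 < Rmin (Rabs t / 2) (eps * Rabs t / (4 * B))).
  { apply Rmin_pos; [lra |]. apply Rdiv_lt_0_compat; nra. }
  destruct (Hlim (mkposreal _ He1)) as [M1 HM1]. simpl in HM1.
  destruct (H (eps * Rabs t / 4) ltac:(nra)) as [M2 HM2].
  exists (M1 + M2)%nat. intros n c k Hn Hk. specialize (HM1 n ltac:(lia)). specialize (HM2 n c k ltac:(lia) Hk).
  cbv beta in HM2. rewrite Laplacian_residual in HM2.
  assert (HL := lam_pow_pos p q Hp Hq n). specialize (Hbd c _ (vertex_unit n k Hk)).
  assert (HM3 : Rabs (lam ^ n * (2 * (a n - 1)) - - t) < Rabs t / 2) by (eapply Rlt_le_trans; [exact HM1 | apply Rmin_l]).
  assert (HM4 : Rabs (lam ^ n * (2 * (a n - 1)) - - t) <= eps * Rabs t / (4 * B)) by (left; eapply Rlt_le_trans; [exact HM1 | apply Rmin_r]).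
  assert (B1 : Rabs t / 2 <= 2 * lam ^ n * Rabs (a n - 1)).
  { replace (2 * lam ^ n * Rabs (a n - 1)) with (Rabs (lam ^ n * (2 * (a n - 1)))).
    - assert (T := Rabs_triang_inv (- t) (- t - lam ^ n * (2 * (a n - 1)))).
      rewrite (Rabs_minus_sym (- t)), Rabs_Ropp in T.
      replace (- t - (- t - lam ^ n * (2 * (a n - 1)))) with (lam ^ n * (2 * (a n - 1))) in T by ring. lra.
    - rewrite !Rabs_mult, (Rabs_pos_eq 2), (Rabs_pos_eq (lam ^ n)) by lra. ring. }
  assert (B2 : 2 * lam ^ n * Rabs (residual f n c k) <= eps * Rabs t / 2).
  { set (u := f c (vertex p q n k)) in *. set (d := lam ^ n * (2 * (a n - 1)) - - t) in *.
    assert (B3 : Rabs (d * u) <= eps * Rabs t / 4).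
    { rewrite Rabs_mult. replace (eps * Rabs t / 4) with (eps * Rabs t / (4 * B) * B) by (field; lra).
      apply Rmult_le_compat; trivial; apply Rabs_pos. }
    replace (2 * lam ^ n * Rabs (residual f n c k)) with (Rabs (2 * lam ^ n * residual f n c k)).
    2:{ rewrite !Rabs_mult, (Rabs_pos_eq 2), (Rabs_pos_eq (lam ^ n)) by lra. ring. }
    apply Rabs_def2 in HM2. apply Rabs_le_between in B3. apply Rabs_le. lra. }
  apply Rmult_le_reg_l with (2 * lam ^ n); [lra |].
  apply Rle_trans with (eps * (Rabs t / 2)); [lra |]. nra.
Qed.

Lemma residual_eigenfunction f : continuous_double f ->
  (forall n c k, (N <= n)%nat -> (k <= 3 ^ n)%nat -> residual f n c k = 0) -> eigenfunction p q t f.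
Proof.
  intros Hf H. split; [trivial | split].
  - destruct Hf as (Hc & F0 & F1). split; [| cbv beta; now rewrite F0, F1].
    intros c x Hx. apply (filterlim_comp _ _ _ (f c) (fun y => t * y) _ (locally (f c x))); [now apply Hc |].
    apply (continuous_mult (K := R_AbsRing) (fun _ => t) (fun y => y)); [apply continuous_const | apply continuous_id].
  - intros eps Heps. destruct (continuous_double_bounded f Hf) as (B & HB & Hbd).
    apply is_lim_seq_spec in Hlim. assert (He : 0 < eps / B) by now apply Rdiv_lt_0_compat.
    destruct (Hlim (mkposreal _ He)) as [M HM]. simpl in HM. exists (N + M)%nat. intros n c k Hn Hk.
    specialize (HM n ltac:(lia)). rewrite Laplacian_residual, H by (trivial; lia).
    rewrite Rmult_0_r, Ropp_0, Rminus_0_l, Rabs_Ropp, Rabs_mult.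
    specialize (Hbd c _ (vertex_unit n k Hk)).
    apply Rle_lt_trans with (Rabs (lam ^ n * (2 * (a n - 1)) - - t) * B).
    + apply Rmult_le_compat_l; [apply Rabs_pos | trivial].
    + now apply Rlt_div_r.
Qed.

End Decimation.

(** * Solutions of the eigenvalue equation *)

(** The upper envelope of the cones with slope [L] below the given points. *)
Lemma lipschitz_extension (G : R -> R -> Prop) L : 0 <= L -> (exists x y, G x y) ->
  (forall x y x' y', G x y -> G x' y' -> Rabs (y - y') <= L * Rabs (x - x')) ->
  exists f, (forall x y, Rabs (f y - f x) <= L * Rabs (y - x)) /\ forall x y, G x y -> f x = y.
Proof.
  intros HL (x0 & y0 & H0) H.
  set (E := fun z r => exists x y, G x y /\ r = y - L * Rabs (z - x)).
  assert (Hlub : forall z, exists m, is_lub (E z) m).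
  { intros z. destruct (completeness (E z)) as [m Hm]; [| | now exists m].
    - exists (y0 + L * Rabs (z - x0)). intros r (x & y & Hxy & ->). specialize (H _ _ _ _ Hxy H0).
      assert (T := Rabs_triang (x - z) (z - x0)). replace (x - z + (z - x0)) with (x - x0) in T by ring.
      rewrite (Rabs_minus_sym x z) in T. apply Rabs_le_between in H. nra.
    - now exists (y0 - L * Rabs (z - x0)), x0, y0. }
  set (f := fun z => epsilon (inhabits 0) (is_lub (E z))).
  assert (Hf : forall z, is_lub (E z) (f z)) by (intros z; unfold f; apply epsilon_spec, Hlub).
  assert (Hle : forall x y, f y - f x <= L * Rabs (y - x)).
  { intros x y. enough (f y <= f x + L * Rabs (y - x)) by lra. apply (Hf y). intros r (u & v & Huv & ->).
    assert (B : v - L * Rabs (x - u) <= f x) by (apply (Hf x); now exists u, v).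
    assert (T := Rabs_triang (x - y) (y - u)). replace (x - y + (y - u)) with (x - u) in T by ring.
    rewrite (Rabs_minus_sym x y) in T. nra. }
  exists f. split.
  - intros x y. apply Rabs_le. generalize (Hle x y) (Hle y x). rewrite (Rabs_minus_sym x y). lra.
  - intros x y Hxy. apply Rle_antisym.
    + apply (Hf x). intros r (u & v & Huv & ->). specialize (H _ _ _ _ Huv Hxy).
      rewrite (Rabs_minus_sym u x) in H. apply Rabs_le_between in H. lra.
    + apply (Hf x). exists x, y. split; trivial. rewrite Rminus_diag, Rabs_R0. ring.
Qed.

Section Transfer.

Variables p q : R.
Hypothesis Hp : 0 < p < 1.
Hypothesis Hq : q = 1 - p.

Local Notation lam := (lambda p q).
Local Notation cell := (cell_length p q).
Local Notation pos := (position p q).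

(** The factors by which the product of the transfer matrices of the three subcells
    of a cell changes their off-diagonal entries [b] and [c]. *)
Definition ratioB (x : R) : R := (x ^ 2 - p ^ 2) / (q * (1 + p)).
Definition ratioC (x : R) : R := (x ^ 2 - q ^ 2) * (1 + p) / (p ^ 2 * q).

Variables a b c : nat -> R.
Hypothesis Ha : forall n, cubP p q (a (S n)) = a n.
Hypothesis Hb : forall n, b n = ratioB (a (S n)) * b (S n).
Hypothesis Hc : forall n, c n = ratioC (a (S n)) * c (S n).
Hypothesis Hbc : forall n, b n * c n = a n ^ 2 - 1.

(** A value together with a slope; for [a = cos], [b = - c = sin] over a cell
    of unit length this is a rotation. *)
Definition transfer (n k : nat) (v : R * R) : R * R :=
  (a n * fst v + cell n k * b n * snd v, c n / cell n k * fst v + a n * snd v).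

Fixpoint state (n : nat) (v : R * R) (k : nat) : R * R :=
  match k with O => v | S k => transfer n k (state n v k) end.

Lemma transfer_thirds n k v :
  transfer (S n) (3 * k + 2) (transfer (S n) (3 * k + 1) (transfer (S n) (3 * k) v)) = transfer n k v.
Proof.
  unfold transfer. cbn [fst snd]. rewrite cell_0, cell_1, cell_2.
  assert (Hl := cell_pos p q Hp Hq n k). rewrite <- (Ha n), (Hb n), (Hc n).
  assert (D := Hbc (S n)). assert (Hpq := pq_pos p q Hp Hq).
  revert Hl D. generalize (cell n k) (a (S n)) (b (S n)) (c (S n)) (fst v) (snd v).
  intros l x y z u w Hl D. unfold cubP, ratioB, ratioC.
  (* Modulo [b c = a ^ 2 - 1] both sides are linear in [b c]; the factors below
     are the coefficients of that relation. *)
  f_equal; apply Rminus_diag_uniq.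
  - transitivity ((x * (1 - p * q) / (p * q) * u + l * y * p ^ 2 / (q * (1 + p)) * w) * (y * z - (x ^ 2 - 1))).
    + rewrite Hq. field. repeat split; lra.
    + rewrite D. ring.
  - transitivity ((z / l * q * (1 + p) / p ^ 2 * u + x * (1 - p * q) / (p * q) * w) * (y * z - (x ^ 2 - 1))).
    + rewrite Hq. field. repeat split; lra.
    + rewrite D. ring.
Qed.

Lemma state_thirds n v k : state (S n) v (3 * k) = state n v k.
Proof.
  induction k; [reflexivity |]. replace (3 * S k)%nat with (S (S (S (3 * k)))) by lia. cbn [state].
  rewrite IHk. replace (S (S (3 * k))) with (3 * k + 2)%nat by lia. replace (S (3 * k)) with (3 * k + 1)%nat by lia.
  apply transfer_thirds.
Qed.

Lemma state_level n m v k : state (n + m) v (3 ^ m * k) = state n v k.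
Proof.
  revert k. induction m; intros k; [now rewrite Nat.add_0_r, Nat.mul_1_l |].
  rewrite <- plus_n_Sm. replace (3 ^ S m * k)%nat with (3 * (3 ^ m * k))%nat by (simpl; lia).
  now rewrite state_thirds.
Qed.

(** The whole interval is the only cell of level 0. *)
Lemma state_last n v : state n v (3 ^ n) = (a 0 * fst v + b 0 * snd v, c 0 * fst v + a 0 * snd v).
Proof.
  assert (H := state_level 0 n v 1). rewrite Nat.mul_1_r, Nat.add_0_l in H. rewrite H. cbn [state].
  unfold transfer. cbn [cell_length]. f_equal; field.
Qed.

Lemma state_linear n x y k :
  state n (x, y) k = (x * fst (state n (1, 0) k) + y * fst (state n (0, 1) k), x * snd (state n (1, 0) k) + y * snd (state n (0, 1) k)).
Proof.
  induction k; cbn [state]; [simpl; f_equal; ring |]. rewrite IHk. unfold transfer. cbn [fst snd]. f_equal; ring.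
Qed.

Definition value (n : nat) (v : R * R) (k : nat) : R := fst (state n v k).

Lemma value_succ n v k : value n v (S k) = a n * value n v k + cell n k * b n * snd (state n v k).
Proof. reflexivity. Qed.

(** The transfer is inverted by flipping the sign of the slope. *)
Lemma value_pred n v k : value n v k = a n * value n v (S k) - cell n k * b n * snd (state n v (S k)).
Proof.
  unfold value. cbn [state]. unfold transfer. cbn [fst snd]. assert (Hl := cell_pos p q Hp Hq n k).
  transitivity ((a n ^ 2 - b n * c n) * fst (state n v k)); [rewrite Hbc; ring | field; lra].
Qed.

Lemma value_interior n v k :
  wleft p q n (S k) * value n v k + (1 - wleft p q n (S k)) * value n v (S (S k)) = a n * value n v (S k).
Proof.
  rewrite value_pred, (value_succ n v (S k)). unfold wleft. replace (S k - 1)%nat with k by lia.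
  generalize (cell_pos p q Hp Hq n k) (cell_pos p q Hp Hq n (S k)). intros. field. lra.
Qed.

Variables (N : nat) (D : R).
Hypothesis HD : 0 <= D.
Hypothesis HbN : forall n, (N <= n)%nat -> b n <> 0 /\ Rabs (b n) <= 2.
Hypothesis HcN : forall n, (N <= n)%nat -> lam ^ n * Rabs (c n) <= D.
Hypothesis HaN : forall n, (N <= n)%nat -> lam ^ n * Rabs (a n - 1) <= D.

Definition size (v : R * R) : R := Rabs (fst v) + Rabs (snd v).

Lemma size_pos v : 0 <= size v.
Proof. unfold size. generalize (Rabs_pos (fst v)) (Rabs_pos (snd v)). lra. Qed.

Lemma cell_le_1 n k : cell n k <= 1.
Proof.
  eapply Rle_trans; [apply (cell_small p q Hp Hq) |]. assert (HM := Mx_bounds p q Hp Hq).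
  rewrite <- (pow1 n). apply pow_incr. lra.
Qed.

Lemma size_transfer n k v :
  size (transfer n k v) <= exp (Rabs (b n) * cell n k + (Rabs (a n - 1) + Rabs (c n)) * / cell n k) * size v.
Proof.
  assert (Hl := cell_pos p q Hp Hq n k). assert (Hl1 := cell_le_1 n k).
  assert (Hi : 1 <= / cell n k) by (rewrite <- Rinv_1; apply Rinv_le_contravar; lra).
  eapply Rle_trans; [| apply Rmult_le_compat_r; [apply size_pos | apply exp_ineq1_le]].
  unfold size, transfer. cbn [fst snd]. unfold Rdiv.
  assert (HA : Rabs (a n) <= 1 + Rabs (a n - 1)).
  { assert (T := Rabs_triang 1 (a n - 1)). replace (1 + (a n - 1)) with (a n) in T by ring. rewrite Rabs_R1 in T. lra. }
  assert (T1 := Rabs_triang (a n * fst v) (cell n k * b n * snd v)).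
  assert (T2 := Rabs_triang (c n * / cell n k * fst v) (a n * snd v)).
  rewrite !Rabs_mult in T1, T2. rewrite (Rabs_pos_eq (cell n k)) in T1 by lra. rewrite (Rabs_pos_eq (/ cell n k)) in T2 by lra.
  revert T1 T2 Hl Hi HA. generalize (Rabs_pos (fst v)) (Rabs_pos (snd v)) (Rabs_pos (a n)) (Rabs_pos (a n - 1)) (Rabs_pos (b n)) (Rabs_pos (c n)).
  generalize (Rabs (a n * fst v + cell n k * b n * snd v)) (Rabs (c n * / cell n k * fst v + a n * snd v)).
  generalize (Rabs (fst v)) (Rabs (snd v)) (Rabs (a n)) (Rabs (a n - 1)) (Rabs (b n)) (Rabs (c n)) (cell n k) (/ cell n k).
  intros u w A d B C l i X Y Hu Hw HA Hd HB HC T1 T2 Hl Hi HAd.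
  assert (A <= 1 + d * i) by nra.
  assert (A * u <= (1 + d * i) * u) by (apply Rmult_le_compat_r; trivial).
  assert (A * w <= (1 + d * i) * w) by (apply Rmult_le_compat_r; trivial).
  assert (0 <= B * l * u) by (apply Rmult_le_pos; [apply Rmult_le_pos; lra | lra]).
  assert (0 <= C * i * w) by (apply Rmult_le_pos; [apply Rmult_le_pos; lra | lra]).
  nra.
Qed.

(** The sums of the cell lengths and of their inverses over a level are [1] and
    [lam ^ n]; the latter is what the decay of [a n - 1] and [c n] compensates. *)
Lemma size_state n v k : (N <= n)%nat -> (k <= 3 ^ n)%nat -> size (state n v k) <= exp (2 + 2 * D) * size v.
Proof.
  intros Hn Hk. set (g := fun j => Rabs (b n) * cell n j + (Rabs (a n - 1) + Rabs (c n)) * / cell n j).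
  assert (Hg : forall j, 0 <= g j).
  { intros j. assert (Hl := cell_pos p q Hp Hq n j). assert (0 < / cell n j) by now apply Rinv_0_lt_compat. unfold g.
    generalize (Rabs_pos (a n - 1)) (Rabs_pos (b n)) (Rabs_pos (c n)). intros. nra. }
  assert (G : forall j, size (state n v j) <= exp (Rsum g j) * size v).
  { induction j; cbn [state Rsum]; [rewrite exp_0; lra |].
    eapply Rle_trans; [apply size_transfer |]. fold (g j). rewrite exp_plus, (Rmult_comm (exp (Rsum g j))), Rmult_assoc.
    apply Rmult_le_compat_l; [left; apply exp_pos | trivial]. }
  eapply Rle_trans; [apply G |]. apply Rmult_le_compat_r; [apply size_pos |]. apply exp_le_mono.
  apply Rle_trans with (Rsum g (3 ^ n)).
  - replace (3 ^ n)%nat with (k + (3 ^ n - k))%nat by lia. rewrite Rsum_plus.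
    assert (0 <= Rsum (fun j => g (k + j)%nat) (3 ^ n - k)) by (apply Rsum_pos; auto). lra.
  - assert (E : forall m, Rsum g m = Rabs (b n) * Rsum (cell n) m + (Rabs (a n - 1) + Rabs (c n)) * Rsum (fun j => / cell n j) m).
    { induction m; cbn [Rsum]; [ring |]. rewrite IHm. unfold g. ring. }
    rewrite E, cell_sum_inv by trivial. change (Rsum (cell n) (3 ^ n)) with (pos n (3 ^ n)). rewrite pos_last by trivial.
    generalize (proj2 (HbN n Hn)) (HcN n Hn) (HaN n Hn). lra.
Qed.

Definition lipschitz_constant (v : R * R) : R := (D + 2) * (exp (2 + 2 * D) * size v) + 1.

Lemma lipschitz_constant_pos v : 0 < lipschitz_constant v.
Proof.
  unfold lipschitz_constant. assert (0 <= (D + 2) * (exp (2 + 2 * D) * size v)); [| lra].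
  apply Rmult_le_pos; [lra |]. apply Rmult_le_pos; [left; apply exp_pos | apply size_pos].
Qed.

Lemma value_step n v k : (N <= n)%nat -> (k < 3 ^ n)%nat ->
  Rabs (value n v (S k) - value n v k) <= lipschitz_constant v * cell n k.
Proof.
  intros Hn Hk. assert (Hs := size_state n v k Hn ltac:(lia)). rewrite value_succ.
  assert (Hl := cell_pos p q Hp Hq n k). assert (Hi := inv_cell_le p q Hp Hq n k Hk).
  assert (HL := lam_pow_pos p q Hp Hq n). assert (Had := HaN n Hn). assert (Hb2 := proj2 (HbN n Hn)).
  assert (Hal : Rabs (a n - 1) <= D * cell n k).
  { apply Rmult_le_reg_r with (/ cell n k); [now apply Rinv_0_lt_compat |]. rewrite Rmult_assoc, Rinv_r, Rmult_1_r by lra.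
    generalize (Rabs_pos (a n - 1)). intros. nra. }
  unfold lipschitz_constant, value. set (S0 := exp (2 + 2 * D) * size v) in *.
  replace (a n * fst (state n v k) + cell n k * b n * snd (state n v k) - fst (state n v k))
    with ((a n - 1) * fst (state n v k) + cell n k * (b n * snd (state n v k))) by ring.
  eapply Rle_trans; [apply Rabs_triang |]. rewrite !Rabs_mult, (Rabs_pos_eq (cell n k)) by lra.
  unfold size in Hs at 1. revert Hs Hal Hb2 Hl. generalize (Rabs_pos (a n - 1)) (Rabs_pos (b n)).
  generalize (Rabs_pos (fst (state n v k))) (Rabs_pos (snd (state n v k))).
  generalize (Rabs (fst (state n v k))) (Rabs (snd (state n v k))) (Rabs (a n - 1)) (Rabs (b n)) (cell n k) S0.
  clear - HD. intros y e d B l S0 Hy He Hd HB Hs Hal Hb2 Hl.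
  assert (d * y <= D * l * S0) by (apply Rmult_le_compat; lra).
  assert (B * e <= 2 * S0) by (apply Rmult_le_compat; lra). nra.
Qed.

Lemma value_lipschitz_level n v j k : (N <= n)%nat -> (j <= k <= 3 ^ n)%nat ->
  Rabs (value n v k - value n v j) <= lipschitz_constant v * (pos n k - pos n j).
Proof.
  intros Hn [Hjk Hk]. induction Hjk.
  - rewrite !Rminus_diag, Rabs_R0. lra.
  - specialize (IHHjk ltac:(lia)). assert (Hst := value_step n v m Hn ltac:(lia)).
    rewrite pos_succ. replace (value n v (S m) - value n v j) with ((value n v (S m) - value n v m) + (value n v m - value n v j)) by ring.
    eapply Rle_trans; [apply Rabs_triang |]. lra.
Qed.

Lemma value_lipschitz n m v j k : (N <= n)%nat -> (N <= m)%nat -> (j <= 3 ^ n)%nat -> (k <= 3 ^ m)%nat ->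
  Rabs (value n v j - value m v k) <= lipschitz_constant v * Rabs (pos n j - pos m k).
Proof.
  intros Hn Hm Hj Hk.
  assert (G : forall i j k, (N <= i)%nat -> (j <= 3 ^ i)%nat -> (k <= 3 ^ i)%nat ->
    Rabs (value i v j - value i v k) <= lipschitz_constant v * Rabs (pos i j - pos i k)).
  { clear j k Hj Hk. intros i j k Hi Hj Hk. destruct (le_lt_dec j k) as [H | H].
    - rewrite Rabs_minus_sym, (Rabs_minus_sym (pos i j)). rewrite (Rabs_pos_eq (pos i k - pos i j)).
      + apply value_lipschitz_level; trivial. lia.
      + generalize (pos_increasing p q Hp Hq i j k H). lra.
    - rewrite (Rabs_pos_eq (pos i j - pos i k)).
      + apply value_lipschitz_level; trivial. lia.
      + generalize (pos_increasing p q Hp Hq i k j ltac:(lia)). lra. }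
  unfold value. rewrite <- (state_level n m v j), <- (state_level m n v k), <- (pos_level p q Hp Hq n m j), <- (pos_level p q Hp Hq m n k).
  rewrite (Nat.add_comm m n). apply G; [lia | |]; rewrite Nat.pow_add_r.
  - rewrite Nat.mul_comm. apply Nat.mul_le_mono_r; trivial.
  - apply Nat.mul_le_mono_l; trivial.
Qed.

(** Opposite slopes in the two copies are the equation at the first glued point. *)
Definition represents (f : dfun) (x e : R) : Prop :=
  (forall s, continuous_on unit_itv (f s)) /\
  forall (s : bool) n k, (N <= n)%nat -> (k <= 3 ^ n)%nat ->
    f s (vertex p q n k) = value n (x, if s then e else - e) k.

Lemma solution_exists v : exists f, continuous_on unit_itv f /\
  forall n k, (N <= n)%nat -> (k <= 3 ^ n)%nat -> f (vertex p q n k) = value n v k.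
Proof.
  assert (HL := lipschitz_constant_pos v).
  destruct (lipschitz_extension
    (fun x y => exists n k, (N <= n)%nat /\ (k <= 3 ^ n)%nat /\ x = pos n k /\ y = value n v k)
    (lipschitz_constant v)) as (f & Hf & HG).
  - lra.
  - exists (pos N 0), (value N v 0), N, 0%nat. repeat split; lia.
  - intros x y x' y' (n & k & Hn & Hk & -> & ->) (n' & k' & Hn' & Hk' & -> & ->). now apply value_lipschitz.
  - exists f. split; [now apply (lipschitz_continuous_on f (lipschitz_constant v)) |].
    intros n k Hn Hk. rewrite vertex_pos by trivial. apply HG. now exists n, k.
Qed.

Lemma represents_exists x e : exists f, represents f x e.
Proof.
  destruct (solution_exists (x, e)) as (f & Cf & Hf). destruct (solution_exists (x, - e)) as (g & Cg & Hg).
  exists (fun s : bool => if s then f else g). split; intros []; auto.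
Qed.

(** Both sides are continuous and agree at the vertices, which are dense. *)
Lemma represents_combination u w f x e : represents u 1 0 -> represents w 0 1 -> represents f x e ->
  forall s z, unit_itv z -> f s z = x * u s z + e * w s z.
Proof.
  intros [Cu Hu] [Cw Hw] [Cf Hf] s z Hz.
  destruct (Req_dec (f s z) (x * u s z + e * w s z)) as [E | NE]; trivial. exfalso.
  set (eps := Rabs (f s z - (x * u s z + e * w s z))).
  assert (Heps : 0 < eps) by (apply Rabs_pos_lt; lra).
  set (eta := eps / (2 + Rabs x + Rabs e)). assert (Hx := Rabs_pos x). assert (He := Rabs_pos e).
  assert (Heta : 0 < eta) by (apply Rdiv_lt_0_compat; lra).
  destruct (continuous_on_unit_eps _ (Cf s) z Hz eta Heta) as (d1 & Hd1 & H1).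
  destruct (continuous_on_unit_eps _ (Cu s) z Hz eta Heta) as (d2 & Hd2 & H2).
  destruct (continuous_on_unit_eps _ (Cw s) z Hz eta Heta) as (d3 & Hd3 & H3).
  destruct (vertex_dense p q Hp Hq z (Rmin d1 (Rmin d2 d3)) Hz ltac:(repeat apply Rmin_pos; trivial) N) as (n & k & Hn & Hk & Hd).
  set (y := vertex p q n k) in *. assert (Hy : unit_itv y) by now apply vertex_unit.
  assert (D1 : Rabs (y - z) < d1) by (eapply Rlt_le_trans; [exact Hd | apply Rmin_l]).
  assert (D23 : Rabs (y - z) < Rmin d2 d3) by (eapply Rlt_le_trans; [exact Hd | apply Rmin_r]).
  assert (D2 : Rabs (y - z) < d2) by (eapply Rlt_le_trans; [exact D23 | apply Rmin_l]).
  assert (D3 : Rabs (y - z) < d3) by (eapply Rlt_le_trans; [exact D23 | apply Rmin_r]).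
  specialize (H1 y Hy D1). specialize (H2 y Hy D2). specialize (H3 y Hy D3).
  assert (Ey : f s y = x * u s y + e * w s y).
  { assert (Lin : forall x' e', value n (x', e') k = x' * fst (state n (1, 0) k) + e' * fst (state n (0, 1) k)).
    { intros. unfold value. now rewrite state_linear. }
    unfold y. rewrite Hf, Hu, Hw by trivial. rewrite !Lin. destruct s; ring. }
  assert (B : eps <= Rabs (f s y - f s z) + Rabs x * Rabs (u s y - u s z) + Rabs e * Rabs (w s y - w s z)).
  { rewrite <- !Rabs_mult. unfold eps.
    replace (f s z - (x * u s z + e * w s z)) with (- (f s y - f s z) + (x * (u s y - u s z) + e * (w s y - w s z))) by (rewrite Ey; ring).
    eapply Rle_trans; [apply Rabs_triang |]. rewrite Rabs_Ropp.
    generalize (Rabs_triang (x * (u s y - u s z)) (e * (w s y - w s z))). lra. }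
  assert (E : eta * (2 + Rabs x + Rabs e) = eps) by (unfold eta; field; lra). nra.
Qed.

Lemma cell_first n : 0 < cell n 0.
Proof. apply cell_pos; trivial. Qed.

Lemma three_pow_pos n : (0 < 3 ^ n)%nat.
Proof. apply Nat.neq_0_lt_0, Nat.pow_nonzero. lia. Qed.

Lemma represents_independent u w x e : represents u 1 0 -> represents w 0 1 ->
  (forall z, unit_itv z -> x * u true z + e * w true z = 0) -> x = 0 /\ e = 0.
Proof.
  intros [_ Hu] [_ Hw] H. assert (H3 := three_pow_pos N). assert (Hl := cell_first N). assert (HB := proj1 (HbN N (le_n _))).
  assert (H0 := H _ (vertex_unit p q Hp Hq N 0 ltac:(lia))). assert (H1 := H _ (vertex_unit p q Hp Hq N 1 ltac:(lia))).
  rewrite Hu, Hw in H0, H1 by lia. unfold value in *. cbn [state] in *. unfold transfer in H1. cbn [fst snd] in *.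
  assert (Hx : x = 0) by lra. split; trivial. subst x.
  apply Rmult_eq_reg_r with (cell N 0 * b N); [lra |]. apply Rmult_integral_contrapositive. split; lra.
Qed.

(** At the second glued point the values agree if [b 0 * e = 0], and the two slopes
    there add up to [2 * c 0 * x]. *)
Lemma represents_eigenfunction t f x e : t <> 0 -> is_lim_seq (fun n => lam ^ n * (2 * (a n - 1))) (- t) ->
  (forall n, (N <= n)%nat -> p <= a n) ->
  represents f x e -> c 0 * x = 0 -> b 0 * e = 0 -> eigenfunction p q t f.
Proof.
  intros Ht Hlim Hap [Cf Hf] Hx He. assert (H3 := three_pow_pos).
  assert (V1 : forall n s, (N <= n)%nat -> f s (vertex p q n (3 ^ n)) = a 0 * x).
  { intros n s Hn. rewrite Hf by trivial. unfold value. rewrite state_last. cbn [fst snd]. destruct s; lra. }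
  apply (residual_eigenfunction p q Hp Hq a N t Hlim).
  - split; [trivial |]. split.
    + generalize (Hf true N 0%nat (le_n _) ltac:(lia)) (Hf false N 0%nat (le_n _) ltac:(lia)).
      rewrite vertex_pos by (trivial; lia). change (pos N 0) with 0. intros -> ->. reflexivity.
    + generalize (V1 N true (le_n _)) (V1 N false (le_n _)).
      rewrite vertex_pos, pos_last by (trivial; lia). intros -> ->. reflexivity.
  - intros n s k Hn Hk. specialize (H3 n).
    destruct (Nat.eq_dec k 0) as [-> | K0]; [| destruct (Nat.eq_dec k (3 ^ n)) as [-> | K1]].
    + rewrite residual_left, !Hf by (trivial; lia). rewrite !value_succ. unfold value. cbn [state fst snd]. field.
    + rewrite residual_right, V1 by trivial. assert (Em : (3 ^ n = S (3 ^ n - 1))%nat) by lia.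
      rewrite !Hf by lia. rewrite (value_pred n (x, e)), (value_pred n (x, - e)), <- Em.
      unfold value. rewrite !state_last. cbn [fst snd].
      transitivity (- (cell n (3 ^ n - 1) * b n) * (c 0 * x)); [field_simplify; lra | rewrite Hx; ring].
    + rewrite (residual_interior p q Hp Hq) by lia. rewrite !Hf by lia.
      assert (E := value_interior n (x, if s then e else - e) (k - 1)). replace (S (k - 1)) with k in E by lia. lra.
Qed.

(** At level [N] the equation at interior vertices propagates the first two
    values; the slope does not depend on the level because the transfer
    matrices of consecutive levels are compatible. *)
Lemma solution_unique g : (forall n k, (N <= n)%nat -> (0 < k < 3 ^ n)%nat ->
    wleft p q n k * g (vertex p q n (k - 1)) + (1 - wleft p q n k) * g (vertex p q n (S k)) = a n * g (vertex p q n k)) ->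
  exists e, forall n k, (N <= n)%nat -> (k <= 3 ^ n)%nat -> g (vertex p q n k) = value n (g 0, e) k.
Proof.
  intros H. set (e := fun n => (g (vertex p q n 1) - a n * g 0) / (b n * cell n 0)).
  assert (H0 : forall n, vertex p q n 0 = 0) by (intros n; rewrite vertex_pos by (trivial; lia); reflexivity).
  assert (L : forall n, (N <= n)%nat -> forall k, (S k <= 3 ^ n)%nat ->
    g (vertex p q n k) = value n (g 0, e n) k /\ g (vertex p q n (S k)) = value n (g 0, e n) (S k)).
  { intros n Hn. assert (Hl := cell_first n). assert (HB := proj1 (HbN n Hn)). induction k; intros Hk.
    - split; [now rewrite H0 |]. rewrite value_succ. unfold value, e. cbn [state fst snd]. field. split; [lra | trivial].
    - destruct (IHk ltac:(lia)) as [I1 I2]. split; trivial.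
      specialize (H n (S k) Hn ltac:(lia)). assert (E := value_interior n (g 0, e n) k).
      replace (S k - 1)%nat with k in H by lia. rewrite I1, I2 in H.
      assert (Hw : 0 < 1 - wleft p q n (S k)).
      { unfold wleft. replace (S k - 1)%nat with k by lia. generalize (cell_pos p q Hp Hq n k) (cell_pos p q Hp Hq n (S k)). intros.
        replace (1 - cell n (S k) / (cell n k + cell n (S k))) with (cell n k / (cell n k + cell n (S k))) by (field; lra).
        apply Rdiv_lt_0_compat; lra. }
      apply Rmult_eq_reg_l with (1 - wleft p q n (S k)); lra. }
  assert (L' : forall n k, (N <= n)%nat -> (k <= 3 ^ n)%nat -> g (vertex p q n k) = value n (g 0, e n) k).
  { intros n k Hn Hk. assert (H3 := three_pow_pos n). destruct k; [apply L; trivial; lia |]. now apply L. }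
  exists (e N). intros n k Hn Hk. rewrite L' by trivial. do 2 f_equal.
  assert (H3 := three_pow_pos N). assert (H3' := three_pow_pos (n - N)).
  assert (E1 := L' N 1%nat (le_n _) ltac:(lia)).
  assert (E2 : g (vertex p q N 1) = value N (g 0, e n) 1).
  { unfold value. rewrite <- (state_level N (n - N)). replace (N + (n - N))%nat with n by lia.
    assert (Hle : (3 ^ (n - N) * 1 <= 3 ^ n)%nat) by (rewrite Nat.mul_1_r; apply Nat.pow_le_mono_r; lia).
    change (g (vertex p q N 1) = value n (g 0, e n) (3 ^ (n - N) * 1)). rewrite <- L' by trivial.
    rewrite !vertex_pos by (trivial; lia). f_equal.
    assert (Ep := pos_level p q Hp Hq N (n - N) 1). replace (N + (n - N))%nat with n in Ep by lia. now symmetry. }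
  rewrite E1 in E2. unfold value in E2. cbn [state] in E2. unfold transfer in E2. cbn [fst snd] in E2.
  assert (Hl := cell_first N). assert (HB := proj1 (HbN N (le_n _))).
  apply Rmult_eq_reg_l with (cell N 0 * b N); [lra |]. apply Rmult_integral_contrapositive. split; lra.
Qed.

Lemma eigenfunction_represents t f : t <> 0 -> is_lim_seq (fun n => lam ^ n * (2 * (a n - 1))) (- t) ->
  (forall n, (N <= n)%nat -> p <= a n) ->
  eigenfunction p q t f -> exists x e, represents f x e /\ c 0 * x = 0 /\ b 0 * e = 0.
Proof.
  intros Ht Hlim Hap Hf. assert (Hr := eigenfunction_residual p q Hp Hq a N t Ha Hap Ht Hlim f Hf).
  destruct Hf as ((Cf & F0 & F1) & _).
  assert (Hs : forall s, exists e, forall n k, (N <= n)%nat -> (k <= 3 ^ n)%nat -> f s (vertex p q n k) = value n (f s 0, e) k).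
  { intros s. apply solution_unique. intros n k Hn Hk. specialize (Hr n s k Hn ltac:(lia)).
    rewrite (residual_interior p q Hp Hq) in Hr by trivial. lra. }
  destruct (Hs true) as [e He]. destruct (Hs false) as [e' He'].
  set (x := f true 0) in *. rewrite <- F0 in He'.
  assert (H3 := three_pow_pos N). assert (Hl := cell_first N). assert (HB := proj1 (HbN N (le_n _))).
  assert (Ee : e' = - e).
  { assert (G := Hr N true 0%nat (le_n _) ltac:(lia)). rewrite residual_left, He, He', He in G by lia.
    unfold value in G. cbn [state] in G. unfold transfer in G. cbn [fst snd] in G.
    apply Rmult_eq_reg_l with (cell N 0 * b N); [lra |]. apply Rmult_integral_contrapositive. split; lra. }
  subst e'. exists x, e. split; [split; trivial; intros [] n k Hn Hk; auto | split].
  - assert (G := Hr N true (3 ^ N)%nat (le_n _) (le_n _)).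
    assert (Em : (3 ^ N = S (3 ^ N - 1))%nat) by lia.
    assert (Hl1 := cell_pos p q Hp Hq N (3 ^ N - 1)).
    assert (G' := Hr N false (3 ^ N)%nat (le_n _) (le_n _)).
    rewrite residual_right, !He, He' in G by lia. rewrite residual_right, He, !He' in G' by lia.
    rewrite (value_pred N (x, e) (3 ^ N - 1)), (value_pred N (x, - e) (3 ^ N - 1)), <- Em in G, G'.
    unfold value in G, G'. rewrite !state_last in G, G'. cbn [fst snd] in G, G'.
    apply Rmult_eq_reg_l with (cell N (3 ^ N - 1) * b N); [lra |]. apply Rmult_integral_contrapositive. split; lra.
  - assert (G1 := He N (3 ^ N)%nat (le_n _) (le_n _)). assert (G2 := He' N (3 ^ N)%nat (le_n _) (le_n _)).
    rewrite vertex_pos, pos_last in G1, G2 by (trivial; lia). unfold value in G1, G2.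
    rewrite state_last in G1, G2. cbn [fst snd] in G1, G2. rewrite F1, G2 in G1. lra.
Qed.

(** The eigenspace is spanned by the solution with slope 0 and the one with
    value 0, as far as these close up at the second glued point. *)
Lemma eigenvalue_dimension t : t <> 0 -> is_lim_seq (fun n => lam ^ n * (2 * (a n - 1))) (- t) ->
  (forall n, (N <= n)%nat -> p <= a n) -> eigenvalue_mult p q t (ind (b 0 = 0) + ind (c 0 = 0)).
Proof.
  intros Ht Hlim Hap.
  destruct (represents_exists 1 0) as [u Hu]. destruct (represents_exists 0 1) as [w Hw].
  assert (Eu : c 0 = 0 -> eigenfunction p q t u).
  { intros E. apply (represents_eigenfunction t u 1 0); trivial; rewrite ?E; ring. }
  assert (Ew : b 0 = 0 -> eigenfunction p q t w).
  { intros E. apply (represents_eigenfunction t w 0 1); trivial; rewrite ?E; ring. }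
  assert (Span : forall f, eigenfunction p q t f -> exists x e, c 0 * x = 0 /\ b 0 * e = 0 /\
    forall s z, unit_itv z -> f s z = x * u s z + e * w s z).
  { intros f Hf. destruct (eigenfunction_represents t f Ht Hlim Hap Hf) as (x & e & Hr & Hx & He).
    exists x, e. repeat split; trivial. intros. now apply represents_combination. }
  assert (Ind := fun x e => represents_independent u w x e Hu Hw).
  destruct (Req_dec (b 0) 0) as [B0 | B0], (Req_dec (c 0) 0) as [C0 | C0];
    rewrite ?(ind_true (b 0 = 0)), ?(ind_false (b 0 = 0)), ?(ind_true (c 0 = 0)), ?(ind_false (c 0 = 0)) by trivial.
  - exists (fun i => if Nat.eqb i 0 then u else w). split; [| split].
    + intros [|i] _; simpl; auto.
    + intros y Hy. assert (Hz : y 0%nat = 0 /\ y 1%nat = 0).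
      { apply Ind. intros z Hz. specialize (Hy true z Hz). unfold lin_comb in Hy. simpl in Hy. lra. }
      intros [|[|i]] Hi; [tauto | tauto | lia].
    + intros f Hf. destruct (Span f Hf) as (x & e & _ & _ & E). exists (fun i => if Nat.eqb i 0 then x else e).
      intros s z Hz. rewrite E by trivial. unfold lin_comb. simpl. ring.
  - exists (fun _ => w). split; [auto | split].
    + intros y Hy. assert (Hz : 0 = 0 /\ y 0%nat = 0).
      { apply Ind. intros z Hz. specialize (Hy true z Hz). unfold lin_comb in Hy. simpl in Hy. lra. }
      intros [|i] Hi; [tauto | lia].
    + intros f Hf. destruct (Span f Hf) as (x & e & Hx & _ & E). exists (fun _ => e).
      intros s z Hz. rewrite E by trivial. apply Rmult_integral in Hx. destruct Hx as [Hx | ->]; [contradiction |].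
      unfold lin_comb. simpl. ring.
  - exists (fun _ => u). split; [auto | split].
    + intros y Hy. assert (Hz : y 0%nat = 0 /\ 0 = 0).
      { apply Ind. intros z Hz. specialize (Hy true z Hz). unfold lin_comb in Hy. simpl in Hy. lra. }
      intros [|i] Hi; [tauto | lia].
    + intros f Hf. destruct (Span f Hf) as (x & e & _ & He & E). exists (fun _ => x).
      intros s z Hz. rewrite E by trivial. apply Rmult_integral in He. destruct He as [He | ->]; [contradiction |].
      unfold lin_comb. simpl. ring.
  - exists (fun _ => u). split; [intros; lia | split; [intros; lia |]].
    intros f Hf. destruct (Span f Hf) as (x & e & Hx & He & E). exists (fun _ => 0).
    intros s z Hz. rewrite E by trivial. apply Rmult_integral in Hx. apply Rmult_integral in He.
    destruct Hx as [Hx | ->]; [contradiction |]. destruct He as [He | ->]; [contradiction |].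
    unfold lin_comb. simpl. ring.
Qed.

End Transfer.

(** * Normalizing the transfer matrices *)

Fixpoint rprod (r : nat -> R) (n m : nat) : R :=
  match m with O => 1 | S m => rprod r n m * r (n + S m)%nat end.

Lemma rprod_head r n m : rprod r n (S m) = r (S n) * rprod r (S n) m.
Proof.
  induction m; [simpl; rewrite Nat.add_1_r; ring |]. change (rprod r n (S (S m))) with (rprod r n (S m) * r (n + S (S m))%nat).
  rewrite IHm. cbn [rprod]. replace (S n + S m)%nat with (n + S (S m))%nat by lia. ring.
Qed.

Lemma rprod_zero r n m : rprod r n m = 0 <-> exists j, (1 <= j <= m)%nat /\ r (n + j)%nat = 0.
Proof.
  induction m; cbn [rprod].
  - split; [lra | intros (j & Hj & _); lia].
  - split.
    + intros H. apply Rmult_integral in H. destruct H as [H | H].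
      * apply IHm in H. destruct H as (j & Hj & H). exists j. split; [lia | trivial].
      * exists (S m). split; [lia | trivial].
    + intros (j & Hj & H). destruct (Nat.eq_dec j (S m)) as [-> | NE]; [rewrite H; ring |].
      rewrite (proj2 IHm); [ring |]. exists j. split; [lia | trivial].
Qed.

(** The solution of [u n = r (n + 1) * u (n + 1)] with value 1 at [N]. *)
Definition two_sided (r : nat -> R) (N n : nat) : R := rprod r n (N - n) / rprod r N (n - N).

Section TwoSided.

Variables (r : nat -> R) (N : nat).
Hypothesis Hr : forall n, (N < n)%nat -> r n <> 0.

Lemma rprod_neq_0 m : rprod r N m <> 0.
Proof. intros H. apply rprod_zero in H. destruct H as (j & Hj & H). apply (Hr (N + j)); trivial. lia. Qed.

Lemma two_sided_rec n : two_sided r N n = r (S n) * two_sided r N (S n).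
Proof.
  unfold two_sided. destruct (le_lt_dec N n) as [H | H].
  - replace (N - n)%nat with 0%nat by lia. replace (N - S n)%nat with 0%nat by lia.
    replace (S n - N)%nat with (S (n - N)) by lia. cbn [rprod]. replace (N + S (n - N))%nat with (S n) by lia.
    assert (H1 := rprod_neq_0 (n - N)). assert (H2 := Hr (S n) ltac:(lia)). field. split; trivial.
  - replace (N - n)%nat with (S (N - S n)) by lia. rewrite rprod_head.
    replace (n - N)%nat with 0%nat by lia. replace (S n - N)%nat with 0%nat by lia. cbn [rprod]. field.
Qed.

Lemma two_sided_forward n : (N <= n)%nat -> two_sided r N n = / rprod r N (n - N).
Proof. intros H. unfold two_sided. replace (N - n)%nat with 0%nat by lia. cbn [rprod]. apply Rmult_1_l. Qed.

Lemma two_sided_zero : two_sided r N 0 = 0 <-> exists j, (1 <= j <= N)%nat /\ r j = 0.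
Proof.
  unfold two_sided. rewrite Nat.sub_0_r. cbn [Nat.sub rprod]. rewrite Rdiv_1_r. apply rprod_zero.
Qed.

End TwoSided.

Section Spectrum.

Variables (p q : R) (Phi : C -> C).
Hypothesis Hp : 0 < p < 1.
Hypothesis Hq : q = 1 - p.
Hypothesis Hfun : forall z : C, Phi (RtoC (lambda p q) * z)%C = Rpoly p q (Phi z).
Hypothesis Hzero : Phi (RtoC 0) = RtoC 0.
Hypothesis Hder : is_Cderive Phi (RtoC 0) (RtoC 1).

Local Notation lam := (lambda p q).

Variable t : R.
Hypothesis Ht : t <> 0.

Local Notation a := (orbit p q Phi t).

(** The derivative of [Phi] at 0 is 1. *)
Lemma orbit_rate : is_lim_seq (fun n => lam ^ n * (2 * (a n - 1))) (- t).
Proof.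
  apply is_lim_seq_spec. intros eps. assert (HT := Rabs_pos_lt t Ht).
  assert (He : 0 < eps / (2 * Rabs t)) by (apply Rdiv_lt_0_compat; [apply cond_pos | lra]).
  destruct (proj1 (is_Cderive_eps _ _ _) Hder _ He) as (d & Hd & H).
  destruct (div_lam_pow_small p q Hp Hq (RtoC (- t)) d Hd) as [N HN].
  exists N. intros n Hn. specialize (HN n Hn). assert (HL := lam_pow_pos p q Hp Hq n).
  rewrite <- RtoC_pow, <- RtoC_div in HN by lra.
  replace (- t / lam ^ n) with (- (t / lam ^ n)) in HN by (field; lra).
  specialize (H _ HN). unfold orbit, psiR. rewrite Hzero in H. set (h := - (t / lam ^ n)) in *.
  replace (0 + RtoC h)%C with (RtoC h) in H by ring.
  assert (B : Rabs (Re (Phi (RtoC h)) - h) <= eps / (2 * Rabs t) * Rabs h).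
  { rewrite <- (Cmod_R h). eapply Rle_trans; [| exact H].
    eapply Rle_trans; [| apply re_le_Cmod]. apply Req_le. f_equal.
    replace (Phi (RtoC h) - 0 - 1 * RtoC h)%C with (Phi (RtoC h) - RtoC h)%C by ring. reflexivity. }
  replace (lam ^ n * (2 * (1 + Re (Phi (RtoC h)) / 2 - 1)) - - t) with (lam ^ n * (Re (Phi (RtoC h)) - h)) by (unfold h; field; lra).
  rewrite Rabs_mult, (Rabs_pos_eq (lam ^ n)) by lra.
  apply Rle_lt_trans with (lam ^ n * (eps / (2 * Rabs t) * Rabs h)); [apply Rmult_le_compat_l; lra |].
  unfold h. rewrite Rabs_Ropp. unfold Rdiv at 2. rewrite Rabs_mult, (Rabs_pos_eq (/ lam ^ n)) by (left; now apply Rinv_0_lt_compat).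
  replace (lam ^ n * (eps / (2 * Rabs t) * (Rabs t * / lam ^ n))) with (eps / 2) by (field; split; lra).
  generalize (cond_pos eps). lra.
Qed.

(** Near 1 the deviation of [ratioB] from 1 is at most [kB] times that of its
    argument, by [ratioB_minus_1]. *)
Local Notation kB := (3 / (q * (1 + p))).

Lemma orbit_eventually : exists N, forall n, (N <= n)%nat ->
  p < a n /\ q < a n /\ a n <> 1 /\ Rabs (a n - 1) <= 1 /\ kB * Rabs (a n - 1) <= 1 / 2 /\ lam ^ n * Rabs (a n - 1) <= Rabs t + 1.
Proof.
  assert (H1 := orbit_to_1 p q Phi Hp Hq Hzero Hder t). apply is_lim_seq_spec in H1.
  assert (H2 := orbit_rate). apply is_lim_seq_spec in H2.
  assert (HB : 0 < kB) by (apply Rdiv_lt_0_compat; nra).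
  assert (He : 0 < Rmin (Rmin p q) (1 / 2 / kB)).
  { repeat apply Rmin_pos; try lra. apply Rdiv_lt_0_compat; lra. }
  destruct (H1 (mkposreal _ He)) as [N1 HN1]. destruct (H2 (mkposreal 1 Rlt_0_1)) as [N2 HN2]. simpl in HN1, HN2.
  destruct (div_lam_pow_small p q Hp Hq (RtoC t) 1 Rlt_0_1) as [N3 HN3].
  exists (N1 + N2 + N3)%nat. intros n Hn. specialize (HN1 n ltac:(lia)). specialize (HN2 n ltac:(lia)). specialize (HN3 n ltac:(lia)).
  assert (HL := lam_pow_pos p q Hp Hq n).
  assert (M1 : Rabs (a n - 1) < Rmin p q) by (eapply Rlt_le_trans; [exact HN1 | apply Rmin_l]).
  assert (M2 : Rabs (a n - 1) < 1 / 2 / kB) by (eapply Rlt_le_trans; [exact HN1 | apply Rmin_r]).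
  assert (Mp := Rmin_l p q). assert (Mq := Rmin_r p q).
  assert (M3 := M1). apply Rabs_def2 in M3. repeat split; try lra.
  - apply (orbit_neq_1 p q Phi Hp Hq Hfun Hzero Hder); trivial.
    rewrite <- RtoC_pow, <- RtoC_div, Cmod_R in HN3 by lra. apply Rabs_def2 in HN3. lra.
  - rewrite Rmult_comm. left. now apply Rlt_div_r.
  - replace (lam ^ n * Rabs (a n - 1)) with (Rabs (lam ^ n * (2 * (a n - 1))) / 2).
    + assert (T := Rabs_triang (lam ^ n * (2 * (a n - 1)) - - t) (- t)).
      replace (lam ^ n * (2 * (a n - 1)) - - t + - t) with (lam ^ n * (2 * (a n - 1))) in T by ring.
      rewrite Rabs_Ropp in T. generalize (Rabs_pos t). lra.
    + rewrite !Rabs_mult, (Rabs_pos_eq 2), (Rabs_pos_eq (lam ^ n)) by lra. field.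
Qed.

Lemma ratioB_zero x : ratioB p q x = 0 <-> x ^ 2 = p ^ 2.
Proof.
  unfold ratioB. assert (0 < q * (1 + p)) by nra. split; intros E.
  - apply Rmult_integral in E. destruct E as [E | E]; [lra |]. now apply Rinv_neq_0_compat in E; [| lra].
  - rewrite E. field. split; lra.
Qed.

Lemma ratioC_zero x : ratioC p q x = 0 <-> x ^ 2 = q ^ 2.
Proof.
  assert (Hq0 : 0 < q) by lra. assert (0 < p ^ 2) by (apply pow_lt; lra). assert (0 < p ^ 2 * q) by nra. unfold ratioC. split; intros E.
  - apply Rmult_integral in E. destruct E as [E | E]; [| now apply Rinv_neq_0_compat in E; [| lra]].
    apply Rmult_integral in E. destruct E as [E | E]; lra.
  - rewrite E. field. split; lra.
Qed.

(** Multiply [cubP_minus_1] and [cubP_plus_1]. *)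
Lemma ratio_product x : cubP p q x ^ 2 - 1 = ratioB p q x * ratioC p q x * (x ^ 2 - 1).
Proof. unfold cubP, ratioB, ratioC. rewrite Hq. field. repeat split; lra. Qed.

Lemma ratioB_minus_1 x : ratioB p q x - 1 = (x - 1) * (x + 1) / (q * (1 + p)).
Proof. unfold ratioB. rewrite Hq. field. split; lra. Qed.

(** [a n - 1] shrinks by a factor of at least 3, so the deviations of the
    factors from 1 telescope against the differences of [|a n - 1|]. *)
Lemma ratioB_product_near_1 N :
  (forall n, (N <= n)%nat -> p < a n /\ q < a n /\ a n <> 1 /\ Rabs (a n - 1) <= 1 /\ kB * Rabs (a n - 1) <= 1 / 2 /\ lam ^ n * Rabs (a n - 1) <= Rabs t + 1) ->
  forall m, Rabs (rprod (fun n => ratioB p q (a n)) N m - 1) <= kB * (Rabs (a N - 1) - Rabs (a (N + m)%nat - 1)).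
Proof.
  intros H. assert (Hpq := pq_pos p q Hp Hq). assert (Hle := pq_le p q Hq).
  assert (HB : 0 < kB) by (apply Rdiv_lt_0_compat; nra).
  induction m; [rewrite Nat.add_0_r; simpl; rewrite !Rminus_diag, Rabs_R0; lra |].
  cbn [rprod]. set (P := rprod _ N m) in *. rewrite <- plus_n_Sm.
  assert (G := a_minus_1_growth p q Hp Hq a N (orbit_S p q Phi Hp Hq Hfun Hzero Hder t) (fun n Hn => Rlt_le _ _ (proj1 (H n Hn))) (N + m) ltac:(lia)).
  destruct (H N (le_n _)) as (_ & _ & _ & _ & HN & _).
  destruct (H (S (N + m)) ltac:(lia)) as (A1 & A2 & _ & A3 & _).
  set (x := a (S (N + m))) in *. set (d := Rabs (x - 1)) in *.
  assert (Hd : 0 <= d) by apply Rabs_pos.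
  assert (G3 : 3 * d <= Rabs (a (N + m)%nat - 1)).
  { rewrite G. apply Rmult_le_compat_r; trivial. unfold growth. apply Rle_div_r; trivial. nra. }
  assert (Hr : Rabs (ratioB p q x - 1) <= kB * d).
  { rewrite ratioB_minus_1. unfold Rdiv. rewrite !Rabs_mult, (Rabs_pos_eq (/ (q * (1 + p)))) by (left; apply Rinv_0_lt_compat; nra).
    fold d. assert (Rabs (x + 1) <= 3) by (apply Rabs_le; apply Rabs_le_between in A3; lra).
    assert (0 < / (q * (1 + p))) by (apply Rinv_0_lt_compat; nra).
    replace (3 * / (q * (1 + p)) * d) with (d * 3 * / (q * (1 + p))) by ring.
    apply Rmult_le_compat_r; [lra |]. apply Rmult_le_compat_l; trivial. }
  assert (HP : Rabs P <= 2).
  { assert (T := Rabs_triang 1 (P - 1)). replace (1 + (P - 1)) with P in T by ring. rewrite Rabs_R1 in T.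
    assert (0 <= kB * Rabs (a (N + m)%nat - 1)) by (apply Rmult_le_pos; [lra | apply Rabs_pos]). lra. }
  replace (P * ratioB p q x - 1) with ((P - 1) + P * (ratioB p q x - 1)) by ring.
  eapply Rle_trans; [apply Rabs_triang |]. rewrite Rabs_mult.
  assert (Rabs P * Rabs (ratioB p q x - 1) <= 2 * (kB * d)) by (apply Rmult_le_compat; trivial; apply Rabs_pos).
  assert (kB * (3 * d) <= kB * Rabs (a (N + m)%nat - 1)) by (apply Rmult_le_compat_l; lra). lra.
Qed.

(** The recursions for [b] and [c] are solved with the value 1, and
    [a N ^ 2 - 1], at a level beyond which the orbit is close to 1.  Going down to
    level 0, zeros are created exactly where the orbit meets the zeros of the
    ratios. *)
Lemma eigenspace_dimension : eigenvalue_mult p q t (ind (hits p q Phi t p) + ind (hits p q Phi t q)).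
Proof.
  destruct orbit_eventually as [N H]. assert (Hpq := pq_pos p q Hp Hq).
  set (rB := fun n => ratioB p q (a n)). set (rC := fun n => ratioC p q (a n)).
  assert (NB : forall n, (N < n)%nat -> rB n <> 0).
  { intros n Hn E. apply ratioB_zero in E. destruct (H n ltac:(lia)) as (A1 & _). nra. }
  assert (NC : forall n, (N < n)%nat -> rC n <> 0).
  { intros n Hn E. apply ratioC_zero in E. destruct (H n ltac:(lia)) as (_ & A1 & _). nra. }
  set (b := two_sided rB N). set (c := fun n => (a N ^ 2 - 1) * two_sided rC N n).
  assert (Hb : forall n, b n = ratioB p q (a (S n)) * b (S n)) by (intros; now apply two_sided_rec).
  assert (Hc : forall n, c n = ratioC p q (a (S n)) * c (S n)).
  { intros n. unfold c. rewrite (two_sided_rec rC N NC n). unfold rC. ring. }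
  assert (Ha : forall n, cubP p q (a (S n)) = a n) by (apply orbit_S; trivial).
  assert (Hstep : forall n, a n ^ 2 - 1 = ratioB p q (a (S n)) * ratioC p q (a (S n)) * (a (S n) ^ 2 - 1)).
  { intros n. rewrite <- ratio_product, Ha. reflexivity. }
  assert (Hup : forall m, b (N + m)%nat * c (N + m)%nat = a (N + m)%nat ^ 2 - 1).
  { induction m.
    - rewrite Nat.add_0_r. unfold c, b. rewrite !two_sided_forward, Nat.sub_diag by lia. cbn [rprod]. field.
    - rewrite <- plus_n_Sm. rewrite Hstep, (Hb (N + m)%nat), (Hc (N + m)%nat) in IHm.
      apply Rmult_eq_reg_l with (ratioB p q (a (S (N + m))) * ratioC p q (a (S (N + m)))); [lra |].
      apply Rmult_integral_contrapositive. split; [apply (NB (S (N + m))) | apply (NC (S (N + m)))]; lia. }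
  assert (Hbc : forall n, b n * c n = a n ^ 2 - 1).
  { assert (Hdown : forall m n, (n + m = N)%nat -> b n * c n = a n ^ 2 - 1).
    { induction m; intros n Hn.
      - assert (n = N) as -> by lia. assert (E := Hup 0%nat). rewrite Nat.add_0_r in E. exact E.
      - rewrite Hstep, <- (IHm (S n)), (Hb n), (Hc n) by lia. ring. }
    intros n. destruct (le_lt_dec N n) as [L | L].
    - replace n with (N + (n - N))%nat by lia. apply Hup.
    - apply (Hdown (N - n)%nat). lia. }
  assert (HP : forall n, (N <= n)%nat -> 1 / 2 <= rprod rB N (n - N) <= 3 / 2).
  { intros n Hn. assert (G := ratioB_product_near_1 N H (n - N)). fold rB in G.
    destruct (H N (le_n _)) as (_ & _ & _ & _ & HN & _).
    assert (HB : 0 < kB) by (apply Rdiv_lt_0_compat; nra).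
    assert (0 <= kB * Rabs (a (N + (n - N))%nat - 1)) by (apply Rmult_le_pos; [lra | apply Rabs_pos]).
    assert (G' : Rabs (rprod rB N (n - N) - 1) <= 1 / 2) by lra. apply Rabs_le_between in G'. lra. }
  assert (Eb : forall n, (N <= n)%nat -> b n = / rprod rB N (n - N)) by (intros; now apply two_sided_forward).
  rewrite (ind_iff (hits p q Phi t p) (b 0%nat = 0)).
  2:{ unfold b. rewrite two_sided_zero. split.
      - intros (j & Hj & E). exists j. split; [split; trivial | now apply ratioB_zero].
        destruct (le_lt_dec j N) as [L | L]; trivial. exfalso. apply (NB j L). now apply ratioB_zero.
      - intros (j & Hj & E). exists j. split; [lia | now apply ratioB_zero]. }
  rewrite (ind_iff (hits p q Phi t q) (c 0%nat = 0)).
  2:{ destruct (H N (le_n _)) as (A1 & _ & A2 & _).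
      assert (A3 : a N ^ 2 - 1 <> 0).
      { replace (a N ^ 2 - 1) with ((a N - 1) * (a N + 1)) by ring. apply Rmult_integral_contrapositive. split; lra. }
      unfold c. transitivity (two_sided rC N 0 = 0).
      - rewrite two_sided_zero. split.
        + intros (j & Hj & E). exists j. split; [split; trivial | now apply ratioC_zero].
          destruct (le_lt_dec j N) as [L | L]; trivial. exfalso. apply (NC j L). now apply ratioC_zero.
        + intros (j & Hj & E). exists j. split; [lia | now apply ratioC_zero].
      - split; [intros ->; ring |]. intros E. apply Rmult_integral in E. tauto. }
  apply (eigenvalue_dimension p q Hp Hq a b c Ha Hb Hc Hbc N (5 * (Rabs t + 1))); trivial.
  - generalize (Rabs_pos t). lra.
  - intros n Hn. rewrite Eb by trivial. specialize (HP n Hn).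
    split; [apply Rinv_neq_0_compat; lra |]. rewrite Rabs_pos_eq by (left; apply Rinv_0_lt_compat; lra).
    replace 2 with (/ (1 / 2)) by field. apply Rinv_le_contravar; lra.
  - intros n Hn. specialize (HP n Hn). destruct (H n Hn) as (_ & _ & _ & A1 & _ & A2).
    assert (Ec : c n = rprod rB N (n - N) * (a n - 1) * (a n + 1)).
    { assert (E := Hbc n). rewrite Eb in E by trivial.
      apply Rmult_eq_reg_l with (/ rprod rB N (n - N)); [| apply Rinv_neq_0_compat; lra]. rewrite E. field. lra. }
    rewrite Ec, !Rabs_mult. rewrite (Rabs_pos_eq (rprod _ _ _)) by lra.
    assert (A3 : Rabs (a n + 1) <= 3) by (apply Rabs_le; apply Rabs_le_between in A1; lra).
    assert (HL := lam_pow_pos p q Hp Hq n). assert (A4 := Rabs_pos (a n - 1)). assert (A5 := Rabs_pos (a n + 1)).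
    set (P := rprod _ _ _) in *.
    replace (lam ^ n * (P * Rabs (a n - 1) * Rabs (a n + 1))) with ((P * Rabs (a n + 1)) * (lam ^ n * Rabs (a n - 1))) by ring.
    assert (0 <= lam ^ n * Rabs (a n - 1)) by (apply Rmult_le_pos; lra).
    apply Rmult_le_compat; trivial; nra.
  - intros n Hn. destruct (H n Hn) as (_ & _ & _ & _ & _ & A2). generalize (Rabs_pos t). lra.
  - apply orbit_rate.
  - intros n Hn. left. apply (H n Hn).
Qed.

End Spectrum.

Theorem proposition5p2 (p q : R) (Phi : C -> C) :
  0 < p < 1 ->
  q = 1 - p ->
  entire Phi ->
  (forall z : C, Phi (RtoC (lambda p q) * z)%C = Rpoly p q (Phi z)) ->
  Phi (RtoC 0) = RtoC 0 ->
  @is_derive C_AbsRing C_NormedModule Phi (RtoC 0) (RtoC 1) ->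
  exists zetaL zeta0 zeta4 : C -> C,
    is_spectral_zeta p q zetaL /\
    is_polynomial_zeta Phi (RtoC 0) zeta0 /\
    is_polynomial_zeta Phi (RtoC (-4)) zeta4 /\
    (forall s : C, ~ pole zeta0 s -> ~ pole zeta4 s ->
       zetaL s = (zeta0 s + zeta4 s)%C) /\
    (forall y : R, ~ pole zetaL (0, y)) /\
    is_regularized_det zetaL (RtoC (1 / (p * q))).
Proof.
  intros Hp Hq _ Hfun Hzero Hder. exists (zetaL p q), (zeta0 p q), (zeta4 p q).
  split; [| split; [| split; [| split; [| split]]]].
  - apply (zetaL_spec p q Phi); trivial. intros t Ht. now apply eigenspace_dimension.
  - now apply zeta0_spec.
  - now apply zeta4_spec.
  - now apply (zeta_sum p q Phi).
  - now apply (zetaL_imaginary_axis p q Phi).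
  - now apply (zetaL_det p q Phi).
Qed.
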